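(* Let $s\in[0,1]$. Let $X$ and $Y$ be first-order polynomials in $a$ and $a^\dagger$ such that $$(L^{(s)*}+L^{(s)})(\rho^{s/2}X\rho^{(1-s)/2})=\lambda\,\rho^{s/2}X\rho^{(1-s)/2},\qquad (L^{(s)*}+L^{(s)})(\rho^{s/2}Y\rho^{(1-s)/2})=\mu\,\rho^{s/2}Y\rho^{(1-s)/2},$$ where $\mu\le\lambda\le0$ and $(\lambda,\mu)\ne(0,0)$. Then, for all $n,m\in\mathbb N$, $$(L^{(s)*}+L^{(s)})(\rho^{s/2}X^nY^m\rho^{(1-s)/2})=(n\lambda+m\mu)\,\rho^{s/2}X^nY^m\rho^{(1-s)/2}+\rho^{s/2}R_{n,m}\rho^{(1-s)/2},$$ where $R_{n,m}\in\operatorname{span}\{X^iY^j:i+j\le n+m-2\}$ when $n+m\ge2$, and $R_{n,m}=0$ otherwise. The eigenvalues of $(L^{(s)*}+L^{(s)})\restriction\mathcal X$ are precisely the numbers $n\lambda+m\mu$, with $n,m\in\mathbb N$.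
   Context: $\mathbb N=\{0,1,2,\dots\}$. $\mathsf h=\Gamma(\mathbb C)$ is the one-mode bosonic Fock space with orthonormal basis $(e_n)_{n\ge0}$; $ae_n=\sqrt n\,e_{n-1}$ ($ae_0=0$), $a^\dagger e_n=\sqrt{n+1}\,e_{n+1}$, $N=a^\dagger a$; $W(z)=\exp(za^\dagger-\overline z a)$, $z\in\mathbb C$. $\mathcal B(\mathsf h)$, $\mathcal B_2(\mathsf h)$ are the bounded and Hilbert--Schmidt operators, with $\langle X,Y\rangle_2=\mathrm{Tr}(X^*Y)$. Gaussian QMS: let $\Omega\in\mathbb R$, $\kappa,\zeta,u_1,u_2,v_1,v_2\in\mathbb C$, $\gamma=\frac12\sum_{\ell=1}^2(|v_\ell|^2-|u_\ell|^2)$, and define real-linear operators on $\mathbb C$ by $Zz=(\mathrm i\Omega-\gamma)z+\mathrm i\kappa\overline z$ and $Cz=\sum_{\ell=1}^2\big((|u_\ell|^2+|v_\ell|^2)z+2v_\ell u_\ell\overline z\big)$. The Gaussian quantum Markov semigroup $(\mathcal T_t)_{t\ge0}$ is the weak$^*$-continuous semigroup of normal, completely positive, identity-preserving maps on $\mathcal B(\mathsf h)$ determined by $$\mathcal T_t(W(z))=\exp\Big\{-\tfrac12\int_0^t\Re\big(\overline{e^{rZ}z}\,C(e^{rZ}z)\big)dr+\mathrm i\int_0^t\Re\big(\overline\zeta\,e^{rZ}z\big)dr\Big\}W(e^{tZ}z).$$ Drift matrix: $\mathbf Z=\begin{pmatrix}-\gamma-\Im\kappa&\Re\kappa-\Omega\\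 \Re\kappa+\Omega&-\gamma+\Im\kappa\end{pmatrix}$. Standing assumptions: $\mathbf Z$ is stable (eigenvalues with strictly negative real parts); the unique normal invariant state $\rho$ is faithful; and (standardization) $\zeta=0$, $\kappa=\mathrm i\tanh(\beta/2)\sum_\ell u_\ell v_\ell$ with $\beta=-\log\big(\sum_\ell|u_\ell|^2/\sum_\ell|v_\ell|^2\big)>0$, so that $\rho=(1-e^{-\beta})e^{-\beta N}$. Induced semigroup: for $s\in[0,1]$, $T_t^{(s)}(\rho^{s/2}X\rho^{(1-s)/2})=\rho^{s/2}\mathcal T_t(X)\rho^{(1-s)/2}$, $X\in\mathcal B(\mathsf h)$, extends uniquely to a strongly continuous contraction semigroup on $\mathcal B_2(\mathsf h)$, with generator $L^{(s)}$. Embedded polynomials: $\mathcal X\subset\mathcal B_2(\mathsf h)$ is the dense space of all $\rho^{s/2}P(a,a^\dagger)\rho^{(1-s)/2}$ with $P$ a noncommutative polynomial (initially defined on the span of the $e_n$ and extended by continuity); $\mathcal X\subset\operatorname{Dom}L^{(s)}\cap\operatorname{Dom}L^{(s)*}$, and $L^{(s)*}+L^{(s)}$ is here defined on $\mathcal X$ as the sum. A first-order polynomial is one of total degree one; $X^0=Y^0=\mathbf 1$.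
   Formalization: For the claim on the eigenvalues of the restriction to the embedded polynomials, X and Y are additionally assumed linearly independent when λ = μ; without this the claim fails, e.g. for X = Y when the other first-order eigenvalue is not a multiple of λ. *)

(* Defs.v *)
From Stdlib Require Import Reals Factorial Lra Lia.
From Coquelicot Require Import Coquelicot.
Open Scope R_scope.

Definition Cexp (w : C) : C :=
  (exp (Re w) * cos (Im w), exp (Re w) * sin (Im w)).

Definition CSeries (c : nat -> C) : C :=
  (Series (fun n => Re (c n)), Series (fun n => Im (c n))).

Definition sqsum (x : nat -> C) : Prop := ex_series (fun n => Cmod (x n) ^ 2).

(** Gamma(C), identified with l^2(N) through the basis (e_n). *)
Record fock := mkfock { coord :> nat -> C; fockP : sqsum coord }.

Lemma sqsum_plus (x y : nat -> C) :
  sqsum x -> sqsum y -> sqsum (fun n => Cplus (x n) (y n)).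
Proof.
intros Hx Hy; unfold sqsum in *.
apply (ex_series_le (V := R_CompleteNormedModule) _
         (fun n => scal 2 (plus (Cmod (x n) ^ 2) (Cmod (y n) ^ 2)))).
- intros n; change (Rabs (Cmod (x n + y n) ^ 2)
                    <= 2 * (Cmod (x n) ^ 2 + Cmod (y n) ^ 2)).
  rewrite Rabs_pos_eq by apply pow2_ge_0.
  pose proof (Cmod_triangle (x n) (y n)).
  pose proof (Cmod_ge_0 (x n + y n)).
  assert (Cmod (x n + y n) ^ 2 <= (Cmod (x n) + Cmod (y n)) ^ 2)
    by (apply pow_incr; lra).
  pose proof (pow2_ge_0 (Cmod (x n) - Cmod (y n))).
  lra.
- apply (ex_series_scal (V := R_NormedModule)).
  now apply (ex_series_plus (V := R_NormedModule)).
Qed.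

Lemma sqsum_scal (c : C) (x : nat -> C) :
  sqsum x -> sqsum (fun n => Cmult c (x n)).
Proof.
intros Hx; unfold sqsum in *.
apply (ex_series_ext (V := R_NormedModule)
         (fun n => scal (Cmod c ^ 2) (Cmod (x n) ^ 2))).
- intros n; rewrite Cmod_mult; change scal with Rmult; simpl; ring.
- now apply (ex_series_scal (V := R_NormedModule)).
Qed.

Definition delta (n : nat) : nat -> C :=
  fun m => if Nat.eqb m n then RtoC 1 else RtoC 0.

Lemma sqsum_delta (n : nat) : sqsum (delta n).
Proof.
unfold sqsum; apply (ex_series_incr_n (V := R_NormedModule) _ (S n)).
exists 0; apply (is_series_ext (V := R_NormedModule) (fun _ => 0)).
- intros k; unfold delta.
  replace (Nat.eqb (S n + k) n) with false
    by (symmetry; apply PeanoNat.Nat.eqb_neq; lia).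
  rewrite Cmod_0; simpl; ring.
- apply (filterlim_ext (fun _ : nat => zero)).
  + intros k; rewrite sum_n_const; simpl; change zero with 0; ring.
  + apply filterlim_const.
Qed.

Lemma sqsum_zero : sqsum (fun _ => RtoC 0).
Proof.
apply (ex_series_ext (V := R_NormedModule)
         (fun n => Cmod (Cmult (RtoC 0) (delta 0 n)) ^ 2)).
- intros n; now rewrite Cmult_0_l.
- apply (sqsum_scal (RtoC 0)), sqsum_delta.
Qed.

Definition fzero : fock := mkfock _ sqsum_zero.
Definition fplus (x y : fock) : fock := mkfock _ (sqsum_plus x y (fockP x) (fockP y)).
Definition fscal (c : C) (x : fock) : fock := mkfock _ (sqsum_scal c x (fockP x)).
Definition e (n : nat) : fock := mkfock _ (sqsum_delta n).

Definition inner (x y : fock) : C := CSeries (fun n => Cmult (Cconj (x n)) (y n)).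
Definition fnorm (x : fock) : R := sqrt (Series (fun n => Cmod (x n) ^ 2)).

(** Maps on operators are total functions on [op], constrained only on the
    bounded (or Hilbert-Schmidt) operators. *)
Definition op := fock -> fock.

Definition op_id : op := fun x => x.
Definition op_zero : op := fun _ => fzero.
Definition op_add (A B : op) : op := fun x => fplus (A x) (B x).
Definition op_scal (c : C) (A : op) : op := fun x => fscal c (A x).
Definition op_sub (A B : op) : op := op_add A (op_scal (RtoC (-1)) B).

Definition bounded_op (A : op) : Prop :=
  (forall x y, A (fplus x y) = fplus (A x) (A y)) /\
  (forall c x, A (fscal c x) = fscal c (A x)) /\
  exists M : R, forall x, fnorm (A x) <= M * fnorm x.

Definition hs (A : op) : Prop :=
  bounded_op A /\ ex_series (fun n => fnorm (A (e n)) ^ 2).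

(** Tr(A^* B) = sum_n <e_n, A^* B e_n> = sum_n <A e_n, B e_n>. *)
Definition hs_inner (A B : op) : C := CSeries (fun n => inner (A (e n)) (B (e n))).
Definition hs_norm (A : op) : R := sqrt (Series (fun n => fnorm (A (e n)) ^ 2)).

(** The weak^* (sigma-weak) topology of B(h) is defined by the functionals
    A |-> sum_k <u_k, A v_k> with sum_k |u_k|^2 and sum_k |v_k|^2 finite. *)
Definition sqsum_vec (u : nat -> fock) : Prop := ex_series (fun k => fnorm (u k) ^ 2).

Definition wstar_fun (u v : nat -> fock) (A : op) : C :=
  CSeries (fun k => inner (u k) (A (v k))).

Definition wstar_lim (F : (op -> Prop) -> Prop) (A : op) : Prop :=
  forall u v, sqsum_vec u -> sqsum_vec v ->
    filterlim (wstar_fun u v) F (locally (wstar_fun u v A)).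

Definition normal_map (Phi : op -> op) : Prop :=
  forall (F : (op -> Prop) -> Prop) (A : op),
    ProperFilter F -> F bounded_op -> bounded_op A ->
    wstar_lim F A -> wstar_lim (filtermap Phi F) (Phi A).

(** Positivity of the operator matrix (A_ij), 0 <= i,j <= n, on h^(n+1). *)
Definition positive_mx (n : nat) (A : nat -> nat -> op) : Prop :=
  forall xi : nat -> fock,
    let q : C := sum_n (fun i => sum_n (fun j => inner (xi i) (A i j (xi j))) n) n in
    Im q = 0 /\ 0 <= Re q.

Definition completely_positive (Phi : op -> op) : Prop :=
  forall (n : nat) (A : nat -> nat -> op),
    (forall i j, bounded_op (A i j)) ->
    positive_mx n A -> positive_mx n (fun i j => Phi (A i j)).

Record is_qms (T : R -> op -> op) : Prop := {
  qms_bounded : forall t A, 0 <= t -> bounded_op A -> bounded_op (T t A);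
  qms_add : forall t A B, 0 <= t -> bounded_op A -> bounded_op B ->
    T t (op_add A B) = op_add (T t A) (T t B);
  qms_scal : forall t c A, 0 <= t -> bounded_op A ->
    T t (op_scal c A) = op_scal c (T t A);
  qms_normal : forall t, 0 <= t -> normal_map (T t);
  qms_cp : forall t, 0 <= t -> completely_positive (T t);
  qms_unital : forall t, 0 <= t -> T t op_id = op_id;
  qms_0 : forall A, bounded_op A -> T 0 A = A;
  qms_semigroup : forall t r A, 0 <= t -> 0 <= r -> bounded_op A ->
    T (t + r) A = T t (T r A);
  qms_wstar_cont : forall t0 A, 0 <= t0 -> bounded_op A ->
    wstar_lim (filtermap (fun t => T t A) (within (fun t => 0 <= t) (locally t0)))
      (T t0 A)
}.

(** Acting entrywise on arbitrary sequences, so that no domain is needed; on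
    the span of the [delta n] these are the usual operators. *)
Definition ann (f : nat -> C) : nat -> C :=
  fun n => Cmult (RtoC (sqrt (INR (S n)))) (f (S n)).
Definition cre (f : nat -> C) : nat -> C :=
  fun n => match n with
           | O => RtoC 0
           | S k => Cmult (RtoC (sqrt (INR (S k)))) (f k)
           end.

Definition weyl_gen (z : C) (f : nat -> C) : nat -> C :=
  fun m => Cminus (Cmult z (cre f m)) (Cmult (Cconj z) (ann f m)).

(** W = exp(z a^dagger - conj(z) a): the e_n are analytic vectors of the
    exponent, so exp is given there by the power series and extends by
    continuity. *)
Definition is_weyl (z : C) (W : op) : Prop :=
  bounded_op W /\
  forall n m : nat,
    is_series (V := C_NormedModule)
      (fun k => Cmult (RtoC (/ INR (fact k))) (Nat.iter k (weyl_gen z) (delta n) m))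
      (W (e n) m).

Record gaussian_data := {
  Omega : R;
  kappa : C;
  zeta : C;
  u1 : C; u2 : C;
  v1 : C; v2 : C
}.

Definition usq (p : gaussian_data) : R := Cmod (u1 p) ^ 2 + Cmod (u2 p) ^ 2.
Definition vsq (p : gaussian_data) : R := Cmod (v1 p) ^ 2 + Cmod (v2 p) ^ 2.
Definition uv (p : gaussian_data) : C := (u1 p * v1 p + u2 p * v2 p)%C.
Definition gamma (p : gaussian_data) : R := / 2 * (vsq p - usq p).

Definition Zop (p : gaussian_data) (z : C) : C :=
  ((Ci * RtoC (Omega p) - RtoC (gamma p)) * z + Ci * kappa p * Cconj z)%C.
Definition Cop (p : gaussian_data) (z : C) : C :=
  (RtoC (usq p + vsq p) * z + RtoC 2 * uv p * Cconj z)%C.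

Definition expZ (p : gaussian_data) (t : R) (z : C) : C :=
  CSeries (fun k => Cmult (RtoC (t ^ k / INR (fact k))) (Nat.iter k (Zop p) z)).

Definition weyl_factor (p : gaussian_data) (t : R) (z : C) : C :=
  Cexp (RtoC (- / 2 * RInt (fun r => Re (Cconj (expZ p r z) * Cop p (expZ p r z))%C) 0 t)
        + Ci * RtoC (RInt (fun r => Re (Cconj (zeta p) * expZ p r z)%C) 0 t))%C.

Definition is_gaussian_qms (p : gaussian_data) (T : R -> op -> op) : Prop :=
  is_qms T /\
  forall t z W W', 0 <= t -> is_weyl z W -> is_weyl (expZ p t z) W' ->
    T t W = op_scal (weyl_factor p t z) W'.

Definition drift_matrix (p : gaussian_data) : @matrix C 2 2 :=
  mk_matrix 2 2 (fun i j =>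
    match i, j with
    | O, O => RtoC (- gamma p - Im (kappa p))
    | O, _ => RtoC (Re (kappa p) - Omega p)
    | _, O => RtoC (Re (kappa p) + Omega p)
    | _, _ => RtoC (- gamma p + Im (kappa p))
    end).

Definition mx_eigenvalue (M : @matrix C 2 2) (nu : C) : Prop :=
  exists w : @matrix C 2 1,
    w <> Mzero /\
    Mmult (T := C_Ring) M w = mk_matrix 2 1 (fun i j => Cmult nu (coeff_mat (RtoC 0) w i j)).

Definition stable (M : @matrix C 2 2) : Prop :=
  forall nu, mx_eigenvalue M nu -> Re nu < 0.

Definition beta (p : gaussian_data) : R := - ln (usq p / vsq p).

(** Eigenvalues of rho = (1 - e^{-beta}) e^{-beta N}. *)
Definition rho_wt (p : gaussian_data) (n : nat) : R :=
  (1 - exp (- beta p)) * exp (- beta p * INR n).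

Definition rho_state (p : gaussian_data) (A : op) : C :=
  CSeries (fun n => Cmult (RtoC (rho_wt p n)) (inner (e n) (A (e n)))).

(** Spectral decomposition of density operators: the normal states are the
    A |-> sum_k <u_k, A u_k> with sum_k |u_k|^2 = 1. *)
Definition normal_state (omega : op -> C) : Prop :=
  exists u : nat -> fock,
    is_series (fun k => fnorm (u k) ^ 2) 1 /\
    forall A, bounded_op A -> omega A = wstar_fun u u A.

Definition invariant_state (T : R -> op -> op) (omega : op -> C) : Prop :=
  forall t A, 0 <= t -> bounded_op A -> omega (T t A) = omega A.

Definition faithful_state (omega : op -> C) : Prop :=
  forall A, bounded_op A ->
    (forall x, Im (inner x (A x)) = 0 /\ 0 <= Re (inner x (A x))) ->
    omega A = RtoC 0 -> A = op_zero.

Record standing (p : gaussian_data) (T : R -> op -> op) : Prop := {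
  st_stable : stable (drift_matrix p);
  st_zeta : zeta p = RtoC 0;
  st_kappa : kappa p = (Ci * RtoC (tanh (beta p / 2)) * uv p)%C;
  (* [ln] vanishes outside (0, oo), so this entails 0 < usq p < vsq p. *)
  st_beta : 0 < beta p;
  st_normal : normal_state (rho_state p);
  st_invariant : invariant_state T (rho_state p);
  st_unique : forall omega, normal_state omega -> invariant_state T omega ->
    forall A, bounded_op A -> omega A = rho_state p A;
  st_faithful : faithful_state (rho_state p)
}.

(** For an operator X given by its columns X e_n, [embedded p s X xi] says that
    xi is the Hilbert-Schmidt operator rho^{s/2} X rho^{(1-s)/2}; it is
    determined by its values on the e_n. *)
Definition embedded (p : gaussian_data) (s : R) (X : nat -> nat -> C) (xi : op) : Prop :=
  hs xi /\
  forall n m, xi (e n) m =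
    Cmult (RtoC (Rpower (rho_wt p m) (s / 2)))
      (Cmult (X n m) (RtoC (Rpower (rho_wt p n) ((1 - s) / 2)))).

Record is_induced (p : gaussian_data) (s : R) (T Ts : R -> op -> op) : Prop := {
  ind_hs : forall t x, 0 <= t -> hs x -> hs (Ts t x);
  ind_add : forall t x y, 0 <= t -> hs x -> hs y ->
    Ts t (op_add x y) = op_add (Ts t x) (Ts t y);
  ind_scal : forall t c x, 0 <= t -> hs x -> Ts t (op_scal c x) = op_scal c (Ts t x);
  ind_contr : forall t x, 0 <= t -> hs x -> hs_norm (Ts t x) <= hs_norm x;
  ind_0 : forall x, hs x -> Ts 0 x = x;
  ind_semigroup : forall t r x, 0 <= t -> 0 <= r -> hs x ->
    Ts (t + r) x = Ts t (Ts r x);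
  ind_cont : forall x, hs x ->
    filterlim (fun t => hs_norm (op_sub (Ts t x) x)) (at_right 0) (locally 0);
  ind_embed : forall t X xi, 0 <= t -> bounded_op X ->
    embedded p s (fun n => X (e n)) xi ->
    embedded p s (fun n => T t X (e n)) (Ts t xi)
}.

Definition generator (Ts : R -> op -> op) (x y : op) : Prop :=
  hs x /\ hs y /\
  filterlim (fun t => hs_norm (op_sub (op_scal (RtoC (/ t)) (op_sub (Ts t x) x)) y))
    (at_right 0) (locally 0).

Definition adjoint (L : op -> op -> Prop) (y z : op) : Prop :=
  hs y /\ hs z /\ forall x w, L x w -> hs_inner y w = hs_inner z x.

(** L^* + L as a graph: x must lie in both domains. *)
Definition adj_plus_gen (Ts : R -> op -> op) (x y : op) : Prop :=
  exists w1 w2, adjoint (generator Ts) x w1 /\ generator Ts x w2 /\ y = op_add w1 w2.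

Inductive ncpoly :=
  | NCconst (c : C)
  | NCa
  | NCadag
  | NCadd (P Q : ncpoly)
  | NCmul (P Q : ncpoly).

Fixpoint nc_eval (P : ncpoly) (f : nat -> C) : nat -> C :=
  match P with
  | NCconst c => fun m => Cmult c (f m)
  | NCa => ann f
  | NCadag => cre f
  | NCadd P Q => fun m => Cplus (nc_eval P f m) (nc_eval Q f m)
  | NCmul P Q => nc_eval P (nc_eval Q f)
  end.

Fixpoint NCpow (P : ncpoly) (n : nat) : ncpoly :=
  match n with
  | O => NCconst (RtoC 1)
  | S k => NCmul P (NCpow P k)
  end.

Definition nc_cols (P : ncpoly) : nat -> nat -> C := fun n => nc_eval P (delta n).

(** Equality as operators on the span of the e_n, not in the free algebra. *)
Definition nc_eq (P Q : ncpoly) : Prop := forall n m, nc_cols P n m = nc_cols Q n m.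

Definition first_order (X : ncpoly) : Prop :=
  exists x y c : C,
    (x <> RtoC 0 \/ y <> RtoC 0) /\
    nc_eq X (NCadd (NCadd (NCmul (NCconst x) NCa) (NCmul (NCconst y) NCadag)) (NCconst c)).

Definition lin_indep (X Y : ncpoly) : Prop :=
  forall b c : C,
    nc_eq (NCadd (NCmul (NCconst b) X) (NCmul (NCconst c) Y)) (NCconst (RtoC 0)) ->
    b = RtoC 0 /\ c = RtoC 0.

Definition monom (X Y : ncpoly) (i j : nat) : ncpoly := NCmul (NCpow X i) (NCpow Y j).

Definition in_span (X Y : ncpoly) (d : nat) (R : ncpoly) : Prop :=
  exists c : nat -> nat -> C, forall n m,
    nc_cols R n m =
    sum_n (fun i => sum_n (fun j => Cmult (c i j) (nc_cols (monom X Y i j) n m)) (d - i)) d.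

Definition embedded_poly (p : gaussian_data) (s : R) (P : ncpoly) (xi : op) : Prop :=
  embedded p s (nc_cols P) xi.

Definition eigenvalue_on_polys (p : gaussian_data) (s : R) (Ts : R -> op -> op) (nu : C)
  : Prop :=
  exists P xi,
    embedded_poly p s P xi /\ xi <> op_zero /\ adj_plus_gen Ts xi (op_scal nu xi).

(* Main.v *)
Require Import Defs.
From Stdlib Require Import Reals Factorial Lra Lia Wf_nat.
From Stdlib Require Import Classical ClassicalEpsilon FunctionalExtensionality ProofIrrelevance.
From Stdlib Require List Cantor.
From Coquelicot Require Import Coquelicot.
Open Scope R_scope.

(** Write [A_z = z a^dag - conj z a], so that [W(z) = exp A_z].  Replacing [z] by
    [r z] in the explicit formula for [T_t (W(z))] and comparing powers of [r]
    gives the action of the induced semigroup on the embedded powers of [A_z],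
    which span the polynomials.  Differentiating at [t = 0], [L^(s)] acts on
    polynomials by a quadratic expression in the left and right multiplications
    by [a] and [a^dag]; its formal Hilbert-Schmidt adjoint is read off from
    [rho^s a rho^-s = e^(beta s) a].  Embedded polynomials are dense, lie in
    [Dom L^(s)] and are invariant under the semigroup, so a mean value argument
    shows that on them the formal adjoint is the adjoint of [L^(s)].

    The sum [K] of the two expressions kills [1] (this uses the invariance of
    [rho], through the value of [kappa]) and is quadratic, so that
    [K(X P) = X K(P) + K(X) P + D_X(P)] for [X] of first order, where [D_X] is a
    derivation mapping [a] and [a^dag] to scalars.  Hence [K] is triangular on the monomials
    [X^i Y^j], with diagonal entries [i lambda + j mu]. *)

(** * Finite sums and series *)

(** The formula for [T_t] concerns bounded operators only, while polynomials are unbounded, so the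
    embedding property of the induced semigroup cannot be applied to them directly. It is applied to
    Weyl operators, constructed as matrices for small [z], and the polynomials are reached as Taylor
    coefficients in [r]. The term-by-term expansion rests on the weights of [rho]: for small [r] the
    embedded exponential series converges geometrically in Hilbert-Schmidt norm, and the semigroup
    is a contraction.

    Knowing [L^(s)] on polynomials does not determine its adjoint, since they are not known to be a
    core. The estimate comparing [<P, T_t x> - <P, x>] with [t] times the formal adjoint is
    therefore stated in a form that survives passage from polynomial [x] to arbitrary [x] by
    density, and only then divided by [t].

    Triangularity alone does not give an eigenvector for each [i lambda + j mu], because these
    numbers may coincide. The least index carrying a given value [nu] is chosen: on the span of the
    earlier monomials [K - nu] has nonzero diagonal entries, so the lower terms can be corrected
    away. *)

Ltac real_equation := match goal with |- ?a = ?b => change (@eq R a b) end.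

(** Sums run over the indices below [N], so that the empty sum exists and inductions start from it;
    [sum_n_rsum] translates to the inclusive sums of the library. *)
Fixpoint rsum (f : nat -> R) (N : nat) : R :=
  match N with O => 0 | S k => rsum f k + f k end.

Fixpoint csum (f : nat -> C) (N : nat) : C :=
  match N with O => RtoC 0 | S k => Cplus (csum f k) (f k) end.

Lemma rsum_ext f g N : (forall n, (n < N)%nat -> f n = g n) -> rsum f N = rsum g N.
Proof. induction N as [|N IH]; intros H; simpl; [easy|]. rewrite IH, H; auto. Qed.

Lemma csum_ext f g N : (forall n, (n < N)%nat -> f n = g n) -> csum f N = csum g N.
Proof. induction N as [|N IH]; intros H; simpl; [easy|]. rewrite IH, H; auto. Qed.

Lemma rsum_plus f g N : rsum (fun n => f n + g n) N = rsum f N + rsum g N.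
Proof. induction N as [|N IH]; simpl; [lra|rewrite IH; lra]. Qed.

Lemma rsum_scal a f N : rsum (fun n => a * f n) N = a * rsum f N.
Proof. induction N as [|N IH]; simpl; [lra|rewrite IH; lra]. Qed.

Lemma csum_plus f g N : csum (fun n => f n + g n)%C N = (csum f N + csum g N)%C.
Proof. induction N as [|N IH]; simpl; [ring|rewrite IH; ring]. Qed.

Lemma csum_scal a f N : csum (fun n => a * f n)%C N = (a * csum f N)%C.
Proof. induction N as [|N IH]; simpl; [ring|rewrite IH; ring]. Qed.

Lemma csum_0 N : csum (fun _ => RtoC 0) N = RtoC 0.
Proof. induction N as [|N IH]; simpl; [easy|rewrite IH; ring]. Qed.

Lemma rsum_le f g N : (forall n, (n < N)%nat -> f n <= g n) -> rsum f N <= rsum g N.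
Proof.
induction N as [|N IH]; intros H; simpl; [lra|].
apply Rplus_le_compat; auto.
Qed.

Lemma rsum_nonneg f N : (forall n, (n < N)%nat -> 0 <= f n) -> 0 <= rsum f N.
Proof.
induction N as [|N IH]; intros H; simpl; [lra|].
apply Rplus_le_le_0_compat; auto.
Qed.

Lemma rsum_mono f N M : (forall n, 0 <= f n) -> (N <= M)%nat -> rsum f N <= rsum f M.
Proof.
intros H; induction 1 as [|M _ IH]; [lra|]; simpl; specialize (H M); lra.
Qed.

Lemma rsum_term f N n : (forall n, 0 <= f n) -> (n < N)%nat -> f n <= rsum f N.
Proof.
intros H Hn; apply Rle_trans with (rsum f (S n)); [|now apply rsum_mono].
simpl; pose proof (rsum_nonneg f n (fun k _ => H k)); lra.
Qed.

Lemma rsum_swap (f : nat -> nat -> R) N M :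
  rsum (fun n => rsum (fun m => f n m) M) N = rsum (fun m => rsum (fun n => f n m) N) M.
Proof.
induction N as [|N IH]; simpl.
- induction M as [|M IH]; simpl; [easy|]; rewrite <- IH; ring.
- rewrite IH, <- rsum_plus; easy.
Qed.

Lemma csum_swap (f : nat -> nat -> C) N M :
  csum (fun n => csum (fun m => f n m) M) N = csum (fun m => csum (fun n => f n m) N) M.
Proof.
induction N as [|N IH]; simpl.
- symmetry; apply csum_0.
- rewrite IH, <- csum_plus; easy.
Qed.

Lemma csum_shift f N : csum f (S N) = (f 0%nat + csum (fun n => f (S n)) N)%C.
Proof. induction N as [|N IH]; [simpl; ring|]. simpl in *; rewrite IH; ring. Qed.

Lemma Re_csum f N : Re (csum f N) = rsum (fun n => Re (f n)) N.
Proof. induction N as [|N IH]; simpl; [easy|]. now rewrite <- IH. Qed.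

Lemma Im_csum f N : Im (csum f N) = rsum (fun n => Im (f n)) N.
Proof. induction N as [|N IH]; simpl; [easy|]. now rewrite <- IH. Qed.

Lemma csum_conj f N : Cconj (csum f N) = csum (fun n => Cconj (f n)) N.
Proof.
induction N as [|N IH]; simpl; [unfold Cconj; simpl; unfold RtoC; f_equal; lra|].
rewrite <- IH; apply Cplus_conj.
Qed.

Lemma csum_RtoC f N : csum (fun n => RtoC (f n)) N = RtoC (rsum f N).
Proof. induction N as [|N IH]; simpl; [easy|]. rewrite IH, RtoC_plus; easy. Qed.

Lemma Cmod_csum f N : Cmod (csum f N) <= rsum (fun n => Cmod (f n)) N.
Proof.
induction N as [|N IH]; simpl; [rewrite Cmod_0; lra|].
eapply Rle_trans; [apply Cmod_triangle|lra].
Qed.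

Lemma sum_n_rsum f N : sum_n f N = rsum f (S N).
Proof.
induction N as [|N IH].
- rewrite sum_O; simpl; lra.
- rewrite sum_Sn, IH; reflexivity.
Qed.

Lemma sum_n_csum (f : nat -> C) N : sum_n f N = csum f (S N).
Proof.
induction N as [|N IH].
- rewrite sum_O; simpl; ring.
- rewrite sum_Sn, IH; reflexivity.
Qed.

(** Induction on [N]: the new cross term [2 S x y] is at most [A y^2 + B x^2], because its square is
    at most [4 A B x^2 y^2] by the induction hypothesis. *)
Lemma rsum_cauchy_schwarz a b N :
  (rsum (fun n => a n * b n) N) ^ 2 <= rsum (fun n => a n ^ 2) N * rsum (fun n => b n ^ 2) N.
Proof.
induction N as [|N IH]; cbn [rsum]; [lra|].
set (S := rsum (fun n => a n * b n) N) in *.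
set (A := rsum (fun n => a n ^ 2) N) in *.
set (B := rsum (fun n => b n ^ 2) N) in *.
assert (HA : 0 <= A) by (apply rsum_nonneg; intros; apply pow2_ge_0).
assert (HB : 0 <= B) by (apply rsum_nonneg; intros; apply pow2_ge_0).
set (x := a N); set (y := b N).
assert (H : Rabs (2 * (S * (x * y))) <= Rabs (A * y ^ 2 + B * x ^ 2)).
{ apply Rsqr_le_abs_0; unfold Rsqr.
  assert (0 <= (A * y ^ 2 - B * x ^ 2) ^ 2) by apply pow2_ge_0.
  assert (0 <= (x * y) ^ 2 * (A * B - S ^ 2))
    by (apply Rmult_le_pos; [apply pow2_ge_0|lra]).
  nra. }
rewrite (Rabs_pos_eq (A * y ^ 2 + B * x ^ 2)) in H.
- pose proof (Rle_abs (2 * (S * (x * y)))).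
  replace ((S + x * y) ^ 2) with (S ^ 2 + 2 * (S * (x * y)) + x ^ 2 * y ^ 2) by ring.
  replace ((A + x ^ 2) * (B + y ^ 2))
    with (A * B + (A * y ^ 2 + B * x ^ 2) + x ^ 2 * y ^ 2) by ring.
  lra.
- apply Rplus_le_le_0_compat; apply Rmult_le_pos; auto; apply pow2_ge_0.
Qed.

Lemma is_series_rsum a l : is_series a l <-> is_lim_seq (rsum a) l.
Proof.
split; intros H.
- apply is_lim_seq_incr_1; apply is_lim_seq_ext with (sum_n a); [|exact H].
  intros n; apply sum_n_rsum.
- apply is_lim_seq_incr_1 in H.
  apply is_lim_seq_ext with (v := sum_n a) in H; [exact H|].
  intros n; symmetry; apply sum_n_rsum.
Qed.

Lemma Series_lim a : ex_series a -> is_lim_seq (rsum a) (Series a).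
Proof. intros H; apply is_series_rsum, Series_correct, H. Qed.

Lemma series_bounded a M :
  (forall n, 0 <= a n) -> (forall N, rsum a N <= M) -> ex_series a /\ Series a <= M.
Proof.
intros Ha HM.
assert (H : ex_finite_lim_seq (rsum a)).
{ apply ex_finite_lim_seq_incr with M; auto; intros n; simpl; specialize (Ha n); lra. }
destruct H as [l Hl].
assert (Hs : is_series a l) by now apply is_series_rsum.
split; [now exists l|].
rewrite (is_series_unique _ _ Hs).
apply (is_lim_seq_le (rsum a) (fun _ => M) l M); auto; apply is_lim_seq_const.
Qed.

Lemma rsum_le_Series a N : (forall n, 0 <= a n) -> ex_series a -> rsum a N <= Series a.
Proof.
intros Ha H.
apply (is_lim_seq_le_loc (fun _ => rsum a N) (rsum a) (rsum a N) (Series a)).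
- exists N; intros n Hn; now apply rsum_mono.
- apply is_lim_seq_const.
- now apply Series_lim.
Qed.

Lemma Series_nonneg a : (forall n, 0 <= a n) -> ex_series a -> 0 <= Series a.
Proof. intros Ha H; apply (rsum_le_Series a 0); auto. Qed.

Lemma ex_series_dom (a b : nat -> R) :
  (forall n, 0 <= a n <= b n) -> ex_series b -> ex_series a.
Proof.
intros H Hb; apply (ex_series_le (V := R_CompleteNormedModule) a b); auto.
intros n; change (Rabs (a n) <= b n); rewrite Rabs_pos_eq; apply H.
Qed.

(** Coordinatewise, to match [CSeries], which is a pair of real series. *)
Definition Clim (u : nat -> C) (l : C) : Prop :=
  is_lim_seq (fun n => Re (u n)) (Re l) /\ is_lim_seq (fun n => Im (u n)) (Im l).

Lemma Cmod_re_im (c : C) : Cmod c = sqrt (Re c ^ 2 + Im c ^ 2).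
Proof. reflexivity. Qed.

Lemma im_le_Cmod (c : C) : Rabs (Im c) <= Cmod c.
Proof. eapply Rle_trans; [apply Rmax_r|apply Rmax_Cmod]. Qed.

Lemma Cmod_le_re_im (c : C) : Cmod c <= Rabs (Re c) + Rabs (Im c).
Proof.
assert (H : c = Cplus (RtoC (Re c)) (Cmult Ci (RtoC (Im c)))).
{ destruct c as [x y]; unfold Cplus, Cmult, RtoC, Ci; simpl; f_equal; ring. }
rewrite H at 1; eapply Rle_trans; [apply Cmod_triangle|].
rewrite Cmod_mult, Cmod_Ci, !Cmod_R; lra.
Qed.

Lemma Clim_Cmod u l : Clim u l -> is_lim_seq (fun n => Cmod (u n)) (Cmod l).
Proof.
intros [H1 H2].
apply is_lim_seq_ext with (fun n => sqrt (Re (u n) * Re (u n) + Im (u n) * Im (u n))).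
{ intros n; rewrite Cmod_re_im; f_equal; ring. }
replace (Cmod l) with (sqrt (Re l * Re l + Im l * Im l))
  by (rewrite Cmod_re_im; f_equal; ring).
apply (is_lim_seq_continuous sqrt).
- apply continuity_pt_sqrt; nra.
- apply is_lim_seq_plus'; apply is_lim_seq_mult'; auto.
Qed.

Lemma Clim_unique u l l' : Clim u l -> Clim u l' -> l = l'.
Proof.
intros [H1 H2] [H3 H4].
apply is_lim_seq_unique in H1, H2, H3, H4.
rewrite H1 in H3; rewrite H2 in H4; inversion H3; inversion H4.
destruct l, l'; simpl in *; congruence.
Qed.

Lemma Clim_ext u v l : (forall n, u n = v n) -> Clim u l -> Clim v l.
Proof.
intros H [H1 H2]; split.
- apply is_lim_seq_ext with (2 := H1); intros n; now rewrite H.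
- apply is_lim_seq_ext with (2 := H2); intros n; now rewrite H.
Qed.

Lemma Clim_plus u v l l' : Clim u l -> Clim v l' -> Clim (fun n => u n + v n)%C (l + l')%C.
Proof. intros [H1 H2] [H3 H4]; split; simpl; now apply is_lim_seq_plus'. Qed.

Lemma Clim_const c : Clim (fun _ => c) c.
Proof. split; apply is_lim_seq_const. Qed.

Lemma Clim_mult u v l l' : Clim u l -> Clim v l' -> Clim (fun n => u n * v n)%C (l * l')%C.
Proof.
intros [H1 H2] [H3 H4]; split; simpl.
- apply is_lim_seq_minus'; now apply is_lim_seq_mult'.
- apply is_lim_seq_plus'; now apply is_lim_seq_mult'.
Qed.

Lemma Clim_conj u l : Clim u l -> Clim (fun n => Cconj (u n)) (Cconj l).
Proof.
intros [H1 H2]; split; simpl; [easy|].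
now apply is_lim_seq_opp in H2.
Qed.

Lemma Clim_incr u l : Clim (fun n => u (S n)) l <-> Clim u l.
Proof.
split; intros [H1 H2]; split.
- now apply is_lim_seq_incr_1.
- now apply is_lim_seq_incr_1.
- now apply (is_lim_seq_incr_1 (fun n => Re (u n))).
- now apply (is_lim_seq_incr_1 (fun n => Im (u n))).
Qed.

Lemma Clim_of_Cmod u l :
  is_lim_seq (fun n => Cmod (u n - l)%C) 0 -> Clim u l.
Proof.
intros H; split.
- apply is_lim_seq_ext with (fun n => Re (u n - l)%C + Re l); [intros n; unfold Re; simpl; ring|].
  replace (Finite (Re l)) with (Finite (0 + Re l)) by (f_equal; ring).
  apply is_lim_seq_plus'; [|apply is_lim_seq_const].
  apply is_lim_seq_abs_0.
  apply (is_lim_seq_le_le (fun _ => 0) _ (fun n => Cmod (u n - l)%C)); auto.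
  + intros n; split; [apply Rabs_pos|apply re_le_Cmod].
  + apply is_lim_seq_const.
- apply is_lim_seq_ext with (fun n => Im (u n - l)%C + Im l); [intros n; unfold Im; simpl; ring|].
  replace (Finite (Im l)) with (Finite (0 + Im l)) by (f_equal; ring).
  apply is_lim_seq_plus'; [|apply is_lim_seq_const].
  apply is_lim_seq_abs_0.
  apply (is_lim_seq_le_le (fun _ => 0) _ (fun n => Cmod (u n - l)%C)); auto.
  + intros n; split; [apply Rabs_pos|apply im_le_Cmod].
  + apply is_lim_seq_const.
Qed.

(** [CSeries] is total and has some value even for a divergent series; its algebraic rules are
    available only under this absolute summability. *)
Definition csummable (c : nat -> C) : Prop := ex_series (fun n => Cmod (c n)).

Lemma csummable_dom (c : nat -> C) (b : nat -> R) :
  (forall n, Cmod (c n) <= b n) -> ex_series b -> csummable c.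
Proof. intros H; apply ex_series_dom; intros n; split; [apply Cmod_ge_0|apply H]. Qed.

Lemma csummable_Re c : csummable c -> ex_series (fun n => Re (c n)).
Proof.
intros H; apply ex_series_Rabs, ex_series_dom with (2 := H).
intros n; split; [apply Rabs_pos|apply re_le_Cmod].
Qed.

Lemma csummable_Im c : csummable c -> ex_series (fun n => Im (c n)).
Proof.
intros H; apply ex_series_Rabs, ex_series_dom with (2 := H).
intros n; split; [apply Rabs_pos|apply im_le_Cmod].
Qed.

Lemma CSeries_lim c : csummable c -> Clim (csum c) (CSeries c).
Proof.
intros H; split.
- apply is_lim_seq_ext with (rsum (fun n => Re (c n))).
  + intros n; symmetry; apply Re_csum.
  + now apply Series_lim, csummable_Re.
- apply is_lim_seq_ext with (rsum (fun n => Im (c n))).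
  + intros n; symmetry; apply Im_csum.
  + now apply Series_lim, csummable_Im.
Qed.

Lemma csummable_plus c d :
  csummable c -> csummable d -> csummable (fun n => c n + d n)%C.
Proof.
intros H1 H2; apply csummable_dom with (fun n => Cmod (c n) + Cmod (d n)).
- intros n; apply Cmod_triangle.
- now apply (ex_series_plus (V := R_NormedModule)).
Qed.

Lemma csummable_scal a c : csummable c -> csummable (fun n => a * c n)%C.
Proof.
intros H1; apply csummable_dom with (fun n => Cmod a * Cmod (c n)).
- intros n; rewrite Cmod_mult; lra.
- now apply (ex_series_scal (V := R_NormedModule)).
Qed.

Lemma csummable_conj c : csummable c -> csummable (fun n => Cconj (c n)).
Proof.
intros H; apply csummable_dom with (2 := H); intros n; rewrite Cmod_conj; lra.
Qed.

Lemma csummable_ext c d : (forall n, c n = d n) -> csummable c -> csummable d.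
Proof. intros H; apply csummable_dom; intros n; rewrite H; lra. Qed.

Lemma CSeries_ext c d : (forall n, c n = d n) -> CSeries c = CSeries d.
Proof. intros H; f_equal; now apply functional_extensionality. Qed.

Lemma CSeries_eq c l : csummable c -> Clim (csum c) l -> CSeries c = l.
Proof. intros H; apply Clim_unique, CSeries_lim, H. Qed.

Lemma CSeries_plus c d :
  csummable c -> csummable d ->
  CSeries (fun n => c n + d n)%C = (CSeries c + CSeries d)%C.
Proof.
intros H1 H2; apply CSeries_eq; [now apply csummable_plus|].
apply Clim_ext with (fun N => csum c N + csum d N)%C.
- intros n; now rewrite csum_plus.
- apply Clim_plus; now apply CSeries_lim.
Qed.

Lemma CSeries_scal a c :
  csummable c -> CSeries (fun n => a * c n)%C = (a * CSeries c)%C.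
Proof.
intros H1; apply CSeries_eq; [now apply csummable_scal|].
apply Clim_ext with (fun N => a * csum c N)%C.
- intros n; now rewrite csum_scal.
- apply Clim_mult; [apply Clim_const|now apply CSeries_lim].
Qed.

Lemma CSeries_conj c :
  csummable c -> CSeries (fun n => Cconj (c n)) = Cconj (CSeries c).
Proof.
intros H1; apply CSeries_eq; [now apply csummable_conj|].
apply Clim_ext with (fun N => Cconj (csum c N)).
- intros n; now rewrite csum_conj.
- now apply Clim_conj, CSeries_lim.
Qed.

Lemma csummable_incr c : csummable (fun n => c (S n)) <-> csummable c.
Proof. symmetry; apply (ex_series_incr_1 (fun n => Cmod (c n))). Qed.

Lemma CSeries_incr c :
  csummable c -> CSeries c = (c 0%nat + CSeries (fun n => c (S n)))%C.
Proof.
intros H; apply CSeries_eq; auto.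
apply Clim_incr.
apply Clim_ext with (fun N => c 0%nat + csum (fun n => c (S n)) N)%C.
- intros n; now rewrite csum_shift.
- apply Clim_plus; [apply Clim_const|now apply CSeries_lim, csummable_incr].
Qed.

Lemma CSeries_0 c : (forall n, c n = RtoC 0) -> CSeries c = RtoC 0.
Proof.
intros H; unfold CSeries.
rewrite (Series_ext _ (fun _ => 0 * 0)), (Series_ext (fun n => Im (c n)) (fun _ => 0 * 0)).
- now rewrite Series_scal_l, Rmult_0_l.
- intros n; rewrite H; simpl; ring.
- intros n; rewrite H; simpl; ring.
Qed.

Lemma Cmod_CSeries c : csummable c -> Cmod (CSeries c) <= Series (fun n => Cmod (c n)).
Proof.
intros H.
apply (is_lim_seq_le (fun N => Cmod (csum c N)) (rsum (fun n => Cmod (c n)))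
         (Cmod (CSeries c)) (Series (fun n => Cmod (c n)))).
- intros n; apply Cmod_csum.
- now apply Clim_Cmod, CSeries_lim.
- now apply Series_lim.
Qed.

Lemma is_series_CSeries c : csummable c -> is_series (V := C_NormedModule) c (CSeries c).
Proof.
intros H.
destruct (CSeries_lim c H) as [H1 H2].
apply is_lim_seq_incr_1 in H1; apply is_lim_seq_incr_1 in H2.
apply filterlim_locally; intros eps.
apply is_lim_seq_spec in H1; apply is_lim_seq_spec in H2.
destruct (H1 eps) as [N1 HN1]; destruct (H2 eps) as [N2 HN2].
exists (max N1 N2); intros n Hn.
rewrite sum_n_csum.
split; [apply HN1|apply HN2]; lia.
Qed.

Lemma CSeries_single c n :
  (forall k, k <> n -> c k = RtoC 0) -> CSeries c = c n.
Proof.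
intros H.
assert (Hs : forall N, csum c N = if Nat.ltb n N then c n else RtoC 0).
{ induction N as [|N IH]; simpl; [easy|]; rewrite IH.
  destruct (Nat.ltb_spec n N); destruct (Nat.ltb_spec n (S N)); try lia.
  - rewrite (H N) by lia; ring.
  - replace N with n by lia; ring.
  - rewrite (H N) by lia; ring. }
apply CSeries_eq.
- apply (ex_series_incr_n (V := R_NormedModule) _ (S n)).
  exists 0; apply (is_series_ext (V := R_NormedModule) (fun _ => 0)).
  + intros k; rewrite H by lia; now rewrite Cmod_0.
  + apply is_series_rsum; apply is_lim_seq_ext with (fun _ => 0); [|apply is_lim_seq_const].
    intros k; induction k; simpl; lra.
- split; apply is_lim_seq_ext_loc with (2 := is_lim_seq_const _);
    exists (S n); intros k Hk; rewrite Hs; destruct (Nat.ltb_spec n k); easy || lia.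
Qed.

Lemma geom_series x : Rabs x < 1 -> ex_series (fun n => x ^ n) /\ Series (fun n => x ^ n) = / (1 - x).
Proof.
intros H; split; [exists (/ (1 - x)); now apply is_series_geom|now apply Series_geom].
Qed.

(** * Operators on the Fock space and their matrices *)

Lemma fock_ext (x y : fock) : (forall n, x n = y n) -> x = y.
Proof.
destruct x as [f Hf], y as [g Hg]; simpl; intros H.
assert (f = g) by now apply functional_extensionality.
subst g; f_equal; apply proof_irrelevance.
Qed.

Lemma fnorm_sq (x : fock) : fnorm x ^ 2 = Series (fun n => Cmod (x n) ^ 2).
Proof.
unfold fnorm; rewrite pow2_sqrt; auto.
apply Series_nonneg; [intros; apply pow2_ge_0|apply fockP].
Qed.

Lemma fnorm_pos x : 0 <= fnorm x.
Proof. apply sqrt_pos. Qed.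

Lemma fnorm_partial (x : fock) N : rsum (fun n => Cmod (x n) ^ 2) N <= fnorm x ^ 2.
Proof.
rewrite fnorm_sq; apply rsum_le_Series; [intros; apply pow2_ge_0|apply fockP].
Qed.

Lemma fnorm_coord (x : fock) n : Cmod (x n) <= fnorm x.
Proof.
apply Rsqr_incr_0_var; [|apply fnorm_pos]; rewrite !Rsqr_pow2.
apply Rle_trans with (2 := fnorm_partial x (S n)).
apply (rsum_term (fun n => Cmod (x n) ^ 2)); [intros; apply pow2_ge_0|lia].
Qed.

Lemma fnorm_le (x : fock) M :
  0 <= M -> (forall N, rsum (fun n => Cmod (x n) ^ 2) N <= M ^ 2) -> fnorm x <= M.
Proof.
intros HM H; apply Rsqr_incr_0_var; auto; rewrite !Rsqr_pow2, fnorm_sq.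
apply series_bounded; auto; intros; apply pow2_ge_0.
Qed.

Definition vec (f : nat -> C) : fock :=
  match excluded_middle_informative (sqsum f) with
  | left H => mkfock f H
  | right _ => fzero
  end.

Lemma vec_coord f n : sqsum f -> vec f n = f n.
Proof. intros H; unfold vec; destruct (excluded_middle_informative (sqsum f)); easy. Qed.

Lemma sqsum_bounded f M : (forall N, rsum (fun n => Cmod (f n) ^ 2) N <= M) -> sqsum f.
Proof. intros H; apply (series_bounded _ M); auto; intros; apply pow2_ge_0. Qed.

Lemma sqsum_mult (f g : nat -> C) :
  sqsum f -> sqsum g -> csummable (fun n => f n * g n)%C.
Proof.
intros Hf Hg; apply csummable_dom with (fun n => / 2 * (Cmod (f n) ^ 2 + Cmod (g n) ^ 2)).
- intros n; rewrite Cmod_mult; pose proof (pow2_ge_0 (Cmod (f n) - Cmod (g n))); lra.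
- apply (ex_series_scal (V := R_NormedModule)), (ex_series_plus (V := R_NormedModule)); easy.
Qed.

(** Columns come first: [M n m] is the [m]-th coordinate of the image of [e n], as for [nc_cols].
    The default value of [vec] is never met once the matrix is bounded. *)
Definition toop (M : nat -> nat -> C) : op :=
  fun x => vec (fun m => CSeries (fun n => Cmult (M n m) (x n))).

(** Boundedness is stated on finite sections, so it can be checked before any convergence is known;
    square summability of the rows and convergence of the matrix product are consequences. *)
Definition bddmx (M : nat -> nat -> C) (B : R) : Prop :=
  forall N K (x : nat -> C),
    rsum (fun m => Cmod (csum (fun n => M n m * x n)%C N) ^ 2) K
    <= B ^ 2 * rsum (fun n => Cmod (x n) ^ 2) N.

(** The bound is tested on the conjugate of the truncated row itself. Keeping only coordinate [m] of
    the image gives [S0^2 <= B^2 S0], hence [S0 <= B^2] uniformly in the truncation. *)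
Lemma bddmx_row M B m : bddmx M B -> sqsum (fun n => M n m).
Proof.
intros H; apply sqsum_bounded with (B ^ 2); intros N.
specialize (H N (S m) (fun n => Cconj (M n m))).
set (S0 := rsum (fun n => Cmod (M n m) ^ 2) N) in *.
assert (H0 : 0 <= S0) by (apply rsum_nonneg; intros; apply pow2_ge_0).
rewrite (rsum_ext (fun n => Cmod (Cconj (M n m)) ^ 2) (fun n => Cmod (M n m) ^ 2)) in H
  by (intros; now rewrite Cmod_conj).
fold S0 in H.
assert (H1 : S0 ^ 2 <= B ^ 2 * S0).
{ eapply Rle_trans with (2 := H).
  eapply Rle_trans;
    [|apply (rsum_term (fun m0 => Cmod (csum (fun n => M n m0 * Cconj (M n m))%C N) ^ 2) _ m);
      [intros; apply pow2_ge_0|lia]].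
  cbv beta.
  rewrite (csum_ext _ (fun n => RtoC (Cmod (M n m) ^ 2)))
    by (intros; now rewrite <- Cmod2_conj).
  rewrite csum_RtoC, Cmod_R; fold S0; rewrite Rabs_pos_eq by easy; lra. }
destruct (Req_dec S0 0) as [Hz|Hz]; [rewrite Hz; apply pow2_ge_0|].
apply Rmult_le_reg_r with S0; lra.
Qed.

Lemma bddmx_lim M B (x : fock) m :
  bddmx M B -> Clim (csum (fun n => M n m * x n)%C) (CSeries (fun n => M n m * x n)%C).
Proof.
intros H; apply CSeries_lim, sqsum_mult; [now apply bddmx_row with B|apply fockP].
Qed.

Lemma is_lim_seq_rsum (u : nat -> nat -> R) (l : nat -> R) K :
  (forall m, is_lim_seq (fun N => u N m) (l m)) ->
  is_lim_seq (fun N => rsum (u N) K) (rsum l K).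
Proof.
intros H; induction K as [|K IH]; simpl; [apply is_lim_seq_const|].
now apply is_lim_seq_plus'.
Qed.

Lemma is_lim_seq_pow2 u (l : R) :
  is_lim_seq u l -> is_lim_seq (fun n => u n ^ 2) (l ^ 2).
Proof.
intros H; apply is_lim_seq_ext with (fun n => u n * u n); [intros; ring|].
replace (l ^ 2) with (l * l) by ring; now apply is_lim_seq_mult'.
Qed.

(** The number [K] of output coordinates stays fixed while the input section grows, so the limit is
    taken in a finite sum. *)
Lemma bddmx_partial M B (x : fock) K :
  bddmx M B ->
  rsum (fun m => Cmod (CSeries (fun n => M n m * x n)%C) ^ 2) K <= (Rabs B * fnorm x) ^ 2.
Proof.
intros H.
apply (is_lim_seq_le
  (fun N => rsum (fun m => Cmod (csum (fun n => M n m * x n)%C N) ^ 2) K)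
  (fun N => (Rabs B * fnorm x) ^ 2)
  (rsum (fun m => Cmod (CSeries (fun n => M n m * x n)%C) ^ 2) K)
  ((Rabs B * fnorm x) ^ 2)).
- intros N; eapply Rle_trans; [apply H|].
  rewrite Rpow_mult_distr, pow2_abs.
  apply Rmult_le_compat_l; [apply pow2_ge_0|apply fnorm_partial].
- apply is_lim_seq_rsum; intros m.
  now apply is_lim_seq_pow2, Clim_Cmod, bddmx_lim with B.
- apply is_lim_seq_const.
Qed.

Lemma toop_coord M B (x : fock) m :
  bddmx M B -> toop M x m = CSeries (fun n => M n m * x n)%C.
Proof.
intros H; apply (vec_coord (fun m => CSeries (fun n => M n m * x n)%C)).
apply sqsum_bounded with ((Rabs B * fnorm x) ^ 2); intros K; now apply bddmx_partial.
Qed.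

Lemma toop_bounded M B : bddmx M B -> bounded_op (toop M).
Proof.
intros H.
assert (Hs : forall (x : fock) m, csummable (fun n => M n m * x n)%C)
  by (intros x m; apply sqsum_mult; [now apply bddmx_row with B|apply fockP]).
split; [|split].
- intros x y; apply fock_ext; intros m; simpl.
  rewrite !(toop_coord M B) by easy; simpl.
  rewrite <- CSeries_plus by apply Hs.
  apply CSeries_ext; intros n; ring.
- intros c x; apply fock_ext; intros m; simpl.
  rewrite !(toop_coord M B) by easy; simpl.
  rewrite <- CSeries_scal by apply Hs.
  apply CSeries_ext; intros n; ring.
- exists (Rabs B); intros x; apply fnorm_le.
  + apply Rmult_le_pos; [apply Rabs_pos|apply fnorm_pos].
  + intros N; erewrite rsum_ext; [now apply (bddmx_partial M B x)|].
    intros n _; cbv beta; now rewrite (toop_coord M B).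
Qed.

Lemma toop_e M B n m : bddmx M B -> toop M (e n) m = M n m.
Proof.
intros H; rewrite (toop_coord M B) by easy.
rewrite (CSeries_single _ n).
- simpl; unfold delta; rewrite Nat.eqb_refl; ring.
- intros k Hk; simpl; unfold delta.
  destruct (Nat.eqb_spec k n); [easy|ring].
Qed.

Definition hsmx (M : nat -> nat -> C) (S : R) : Prop :=
  forall N K, rsum (fun n => rsum (fun m => Cmod (M n m) ^ 2) K) N <= S.

Lemma hsmx_pos M S : hsmx M S -> 0 <= S.
Proof. intros H; apply (H 0%nat 0%nat). Qed.

(** Cauchy-Schwarz in each row: the operator norm is at most the Hilbert-Schmidt norm. *)
Lemma hsmx_bdd M S : hsmx M S -> bddmx M (sqrt S).
Proof.
intros H N K x.
rewrite pow2_sqrt by now apply hsmx_pos with M.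
apply Rle_trans with
  (rsum (fun m => rsum (fun n => Cmod (M n m) ^ 2) N * rsum (fun n => Cmod (x n) ^ 2) N) K).
- apply rsum_le; intros m _.
  apply Rle_trans with ((rsum (fun n => Cmod (M n m) * Cmod (x n)) N) ^ 2);
    [|apply rsum_cauchy_schwarz].
  apply pow_incr; split; [apply Cmod_ge_0|].
  eapply Rle_trans; [apply Cmod_csum|].
  apply rsum_le; intros; rewrite Cmod_mult; lra.
- rewrite (rsum_ext _ (fun m => rsum (fun n => Cmod (x n) ^ 2) N
                                * rsum (fun n => Cmod (M n m) ^ 2) N))
    by (intros; ring).
  rewrite rsum_scal, Rmult_comm, <- rsum_swap.
  apply Rmult_le_compat_r; [apply rsum_nonneg; intros; apply pow2_ge_0|apply H].
Qed.

Lemma hs_norm_pos A : 0 <= hs_norm A.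
Proof. apply sqrt_pos. Qed.

Lemma hs_norm_sq A : hs A -> hs_norm A ^ 2 = Series (fun n => fnorm (A (e n)) ^ 2).
Proof.
intros [_ H]; unfold hs_norm; rewrite pow2_sqrt; auto.
apply Series_nonneg; auto; intros; apply pow2_ge_0.
Qed.

Lemma hs_hsmx A : hs A -> hsmx (fun n => A (e n)) (hs_norm A ^ 2).
Proof.
intros H N K; rewrite hs_norm_sq by easy.
apply Rle_trans with (rsum (fun n => fnorm (A (e n)) ^ 2) N).
- apply rsum_le; intros; apply fnorm_partial.
- apply rsum_le_Series; [intros; apply pow2_ge_0|apply H].
Qed.

Lemma hs_intro A S :
  bounded_op A -> hsmx (fun n => A (e n)) S -> hs A /\ hs_norm A ^ 2 <= S.
Proof.
intros HA H.
assert (Hb : ex_series (fun n => fnorm (A (e n)) ^ 2)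
             /\ Series (fun n => fnorm (A (e n)) ^ 2) <= S).
{ apply series_bounded; [intros; apply pow2_ge_0|intros N].
  apply (is_lim_seq_le (fun K => rsum (fun n => rsum (fun m => Cmod (A (e n) m) ^ 2) K) N)
           (fun _ => S) (rsum (fun n => fnorm (A (e n)) ^ 2) N) S).
  - intros K; apply H.
  - apply is_lim_seq_rsum with (u := fun K n => rsum (fun m => Cmod (A (e n) m) ^ 2) K).
    intros n; rewrite fnorm_sq; apply Series_lim, fockP.
  - apply is_lim_seq_const. }
split; [split; easy|].
rewrite hs_norm_sq; [easy|split; easy].
Qed.

Lemma hsmx_ext M M' S : (forall n m, M n m = M' n m) -> hsmx M S -> hsmx M' S.
Proof.
intros H HM N K; erewrite rsum_ext; [apply (HM N K)|].
intros; apply rsum_ext; intros; now rewrite H.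
Qed.

Lemma toop_hs M S :
  hsmx M S ->
  hs (toop M) /\ (forall n m, toop M (e n) m = M n m) /\ hs_norm (toop M) ^ 2 <= S.
Proof.
intros H.
assert (He : forall n m, toop M (e n) m = M n m)
  by (intros; apply toop_e with (sqrt S); now apply hsmx_bdd).
assert (Hh : hs (toop M) /\ hs_norm (toop M) ^ 2 <= S).
{ apply hs_intro; [apply toop_bounded with (sqrt S); now apply hsmx_bdd|].
  apply hsmx_ext with (2 := H); intros; now rewrite He. }
easy.
Qed.

Lemma hs_norm_le A S : hs A -> hsmx (fun n => A (e n)) S -> hs_norm A ^ 2 <= S.
Proof. intros [H _]; now apply hs_intro. Qed.

Fixpoint trunc (x : nat -> C) (N : nat) : fock :=
  match N with O => fzero | S k => fplus (trunc x k) (fscal (x k) (e k)) end.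

Lemma trunc_coord x N m : trunc x N m = if Nat.ltb m N then x m else RtoC 0.
Proof.
induction N as [|N IH]; simpl; [easy|]; rewrite IH; unfold delta.
destruct (Nat.ltb_spec m N), (Nat.ltb_spec m (S N)), (Nat.eqb_spec m N);
  try lia; subst; ring.
Qed.

Lemma bounded_trunc A x N m :
  bounded_op A -> A (trunc x N) m = csum (fun n => x n * A (e n) m)%C N.
Proof.
intros (H1 & H2 & _); induction N as [|N IH]; simpl.
- replace fzero with (fscal (RtoC 0) fzero)
    by (apply fock_ext; intros; simpl; ring).
  rewrite H2; simpl; ring.
- rewrite H1, H2; simpl; now rewrite IH.
Qed.

Lemma fnorm_trunc (x : fock) :
  is_lim_seq (fun N => fnorm (fplus x (fscal (RtoC (-1)) (trunc x N)))) 0.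
Proof.
set (a := fun n => Cmod (x n) ^ 2).
assert (Ha : forall n, 0 <= a n) by (intros; apply pow2_ge_0).
apply (is_lim_seq_le_le (fun _ => 0) _ (fun N => sqrt (Series a - rsum a N))).
- intros N; split; [apply fnorm_pos|].
  assert (H0 : 0 <= Series a - rsum a N)
    by (pose proof (rsum_le_Series a N Ha (fockP x)); lra).
  apply fnorm_le; [apply sqrt_pos|]; intros K.
  rewrite pow2_sqrt by easy.
  apply Rle_trans with (rsum (fun n => Cmod (fplus x (fscal (RtoC (-1)) (trunc x N)) n) ^ 2) (N + K)).
  { apply rsum_mono; [intros; apply pow2_ge_0|lia]. }
  assert (H : rsum (fun n => Cmod (fplus x (fscal (RtoC (-1)) (trunc x N)) n) ^ 2) (N + K)
              = rsum a (N + K) - rsum a N).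
  { induction K as [|K IH].
    - rewrite Nat.add_0_r; rewrite (rsum_ext _ (fun n => 0 * a n)).
      + rewrite rsum_scal; ring.
      + intros n Hn; unfold a.
        cbn [coord fplus fscal]; rewrite trunc_coord; destruct (Nat.ltb_spec n N); [|lia].
        replace (x n + RtoC (-1) * x n)%C with (RtoC 0) by (apply injective_projections; simpl; ring).
        rewrite Cmod_0; ring.
    - rewrite Nat.add_succ_r; cbn [rsum]; rewrite IH; unfold a at 4.
      cbn [coord fplus fscal]; rewrite trunc_coord; destruct (Nat.ltb_spec (N + K) N); [lia|].
      rewrite Cmult_0_r, Cplus_0_r; unfold a; ring. }
  rewrite H.
  pose proof (rsum_le_Series a (N + K) Ha (fockP x)); lra.
- apply is_lim_seq_const.
- replace (Finite 0) with (Finite (sqrt (Series a - Series a)))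
    by (rewrite Rminus_diag, sqrt_0; easy).
  apply (is_lim_seq_continuous sqrt).
  + apply continuity_pt_sqrt; lra.
  + apply is_lim_seq_minus'; [apply is_lim_seq_const|apply Series_lim, fockP].
Qed.

Lemma bounded_coord A (x : fock) m :
  bounded_op A -> Clim (csum (fun n => x n * A (e n) m)%C) (A x m).
Proof.
intros HA; pose proof HA as (H1 & H2 & M & HM).
apply Clim_of_Cmod.
apply (is_lim_seq_le_le (fun _ => 0) _
  (fun N => M * fnorm (fplus x (fscal (RtoC (-1)) (trunc x N))))).
- intros N; split; [apply Cmod_ge_0|].
  eapply Rle_trans; [|apply HM].
  eapply Rle_trans; [|apply (fnorm_coord _ m)].
  rewrite H1, H2; cbn [coord fplus fscal].
  rewrite (bounded_trunc A) by easy.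
  rewrite <- Cmod_opp; right; f_equal.
  unfold RtoC; apply injective_projections; simpl; ring.
- apply is_lim_seq_const.
- replace (Finite 0) with (Finite (M * 0)) by (f_equal; ring).
  apply is_lim_seq_mult'; [apply is_lim_seq_const|apply fnorm_trunc].
Qed.

(** A bounded operator is determined by its entries because truncations converge in norm. With
    extensionality this gives Leibniz equality, the form in which the hypotheses on semigroups and
    adjoints state equations between operators. *)
Lemma op_ext A B :
  bounded_op A -> bounded_op B -> (forall n m, A (e n) m = B (e n) m) -> A = B.
Proof.
intros HA HB H; apply functional_extensionality; intros x; apply fock_ext; intros m.
apply Clim_unique with (csum (fun n => x n * A (e n) m)%C).
- now apply bounded_coord.
- apply Clim_ext with (csum (fun n => x n * B (e n) m)%C); [|now apply bounded_coord].
  intros N; apply csum_ext; intros; now rewrite H.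
Qed.

Lemma bounded_zero : bounded_op op_zero.
Proof.
split; [|split].
- intros x y; apply fock_ext; intros n; simpl; ring.
- intros c x; apply fock_ext; intros n; simpl; ring.
- exists 0; intros x; rewrite Rmult_0_l; apply fnorm_le; [lra|]; intros k.
  right; transitivity (rsum (fun _ => 0 * 0) k); [|rewrite rsum_scal; ring].
  apply rsum_ext; intros j _; simpl; rewrite Cmod_0; ring.
Qed.

Lemma sq_triangle (a b : C) : Cmod (a + b) ^ 2 <= 2 * Cmod a ^ 2 + 2 * Cmod b ^ 2.
Proof.
pose proof (Cmod_triangle a b); pose proof (Cmod_ge_0 (a + b)).
assert (Cmod (a + b) ^ 2 <= (Cmod a + Cmod b) ^ 2) by (apply pow_incr; lra).
pose proof (pow2_ge_0 (Cmod a - Cmod b)); lra.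
Qed.

Lemma hsmx_plus M M' S S' :
  hsmx M S -> hsmx M' S' -> hsmx (fun n m => M n m + M' n m)%C (2 * S + 2 * S').
Proof.
intros H H' N K.
apply Rle_trans with (rsum (fun n => 2 * rsum (fun m => Cmod (M n m) ^ 2) K
                                     + 2 * rsum (fun m => Cmod (M' n m) ^ 2) K) N).
- apply rsum_le; intros n _; rewrite <- !rsum_scal, <- rsum_plus.
  apply rsum_le; intros m _; apply sq_triangle.
- rewrite rsum_plus, !rsum_scal; specialize (H N K); specialize (H' N K); lra.
Qed.

Lemma hsmx_scal c M S : hsmx M S -> hsmx (fun n m => c * M n m)%C (Cmod c ^ 2 * S).
Proof.
intros H N K.
rewrite (rsum_ext _ (fun n => Cmod c ^ 2 * rsum (fun m => Cmod (M n m) ^ 2) K)).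
- rewrite rsum_scal; apply Rmult_le_compat_l; [apply pow2_ge_0|apply H].
- intros n _; rewrite <- rsum_scal; apply rsum_ext; intros; rewrite Cmod_mult; ring.
Qed.

Lemma fnorm_fplus x y : fnorm (fplus x y) ^ 2 <= 2 * fnorm x ^ 2 + 2 * fnorm y ^ 2.
Proof.
rewrite fnorm_sq; apply series_bounded; [intros; apply pow2_ge_0|]; intros N.
apply Rle_trans with (rsum (fun n => 2 * Cmod (x n) ^ 2 + 2 * Cmod (y n) ^ 2) N).
- apply rsum_le; intros; apply sq_triangle.
- rewrite rsum_plus, !rsum_scal.
  pose proof (fnorm_partial x N); pose proof (fnorm_partial y N); lra.
Qed.

Lemma fnorm_fscal c x : fnorm (fscal c x) = Cmod c * fnorm x.
Proof.
unfold fnorm.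
rewrite (Series_ext _ (fun n => Cmod c ^ 2 * Cmod (x n) ^ 2))
  by (intros; cbn [coord fscal]; rewrite Cmod_mult; ring).
rewrite Series_scal_l, sqrt_mult_alt by apply pow2_ge_0.
rewrite sqrt_pow2; [easy|apply Cmod_ge_0].
Qed.

Lemma bounded_add A B : bounded_op A -> bounded_op B -> bounded_op (op_add A B).
Proof.
intros (A1 & A2 & MA & HA) (B1 & B2 & MB & HB); unfold op_add; split; [|split].
- intros; rewrite A1, B1; apply fock_ext; intros; simpl; ring.
- intros; rewrite A2, B2; apply fock_ext; intros; simpl; ring.
- exists (2 * (Rabs MA + Rabs MB)); intros x.
  pose proof (fnorm_fplus (A x) (B x)) as H.
  pose proof (fnorm_pos x); pose proof (fnorm_pos (A x)); pose proof (fnorm_pos (B x)).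
  assert (HA' : fnorm (A x) <= Rabs MA * fnorm x)
    by (eapply Rle_trans; [apply HA|]; apply Rmult_le_compat_r; auto; apply Rle_abs).
  assert (HB' : fnorm (B x) <= Rabs MB * fnorm x)
    by (eapply Rle_trans; [apply HB|]; apply Rmult_le_compat_r; auto; apply Rle_abs).
  apply Rle_trans with (2 * (fnorm (A x) + fnorm (B x))); [|lra].
  apply Rsqr_incr_0_var; [rewrite !Rsqr_pow2; nra|lra].
Qed.

Lemma bounded_scal c A : bounded_op A -> bounded_op (op_scal c A).
Proof.
intros (A1 & A2 & MA & HA); unfold op_scal; split; [|split].
- intros; rewrite A1; apply fock_ext; intros; simpl; ring.
- intros; rewrite A2; apply fock_ext; intros; simpl; ring.
- exists (Cmod c * MA); intros x; rewrite fnorm_fscal, Rmult_assoc.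
  apply Rmult_le_compat_l; [apply Cmod_ge_0|apply HA].
Qed.

(** The crude factor 2 avoids square roots and suffices for membership; the sharp inequality is
    [hs_triangle], which needs the inner product. *)
Lemma hs_add A B :
  hs A -> hs B ->
  hs (op_add A B) /\ hs_norm (op_add A B) ^ 2 <= 2 * hs_norm A ^ 2 + 2 * hs_norm B ^ 2.
Proof.
intros HA HB; apply hs_intro; [apply bounded_add; [apply HA|apply HB]|].
apply (hsmx_plus (fun n => A (e n)) (fun n => B (e n))); now apply hs_hsmx.
Qed.

Lemma hs_scal c A :
  hs A -> hs (op_scal c A) /\ hs_norm (op_scal c A) ^ 2 <= Cmod c ^ 2 * hs_norm A ^ 2.
Proof.
intros HA; apply hs_intro; [apply bounded_scal, HA|].
apply (hsmx_scal c (fun n => A (e n))); now apply hs_hsmx.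
Qed.

Lemma hs_sub A B :
  hs A -> hs B ->
  hs (op_sub A B) /\ hs_norm (op_sub A B) ^ 2 <= 2 * hs_norm A ^ 2 + 2 * hs_norm B ^ 2.
Proof.
intros HA HB.
destruct (hs_scal (RtoC (-1)) B HB) as [H1 H2].
destruct (hs_add A _ HA H1) as [H3 H4].
split; auto.
rewrite Cmod_R, pow2_abs in H2; unfold op_sub; lra.
Qed.

Lemma hs_entry A n m : hs A -> Cmod (A (e n) m) <= hs_norm A.
Proof.
intros HA; apply Rsqr_incr_0_var; [|apply hs_norm_pos]; rewrite !Rsqr_pow2.
apply Rle_trans with (2 := hs_hsmx A HA (S n) (S m)).
eapply Rle_trans;
  [|apply (rsum_term (fun n => rsum (fun m => Cmod (A (e n) m) ^ 2) (S m)) _ n); [|lia]].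
- apply (rsum_term (fun m => Cmod (A (e n) m) ^ 2)); [intros; apply pow2_ge_0|lia].
- intros; apply rsum_nonneg; intros; apply pow2_ge_0.
Qed.

(** * The Hilbert-Schmidt inner product *)

Lemma sqsum_conj (x : nat -> C) : sqsum x -> sqsum (fun n => Cconj (x n)).
Proof.
intros H; apply ex_series_ext with (2 := H); intros n; now rewrite Cmod_conj.
Qed.

Lemma inner_summable (x y : fock) : csummable (fun n => Cconj (x n) * y n)%C.
Proof. apply (sqsum_mult (fun n => Cconj (x n))); [apply sqsum_conj, fockP|apply fockP]. Qed.

Lemma inner_plus_r x y z : inner x (fplus y z) = (inner x y + inner x z)%C.
Proof.
unfold inner; rewrite <- CSeries_plus by apply inner_summable.
apply CSeries_ext; intros; simpl; ring.
Qed.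

Lemma inner_scal_r c x y : inner x (fscal c y) = (c * inner x y)%C.
Proof.
unfold inner; rewrite <- CSeries_scal by apply inner_summable.
apply CSeries_ext; intros; simpl; ring.
Qed.

Lemma inner_conj x y : inner y x = Cconj (inner x y).
Proof.
unfold inner; rewrite <- CSeries_conj by apply inner_summable.
apply CSeries_ext; intros; rewrite Cmult_conj, Cconj_conj; ring.
Qed.

Lemma inner_bound x y : Cmod (inner x y) <= / 2 * (fnorm x ^ 2 + fnorm y ^ 2).
Proof.
unfold inner; eapply Rle_trans; [apply Cmod_CSeries, inner_summable|].
rewrite !fnorm_sq, <- Series_plus by apply fockP.
rewrite <- Series_scal_l; apply Series_le.
- intros n; split; [apply Cmod_ge_0|].
  rewrite Cmod_mult, Cmod_conj; pose proof (pow2_ge_0 (Cmod (x n) - Cmod (y n))); lra.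
- apply (ex_series_scal (V := R_NormedModule)), (ex_series_plus (V := R_NormedModule));
    apply fockP.
Qed.

Lemma inner_self x : inner x x = RtoC (fnorm x ^ 2).
Proof.
rewrite fnorm_sq; unfold inner; apply injective_projections; simpl.
- apply Series_ext; intros n; change (Re (Cconj (x n) * x n)%C = Cmod (x n) ^ 2).
  rewrite Cmult_comm, <- Cmod2_conj; reflexivity.
- rewrite (Series_ext _ (fun _ => 0 * 0)); [rewrite Series_scal_l; ring|].
  intros n; simpl; ring.
Qed.

Lemma hs_inner_summable A B : hs A -> hs B -> csummable (fun n => inner (A (e n)) (B (e n))).
Proof.
intros [_ HA] [_ HB].
apply csummable_dom with (fun n => / 2 * (fnorm (A (e n)) ^ 2 + fnorm (B (e n)) ^ 2)).
- intros n; apply inner_bound.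
- now apply (ex_series_scal (V := R_NormedModule)), (ex_series_plus (V := R_NormedModule)).
Qed.

Lemma hs_inner_add_r A B D :
  hs A -> hs B -> hs D -> hs_inner A (op_add B D) = (hs_inner A B + hs_inner A D)%C.
Proof.
intros HA HB HD; unfold hs_inner; rewrite <- CSeries_plus by now apply hs_inner_summable.
apply CSeries_ext; intros; apply inner_plus_r.
Qed.

Lemma hs_inner_scal_r c A B :
  hs A -> hs B -> hs_inner A (op_scal c B) = (c * hs_inner A B)%C.
Proof.
intros HA HB; unfold hs_inner; rewrite <- CSeries_scal by now apply hs_inner_summable.
apply CSeries_ext; intros; apply inner_scal_r.
Qed.

Lemma hs_inner_sub_r A B D :
  hs A -> hs B -> hs D -> hs_inner A (op_sub B D) = (hs_inner A B - hs_inner A D)%C.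
Proof.
intros HA HB HD; unfold op_sub.
rewrite hs_inner_add_r, hs_inner_scal_r; auto; [|now apply hs_scal].
unfold RtoC; apply injective_projections; simpl; ring.
Qed.

Lemma hs_inner_conj A B : hs A -> hs B -> hs_inner B A = Cconj (hs_inner A B).
Proof.
intros HA HB; unfold hs_inner; rewrite <- CSeries_conj by now apply hs_inner_summable.
apply CSeries_ext; intros; apply inner_conj.
Qed.

Lemma hs_inner_add_l A B D :
  hs A -> hs B -> hs D -> hs_inner (op_add B D) A = (hs_inner B A + hs_inner D A)%C.
Proof.
intros HA HB HD.
rewrite (hs_inner_conj A), hs_inner_add_r, Cplus_conj, <- !hs_inner_conj; auto.
now apply hs_add.
Qed.

Lemma hs_inner_scal_l c A B :
  hs A -> hs B -> hs_inner (op_scal c B) A = (Cconj c * hs_inner B A)%C.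
Proof.
intros HA HB.
rewrite (hs_inner_conj A), hs_inner_scal_r, Cmult_conj, <- !hs_inner_conj; auto.
now apply hs_scal.
Qed.

Lemma hs_inner_bound A B :
  hs A -> hs B -> Cmod (hs_inner A B) <= / 2 * (hs_norm A ^ 2 + hs_norm B ^ 2).
Proof.
intros HA HB; unfold hs_inner; eapply Rle_trans; [apply Cmod_CSeries; now apply hs_inner_summable|].
rewrite !hs_norm_sq, <- Series_plus, <- Series_scal_l; auto; try apply HA; try apply HB.
apply Series_le.
- intros n; split; [apply Cmod_ge_0|apply inner_bound].
- apply (ex_series_scal (V := R_NormedModule)), (ex_series_plus (V := R_NormedModule));
    [apply HA|apply HB].
Qed.

(** The scaling argument behind Cauchy-Schwarz: the best choice is [c = a / b]. If [a] or [b]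
    vanishes, a positive [u] is refuted by a suitable [c]. *)
Lemma le_of_quadratic a b u :
  0 <= a -> 0 <= b -> (forall c, 0 < c -> c * u <= / 2 * (a ^ 2 + c ^ 2 * b ^ 2)) -> u <= a * b.
Proof.
intros Ha Hb H.
destruct (Rle_lt_dec u 0) as [Hu|Hu]; [assert (0 <= a * b) by (now apply Rmult_le_pos); lra|].
destruct (Req_dec b 0) as [->|Hb'].
- set (c := (a ^ 2 + 1) / u).
  assert (Hc : c * u = a ^ 2 + 1) by (unfold c; field; lra).
  pose proof (pow2_ge_0 a).
  assert (0 < c) by (unfold c; apply Rdiv_lt_0_compat; lra).
  specialize (H c H1); rewrite Hc in H; nra.
- destruct (Req_dec a 0) as [->|Ha'].
  + set (c := u / b ^ 2).
    assert (Hp : 0 < b ^ 2) by (apply pow_lt; lra).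
    assert (0 < c) by (unfold c; now apply Rdiv_lt_0_compat).
    specialize (H c H0).
    assert (Hc : c * b ^ 2 = u) by (unfold c; field; lra).
    assert (c * u <= / 2 * (c * u)) by (rewrite <- Hc at 2; lra).
    assert (0 < c * u) by (now apply Rmult_lt_0_compat). lra.
  + assert (Hp : 0 < a / b) by (apply Rdiv_lt_0_compat; lra).
    specialize (H _ Hp).
    replace (/ 2 * (a ^ 2 + (a / b) ^ 2 * b ^ 2)) with (a / b * (a * b)) in H by (field; lra).
    apply Rmult_le_reg_l with (a / b); auto.
Qed.

Lemma hs_cauchy_schwarz A B :
  hs A -> hs B -> Cmod (hs_inner A B) <= hs_norm A * hs_norm B.
Proof.
intros HA HB; apply le_of_quadratic; try apply hs_norm_pos; intros c Hc.
destruct (hs_scal (RtoC c) B HB) as [H1 H2].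
pose proof (hs_inner_bound A _ HA H1) as H.
rewrite hs_inner_scal_r, Cmod_mult, Cmod_R, Rabs_pos_eq in H; auto; try lra.
rewrite Cmod_R, Rabs_pos_eq in H2; lra.
Qed.

Lemma hs_inner_self A : hs A -> hs_inner A A = RtoC (hs_norm A ^ 2).
Proof.
intros HA; rewrite hs_norm_sq by easy; unfold hs_inner.
unfold CSeries, RtoC; apply injective_projections; cbn [fst snd].
- apply Series_ext; intros n; now rewrite inner_self.
- rewrite (Series_ext _ (fun _ => 0 * 0)); [rewrite Series_scal_l; ring|].
  intros n; rewrite inner_self; simpl; ring.
Qed.

(** * Matrices with geometrically decaying entries *)

Definition decays (eta : R) (M : nat -> nat -> C) : Prop :=
  exists B, 0 <= B /\ forall n m, Cmod (M n m) <= B * eta ^ (n + m).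

Section Decay.

Variable eta : R.
Hypothesis eta01 : 0 < eta < 1.

Lemma eta2 : 0 < eta ^ 2 < 1.
Proof. split; [apply pow_lt; lra|]. nra. Qed.

Lemma rsum_eta2 N : rsum (fun n => (eta ^ 2) ^ n) N <= / (1 - eta ^ 2).
Proof.
pose proof eta2.
destruct (geom_series (eta ^ 2)) as [H1 H2]; [rewrite Rabs_pos_eq; lra|].
rewrite <- H2; apply rsum_le_Series; auto; intros; apply pow_le; lra.
Qed.

(** The double geometric series in [n] and [m] factors. Geometric decay is the working criterion for
    being Hilbert-Schmidt: it is stable under linear combinations and gives explicit norm bounds. *)
Lemma decay_hsmx M B :
  0 <= B -> (forall n m, Cmod (M n m) <= B * eta ^ (n + m)) ->
  hsmx M (B ^ 2 * (/ (1 - eta ^ 2)) ^ 2).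
Proof.
intros HB H N K; pose proof eta2 as He.
apply Rle_trans with
  (rsum (fun n => B ^ 2 * (eta ^ 2) ^ n * rsum (fun m => (eta ^ 2) ^ m) K) N).
- apply rsum_le; intros n _; rewrite <- rsum_scal; apply rsum_le; intros m _.
  apply Rle_trans with ((B * eta ^ (n + m)) ^ 2).
  + apply pow_incr; split; [apply Cmod_ge_0|apply H].
  + right; rewrite Rpow_mult_distr, <- !pow_mult, Rmult_assoc, <- pow_add; do 2 f_equal; lia.
- rewrite (rsum_ext _ (fun n => B ^ 2 * rsum (fun m => (eta ^ 2) ^ m) K * (eta ^ 2) ^ n))
    by (intros; ring).
  rewrite rsum_scal, Rmult_assoc; apply Rmult_le_compat_l; [apply pow2_ge_0|].
  replace ((/ (1 - eta ^ 2)) ^ 2) with (/ (1 - eta ^ 2) * / (1 - eta ^ 2)) by ring.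
  assert (H0 : forall J, 0 <= rsum (fun n => (eta ^ 2) ^ n) J)
    by (intros; apply rsum_nonneg; intros; apply pow_le; lra).
  apply Rmult_le_compat; try apply H0; apply rsum_eta2.
Qed.

Lemma dec_hs M : decays eta M -> hs (toop M) /\ forall n m, toop M (e n) m = M n m.
Proof.
intros (B & HB & H); apply decay_hsmx in H; auto.
now destruct (toop_hs _ _ H) as (H1 & H2 & _).
Qed.

Lemma dec_plus M M' : decays eta M -> decays eta M' -> decays eta (fun n m => M n m + M' n m)%C.
Proof.
intros (B & HB & H) (B' & HB' & H'); exists (B + B'); split; [lra|].
intros n m; eapply Rle_trans; [apply Cmod_triangle|].
specialize (H n m); specialize (H' n m); lra.
Qed.

Lemma dec_scal c M : decays eta M -> decays eta (fun n m => c * M n m)%C.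
Proof.
intros (B & HB & H); exists (Cmod c * B); split; [apply Rmult_le_pos; auto; apply Cmod_ge_0|].
intros n m; rewrite Cmod_mult, Rmult_assoc; apply Rmult_le_compat_l; auto; apply Cmod_ge_0.
Qed.

Lemma hs_norm_decay A B :
  hs A -> 0 <= B -> (forall n m, Cmod (A (e n) m) <= B * eta ^ (n + m)) ->
  hs_norm A <= B * / (1 - eta ^ 2).
Proof.
intros HA HB H; pose proof eta2.
assert (0 < / (1 - eta ^ 2)) by (apply Rinv_0_lt_compat; lra).
apply Rsqr_incr_0_var; [|apply Rmult_le_pos; lra].
rewrite !Rsqr_pow2, Rpow_mult_distr.
apply hs_norm_le; auto; now apply (decay_hsmx (fun n => A (e n))).
Qed.

End Decay.

(** * Polynomials as families of columns *)

(** [P n m] is the [m]-th coordinate of [P (delta n)]. *)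
Definition cols := nat -> nat -> C.

Definition cadd (P Q : cols) : cols := fun n m => (P n m + Q n m)%C.
Definition cscal (c : C) (P : cols) : cols := fun n m => (c * P n m)%C.
Definition czero : cols := fun _ _ => RtoC 0.
Definition cone : cols := delta.

(** [la], [lc] multiply by [a], [a^dag] on the left, [ra], [rc] on the right. *)
Definition la (P : cols) : cols := fun n => ann (P n).
Definition lc (P : cols) : cols := fun n => cre (P n).
Definition ra (P : cols) : cols := fun n m =>
  match n with O => RtoC 0 | S k => (RtoC (sqrt (INR (S k))) * P k m)%C end.
Definition rc (P : cols) : cols := fun n m => (RtoC (sqrt (INR (S n))) * P (S n) m)%C.

Lemma cols_ext (P Q : cols) : (forall n m, P n m = Q n m) -> P = Q.
Proof.
intros H; apply functional_extensionality; intros n; apply functional_extensionality; auto.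
Qed.

Lemma sqrt_INR_sq k : (RtoC (sqrt (INR k)) * RtoC (sqrt (INR k)))%C = RtoC (INR k).
Proof. rewrite <- RtoC_mult, sqrt_sqrt; [easy|apply pos_INR]. Qed.

Ltac cols_cases :=
  apply cols_ext; intros n m;
  unfold la, lc, ra, rc, cadd, cscal, czero, ann, cre;
  try (destruct n as [|n]); try (destruct m as [|m]).

Lemma la_add P Q : la (cadd P Q) = cadd (la P) (la Q).
Proof. cols_cases; ring. Qed.
Lemma lc_add P Q : lc (cadd P Q) = cadd (lc P) (lc Q).
Proof. cols_cases; ring. Qed.
Lemma ra_add P Q : ra (cadd P Q) = cadd (ra P) (ra Q).
Proof. cols_cases; ring. Qed.
Lemma rc_add P Q : rc (cadd P Q) = cadd (rc P) (rc Q).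
Proof. cols_cases; ring. Qed.
Lemma la_scal c P : la (cscal c P) = cscal c (la P).
Proof. cols_cases; ring. Qed.
Lemma lc_scal c P : lc (cscal c P) = cscal c (lc P).
Proof. cols_cases; ring. Qed.
Lemma ra_scal c P : ra (cscal c P) = cscal c (ra P).
Proof. cols_cases; ring. Qed.
Lemma rc_scal c P : rc (cscal c P) = cscal c (rc P).
Proof. cols_cases; ring. Qed.

Lemma ra_la P : ra (la P) = la (ra P).
Proof. cols_cases; ring. Qed.
Lemma ra_lc P : ra (lc P) = lc (ra P).
Proof. cols_cases; ring. Qed.
Lemma rc_la P : rc (la P) = la (rc P).
Proof. cols_cases; ring. Qed.
Lemma rc_lc P : rc (lc P) = lc (rc P).
Proof. cols_cases; ring. Qed.

Lemma la_lc P : la (lc P) = cadd (lc (la P)) P.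
Proof.
apply cols_ext; intros n m; unfold la, lc, cadd, ann, cre.
destruct m as [|m].
- rewrite Cmult_assoc, sqrt_INR_sq; simpl INR; ring.
- rewrite !Cmult_assoc, !sqrt_INR_sq, (S_INR (S m)), RtoC_plus; ring.
Qed.

Lemma rc_ra P : rc (ra P) = cadd (ra (rc P)) P.
Proof.
apply cols_ext; intros n m; unfold ra, rc, cadd.
destruct n as [|n].
- rewrite Cmult_assoc, sqrt_INR_sq; simpl INR; ring.
- rewrite !Cmult_assoc, !sqrt_INR_sq, (S_INR (S n)), RtoC_plus; ring.
Qed.

Lemma delta_S n m : delta (S n) (S m) = delta n m.
Proof. reflexivity. Qed.

Lemma delta_comm (f : nat -> C) n m : (f n * delta n m)%C = (f m * delta n m)%C.
Proof.
unfold delta; destruct (Nat.eqb_spec m n); [now subst|ring].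
Qed.

Lemma ra_one : ra cone = la cone.
Proof.
apply cols_ext; intros n m; unfold ra, la, ann, cone.
destruct n as [|n].
- unfold delta; simpl; ring.
- rewrite delta_S; apply (delta_comm (fun k => RtoC (sqrt (INR (S k))))).
Qed.

Lemma rc_one : rc cone = lc cone.
Proof.
apply cols_ext; intros n m; unfold rc, lc, cre, cone.
destruct m as [|m].
- unfold delta; simpl; ring.
- rewrite delta_S; apply (delta_comm (fun k => RtoC (sqrt (INR (S k))))).
Qed.

(* These rules bring every word in the four multiplications to the order [lc], [la], [ra], [rc] from
   the outside in. After that, an operator identity is an identity between entries, which [ring] or
   [field] decides. *)
#[global] Hint Rewrite la_add lc_add ra_add rc_add la_scal lc_scal ra_scal rc_scal
  ra_la ra_lc rc_la rc_lc la_lc rc_ra : cols.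

Definition comm_a (P : cols) : cols := cadd (la P) (cscal (RtoC (-1)) (ra P)).
Definition comm_c (P : cols) : cols := cadd (lc P) (cscal (RtoC (-1)) (rc P)).
Definition jordan_a (P : cols) : cols := cscal (RtoC (/ 2)) (cadd (la P) (ra P)).
Definition jordan_c (P : cols) : cols := cscal (RtoC (/ 2)) (cadd (lc P) (rc P)).

Lemma RtoC_m1 : RtoC (-1) = (- RtoC 1)%C.
Proof. now rewrite <- RtoC_opp. Qed.

Ltac cols_norm :=
  unfold comm_a, comm_c, jordan_a, jordan_c; autorewrite with cols;
  apply cols_ext; intros n m; unfold cadd, cscal, czero; rewrite ?RtoC_m1.

Lemma comm_a_la P : comm_a (la P) = la (comm_a P).
Proof. cols_norm; ring. Qed.
Lemma comm_a_lc P : comm_a (lc P) = cadd (lc (comm_a P)) P.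
Proof. cols_norm; ring. Qed.
Lemma comm_c_la P : comm_c (la P) = cadd (la (comm_c P)) (cscal (RtoC (-1)) P).
Proof. cols_norm; ring. Qed.
Lemma comm_c_lc P : comm_c (lc P) = lc (comm_c P).
Proof. cols_norm; ring. Qed.
Lemma comm_a_one : comm_a cone = czero.
Proof. unfold comm_a; rewrite ra_one; cols_norm; ring. Qed.
Lemma comm_c_one : comm_c cone = czero.
Proof. unfold comm_c; rewrite rc_one; cols_norm; ring. Qed.

(** * Quadratic generators and their formal adjoints *)

Section Quadratic.

Variables al alb k kb u ub S0 E Ei F Fi : C.

(** With [comm_a = [a, .]], [comm_c = [a^dag, .]] and [jordan_a], [jordan_c] the
    symmetrized multiplications: since [[a, A_z^k] = k z A_z^(k-1)], the last
    line differentiates the Gaussian factor of [T_t (W(z))] and the first two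
    differentiate [A_(e^(tZ) z)]. *)
Definition gen_form (P : cols) : cols :=
  cadd (cadd (jordan_c (cadd (cscal al (comm_a P)) (cscal k (comm_c P))))
             (cscal (RtoC (-1)) (jordan_a (cadd (cscal alb (comm_c P)) (cscal kb (comm_a P))))))
       (cscal (RtoC (- / 2))
          (cadd (cscal S0 (comm_a (comm_c P))) (cadd (cscal u (comm_c (comm_c P))) (cscal ub (comm_a (comm_a P)))))).

(** [E = e^(beta s)] and [F = e^(beta (1-s))], with inverses [Ei] and [Fi], come
    from moving [a] and [a^dag] through [rho^s] and [rho^(1-s)]. *)
Definition comm_a_adj (P : cols) : cols := cadd (cscal E (lc P)) (cscal (- Fi)%C (rc P)).
Definition comm_c_adj (P : cols) : cols := cadd (cscal Ei (la P)) (cscal (- F)%C (ra P)).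
Definition jordan_a_adj (P : cols) : cols :=
  cscal (RtoC (/ 2)) (cadd (cscal E (lc P)) (cscal Fi (rc P))).
Definition jordan_c_adj (P : cols) : cols :=
  cscal (RtoC (/ 2)) (cadd (cscal Ei (la P)) (cscal F (ra P))).

(** The terms of [gen_form] with each factor replaced by its adjoint, the factors in reverse order
    and [al], [k], [u] exchanged with [alb], [kb], [ub]. That this is an adjoint is
    [gen_pol_adjoint_pair]; here the coefficients are free parameters and the identities purely
    algebraic. *)
Definition gen_form_adj (P : cols) : cols :=
  cadd (cadd (cadd (cscal alb (comm_a_adj (jordan_c_adj P))) (cscal kb (comm_c_adj (jordan_c_adj P))))
             (cscal (RtoC (-1)) (cadd (cscal al (comm_c_adj (jordan_a_adj P))) (cscal k (comm_a_adj (jordan_a_adj P))))))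
       (cscal (RtoC (- / 2))
          (cadd (cscal S0 (comm_c_adj (comm_a_adj P))) (cadd (cscal ub (comm_c_adj (comm_c_adj P))) (cscal u (comm_a_adj (comm_a_adj P)))))).

Definition sym_form (P : cols) : cols := cadd (gen_form P) (gen_form_adj P).

Lemma sym_form_add P Q : sym_form (cadd P Q) = cadd (sym_form P) (sym_form Q).
Proof.
unfold sym_form, gen_form, gen_form_adj, comm_a_adj, comm_c_adj, jordan_a_adj, jordan_c_adj, comm_a, comm_c, jordan_a, jordan_c; autorewrite with cols.
apply cols_ext; intros n m; unfold cadd, cscal; ring.
Qed.

Lemma sym_form_scal c P : sym_form (cscal c P) = cscal c (sym_form P).
Proof.
unfold sym_form, gen_form, gen_form_adj, comm_a_adj, comm_c_adj, jordan_a_adj, jordan_c_adj, comm_a, comm_c, jordan_a, jordan_c; autorewrite with cols.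
apply cols_ext; intros n m; unfold cadd, cscal; ring.
Qed.

Lemma RtoC_mhalf : RtoC (- / 2) = (- RtoC (/ 2))%C.
Proof. apply RtoC_opp. Qed.

Lemma half_inv : RtoC (/ 2) = (/ (RtoC 1 + RtoC 1))%C.
Proof. rewrite <- RtoC_plus, <- RtoC_inv; f_equal; lra. Qed.

Lemma C2_neq : (RtoC 1 + RtoC 1)%C <> RtoC 0.
Proof. rewrite <- RtoC_plus; intros H; apply RtoC_inj in H; lra. Qed.

Hypothesis HE : E <> RtoC 0.
Hypothesis HF : F <> RtoC 0.
Hypothesis HEi : Ei = (/ E)%C.
Hypothesis HFi : Fi = (/ F)%C.

Ltac sym_form_field :=
  unfold sym_form, gen_form, gen_form_adj, comm_a_adj, comm_c_adj, jordan_a_adj, jordan_c_adj, comm_a, comm_c, jordan_a, jordan_c;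
  autorewrite with cols;
  apply cols_ext; intros n m; unfold cadd, cscal, czero;
  rewrite ?RtoC_mhalf, ?RtoC_m1, ?half_inv, ?HEi, ?HFi; field; repeat split; auto; apply C2_neq.

(** The commutator of a quadratic expression with [la] is linear in the four multiplications, and
    writing [ra = la - comm_a], [rc = lc - comm_c] turns it into a left multiplication plus a
    derivation. Once [sym_form] kills [cone], [c1] and [c2] are the coefficients of [sym_form] at
    [a]. *)
Lemma sym_form_la :
  exists c1 c2 g1 g2 : C, forall P,
  sym_form (la P) = cadd (cadd (la (sym_form P)) (cadd (cscal c1 (la P)) (cscal c2 (lc P))))
                   (cadd (cscal g1 (comm_a P)) (cscal g2 (comm_c P))).
Proof.
set (h := RtoC (/ 2)).
(* Read off from the expanded commutator: the coefficients of [ra] and [rc] are [-g1] and [-g2], and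
   those of [la] and [lc] are [c1 + g1] and [c2 + g2]. *)
exists (alb + h * al - h * alb + h * S0 - h * E * F * (alb + al + S0))%C.
exists (- k + E * E * (k + u) - u * E * Fi)%C.
exists (h * S0 - h * al - h * alb + h * E * F * (alb + al + S0))%C.
exists (u + u * E * Fi)%C.
intros P; unfold h.
sym_form_field.
Qed.

Lemma sym_form_lc :
  exists c1 c2 g1 g2 : C, forall P,
  sym_form (lc P) = cadd (cadd (lc (sym_form P)) (cadd (cscal c1 (la P)) (cscal c2 (lc P))))
                   (cadd (cscal g1 (comm_a P)) (cscal g2 (comm_c P))).
Proof.
set (h := RtoC (/ 2)).
exists (- kb + Ei * Ei * (kb - ub) + ub * Ei * F)%C.
exists (al + h * (alb - al - S0) + h * Ei * Fi * (S0 - alb - al))%C.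
exists (- ub - ub * Ei * F)%C.
exists (- h * (al + alb) - h * S0 - h * Ei * Fi * (S0 - alb - al))%C.
intros P; unfold h.
sym_form_field.
Qed.

(** The relations that make [rho] invariant: the first two encode the standardized value of [kappa],
    the third the relation between [gamma], the noise strength and [beta]. They are verified in
    [sym_gen_hyps]. *)
Hypothesis Hk : (k * (Ei + F) = u * (Ei - F))%C.
Hypothesis Hkb : (kb * (Ei + F) = ub * (Ei - F))%C.
Hypothesis Hal : ((al + alb) * (1 + E * F) + S0 * (E * F - 1) = 0)%C.

Lemma gen_form_one : gen_form cone = czero.
Proof.
unfold gen_form; rewrite comm_a_one, comm_c_one; unfold comm_a, comm_c, jordan_a, jordan_c.
apply cols_ext; intros n m; unfold la, lc, ra, rc, ann, cre, cadd, cscal, czero.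
destruct n, m; ring.
Qed.

(** On [cone] left and right multiplications agree, so only the coefficients of [a a],
    [a^dag a^dag], [a^dag a] and [1] survive. The first vanishes by [Hkb], the second by [Hk], and
    the last two are multiples of the left side of [Hal]. *)
Lemma gen_form_adj_one : gen_form_adj cone = czero.
Proof.
unfold gen_form_adj, comm_a_adj, comm_c_adj, jordan_a_adj, jordan_c_adj; autorewrite with cols; rewrite ?ra_one, ?rc_one.
autorewrite with cols; rewrite ?ra_one, ?rc_one; autorewrite with cols.
apply cols_ext; intros n m; unfold cadd, cscal, czero.
set (A := la (la cone) n m); set (B := lc (la cone) n m); set (D := lc (lc cone) n m).
set (I := cone n m).
assert (H1 : (kb * (Ei * Ei - F * F) = ub * (Ei - F) * (Ei - F))%C).
{ replace (kb * (Ei * Ei - F * F))%C with (kb * (Ei + F) * (Ei - F))%C by ring.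
  rewrite Hkb; ring. }
(* This is [Hk] multiplied by [E Fi (E - Fi)], since [E Fi (Ei + F) = E + Fi]. *)
assert (H2 : (k * (E * E - Fi * Fi) = - (u * (E - Fi) * (E - Fi)))%C).
{ replace (k * (E * E - Fi * Fi))%C
    with (k * (Ei + F) * (E * Fi * (E - Fi)))%C by (rewrite HEi, HFi; field; auto).
  rewrite Hk, HEi, HFi; field; auto. }
set (h := RtoC (/ 2)).
transitivity (A * h * (kb * (Ei * Ei - F * F) - ub * (Ei - F) * (Ei - F))
  - D * h * (k * (E * E - Fi * Fi) - (- (u * (E - Fi) * (E - Fi))))
  + h * ((al + alb) * (1 + E * F) + S0 * (E * F - 1)) * (B - Ei * Fi * (B + I)))%C.
- unfold h; rewrite ?RtoC_mhalf, ?RtoC_m1, ?half_inv, ?HEi, ?HFi; field.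
  repeat split; auto; apply C2_neq.
- rewrite H1, H2, Hal; ring.
Qed.

Lemma sym_form_one : sym_form cone = czero.
Proof.
unfold sym_form; rewrite gen_form_one, gen_form_adj_one; apply cols_ext; intros; unfold cadd, czero; ring.
Qed.

End Quadratic.

(** * Evaluation of noncommutative expressions *)

Lemma nc_eval_plus Q f g :
  nc_eval Q (fun m => f m + g m)%C = (fun m => nc_eval Q f m + nc_eval Q g m)%C.
Proof.
revert f g; induction Q as [c| | |Q1 IH1 Q2 IH2|Q1 IH1 Q2 IH2]; intros f g;
  apply functional_extensionality; intros m; simpl.
- ring.
- unfold ann; ring.
- unfold cre; destruct m; ring.
- rewrite IH1, IH2; ring.
- now rewrite IH2, IH1.
Qed.

Lemma nc_eval_scal Q a f : nc_eval Q (fun m => a * f m)%C = (fun m => a * nc_eval Q f m)%C.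
Proof.
revert f; induction Q as [c| | |Q1 IH1 Q2 IH2|Q1 IH1 Q2 IH2]; intros f;
  apply functional_extensionality; intros m; simpl.
- ring.
- unfold ann; ring.
- unfold cre; destruct m; ring.
- rewrite IH1, IH2; ring.
- now rewrite IH2, IH1.
Qed.

(** Each factor [a] looks one coordinate ahead and [a^dag] one back, so an expression reads finitely
    many coordinates. *)
Lemma nc_eval_local Q m :
  exists M, forall f g, (forall k, (k <= M)%nat -> f k = g k) -> nc_eval Q f m = nc_eval Q g m.
Proof.
assert (H : exists d, forall m f g,
          (forall k, (k <= m + d)%nat -> f k = g k) -> nc_eval Q f m = nc_eval Q g m).
{ clear m; induction Q as [c| | |Q1 [d1 H1] Q2 [d2 H2]|Q1 [d1 H1] Q2 [d2 H2]].
  - exists 0%nat; intros m f g H; simpl; rewrite (H m); auto; lia.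
  - exists 1%nat; intros m f g H; simpl; unfold ann; rewrite (H (S m)); auto; lia.
  - exists 0%nat; intros [|m] f g H; simpl; unfold cre; auto; rewrite (H m); auto; lia.
  - exists (max d1 d2); intros m f g H; simpl; rewrite (H1 m f g), (H2 m f g); auto;
      intros; apply H; lia.
  - exists (d1 + d2)%nat; intros m f g H; simpl; apply H1; intros k Hk.
    apply H2; intros j Hj; apply H; lia. }
destruct H as [d H]; exists (m + d)%nat; intros f g; apply H.
Qed.

(** [nc_eq] compares the actions on basis vectors only, while a first-order expression must be
    replaced by its normal form inside products, where it meets other sequences. Locality reduces
    every sequence to a finite combination of basis vectors. *)
Lemma nc_eval_ext Q Q' f : nc_eq Q Q' -> nc_eval Q f = nc_eval Q' f.
Proof.
intros H; apply functional_extensionality; intros m.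
destruct (nc_eval_local Q m) as [M HM], (nc_eval_local Q' m) as [M' HM'].
set (N := S (max M M')).
(* The truncation of [f] below [N], written as a combination of basis vectors so that linearity
   applies. *)
set (g := fun k => csum (fun n => f n * delta n k)%C N).
assert (Hg : forall k, (k < N)%nat -> f k = g k).
{ intros k Hk; unfold g; clear - Hk; induction N as [|N IH]; [lia|]; simpl.
  destruct (Nat.eq_dec k N) as [->|Hn].
  - rewrite (csum_ext _ (fun _ => RtoC 0)), csum_0.
    + unfold delta; rewrite Nat.eqb_refl; ring.
    + intros n Hn; unfold delta; destruct (Nat.eqb_spec N n); [lia|ring].
  - rewrite <- IH by lia; unfold delta; destruct (Nat.eqb_spec k N); [lia|ring]. }
rewrite (HM f g), (HM' f g) by (intros; apply Hg; unfold N; lia).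
assert (Hs : forall Q0 N0, nc_eval Q0 (fun k => csum (fun n => f n * delta n k)%C N0)
                  = fun m => csum (fun n => f n * nc_cols Q0 n m)%C N0).
{ intros Q0 N0; induction N0 as [|N0 IH]; simpl.
  - apply functional_extensionality; intros j.
    transitivity (nc_eval Q0 (fun k => RtoC 0 * RtoC 0)%C j).
    + f_equal; apply functional_extensionality; intros; ring.
    + rewrite (nc_eval_scal Q0 (RtoC 0) (fun _ => RtoC 0)); ring.
  - rewrite nc_eval_plus, IH, nc_eval_scal; reflexivity. }
unfold g; rewrite !Hs; apply csum_ext; intros n _; now rewrite (H n m).
Qed.

Lemma nc_eval_0 Q : nc_eval Q (fun _ => RtoC 0) = fun _ => RtoC 0.
Proof.
transitivity (nc_eval Q (fun _ => RtoC 0 * RtoC 0)%C).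
- f_equal; apply functional_extensionality; intros; ring.
- rewrite (nc_eval_scal Q (RtoC 0) (fun _ => RtoC 0)).
  apply functional_extensionality; intros; ring.
Qed.

Lemma nc_cols_add Q Q' : nc_cols (NCadd Q Q') = cadd (nc_cols Q) (nc_cols Q').
Proof. reflexivity. Qed.

Lemma nc_cols_scal c Q : nc_cols (NCmul (NCconst c) Q) = cscal c (nc_cols Q).
Proof. reflexivity. Qed.

Lemma nc_cols_one : nc_cols (NCconst (RtoC 1)) = cone.
Proof. apply cols_ext; intros; unfold nc_cols; simpl; unfold cone; ring. Qed.

Lemma nc_cols_ra Q : nc_cols (NCmul Q NCa) = ra (nc_cols Q).
Proof.
apply cols_ext; intros n m; unfold nc_cols, ra; simpl.
assert (H : la cone n = ra cone n) by now rewrite ra_one.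
unfold la, ra, cone in H; rewrite H; destruct n as [|n].
- now rewrite nc_eval_0.
- now rewrite nc_eval_scal.
Qed.

Lemma nc_cols_rc Q : nc_cols (NCmul Q NCadag) = rc (nc_cols Q).
Proof.
apply cols_ext; intros n m; unfold nc_cols, rc; simpl.
assert (H : lc cone n = rc cone n) by now rewrite rc_one.
unfold lc, rc, cone in H; rewrite H; now rewrite nc_eval_scal.
Qed.

(** A property of the columns, so that expressions defining the same operator are identified. *)
Definition pol (P : cols) : Prop := exists Q, P = nc_cols Q.

Lemma pol_one : pol cone.
Proof. exists (NCconst (RtoC 1)); now rewrite nc_cols_one. Qed.

Lemma pol_add P Q : pol P -> pol Q -> pol (cadd P Q).
Proof. intros [A ->] [B ->]; now exists (NCadd A B). Qed.

Lemma pol_scal c P : pol P -> pol (cscal c P).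
Proof. intros [A ->]; now exists (NCmul (NCconst c) A). Qed.

Lemma pol_la P : pol P -> pol (la P).
Proof. intros [A ->]; now exists (NCmul NCa A). Qed.

Lemma pol_lc P : pol P -> pol (lc P).
Proof. intros [A ->]; now exists (NCmul NCadag A). Qed.

Lemma pol_ra P : pol P -> pol (ra P).
Proof. intros [A ->]; exists (NCmul A NCa); now rewrite nc_cols_ra. Qed.

Lemma pol_rc P : pol P -> pol (rc P).
Proof. intros [A ->]; exists (NCmul A NCadag); now rewrite nc_cols_rc. Qed.

#[global] Hint Resolve pol_one pol_add pol_scal pol_la pol_lc pol_ra pol_rc : pol.

Lemma pol_comm_a P : pol P -> pol (comm_a P).
Proof. intros; unfold comm_a; auto with pol. Qed.

Lemma pol_comm_c P : pol P -> pol (comm_c P).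
Proof. intros; unfold comm_c; auto with pol. Qed.

#[global] Hint Resolve pol_comm_a pol_comm_c : pol.

Lemma pol_gen_form al alb k kb u ub S0 P : pol P -> pol (gen_form al alb k kb u ub S0 P).
Proof. intros; unfold gen_form, jordan_a, jordan_c; auto 20 with pol. Qed.

Lemma pol_gen_form_adj al alb k kb u ub S0 E Ei F Fi P :
  pol P -> pol (gen_form_adj al alb k kb u ub S0 E Ei F Fi P).
Proof. intros; unfold gen_form_adj, comm_a_adj, comm_c_adj, jordan_a_adj, jordan_c_adj; auto 20 with pol. Qed.

(** * Polynomials are spanned by powers of the field operators *)

Definition field_op (z : C) (P : cols) : cols := fun n => weyl_gen z (P n).

Definition field_power (z : C) (k : nat) : cols := fun n => Nat.iter k (weyl_gen z) (delta n).

Lemma field_op_eq z P : field_op z P = cadd (cscal z (lc P)) (cscal (- Cconj z)%C (la P)).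
Proof. apply cols_ext; intros n m; unfold field_op, weyl_gen, cadd, cscal, lc, la; ring. Qed.

Lemma field_power_S z k : field_power z (S k) = field_op z (field_power z k).
Proof. reflexivity. Qed.

Lemma field_op_add z P Q : field_op z (cadd P Q) = cadd (field_op z P) (field_op z Q).
Proof. rewrite !field_op_eq; autorewrite with cols; cols_norm; ring. Qed.

Lemma field_op_scal z c P : field_op z (cscal c P) = cscal c (field_op z P).
Proof. rewrite !field_op_eq; autorewrite with cols; cols_norm; ring. Qed.

Lemma field_op_comm v z P :
  field_op v (field_op z P) = cadd (field_op z (field_op v P)) (cscal (v * Cconj z - Cconj v * z)%C P).
Proof. rewrite !field_op_eq; autorewrite with cols; cols_norm; ring. Qed.

Fixpoint colsum (f : nat -> cols) (N : nat) : cols :=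
  match N with O => czero | S k => cadd (colsum f k) (f k) end.

Lemma colsum_entry f N n m : colsum f N n m = csum (fun i => f i n m) N.
Proof. induction N as [|N IH]; simpl; [easy|]; unfold cadd; now rewrite IH. Qed.

Lemma colsum_ext f g N : (forall i, (i < N)%nat -> f i = g i) -> colsum f N = colsum g N.
Proof. induction N as [|N IH]; intros H; simpl; [easy|]. rewrite IH, H; auto. Qed.

Lemma colsum_scal c f N : colsum (fun i => cscal c (f i)) N = cscal c (colsum f N).
Proof.
apply cols_ext; intros n m; unfold cscal; rewrite !colsum_entry; apply csum_scal.
Qed.

Lemma colsum_shift f N : colsum f (S N) = cadd (f 0%nat) (colsum (fun i => f (S i)) N).
Proof.
apply cols_ext; intros n m; unfold cadd; rewrite !colsum_entry; apply csum_shift.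
Qed.

Lemma field_op_czero z : field_op z czero = czero.
Proof.
replace czero with (cscal (RtoC 0) czero) by (apply cols_ext; intros; unfold cscal, czero; ring).
rewrite field_op_scal; apply cols_ext; intros; unfold cscal, czero; ring.
Qed.

Lemma field_op_colsum z f N : field_op z (colsum f N) = colsum (fun i => field_op z (f i)) N.
Proof.
induction N as [|N IH]; simpl; [apply field_op_czero|]; now rewrite field_op_add, IH.
Qed.

(** [mixed_power z v k i] is the coefficient of [eps^i] in [(A_z + eps A_v)^k]. *)
Fixpoint mixed_power (z v : C) (k i : nat) : cols :=
  match k with
  | O => match i with O => cone | S _ => czero end
  | S k' => cadd (field_op z (mixed_power z v k' i))
                 (match i with O => czero | S j => field_op v (mixed_power z v k' j) end)
  end.

Lemma mixed_power_0 z v k : mixed_power z v k 0 = field_power z k.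
Proof.
induction k as [|k IH]; simpl; [easy|]; rewrite IH, field_power_S.
apply cols_ext; intros; unfold cadd, czero; ring.
Qed.

Lemma mixed_power_big z v k i : (k < i)%nat -> mixed_power z v k i = czero.
Proof.
revert i; induction k as [|k IH]; intros [|i] Hi; try lia; simpl; auto.
rewrite !IH by lia; rewrite !field_op_czero; apply cols_ext; intros; unfold cadd, czero; ring.
Qed.

Lemma field_op_lin z v (eps : R) P :
  field_op (z + RtoC eps * v)%C P = cadd (field_op z P) (cscal (RtoC eps) (field_op v P)).
Proof.
rewrite !field_op_eq; autorewrite with cols; apply cols_ext; intros n m; unfold cadd, cscal.
rewrite Cplus_conj, Cmult_conj.
replace (Cconj (RtoC eps)) with (RtoC eps)
  by (unfold Cconj, RtoC; simpl; f_equal; ring).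
ring.
Qed.

Lemma field_power_mix z v (eps : R) k :
  field_power (z + RtoC eps * v)%C k = colsum (fun i => cscal (RtoC eps ^ i)%C (mixed_power z v k i)) (S k).
Proof.
induction k as [|k IH].
- apply cols_ext; intros; simpl; unfold field_power, cadd, cscal, czero, cone; simpl; ring.
- rewrite field_power_S, IH, field_op_lin, field_op_colsum.
  set (a := fun i => cscal (RtoC eps ^ i)%C (field_op z (mixed_power z v k i))).
  set (b := fun i => cscal (RtoC eps ^ S i)%C (field_op v (mixed_power z v k i))).
  transitivity (cadd (colsum a (S (S k))) (colsum b (S k))).
  + f_equal.
    * change (colsum a (S (S k))) with (cadd (colsum a (S k)) (a (S k))).
      unfold a at 2; rewrite mixed_power_big, field_op_czero by lia.
      rewrite (colsum_ext _ a) by (intros; apply field_op_scal).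
      apply cols_ext; intros; unfold cadd, cscal, czero; ring.
    * rewrite field_op_colsum, <- colsum_scal; apply colsum_ext; intros i _; unfold b.
      rewrite field_op_scal; apply cols_ext; intros; unfold cscal; simpl; ring.
  + rewrite (colsum_shift a), (colsum_shift _ (S k)).
    apply cols_ext; intros n m; unfold cadd.
    rewrite !colsum_entry; rewrite (csum_ext (fun i => cscal (RtoC eps ^ S i)%C _ n m)
      (fun i => a (S i) n m + b i n m)%C).
    * rewrite csum_plus; unfold a; cbn [mixed_power]; unfold cscal, cadd, czero; ring.
    * intros i _; unfold a, b; cbn [mixed_power]; unfold cscal, cadd; ring.
Qed.

(** The coefficient is the sum over [i <= k] of [A_z^i A_v A_z^(k-i)]. Moving [A_v] to the left
    costs [i] scalar commutators in the [i]-th term, [k (k+1) / 2] in total. For [k = 0] the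
    truncated [k - 1] is harmless, as its coefficient vanishes. *)
Lemma mixed_power_1 z v k :
  mixed_power z v (S k) 1 =
  cadd (cscal (RtoC (INR (S k))) (field_op v (field_power z k)))
       (cscal (- (v * Cconj z - Cconj v * z) * RtoC (INR k * INR (S k) / 2))%C (field_power z (k - 1))).
Proof.
induction k as [|k IH].
- cbn [mixed_power]; rewrite field_op_czero; apply cols_ext; intros n m.
  unfold cadd, cscal, czero; change (field_power z 0) with cone; simpl INR.
  replace (0 * 1 / 2) with 0 by field; ring.
- change (mixed_power z v (S (S k)) 1) with (cadd (field_op z (mixed_power z v (S k) 1)) (field_op v (mixed_power z v (S k) 0))).
  rewrite IH, mixed_power_0, field_op_add, !field_op_scal.
  set (c := (v * Cconj z - Cconj v * z)%C).
  assert (H1 : field_op z (field_op v (field_power z k)) = cadd (field_op v (field_power z (S k))) (cscal (- c)%C (field_power z k))).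
  { rewrite field_power_S, (field_op_comm v z); fold c.
    apply cols_ext; intros; unfold cadd, cscal; ring. }
  rewrite H1.
  assert (H2 : cscal (- c * RtoC (INR k * INR (S k) / 2))%C (field_op z (field_power z (k - 1)))
             = cscal (- c * RtoC (INR k * INR (S k) / 2))%C (field_power z k)).
  { destruct k as [|k].
    - simpl INR; replace (0 * 1 / 2) with 0 by field.
      apply cols_ext; intros; unfold cscal; ring.
    - rewrite <- field_power_S; do 3 f_equal; lia. }
  rewrite H2.
  replace (S k - 1)%nat with k by lia.
  apply cols_ext; intros n m; unfold cadd, cscal.
  replace (INR (S k) * INR (S (S k)) / 2) with (INR k * INR (S k) / 2 + INR (S k))
    by (rewrite !S_INR; field).
  rewrite (S_INR (S k)), !RtoC_plus; ring.
Qed.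

(** If [p(eps)] denotes the sum, then [p(2 eps) - 2^N p(eps)] has no term of degree [N], and its
    [i]-th coefficient is multiplied by [2^i - 2^N], nonzero for [i < N]. Induction on this replaces
    the inversion of a Vandermonde matrix. *)
Lemma coefficient_extraction (W : cols -> Prop) (f : nat -> cols) N :
  (forall P Q, W P -> W Q -> W (cadd P Q)) -> (forall c P, W P -> W (cscal c P)) ->
  (forall eps : R, W (colsum (fun i => cscal (RtoC eps ^ i)%C (f i)) N)) ->
  forall i, (i < N)%nat -> W (f i).
Proof.
intros Wadd Wscal; revert f; induction N as [|N IH]; intros f H; [lia|].
assert (H1 : forall i, (i < N)%nat -> W (f i)).
{ intros i Hi.
  set (d := fun i => RtoC (2 ^ i - 2 ^ N)).
  assert (Hd : W (cscal (d i) (f i))).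
  { apply (IH (fun i => cscal (d i) (f i))); auto.
    intros eps.
    replace (colsum (fun j => cscal (RtoC eps ^ j)%C (cscal (d j) (f j))) N)
      with (cadd (colsum (fun j => cscal (RtoC (2 * eps) ^ j)%C (f j)) (S N))
                 (cscal (- RtoC (2 ^ N))%C (colsum (fun j => cscal (RtoC eps ^ j)%C (f j)) (S N))));
      [auto|].
    apply cols_ext; intros n m; unfold cadd, cscal; rewrite !colsum_entry; cbn [csum].
    rewrite Cmult_plus_distr_l, <- csum_scal.
    transitivity (csum (fun j => RtoC (2 * eps) ^ j * f j n m + - RtoC (2 ^ N) * (RtoC eps ^ j * f j n m)) N
       + (RtoC (2 * eps) ^ N - RtoC (2 ^ N) * RtoC eps ^ N) * f N n m)%C.
    { rewrite csum_plus; ring. }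
    rewrite <- !RtoC_pow, <- RtoC_mult, <- RtoC_minus, <- Rpow_mult_distr, Rminus_diag.
    rewrite Cmult_0_l, Cplus_0_r; apply csum_ext; intros j _; unfold d.
    rewrite <- !RtoC_pow, RtoC_minus, Rpow_mult_distr, RtoC_mult; ring. }
  assert (Hn : d i <> RtoC 0).
  { unfold d; intros E; apply RtoC_inj in E.
    assert (2 ^ i < 2 ^ N) by (apply Rlt_pow; [lra|easy]). lra. }
  replace (f i) with (cscal (/ d i)%C (cscal (d i) (f i))); auto.
  apply cols_ext; intros; unfold cscal; field; auto. }
intros i Hi; destruct (Nat.eq_dec i N) as [->|]; [|apply H1; lia].
assert (H2 : forall M, (M <= N)%nat -> W (colsum f M)).
{ induction M as [|M IHM]; intros HM; simpl.
  - replace czero with (cscal (RtoC 0) (colsum (fun i => cscal (RtoC 0 ^ i)%C (f i)) (S N))); auto.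
    apply cols_ext; intros; unfold cscal, czero; ring.
  - apply Wadd; [apply IHM; lia|apply H1; lia]. }
replace (f N) with (cadd (colsum (fun i => cscal (RtoC 1 ^ i)%C (f i)) (S N))
                         (cscal (RtoC (-1)) (colsum f N))); auto.
apply cols_ext; intros n m; unfold cadd, cscal; rewrite !colsum_entry; cbn [csum].
rewrite (csum_ext (fun i0 => (RtoC 1 ^ i0 * f i0 n m)%C) (fun i0 => f i0 n m)).
- rewrite <- RtoC_pow, pow1, RtoC_m1; ring.
- intros; rewrite <- RtoC_pow, pow1; ring.
Qed.

Inductive power_span : cols -> Prop :=
  | power_span_pow z k : power_span (field_power z k)
  | power_span_add P Q : power_span P -> power_span Q -> power_span (cadd P Q)
  | power_span_scal c P : power_span P -> power_span (cscal c P).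

(** Polarization: [(A_z + eps A_v)^(k+1)] is itself a power of a field operator, so its first-order
    coefficient lies in the span, and [mixed_power_1] can be solved for [A_v A_z^k]. *)
Lemma power_span_field_op v P : power_span P -> power_span (field_op v P).
Proof.
induction 1 as [z k|P Q _ IHP _ IHQ|c P _ IH].
- assert (H : power_span (mixed_power z v (S k) 1)).
  { apply (coefficient_extraction power_span _ (S (S k))); try (now constructor); [|lia].
    intros eps; rewrite <- field_power_mix; constructor. }
  set (c := (- (v * Cconj z - Cconj v * z) * RtoC (INR k * INR (S k) / 2))%C).
  replace (field_op v (field_power z k)) with
    (cscal (RtoC (/ INR (S k)))
       (cadd (mixed_power z v (S k) 1) (cscal (- c)%C (field_power z (k - 1))))).
  + apply power_span_scal, power_span_add; [easy|apply power_span_scal, power_span_pow].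
  + rewrite mixed_power_1; fold c; apply cols_ext; intros n m; unfold cadd, cscal.
    assert (HS : INR (S k) <> 0) by (apply not_0_INR; lia).
    rewrite RtoC_inv by easy; field; intros E; apply RtoC_inj in E; easy.
- rewrite field_op_add; now constructor.
- rewrite field_op_scal; now constructor.
Qed.

Lemma la_field_op P :
  la P = cscal (RtoC (- / 2)) (cadd (field_op (RtoC 1) P) (cscal Ci (field_op Ci P))).
Proof.
rewrite !field_op_eq; apply cols_ext; intros n m; unfold cadd, cscal.
apply injective_projections; simpl; field.
Qed.

Lemma lc_field_op P :
  lc P = cscal (RtoC (/ 2)) (cadd (field_op (RtoC 1) P) (cscal (- Ci)%C (field_op Ci P))).
Proof.
rewrite !field_op_eq; apply cols_ext; intros n m; unfold cadd, cscal.
apply injective_projections; simpl; field.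
Qed.

Lemma pol_power_span P : pol P -> power_span P.
Proof.
intros [Q ->].
assert (H : forall Q P, power_span P -> power_span (fun n => nc_eval Q (P n))).
{ clear Q; induction Q as [c| | |Q1 IH1 Q2 IH2|Q1 IH1 Q2 IH2]; intros P HP; simpl.
  - now apply (power_span_scal c P).
  - change (power_span (la P)); rewrite la_field_op; apply power_span_scal, power_span_add; [|apply power_span_scal]; now apply power_span_field_op.
  - change (power_span (lc P)); rewrite lc_field_op; apply power_span_scal, power_span_add; [|apply power_span_scal]; now apply power_span_field_op.
  - apply (power_span_add (fun n => nc_eval Q1 (P n)) (fun n => nc_eval Q2 (P n))); auto.
  - apply (IH1 (fun n => nc_eval Q2 (P n))); auto. }
apply (H Q cone), (power_span_pow (RtoC 0) 0).
Qed.

Lemma pol_field_op z P : pol P -> pol (field_op z P).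
Proof. intros; rewrite field_op_eq; auto with pol. Qed.

Lemma pol_field_power z k : pol (field_power z k).
Proof.
induction k as [|k IH]; [exact pol_one|]; rewrite field_power_S; now apply pol_field_op.
Qed.

Lemma field_power_scal (r : R) z k : field_power (RtoC r * z)%C k = cscal (RtoC r ^ k)%C (field_power z k).
Proof.
induction k as [|k IH].
- apply cols_ext; intros; unfold field_power, cscal; simpl; ring.
- rewrite !field_power_S, IH, field_op_scal, !field_op_eq; apply cols_ext; intros; unfold cscal, cadd.
  rewrite Cmult_conj.
  replace (Cconj (RtoC r)) with (RtoC r) by (unfold Cconj, RtoC; simpl; f_equal; ring).
  simpl; ring.
Qed.

(** * Weyl operators *)

Lemma INR_fact_pos k : 0 < INR (fact k).
Proof. apply INR_fact_lt_0. Qed.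

Lemma pow_fact_le_exp y k : 0 <= y -> y ^ k / INR (fact k) <= exp y.
Proof.
intros Hy.
pose proof (is_exp_Reals y) as H.
assert (Hs : is_series (fun n => y ^ n / INR (fact n)) (exp y)).
{ apply is_series_ext with (2 := H); intros n.
  rewrite pow_n_pow; unfold scal, Rdiv; simpl; unfold mult; simpl; ring. }
rewrite <- (is_series_unique _ _ Hs).
assert (Hp : forall n, 0 <= y ^ n / INR (fact n)).
{ intros n; apply Rmult_le_pos; [now apply pow_le|].
  apply Rlt_le, Rinv_0_lt_compat, INR_fact_pos. }
eapply Rle_trans; [apply (rsum_term _ (S k) k Hp); lia|].
apply rsum_le_Series; auto; now exists (exp y).
Qed.

Lemma Rle_of_sq a b : 0 <= b -> a ^ 2 <= b ^ 2 -> a <= b.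
Proof. intros Hb H; apply Rsqr_incr_0_var; auto; now rewrite !Rsqr_pow2. Qed.

Lemma field_power_support z k n m : (n + k < m)%nat \/ (m + k < n)%nat -> field_power z k n m = RtoC 0.
Proof.
revert m; induction k as [|k IH]; intros m H.
- unfold field_power; simpl; unfold delta; destruct (Nat.eqb_spec m n); [lia|easy].
- rewrite field_power_S; unfold field_op, weyl_gen, ann, cre.
  rewrite (IH (S m)) by lia; destruct m as [|m]; [ring|rewrite IH by lia; ring].
Qed.

Lemma Cmod_sqrt_INR j c : Cmod (RtoC (sqrt (INR j)) * c) ^ 2 = INR j * Cmod c ^ 2.
Proof.
rewrite Cmod_mult, Cmod_R, Rpow_mult_distr, pow2_abs, pow2_sqrt; [easy|apply pos_INR].
Qed.

(** The column [A_z^k e_n] is supported on indices at most [n + k], so one more factor multiplies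
    the squared bound by at most [4 |z|^2 (n + 1 + k) <= 4 |z|^2 (n + 1) (k + 1)]. *)
Lemma field_power_bound z k n m :
  Cmod (field_power z k n m) ^ 2 <= (4 * Cmod z ^ 2 * INR (S n)) ^ k * INR (fact k).
Proof.
revert m; induction k as [|k IH]; intros m.
- simpl fact; unfold field_power; simpl; unfold delta; destruct (Nat.eqb m n);
    rewrite ?Cmod_1, ?Cmod_0; lra.
- set (B := (4 * Cmod z ^ 2 * INR (S n)) ^ k * INR (fact k)) in *.
  assert (HB : 0 <= B).
  { eapply Rle_trans; [apply pow2_ge_0|apply (IH 0%nat)]. }
  assert (HL : 0 <= INR (S n + k)) by apply pos_INR.
  assert (Hd : Cmod (cre (field_power z k n) m) ^ 2 <= INR (S n + k) * B).
  { unfold cre; destruct m as [|m].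
    - rewrite Cmod_0; rewrite pow_ne_zero by easy; now apply Rmult_le_pos.
    - rewrite Cmod_sqrt_INR.
      destruct (Nat.le_gt_cases m (n + k)) as [Hm|Hm].
      + apply Rmult_le_compat; auto using pos_INR, pow2_ge_0; apply le_INR; lia.
      + rewrite field_power_support, Cmod_0 by lia.
        rewrite pow_ne_zero, Rmult_0_r by easy; now apply Rmult_le_pos. }
  assert (Ha : Cmod (ann (field_power z k n) m) ^ 2 <= INR (S n + k) * B).
  { unfold ann; rewrite Cmod_sqrt_INR.
    destruct (Nat.le_gt_cases (S m) (n + k)) as [Hm|Hm].
    + apply Rmult_le_compat; auto using pos_INR, pow2_ge_0; apply le_INR; lia.
    + rewrite field_power_support, Cmod_0 by lia.
      rewrite pow_ne_zero, Rmult_0_r by easy; now apply Rmult_le_pos. }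
  rewrite field_power_S; unfold field_op, weyl_gen, Cminus.
  eapply Rle_trans; [apply sq_triangle|].
  rewrite Cmod_opp, !Cmod_mult, Cmod_conj, !(Rpow_mult_distr (Cmod z)).
  pose proof (pow2_ge_0 (Cmod z)) as Hz.
  apply Rle_trans with (4 * Cmod z ^ 2 * (INR (S n + k) * B)).
  { pose proof (Rmult_le_compat_l _ _ _ Hz Hd); pose proof (Rmult_le_compat_l _ _ _ Hz Ha); lra. }
  replace ((4 * Cmod z ^ 2 * INR (S n)) ^ S k * INR (fact (S k)))
    with (4 * Cmod z ^ 2 * (INR (S n) * INR (S k) * B))
    by (unfold B; change (fact (S k)) with (S k * fact k)%nat; rewrite mult_INR; cbn [pow]; ring).
  apply Rmult_le_compat_l; [lra|]; apply Rmult_le_compat_r; auto.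
  rewrite <- mult_INR; apply le_INR; nia.
Qed.

Definition weyl_term (z : C) (k : nat) : cols := cscal (RtoC (/ INR (fact k))) (field_power z k).

(** The growth [(n+1)^k / k!] is traded for [exp(eps (n+1))] at the price of [eps^(-k)]. The
    parameter is kept free in order to be matched later with the decay of the weights of [rho]. *)
Lemma weyl_term_bound_sq z k n m eps :
  0 < eps -> Cmod (weyl_term z k n m) ^ 2 <= (4 * Cmod z ^ 2 / eps) ^ k * exp (eps * INR (S n)).
Proof.
intros He; unfold weyl_term, cscal; rewrite Cmod_mult, Cmod_R, Rpow_mult_distr, pow2_abs.
pose proof (INR_fact_pos k) as Hf.
apply Rle_trans with ((/ INR (fact k)) ^ 2 * ((4 * Cmod z ^ 2 * INR (S n)) ^ k * INR (fact k))).
{ apply Rmult_le_compat_l; [apply pow2_ge_0|apply field_power_bound]. }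
replace ((/ INR (fact k)) ^ 2 * ((4 * Cmod z ^ 2 * INR (S n)) ^ k * INR (fact k)))
  with ((4 * Cmod z ^ 2 / eps) ^ k * ((eps * INR (S n)) ^ k / INR (fact k))).
- apply Rmult_le_compat_l.
  + apply pow_le, Rmult_le_pos; [|apply Rlt_le, Rinv_0_lt_compat; lra].
    pose proof (pow2_ge_0 (Cmod z)); lra.
  + apply pow_fact_le_exp, Rmult_le_pos; [lra|apply pos_INR].
- replace (4 * Cmod z ^ 2 * INR (S n)) with (4 * Cmod z ^ 2 / eps * (eps * INR (S n)))
    by (field; lra).
  rewrite (Rpow_mult_distr (4 * Cmod z ^ 2 / eps) (eps * INR (S n))); field; lra.
Qed.

Lemma weyl_term_bound z k n m : Cmod (weyl_term z k n m) <= exp (INR (S n)) * (2 * Cmod z) ^ k.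
Proof.
pose proof (Cmod_ge_0 z) as Hz.
assert (Hp : 0 <= (2 * Cmod z) ^ k) by (apply pow_le; lra).
assert (He : 1 <= exp (INR (S n))).
{ rewrite <- exp_0; left; apply exp_increasing, lt_0_INR; lia. }
apply Rle_of_sq; [apply Rmult_le_pos; lra|].
eapply Rle_trans; [apply (weyl_term_bound_sq z k n m 1); lra|].
rewrite Rpow_mult_distr, <- pow_mult, (Nat.mul_comm k), pow_mult, Rmult_comm.
replace (4 * Cmod z ^ 2 / 1) with ((2 * Cmod z) ^ 2) by field.
apply Rmult_le_compat_r; [apply pow_le, pow2_ge_0|].
rewrite Rmult_1_l; nra.
Qed.

Lemma CSeries_tail (c : nat -> C) B x K :
  0 <= x < 1 -> 0 <= B -> (forall k, Cmod (c k) <= B * x ^ k) ->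
  csummable c /\ Cmod (CSeries c - csum c K)%C <= B * x ^ K * / (1 - x).
Proof.
intros Hx HB H.
destruct (geom_series x) as [G1 G2]; [rewrite Rabs_pos_eq; lra|].
assert (Hs : csummable c).
{ apply csummable_dom with (1 := H); now apply (ex_series_scal (V := R_NormedModule)). }
split; auto.
revert c B HB H Hs; induction K as [|K IH]; intros c B HB H Hs.
- replace (CSeries c - csum c 0)%C with (CSeries c) by (simpl; ring).
  eapply Rle_trans; [now apply Cmod_CSeries|].
  rewrite pow_O, Rmult_1_r, <- G2, <- Series_scal_l; apply Series_le.
  + intros k; split; [apply Cmod_ge_0|apply H].
  + now apply (ex_series_scal (V := R_NormedModule)).
- rewrite CSeries_incr, csum_shift by easy.
  replace (c 0%nat + CSeries (fun n => c (S n)) - (c 0%nat + csum (fun n => c (S n)) K))%C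
    with (CSeries (fun n => c (S n)) - csum (fun n => c (S n)) K)%C by ring.
  eapply Rle_trans; [apply (IH (fun n => c (S n)) (B * x))|].
  + apply Rmult_le_pos; lra.
  + intros k; eapply Rle_trans; [apply H|]; simpl; lra.
  + now apply csummable_incr.
  + right; simpl; ring.
Qed.

Definition weyl_mx (z : C) : cols := fun n m => CSeries (fun k => weyl_term z k n m).

(** With [|z| <= 1/16] the ratio [2 |z|] in [weyl_term_bound] is at most [1/8], the rate that
    [exp_isometry] asks for. *)
Lemma weyl_term_summable z n m : Cmod z <= / 16 -> csummable (fun k => weyl_term z k n m).
Proof.
intros Hz; apply (CSeries_tail _ (exp (INR (S n))) (2 * Cmod z) 0).
- pose proof (Cmod_ge_0 z); lra.
- left; apply exp_pos.
- intros k; apply weyl_term_bound.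
Qed.

(** * Finitely supported sequences and skew-adjointness *)

Definition finsupp (f : nat -> C) : Prop := exists L, forall m, (L <= m)%nat -> f m = RtoC 0.

Lemma finsupp_summable f : finsupp f -> csummable f.
Proof.
intros [L H]; apply (ex_series_incr_n (V := R_NormedModule) _ L).
exists 0; apply (is_series_ext (V := R_NormedModule) (fun _ => 0)).
- intros k; rewrite H by lia; now rewrite Cmod_0.
- apply is_series_rsum; apply is_lim_seq_ext with (fun _ => 0); [|apply is_lim_seq_const].
  intros k; induction k; simpl; lra.
Qed.

(** Defined on raw sequences because [ann] and [cre] do not preserve [fock]; with one argument
    finitely supported the series is a finite sum. *)
Definition seq_inner (f g : nat -> C) : C := CSeries (fun m => Cconj (f m) * g m)%C.

Lemma finsupp_mult f g : finsupp g -> finsupp (fun m => f m * g m)%C.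
Proof. intros [L H]; exists L; intros m Hm; rewrite H by easy; ring. Qed.

Lemma finsupp_ann f : finsupp f -> finsupp (ann f).
Proof. intros [L H]; exists L; intros m Hm; unfold ann; rewrite H by lia; ring. Qed.

Lemma finsupp_cre f : finsupp f -> finsupp (cre f).
Proof.
intros [L H]; exists (S L); intros [|m] Hm; [lia|]; unfold cre; rewrite H by lia; ring.
Qed.

Lemma finsupp_lin a b f g : finsupp f -> finsupp g -> finsupp (fun m => a * f m + b * g m)%C.
Proof.
intros [L H] [L' H']; exists (max L L'); intros m Hm; rewrite H, H' by lia; ring.
Qed.

Lemma weyl_gen_eq z f : weyl_gen z f = fun m => (z * cre f m + - Cconj z * ann f m)%C.
Proof. apply functional_extensionality; intros m; unfold weyl_gen; ring. Qed.

Lemma finsupp_gen z f : finsupp f -> finsupp (weyl_gen z f).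
Proof.
intros H; rewrite weyl_gen_eq; apply finsupp_lin; [now apply finsupp_cre|now apply finsupp_ann].
Qed.

Lemma seq_inner_lin_r f a b g h :
  finsupp g -> finsupp h ->
  seq_inner f (fun m => a * g m + b * h m)%C = (a * seq_inner f g + b * seq_inner f h)%C.
Proof.
intros Hg Hh; unfold seq_inner.
rewrite <- !CSeries_scal by now apply finsupp_summable, finsupp_mult.
rewrite <- CSeries_plus by now apply csummable_scal, finsupp_summable, finsupp_mult.
apply CSeries_ext; intros; ring.
Qed.

Lemma seq_inner_conj f g : finsupp g -> seq_inner g f = Cconj (seq_inner f g).
Proof.
intros Hg; unfold seq_inner; rewrite <- CSeries_conj by now apply finsupp_summable, finsupp_mult.
apply CSeries_ext; intros; rewrite Cmult_conj, Cconj_conj; ring.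
Qed.

Lemma RtoC_conj r : Cconj (RtoC r) = RtoC r.
Proof. unfold Cconj, RtoC; simpl; f_equal; ring. Qed.

Lemma seq_inner_ann f g : finsupp f -> finsupp g -> seq_inner (ann f) g = seq_inner f (cre g).
Proof.
intros Hf Hg; unfold seq_inner.
rewrite (CSeries_incr (fun m => Cconj (f m) * cre g m)%C)
  by now apply finsupp_summable, finsupp_mult, finsupp_cre.
simpl (cre g 0); rewrite Cmult_0_r, Cplus_0_l; apply CSeries_ext; intros n.
unfold ann, cre; rewrite Cmult_conj, RtoC_conj; ring.
Qed.

Lemma seq_inner_cre f g : finsupp f -> finsupp g -> seq_inner (cre f) g = seq_inner f (ann g).
Proof.
intros Hf Hg; rewrite (seq_inner_conj g) by now apply finsupp_cre.
now rewrite <- seq_inner_ann, <- seq_inner_conj.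
Qed.

Lemma seq_inner_gen z f g :
  finsupp f -> finsupp g -> seq_inner (weyl_gen z f) g = (- seq_inner f (weyl_gen z g))%C.
Proof.
intros Hf Hg.
rewrite (seq_inner_conj g) by now apply finsupp_gen.
rewrite !weyl_gen_eq, !seq_inner_lin_r by auto using finsupp_ann, finsupp_cre.
rewrite Cplus_conj, !Cmult_conj, Copp_conj, Cconj_conj.
rewrite <- !seq_inner_conj by auto using finsupp_ann, finsupp_cre.
rewrite seq_inner_cre, seq_inner_ann by easy; ring.
Qed.

Lemma finsupp_iter z k f : finsupp f -> finsupp (Nat.iter k (weyl_gen z) f).
Proof. intros H; induction k as [|k IH]; simpl; auto; now apply finsupp_gen. Qed.

Lemma seq_inner_iter z i j f :
  finsupp f ->
  seq_inner (Nat.iter i (weyl_gen z) f) (Nat.iter j (weyl_gen z) f)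
  = (RtoC ((-1) ^ i) * seq_inner f (Nat.iter (i + j) (weyl_gen z) f))%C.
Proof.
intros Hf; revert j; induction i as [|i IH]; intros j; simpl Nat.iter.
- rewrite pow_O; ring.
- rewrite seq_inner_gen by now apply finsupp_iter.
  change (weyl_gen z (Nat.iter j (weyl_gen z) f)) with (Nat.iter (S j) (weyl_gen z) f).
  rewrite (IH (S j)), Nat.add_succ_r.
  change (S i + j)%nat with (S (i + j)); cbn [pow]; rewrite RtoC_mult, RtoC_m1; cbn [Nat.iter nat_rect]; unfold Nat.iter; simpl nat_rect; ring.
Qed.

Lemma triangle_sum (h : nat -> nat -> C) K :
  csum (fun i => csum (fun j => h i j) (K - i)) K
  = csum (fun k => csum (fun i => h i (k - i)%nat) (S k)) K.
Proof.
induction K as [|K IH]; [easy|].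
change (csum (fun i => csum (fun j => h i j) (S K - i)) (S K))
  with (csum (fun i => csum (fun j => h i j) (S K - i)) K
        + csum (fun j => h K j) (S K - K))%C.
change (csum (fun k => csum (fun i => h i (k - i)%nat) (S k)) (S K))
  with (csum (fun k => csum (fun i => h i (k - i)%nat) (S k)) K
        + (csum (fun i => h i (K - i)%nat) K + h K (K - K)%nat))%C.
rewrite <- IH; replace (S K - K)%nat with 1%nat by lia; simpl (csum _ 1).
rewrite (csum_ext _ (fun i => csum (fun j => h i j) (K - i) + h i (K - i)%nat)%C).
- rewrite csum_plus, Nat.sub_diag; ring.
- intros i Hi; replace (S K - i)%nat with (S (K - i)) by lia; reflexivity.
Qed.

Lemma csum_split (f : nat -> C) N M :
  csum f (N + M) = (csum f N + csum (fun i => f (N + i)%nat) M)%C.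
Proof.
induction M as [|M IH]; [rewrite Nat.add_0_r; simpl; ring|].
rewrite Nat.add_succ_r; simpl; rewrite IH; ring.
Qed.

Lemma binomial_bound k i : (i <= k)%nat -> / (INR (fact i) * INR (fact (k - i))) <= 2 ^ k / INR (fact k).
Proof.
intros Hi.
assert (H : Binomial.C k i <= 2 ^ k).
{ replace 2 with (1 + 1) by ring; rewrite binomial.
  rewrite <- sum_n_Reals, sum_n_rsum.
  assert (Hp : forall j, 0 <= Binomial.C k j * 1 ^ j * 1 ^ (k - j)).
  { intros j; rewrite !pow1, !Rmult_1_r; unfold Binomial.C.
    apply Rmult_le_pos; [apply pos_INR|apply Rlt_le, Rinv_0_lt_compat].
    apply Rmult_lt_0_compat; apply INR_fact_pos. }
  pose proof (rsum_term _ (S k) i Hp) as H; cbv beta in H; rewrite !pow1, !Rmult_1_r in H.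
  apply H; lia. }
pose proof (INR_fact_pos k).
apply Rmult_le_reg_r with (INR (fact k)); auto.
replace (2 ^ k / INR (fact k) * INR (fact k)) with (2 ^ k) by (field; lra).
eapply Rle_trans; [|apply H]; unfold Binomial.C; right; field.
split; apply INR_fact_neq_0.
Qed.

Lemma alternating_binomial k :
  rsum (fun i => (-1) ^ i / (INR (fact i) * INR (fact (k - i)))) (S k)
  = match k with O => 1 | S _ => 0 end.
Proof.
assert (H : rsum (fun i => (-1) ^ i / (INR (fact i) * INR (fact (k - i)))) (S k)
            = / INR (fact k) * (-1 + 1) ^ k).
{ rewrite binomial, <- sum_n_Reals, sum_n_rsum, <- rsum_scal.
  apply rsum_ext; intros i _; rewrite pow1; unfold Binomial.C; field.
  repeat split; apply INR_fact_neq_0. }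
rewrite H; replace (-1 + 1) with 0 by ring.
destruct k as [|k]; [simpl; field|rewrite pow_i by lia; ring].
Qed.

(** The partial sums [S_K] of [exp(A) f] satisfy [<S_K, S_K> -> <f, f>]: by
    skew-adjointness the terms of total degree [k], [0 < k < K], of the double
    sum cancel by the binomial theorem. *)
Lemma exp_isometry (c : nat -> C) G K :
  0 <= G -> (forall k, Cmod (c k) / INR (fact k) <= G * (/ 8) ^ k) ->
  Cmod (csum (fun i => csum (fun j =>
      RtoC ((-1) ^ i / (INR (fact i) * INR (fact j))) * c (i + j)%nat)%C (S K)) (S K) - c 0%nat)%C
  <= 4 * G * (/ 2) ^ K.
Proof.
intros HG Hc.
set (h := fun i j => (RtoC ((-1) ^ i / (INR (fact i) * INR (fact j))) * c (i + j)%nat)%C).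
(* The triangle [i + j <= K], summed by total degree, reduces to its term of degree zero. *)
assert (Htri : csum (fun i => csum (fun j => h i j) (S K - i)) (S K) = c 0%nat).
{ rewrite triangle_sum, csum_shift.
  rewrite (csum_ext (fun n => csum (fun i => h i (S n - i)%nat) (S (S n))) (fun _ => RtoC 0)).
  - rewrite csum_0; simpl csum; unfold h; simpl; replace (1 / (1 * 1)) with 1 by field; ring.
  - intros n _.
    rewrite (csum_ext _ (fun i => c (S n) * RtoC ((-1) ^ i / (INR (fact i) * INR (fact (S n - i)))))%C).
    + rewrite csum_scal, csum_RtoC, (alternating_binomial (S n)); ring.
    + intros i Hi; unfold h; replace (i + (S n - i))%nat with (S n) by lia; ring. }
(* The factor [2^(i+j)] from the binomial bound turns the rate [1/8] into [1/4]. This is then split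
   as [1/2] times [1/2], for the decay in [K] and for the summation over the corner. *)
assert (Hh : forall i j, Cmod (h i j) <= G * (/ 4) ^ (i + j)).
{ intros i j; unfold h; rewrite Cmod_mult, Cmod_R.
  unfold Rdiv; rewrite Rabs_mult, pow_1_abs, Rmult_1_l.
  pose proof (binomial_bound (i + j) i ltac:(lia)) as Hb.
  replace (i + j - i)%nat with j in Hb by lia.
  assert (Hp : 0 < / (INR (fact i) * INR (fact j))).
  { apply Rinv_0_lt_compat, Rmult_lt_0_compat; apply INR_fact_pos. }
  rewrite Rabs_pos_eq by lra.
  apply Rle_trans with (2 ^ (i + j) / INR (fact (i + j)) * Cmod (c (i + j)%nat)).
  { apply Rmult_le_compat_r; [apply Cmod_ge_0|easy]. }
  replace (2 ^ (i + j) / INR (fact (i + j)) * Cmod (c (i + j)%nat))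
    with (2 ^ (i + j) * (Cmod (c (i + j)%nat) / INR (fact (i + j))))
    by (field; apply INR_fact_neq_0).
  replace (G * (/ 4) ^ (i + j)) with (2 ^ (i + j) * (G * (/ 8) ^ (i + j))).
  - apply Rmult_le_compat_l; [apply pow_le; lra|apply Hc].
  - replace (/ 4) with (2 * / 8) by field; rewrite Rpow_mult_distr; ring. }
assert (Hgeo : forall N, rsum (fun i => (/ 2) ^ i) N <= 2).
{ intros N; destruct (geom_series (/ 2)) as [G1 G2]; [rewrite Rabs_pos_eq; lra|].
  assert (G3 : / (1 - / 2) = 2) by field.
  apply Rle_trans with (Series (fun i => (/ 2) ^ i)); [|lra].
  apply rsum_le_Series; auto; intros; apply pow_le; lra. }
change (Cmod (csum (fun i => csum (fun j => h i j) (S K)) (S K) - c 0%nat)%C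
        <= 4 * G * (/ 2) ^ K).
(* What is left of the square is the corner [i + j > K]. *)
replace (csum (fun i => csum (fun j => h i j) (S K)) (S K) - c 0%nat)%C
  with (csum (fun i => csum (fun j => h i (S K - i + j)%nat) i) (S K)).
- eapply Rle_trans; [apply Cmod_csum|].
  apply Rle_trans with (rsum (fun i => 2 * G * (/ 2) ^ K * (/ 2) ^ i) (S K)).
  + apply rsum_le; intros i Hi; eapply Rle_trans; [apply Cmod_csum|].
    apply Rle_trans with (rsum (fun j => G * (/ 2) ^ K * (/ 2) ^ i * (/ 2) ^ j) i).
    * apply rsum_le; intros j Hj; eapply Rle_trans; [apply Hh|].
      rewrite !Rmult_assoc; apply Rmult_le_compat_l; auto.
      replace (/ 4) with (/ 2 * / 2) by field; rewrite Rpow_mult_distr, <- !pow_add.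
      assert (H2 : forall a b, (b <= a)%nat -> (/ 2) ^ a <= (/ 2) ^ b).
      { intros a b Hab; rewrite !pow_inv; apply Rinv_le_contravar; [apply pow_lt; lra|].
        apply Rle_pow; [lra|easy]. }
      apply H2; lia.
    * rewrite rsum_scal; replace (2 * G * (/ 2) ^ K * (/ 2) ^ i)
        with (G * (/ 2) ^ K * (/ 2) ^ i * 2) by ring.
      apply Rmult_le_compat_l; [|apply Hgeo].
      repeat apply Rmult_le_pos; auto; apply pow_le; lra.
  + rewrite rsum_scal; replace (4 * G * (/ 2) ^ K) with (2 * G * (/ 2) ^ K * 2) by ring.
    apply Rmult_le_compat_l; [|apply Hgeo].
    repeat apply Rmult_le_pos; auto; try lra; apply pow_le; lra.
- rewrite <- Htri.
  assert (Hs : csum (fun i => csum (fun j => h i j) (S K)) (S K)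
    = (csum (fun i => csum (fun j => h i j) (S K - i)) (S K)
      + csum (fun i => csum (fun j => h i (S K - i + j)%nat) i) (S K))%C).
  { rewrite <- csum_plus; apply csum_ext; intros i Hi.
    rewrite <- csum_split; f_equal; lia. }
  rewrite Hs; ring.
Qed.

Lemma finsupp_csum (a : nat -> C) (g : nat -> nat -> C) N :
  (forall j, finsupp (g j)) -> finsupp (fun m => csum (fun j => a j * g j m)%C N).
Proof.
intros H; induction N as [|N [L IH]]; simpl; [now exists 0%nat|].
destruct (H N) as [L' H']; exists (max L L'); intros m Hm.
rewrite IH, H' by lia; ring.
Qed.

Lemma seq_inner_csum_r f (a : nat -> C) (g : nat -> nat -> C) N :
  (forall j, finsupp (g j)) ->
  seq_inner f (fun m => csum (fun j => a j * g j m)%C N) = csum (fun j => a j * seq_inner f (g j))%C N.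
Proof.
intros H; induction N as [|N IH]; simpl.
- unfold seq_inner; apply CSeries_0; intros; ring.
- rewrite <- IH.
  transitivity (seq_inner f (fun m => RtoC 1 * csum (fun j => a j * g j m)%C N + a N * g N m)%C).
  + unfold seq_inner; apply CSeries_ext; intros; ring.
  + rewrite seq_inner_lin_r; [ring|now apply finsupp_csum|apply H].
Qed.

Lemma seq_inner_csum_l f (a : nat -> C) (g : nat -> nat -> C) N :
  finsupp f -> (forall j, finsupp (g j)) ->
  seq_inner (fun m => csum (fun j => a j * g j m)%C N) f
  = csum (fun j => Cconj (a j) * seq_inner (g j) f)%C N.
Proof.
intros Hf H.
rewrite (seq_inner_conj f) by now apply finsupp_csum.
rewrite seq_inner_csum_r, csum_conj by easy; apply csum_ext; intros j _.
now rewrite Cmult_conj, (seq_inner_conj f (g j)).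
Qed.

Lemma seq_inner_csum f g N :
  (forall m, (N <= m)%nat -> f m = RtoC 0) -> seq_inner f g = csum (fun m => Cconj (f m) * g m)%C N.
Proof.
intros H.
assert (Hc : forall m, (N <= m)%nat -> (Cconj (f m) * g m = 0)%C).
{ intros m Hm; rewrite H, RtoC_conj by easy; ring. }
assert (Hs : forall M, csum (fun m => Cconj (f m) * g m)%C (N + M)
                       = csum (fun m => Cconj (f m) * g m)%C N).
{ intros M; rewrite csum_split, (csum_ext (fun i => Cconj (f (N + i)%nat) * g (N + i)%nat)%C (fun _ => RtoC 0)), csum_0;
    [ring|].
  intros i _; apply Hc; lia. }
unfold seq_inner; apply CSeries_eq.
- apply finsupp_summable; exists N; auto.
- split; apply is_lim_seq_ext_loc with (2 := is_lim_seq_const _); exists N; intros M HM;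
    replace M with (N + (M - N))%nat by lia; now rewrite Hs.
Qed.

Lemma seq_inner_partial f M : finsupp f -> rsum (fun m => Cmod (f m) ^ 2) M <= Re (seq_inner f f).
Proof.
intros Hf.
assert (H : Re (seq_inner f f) = Series (fun m => Cmod (f m) ^ 2)).
{ unfold seq_inner; simpl; apply Series_ext; intros n.
  change (Re (Cconj (f n) * f n)%C = Cmod (f n) ^ 2).
  rewrite Cmult_comm, <- Cmod2_conj; reflexivity. }
rewrite H; apply rsum_le_Series; [intros; apply pow2_ge_0|].
pose proof (finsupp_summable _ (finsupp_mult f f Hf)) as Hs; unfold csummable in Hs.
apply ex_series_ext with (2 := Hs); intros n.
change (Cmod (f n * f n)%C = Cmod (f n) ^ 2); rewrite Cmod_mult; ring.
Qed.

Lemma iter_csum z k (x : nat -> C) N m :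
  Nat.iter k (weyl_gen z) (fun m => csum (fun n => x n * delta n m)%C N) m
  = csum (fun n => x n * field_power z k n m)%C N.
Proof.
revert m; induction k as [|k IH]; intros m; [easy|]; simpl Nat.iter.
assert (E : Nat.iter k (weyl_gen z) (fun m => csum (fun n => x n * delta n m)%C N)
            = fun m => csum (fun n => x n * field_power z k n m)%C N)
  by now apply functional_extensionality.
rewrite E; clear; unfold weyl_gen.
induction N as [|N IH].
- simpl; unfold ann, cre; destruct m; ring.
- cbn [csum]; rewrite <- IH; rewrite field_power_S; unfold field_op, weyl_gen, ann, cre; destruct m; ring.
Qed.

(** For the finitely supported [f] with coordinates [x], [exp_isometry] is applied to
    [c k = <f, A^k f>]: the partial sums of [exp(A) f] have squared norm tending to that of [f]. The
    limit is taken at a fixed number [M] of output coordinates. *)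
Lemma weyl_mx_contraction z N M (x : nat -> C) :
  Cmod z <= / 16 ->
  rsum (fun m => Cmod (csum (fun n => weyl_mx z n m * x n)%C N) ^ 2) M
  <= rsum (fun n => Cmod (x n) ^ 2) N.
Proof.
intros Hz; pose proof (Cmod_ge_0 z) as Hz0.
set (f := fun m => csum (fun n => x n * delta n m)%C N).
assert (Hf : forall m, (N <= m)%nat -> f m = RtoC 0).
{ intros m Hm; unfold f; rewrite (csum_ext _ (fun _ => RtoC 0)); [apply csum_0|].
  intros n Hn; unfold delta; destruct (Nat.eqb_spec m n); [lia|ring]. }
assert (Hfx : forall m, (m < N)%nat -> f m = x m).
{ intros m Hm; unfold f; clear - Hm; induction N as [|N IH]; [lia|]; simpl.
  destruct (Nat.eq_dec m N) as [->|Hn].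
  - rewrite (csum_ext _ (fun _ => RtoC 0)), csum_0.
    + unfold delta; rewrite Nat.eqb_refl; ring.
    + intros n Hn; unfold delta; destruct (Nat.eqb_spec N n); [lia|ring].
  - rewrite IH by lia; unfold delta; destruct (Nat.eqb_spec m N); [lia|ring]. }
assert (Hfs : finsupp f) by now exists N.
set (fi := fun i => Nat.iter i (weyl_gen z) f).
assert (Hfi : forall i, finsupp (fi i)) by (intros; now apply finsupp_iter).
set (S0 := fun K m => csum (fun i => RtoC (/ INR (fact i)) * fi i m)%C (S K)).
set (c := fun k => seq_inner f (fi k)).
set (X := rsum (fun n => Cmod (x n)) N).
assert (HX : 0 <= X) by (apply rsum_nonneg; intros; apply Cmod_ge_0).
(* All basis indices occurring in [f] are below [N], so [exp (INR N)] dominates the prefactors of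
   [weyl_term_bound]; the two factors [X] come from the two arguments of [<f, A^k f>]. *)
set (G := exp (INR N) * X * X).
assert (HG : 0 <= G).
{ unfold G; repeat apply Rmult_le_pos; auto; left; apply exp_pos. }
assert (Hc : forall k, Cmod (c k) / INR (fact k) <= G * (/ 8) ^ k).
{ intros k; unfold c; rewrite (seq_inner_csum f _ N Hf).
  apply Rle_trans with (rsum (fun m => exp (INR N) * (/ 8) ^ k * X * Cmod (x m)) N).
  - unfold Rdiv; rewrite Rmult_comm.
    apply Rle_trans with (/ INR (fact k) * rsum (fun m => Cmod (Cconj (f m) * fi k m)%C) N).
    { apply Rmult_le_compat_l; [apply Rlt_le, Rinv_0_lt_compat, INR_fact_pos|apply Cmod_csum]. }
    rewrite <- rsum_scal; apply rsum_le; intros m Hm.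
    rewrite Cmod_mult, Cmod_conj, Hfx by easy.
    replace (/ INR (fact k) * (Cmod (x m) * Cmod (fi k m)))
      with (Cmod (x m) * (/ INR (fact k) * Cmod (fi k m))) by ring.
    rewrite (Rmult_comm _ (Cmod (x m))); apply Rmult_le_compat_l; [apply Cmod_ge_0|].
    unfold fi, f; rewrite iter_csum.
    replace (/ INR (fact k) * Cmod (csum (fun n => x n * field_power z k n m)%C N))
      with (Cmod (csum (fun n => x n * weyl_term z k n m)%C N)).
    + eapply Rle_trans; [apply Cmod_csum|]; unfold X; rewrite <- rsum_scal.
      apply rsum_le; intros n Hn; rewrite Cmod_mult, Rmult_comm.
      apply Rmult_le_compat_r; [apply Cmod_ge_0|].
      eapply Rle_trans; [apply weyl_term_bound|].
      apply Rmult_le_compat.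
      * left; apply exp_pos.
      * apply pow_le; lra.
      * destruct (Nat.eq_dec (S n) N) as [->|]; [lra|left; apply exp_increasing, lt_INR; lia].
      * apply pow_incr; lra.
    + rewrite (csum_ext _ (fun n => RtoC (/ INR (fact k)) * (x n * field_power z k n m))%C)
        by (intros; unfold weyl_term, cscal; ring).
      rewrite csum_scal, Cmod_mult, Cmod_R, Rabs_pos_eq; [easy|].
      apply Rlt_le, Rinv_0_lt_compat, INR_fact_pos.
  - rewrite rsum_scal; unfold G; fold X; right; ring. }
assert (HK : forall K, rsum (fun m => Cmod (S0 K m) ^ 2) M
                       <= rsum (fun n => Cmod (x n) ^ 2) N + 4 * G * (/ 2) ^ K).
{ intros K.
  assert (HS : finsupp (S0 K)) by (apply (finsupp_csum _ fi); auto).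
  eapply Rle_trans; [now apply seq_inner_partial|].
  assert (HE : seq_inner (S0 K) (S0 K) = csum (fun i => csum (fun j =>
      RtoC ((-1) ^ i / (INR (fact i) * INR (fact j))) * c (i + j)%nat)%C (S K)) (S K)).
  { unfold S0 at 1; rewrite (seq_inner_csum_l _ _ fi) by auto.
    apply csum_ext; intros i _; unfold S0; rewrite (seq_inner_csum_r _ _ fi) by auto.
    rewrite <- csum_scal; apply csum_ext; intros j _.
    unfold fi at 1 2; rewrite seq_inner_iter by easy; rewrite RtoC_conj.
    change (seq_inner f (Nat.iter (i + j) (weyl_gen z) f)) with (c (i + j)%nat).
    rewrite !Cmult_assoc, <- !RtoC_mult; do 2 f_equal; field.
    split; apply INR_fact_neq_0. }
  pose proof (exp_isometry c G K HG Hc) as Hiso; rewrite <- HE in Hiso.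
  assert (H0 : c 0%nat = RtoC (rsum (fun n => Cmod (x n) ^ 2) N)).
  { unfold c; rewrite (seq_inner_csum f _ N Hf), <- csum_RtoC; apply csum_ext; intros m Hm.
    change (fi 0%nat) with f; rewrite Hfx, Cmod2_conj by easy; ring. }
  rewrite H0 in Hiso; set (X2 := rsum (fun n => Cmod (x n) ^ 2) N) in *.
  pose proof (re_le_Cmod (seq_inner (S0 K) (S0 K) - RtoC X2)%C) as Hr.
  pose proof (Rle_abs (Re (seq_inner (S0 K) (S0 K) - RtoC X2)%C)) as Ha.
  replace (Re (seq_inner (S0 K) (S0 K) - RtoC X2)%C) with (Re (seq_inner (S0 K) (S0 K)) - X2) in *
    by (unfold Re; simpl; ring).
  lra. }
assert (Hlim : forall m, Clim (fun K => S0 K m) (csum (fun n => weyl_mx z n m * x n)%C N)).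
{ intros m.
  apply Clim_ext with (fun K => csum (fun n => csum (fun k => weyl_term z k n m) (S K) * x n)%C N).
  - intros K; unfold S0, fi, f.
    rewrite (csum_ext (fun i => _ * Nat.iter i (weyl_gen z) _ m)%C
              (fun i => csum (fun n => weyl_term z i n m * x n)%C N)).
    + rewrite csum_swap; apply csum_ext; intros n _.
      rewrite Cmult_comm, <- csum_scal; apply csum_ext; intros; ring.
    + intros i _; rewrite iter_csum, <- csum_scal; apply csum_ext; intros.
      unfold weyl_term, cscal; ring.
  - clear - Hz; induction N as [|N IH]; simpl csum at 1; [apply Clim_const|].
    apply Clim_plus; [easy|]; apply Clim_mult; [|apply Clim_const].
    apply (Clim_incr (csum (fun k => weyl_term z k N m))); apply CSeries_lim; now apply weyl_term_summable. }
replace (rsum (fun n => Cmod (x n) ^ 2) N)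
  with (rsum (fun n => Cmod (x n) ^ 2) N + 4 * G * 0) by ring.
apply (is_lim_seq_le (fun K => rsum (fun m => Cmod (S0 K m) ^ 2) M)
  (fun K => rsum (fun n => Cmod (x n) ^ 2) N + 4 * G * (/ 2) ^ K)
  (rsum (fun m => Cmod (csum (fun n => weyl_mx z n m * x n)%C N) ^ 2) M)
  (rsum (fun n => Cmod (x n) ^ 2) N + 4 * G * 0)); auto.
- apply is_lim_seq_rsum with (u := fun K m => Cmod (S0 K m) ^ 2); intros m.
  now apply is_lim_seq_pow2, Clim_Cmod.
- apply is_lim_seq_plus'; [apply is_lim_seq_const|].
  apply is_lim_seq_mult'; [apply is_lim_seq_const|].
  apply is_lim_seq_geom; rewrite Rabs_pos_eq; lra.
Qed.

Lemma weyl_mx_bdd z : Cmod z <= / 16 -> bddmx (weyl_mx z) 1.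
Proof.
intros Hz N K x; rewrite pow1, Rmult_1_l; now apply weyl_mx_contraction.
Qed.

(** The formula for the semigroup is a statement about whatever operators satisfy [is_weyl]; it
    acquires content through this construction. *)
Lemma weyl_mx_weyl z : Cmod z <= / 16 -> is_weyl z (toop (weyl_mx z)).
Proof.
intros Hz; pose proof (weyl_mx_bdd z Hz) as Hb; split; [now apply toop_bounded with 1|].
intros n m; rewrite (toop_e _ 1) by easy.
apply (is_series_CSeries (fun k => weyl_term z k n m)); now apply weyl_term_summable.
Qed.

(** * Embedded polynomials *)

Definition emb (p : gaussian_data) (s : R) (P : cols) : cols := fun n m =>
  Cmult (RtoC (Rpower (rho_wt p m) (s / 2)))
    (Cmult (P n m) (RtoC (Rpower (rho_wt p n) ((1 - s) / 2)))).

Definition wt (p : gaussian_data) (s : R) (n m : nat) : R :=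
  Rpower (rho_wt p m) (s / 2) * Rpower (rho_wt p n) ((1 - s) / 2).

(** The entries of the embedded [A_z^k / k!] are at most
    [C (small_radius |z|)^k eta^(n + m)]. *)
Definition small_radius (p : gaussian_data) : R := sqrt (8 * exp (5 / 4 * beta p) / beta p).

Definition eta (p : gaussian_data) : R := exp (- beta p / 8).

Section Embedding.

Variable p : gaussian_data.
Variable s : R.
Hypothesis Hb : 0 < beta p.
Hypothesis Hs : 0 <= s <= 1.

Lemma eta_01 : 0 < eta p < 1.
Proof.
split; [apply exp_pos|]; unfold eta; rewrite <- exp_0; apply exp_increasing; lra.
Qed.

Lemma emb_wt P n m : emb p s P n m = (RtoC (wt p s n m) * P n m)%C.
Proof. unfold emb, wt; rewrite RtoC_mult; ring. Qed.

Lemma emb_add P Q : emb p s (cadd P Q) = cadd (emb p s P) (emb p s Q).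
Proof. apply cols_ext; intros; unfold emb, cadd; ring. Qed.

Lemma emb_scal c P : emb p s (cscal c P) = cscal c (emb p s P).
Proof. apply cols_ext; intros; unfold emb, cscal; ring. Qed.

Lemma wt_pos n m : 0 < wt p s n m.
Proof. apply Rmult_lt_0_compat; apply exp_pos. Qed.

Lemma wt_sq n m :
  wt p s n m ^ 2 = (1 - exp (- beta p)) * exp (- beta p * (s * INR m + (1 - s) * INR n)).
Proof.
assert (Hc : 0 < 1 - exp (- beta p)).
{ assert (exp (- beta p) < 1) by (rewrite <- exp_0; apply exp_increasing; lra); lra. }
unfold wt, Rpower, rho_wt.
rewrite !ln_mult, !ln_exp by (auto; apply exp_pos).
rewrite <- (exp_ln (1 - exp (- beta p))) at 3 by easy.
rewrite <- !exp_plus; simpl; rewrite Rmult_1_r, <- exp_plus; f_equal; field.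
Qed.

(** The exponent [s m + (1 - s) n] is at least [n - k] for every [s] in [[0,1]], which makes the
    bound uniform in [s]. *)
Lemma wt_sq_le n m k :
  (n <= m + k)%nat -> wt p s n m ^ 2 <= exp (- beta p * INR n + beta p * INR k).
Proof.
intros H; rewrite wt_sq.
assert (Hn : INR n <= INR m + INR k) by (rewrite <- plus_INR; now apply le_INR).
pose proof (pos_INR k); pose proof (pos_INR m); pose proof (pos_INR n).
pose proof (exp_pos (- beta p)).
apply Rle_trans with (1 * exp (- beta p * (s * INR m + (1 - s) * INR n))).
- apply Rmult_le_compat_r; [left; apply exp_pos|lra].
- rewrite Rmult_1_l.
  assert (INR n - INR k <= s * INR m + (1 - s) * INR n) by nra.
  assert (Hle : - beta p * (s * INR m + (1 - s) * INR n) <= - beta p * INR n + beta p * INR k) by nra.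
  destruct Hle as [Hlt|Heq]; [left; now apply exp_increasing|rewrite Heq; lra].
Qed.

Lemma exp_le a b : a <= b -> exp a <= exp b.
Proof. intros [H|H]; [left; now apply exp_increasing|rewrite H; lra]. Qed.

Lemma exp_pow a k : exp a ^ k = exp (a * INR k).
Proof.
induction k as [|k IH]; [simpl; now rewrite Rmult_0_r, exp_0|].
rewrite S_INR; simpl pow; rewrite IH, <- exp_plus; f_equal; ring.
Qed.

(** For [|n - m| <= k] the squared weight contributes [exp(- beta n + beta k)], and the choice
    [eps = beta / 2] spends [exp(beta (n+1) / 2)] on the Weyl term. The surviving decay
    [exp(- beta n / 2)] is shared between [n] and [m] using [m <= n + k], at a further cost
    [exp(beta k / 4)]. This yields the [5/4] in [small_radius] and, after a square root, the [1/8]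
    in [eta]; the 8 is [4 / (1/2)]. Other entries vanish. *)
Lemma emb_weyl_term_bound z k n m :
  Cmod (emb p s (weyl_term z k) n m)
  <= exp (beta p / 4) * (small_radius p * Cmod z) ^ k * eta p ^ (n + m).
Proof.
pose proof (Cmod_ge_0 z) as Hz; pose proof eta_01 as He.
assert (HD : 0 <= small_radius p) by apply sqrt_pos.
assert (HD2 : small_radius p ^ 2 = 8 * exp (5 / 4 * beta p) / beta p).
{ unfold small_radius; rewrite pow2_sqrt; [easy|].
  pose proof (exp_pos (5 / 4 * beta p)); apply Rlt_le, Rdiv_lt_0_compat; lra. }
assert (Hrhs : 0 <= exp (beta p / 4) * (small_radius p * Cmod z) ^ k * eta p ^ (n + m)).
{ repeat apply Rmult_le_pos; try (left; apply exp_pos).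
  - apply pow_le; now apply Rmult_le_pos.
  - apply pow_le; lra. }
destruct (Nat.le_gt_cases n (m + k)) as [H1|H1];
  [destruct (Nat.le_gt_cases m (n + k)) as [H2|H2]|].
- apply Rle_of_sq; auto.
  rewrite emb_wt, Cmod_mult, Cmod_R, Rpow_mult_distr, pow2_abs.
  apply Rle_trans with (exp (- beta p * INR n + beta p * INR k)
    * ((4 * Cmod z ^ 2 / (beta p / 2)) ^ k * exp (beta p / 2 * INR (S n)))).
  + apply Rmult_le_compat; try apply pow2_ge_0; [now apply wt_sq_le|].
    apply weyl_term_bound_sq; lra.
  + replace ((exp (beta p / 4) * (small_radius p * Cmod z) ^ k * eta p ^ (n + m)) ^ 2)
      with ((4 * Cmod z ^ 2 / (beta p / 2)) ^ k
            * exp (beta p / 2 + 5 / 4 * beta p * INR k - beta p / 4 * INR (n + m))).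
    * rewrite (Rmult_comm (exp _)), Rmult_assoc, <- exp_plus.
      apply Rmult_le_compat_l.
      { apply pow_le, Rmult_le_pos; [nra|left; apply Rinv_0_lt_compat; lra]. }
      apply exp_le; rewrite S_INR, plus_INR.
      assert (INR m <= INR n + INR k) by (rewrite <- plus_INR; now apply le_INR).
      nra.
    * rewrite !Rpow_mult_distr, <- !pow_mult.
      rewrite (Nat.mul_comm k 2), (pow_mult _ 2 k), HD2.
      unfold eta; rewrite !exp_pow.
      replace (4 * Cmod z ^ 2 / (beta p / 2)) with (8 / beta p * Cmod z ^ 2) by (field; lra).
      replace (8 * exp (5 / 4 * beta p) / beta p) with (8 / beta p * exp (5 / 4 * beta p))
        by (field; lra).
      rewrite !Rpow_mult_distr, exp_pow, mult_INR, <- (pow_mult (Cmod z)).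
      replace (beta p / 2 + 5 / 4 * beta p * INR k - beta p / 4 * INR (n + m))
        with (beta p / 4 * INR 2 + (5 / 4 * beta p * INR k + - beta p / 8 * (INR (n + m) * INR 2)))
        by (simpl INR; field).
      rewrite !exp_plus; ring.
- rewrite emb_wt; unfold weyl_term, cscal; rewrite field_power_support by lia.
  rewrite !Cmult_0_r, Cmod_0; easy.
- rewrite emb_wt; unfold weyl_term, cscal; rewrite field_power_support by lia.
  rewrite !Cmult_0_r, Cmod_0; easy.
Qed.

Lemma field_power_weyl_term z k : field_power z k = cscal (RtoC (INR (fact k))) (weyl_term z k).
Proof.
apply cols_ext; intros; unfold weyl_term, cscal; rewrite Cmult_assoc, <- RtoC_mult.
rewrite Rinv_r by apply INR_fact_neq_0; ring.
Qed.

Lemma dec_emb_weyl_term z k : decays (eta p) (emb p s (weyl_term z k)).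
Proof.
exists (exp (beta p / 4) * (small_radius p * Cmod z) ^ k); split.
- apply Rmult_le_pos; [left; apply exp_pos|apply pow_le, Rmult_le_pos];
    [apply sqrt_pos|apply Cmod_ge_0].
- intros n m; apply emb_weyl_term_bound.
Qed.

Lemma dec_emb_pol P : pol P -> decays (eta p) (emb p s P).
Proof.
intros HP; apply pol_power_span in HP; induction HP as [z k|P Q _ IHP _ IHQ|c P _ IH].
- rewrite field_power_weyl_term, emb_scal; apply dec_scal, dec_emb_weyl_term.
- rewrite emb_add; now apply dec_plus.
- rewrite emb_scal; now apply dec_scal.
Qed.

Definition embop (P : cols) : op := toop (emb p s P).

Lemma embop_hs P : pol P -> hs (embop P).
Proof. intros H; apply (dec_hs (eta p)); [apply eta_01|now apply dec_emb_pol]. Qed.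

Lemma embop_e P n m : pol P -> embop P (e n) m = emb p s P n m.
Proof. intros H; apply (dec_hs (eta p)); [apply eta_01|now apply dec_emb_pol]. Qed.

Lemma embop_embedded P : pol P -> embedded p s P (embop P).
Proof. intros H; split; [now apply embop_hs|intros; now apply embop_e]. Qed.

Lemma embedded_unique P xi xi' : embedded p s P xi -> embedded p s P xi' -> xi = xi'.
Proof.
intros [[H1 _] E1] [[H2 _] E2]; apply op_ext; auto; intros n m; now rewrite E1, E2.
Qed.

Lemma embop_add P Q : pol P -> pol Q -> embop (cadd P Q) = op_add (embop P) (embop Q).
Proof.
intros HP HQ; apply op_ext.
- apply embop_hs; auto with pol.
- apply bounded_add; now apply embop_hs.
- intros n m; unfold op_add; cbn [coord fplus]; rewrite !embop_e by auto with pol.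
  now rewrite emb_add.
Qed.

Lemma embop_scal c P : pol P -> embop (cscal c P) = op_scal c (embop P).
Proof.
intros HP; apply op_ext.
- apply embop_hs; auto with pol.
- apply bounded_scal; now apply embop_hs.
- intros n m; unfold op_scal; cbn [coord fscal]; rewrite !embop_e by auto with pol.
  now rewrite emb_scal.
Qed.

Lemma emb_inj P Q : emb p s P = emb p s Q -> P = Q.
Proof.
intros H; apply cols_ext; intros n m.
assert (E : emb p s P n m = emb p s Q n m) by now rewrite H.
rewrite !emb_wt in E.
assert (Hw : RtoC (wt p s n m) <> RtoC 0).
{ intros E0; apply RtoC_inj in E0; pose proof (wt_pos n m); lra. }
replace (P n m) with (/ RtoC (wt p s n m) * (RtoC (wt p s n m) * P n m))%C by (field; auto).
rewrite E; field; auto.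
Qed.

(** The first bound provides the Weyl operator, the second makes its embedded exponential series
    converge geometrically with ratio at most [1/2] in Hilbert-Schmidt norm. *)
Definition small_param (z : C) : Prop := Cmod z <= / 16 /\ small_radius p * Cmod z <= / 2.

Definition weyl_emb (z : C) : op := toop (emb p s (weyl_mx z)).

Lemma emb_weyl_mx_tail z K n m :
  small_param z ->
  Cmod (emb p s (weyl_mx z) n m - csum (fun k => emb p s (weyl_term z k) n m) K)%C
  <= 2 * exp (beta p / 4) * (small_radius p * Cmod z) ^ K * eta p ^ (n + m).
Proof.
intros [Hz1 Hz2]; pose proof (Cmod_ge_0 z) as Hz; pose proof eta_01 as He.
assert (HD : 0 <= small_radius p) by apply sqrt_pos.
set (x := small_radius p * Cmod z) in *.
assert (Hx : 0 <= x) by (now apply Rmult_le_pos).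
set (B := exp (beta p / 4) * eta p ^ (n + m)).
assert (HB : 0 <= B) by (apply Rmult_le_pos; [left; apply exp_pos|apply pow_le; lra]).
destruct (CSeries_tail (fun k => emb p s (weyl_term z k) n m) B x K) as [H1 H2]; auto; [lra| |].
{ intros k; eapply Rle_trans; [apply emb_weyl_term_bound|]; unfold B; fold x; right; ring. }
replace (emb p s (weyl_mx z) n m) with (CSeries (fun k => emb p s (weyl_term z k) n m)).
- eapply Rle_trans; [apply H2|].
  assert (Hi : / (1 - x) <= 2).
  { replace 2 with (/ / 2) by field; apply Rinv_le_contravar; lra. }
  assert (0 <= B * x ^ K) by (apply Rmult_le_pos; auto; now apply pow_le).
  apply Rle_trans with (B * x ^ K * 2); [now apply Rmult_le_compat_l|].
  unfold B; right; ring.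
- rewrite emb_wt; unfold weyl_mx; rewrite <- CSeries_scal by now apply weyl_term_summable.
  apply CSeries_ext; intros k; now rewrite emb_wt.
Qed.

Lemma dec_emb_weyl_mx z : small_param z -> decays (eta p) (emb p s (weyl_mx z)).
Proof.
intros H; exists (2 * exp (beta p / 4)); split.
- pose proof (exp_pos (beta p / 4)); lra.
- intros n m; pose proof (emb_weyl_mx_tail z 0 n m H) as Ht; simpl csum in Ht.
  rewrite pow_O, Rmult_1_r in Ht.
  replace (emb p s (weyl_mx z) n m) with (emb p s (weyl_mx z) n m - RtoC 0)%C by ring; exact Ht.
Qed.

Lemma weyl_emb_hs z : small_param z -> hs (weyl_emb z).
Proof. intros H; apply (dec_hs (eta p)); [apply eta_01|now apply dec_emb_weyl_mx]. Qed.

Lemma weyl_emb_e z n m : small_param z -> weyl_emb z (e n) m = emb p s (weyl_mx z) n m.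
Proof. intros H; apply (dec_hs (eta p)); [apply eta_01|now apply dec_emb_weyl_mx]. Qed.

Lemma pol_weyl_term z k : pol (weyl_term z k).
Proof. unfold weyl_term; apply pol_scal, pol_field_power. Qed.

End Embedding.

(** * The drift flow *)

Lemma CV_radius_geometric a B M r x :
  (forall k, Rabs (a k) <= B * M ^ k) -> 0 <= M -> 0 < r -> M * r <= 1 -> Rabs x < r ->
  Rbar_lt (Rabs x) (CV_radius a).
Proof.
intros H HM Hr HMr Hx.
apply Rbar_lt_le_trans with r; [easy|].
destruct (CV_radius_bounded a) as [Hub _]; apply Hub; exists B; intros n.
rewrite Rabs_mult, <- RPow_abs, (Rabs_pos_eq r) by lra.
assert (HB : 0 <= B).
{ specialize (H 0%nat); rewrite pow_O, Rmult_1_r in H; pose proof (Rabs_pos (a 0%nat)); lra. }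
apply Rle_trans with (B * M ^ n * r ^ n).
- apply Rmult_le_compat_r; [apply pow_le; lra|apply H].
- rewrite Rmult_assoc, <- Rpow_mult_distr.
  assert ((M * r) ^ n <= 1) by (rewrite <- (pow1 n); apply pow_incr; split; [apply Rmult_le_pos; lra|easy]).
  nra.
Qed.

Lemma CV_radius_entire a :
  (forall r, 0 <= r -> exists M, forall n, Rabs (a n * r ^ n) <= M) -> CV_radius a = p_infty.
Proof.
intros H; destruct (CV_radius_bounded a) as [Hub _].
assert (Hr : forall r, 0 <= r -> Rbar_le r (CV_radius a)) by (intros r Hr; apply Hub, H, Hr).
destruct (CV_radius a) as [l| |]; auto.
- specialize (Hr (Rabs l + 1)); pose proof (Rle_abs l); pose proof (Rabs_pos l); simpl in Hr; lra.
- specialize (Hr 0 (Rle_refl 0)); easy.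
Qed.

Section Flow.

Variable p : gaussian_data.

Definition flow_norm : R := Cmod (Ci * RtoC (Omega p) - RtoC (gamma p))%C + Cmod (kappa p).

Lemma Zop_bound z : Cmod (Zop p z) <= flow_norm * Cmod z.
Proof.
unfold Zop, flow_norm; eapply Rle_trans; [apply Cmod_triangle|].
rewrite !Cmod_mult, Cmod_Ci, Cmod_conj; lra.
Qed.

Lemma flow_norm_pos : 0 <= flow_norm.
Proof. apply Rplus_le_le_0_compat; apply Cmod_ge_0. Qed.

Lemma Zop_iter_bound z k : Cmod (Nat.iter k (Zop p) z) <= flow_norm ^ k * Cmod z.
Proof.
induction k as [|k IH]; [simpl; lra|]; simpl Nat.iter.
eapply Rle_trans; [apply Zop_bound|]; simpl pow; rewrite Rmult_assoc.
apply Rmult_le_compat_l; [apply flow_norm_pos|easy].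
Qed.

Lemma Zop_iter_scal (r : R) z k :
  Nat.iter k (Zop p) (RtoC r * z)%C = (RtoC r * Nat.iter k (Zop p) z)%C.
Proof.
induction k as [|k IH]; [easy|]; simpl; rewrite IH; unfold Zop.
rewrite Cmult_conj, RtoC_conj; ring.
Qed.

(** [Zop] is only real-linear, so the flow is handled through its two real coordinates, each an
    everywhere convergent power series in [t]. *)
Definition flow_re (z : C) (k : nat) : R := Re (Nat.iter k (Zop p) z) / INR (fact k).
Definition flow_im (z : C) (k : nat) : R := Im (Nat.iter k (Zop p) z) / INR (fact k).

Lemma expZ_re t z : Re (expZ p t z) = PSeries (flow_re z) t.
Proof.
unfold expZ, CSeries, PSeries; cbn [Re fst]; apply Series_ext; intros k.
unfold flow_re; simpl; unfold Re, Rdiv; ring.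
Qed.

Lemma expZ_im t z : Im (expZ p t z) = PSeries (flow_im z) t.
Proof.
unfold expZ, CSeries, PSeries; cbn [Im snd]; apply Series_ext; intros k.
unfold flow_im; simpl; unfold Im, Rdiv; ring.
Qed.

Lemma expZ_scal t (r : R) z : expZ p t (RtoC r * z)%C = (RtoC r * expZ p t z)%C.
Proof.
apply injective_projections.
- change (Re (expZ p t (RtoC r * z)%C) = Re (RtoC r * expZ p t z)%C).
  replace (Re (RtoC r * expZ p t z)%C) with (r * Re (expZ p t z)) by (unfold Re; simpl; ring).
  rewrite !expZ_re; unfold PSeries; rewrite <- Series_scal_l; apply Series_ext; intros k.
  unfold flow_re; rewrite Zop_iter_scal; unfold Re; simpl; unfold Rdiv; ring.
- change (Im (expZ p t (RtoC r * z)%C) = Im (RtoC r * expZ p t z)%C).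
  replace (Im (RtoC r * expZ p t z)%C) with (r * Im (expZ p t z)) by (unfold Im; simpl; ring).
  rewrite !expZ_im; unfold PSeries; rewrite <- Series_scal_l; apply Series_ext; intros k.
  unfold flow_im; rewrite Zop_iter_scal; unfold Im; simpl; unfold Rdiv; ring.
Qed.

Lemma flow_entire (a : nat -> R) B :
  (forall k, Rabs (a k) <= B * flow_norm ^ k / INR (fact k)) -> CV_radius a = p_infty.
Proof.
intros H; apply CV_radius_entire; intros r Hr; exists (B * exp (flow_norm * r)); intros n.
assert (HB : 0 <= B).
{ specialize (H 0%nat); simpl in H; pose proof (Rabs_pos (a 0%nat)); lra. }
rewrite Rabs_mult, <- RPow_abs, (Rabs_pos_eq r) by lra.
apply Rle_trans with (B * flow_norm ^ n / INR (fact n) * r ^ n).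
- apply Rmult_le_compat_r; [now apply pow_le|apply H].
- replace (B * flow_norm ^ n / INR (fact n) * r ^ n)
    with (B * ((flow_norm * r) ^ n / INR (fact n)))
    by (rewrite Rpow_mult_distr; field; apply INR_fact_neq_0).
  apply Rmult_le_compat_l; auto.
  apply pow_fact_le_exp, Rmult_le_pos; [apply flow_norm_pos|easy].
Qed.

Lemma flow_re_entire z : CV_radius (flow_re z) = p_infty.
Proof.
apply flow_entire with (Cmod z); intros k; unfold flow_re, Rdiv.
pose proof (INR_fact_pos k) as Hf.
rewrite Rabs_mult, (Rabs_pos_eq (/ _)) by (apply Rlt_le, Rinv_0_lt_compat; lra).
apply Rmult_le_compat_r; [apply Rlt_le, Rinv_0_lt_compat; lra|].
eapply Rle_trans; [apply re_le_Cmod|]; rewrite Rmult_comm; apply Zop_iter_bound.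
Qed.

Lemma flow_im_entire z : CV_radius (flow_im z) = p_infty.
Proof.
apply flow_entire with (Cmod z); intros k; unfold flow_im, Rdiv.
pose proof (INR_fact_pos k) as Hf.
rewrite Rabs_mult, (Rabs_pos_eq (/ _)) by (apply Rlt_le, Rinv_0_lt_compat; lra).
apply Rmult_le_compat_r; [apply Rlt_le, Rinv_0_lt_compat; lra|].
eapply Rle_trans; [apply im_le_Cmod|]; rewrite Rmult_comm; apply Zop_iter_bound.
Qed.

Lemma ex_derive_expZ_re z t : ex_derive (fun t => Re (expZ p t z)) t.
Proof.
apply ex_derive_ext with (PSeries (flow_re z)); [intros; now rewrite expZ_re|].
apply ex_derive_PSeries; now rewrite flow_re_entire.
Qed.

Lemma ex_derive_expZ_im z t : ex_derive (fun t => Im (expZ p t z)) t.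
Proof.
apply ex_derive_ext with (PSeries (flow_im z)); [intros; now rewrite expZ_im|].
apply ex_derive_PSeries; now rewrite flow_im_entire.
Qed.

Lemma expZ_0 z : expZ p 0 z = z.
Proof.
apply injective_projections.
- change (Re (expZ p 0 z) = Re z); rewrite expZ_re, PSeries_0; unfold flow_re; simpl; field.
- change (Im (expZ p 0 z) = Im z); rewrite expZ_im, PSeries_0; unfold flow_im; simpl; field.
Qed.

Lemma is_derive_expZ_re_0 z : is_derive (fun t => Re (expZ p t z)) 0 (Re (Zop p z)).
Proof.
apply is_derive_ext with (PSeries (flow_re z)); [intros; now rewrite expZ_re|].
replace (Re (Zop p z)) with (PSeries (PS_derive (flow_re z)) 0).
- apply is_derive_PSeries; now rewrite flow_re_entire.
- rewrite PSeries_0; unfold PS_derive, flow_re; simpl; field.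
Qed.

Lemma is_derive_expZ_im_0 z : is_derive (fun t => Im (expZ p t z)) 0 (Im (Zop p z)).
Proof.
apply is_derive_ext with (PSeries (flow_im z)); [intros; now rewrite expZ_im|].
replace (Im (Zop p z)) with (PSeries (PS_derive (flow_im z)) 0).
- apply is_derive_PSeries; now rewrite flow_im_entire.
- rewrite PSeries_0; unfold PS_derive, flow_im; simpl; field.
Qed.

Definition noise (w : C) : R := Re (Cconj w * Cop p w)%C.

Lemma noise_eq w :
  noise w = (usq p + vsq p) * (Re w * Re w + Im w * Im w)
            + 2 * (Re (uv p) * (Re w * Re w - Im w * Im w) + 2 * Im (uv p) * (Re w * Im w)).
Proof. unfold noise, Cop; destruct w as [x y]; destruct (uv p) as [a b]; simpl; ring. Qed.

Lemma noise_scal (r : R) w : noise (RtoC r * w)%C = r ^ 2 * noise w.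
Proof.
rewrite !noise_eq; destruct w as [x y]; destruct (uv p) as [a b]; simpl; ring.
Qed.

Lemma noise_continuous z t : continuous (fun t => noise (expZ p t z)) t.
Proof.
apply (ex_derive_continuous (V := R_NormedModule) (fun t => noise (expZ p t z))).
assert (H : forall x y A B D, ex_derive x t -> ex_derive y t ->
  ex_derive (fun t => A * (x t * x t + y t * y t)
                      + 2 * (B * (x t * x t - y t * y t) + 2 * D * (x t * y t))) t)
  by (intros; auto_derive; repeat split; auto).
eapply ex_derive_ext; [intros u; symmetry; apply noise_eq|].
apply (H (fun t => Re (expZ p t z)) (fun t => Im (expZ p t z)));
  [apply ex_derive_expZ_re|apply ex_derive_expZ_im].
Qed.

Definition noise_int (z : C) (t : R) : R := / 2 * RInt (fun r => noise (expZ p r z)) 0 t.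

Lemma is_derive_noise_int z t : is_derive (noise_int z) t (/ 2 * noise (expZ p t z)).
Proof.
apply (is_derive_scal (fun t => RInt (fun r => noise (expZ p r z)) 0 t)).
apply (is_derive_RInt (fun r => noise (expZ p r z)) _ 0); [|apply noise_continuous].
exists (mkposreal 1 Rlt_0_1); intros b _.
apply (RInt_correct (V := R_CompleteNormedModule)), (ex_RInt_continuous (V := R_CompleteNormedModule)).
intros; apply noise_continuous.
Qed.

Lemma noise_int_0 z : noise_int z 0 = 0.
Proof. unfold noise_int; rewrite RInt_point; unfold zero; simpl; ring. Qed.

(** Homogeneity of degree two is what turns the Weyl factor at [r z] into the Gaussian
    [exp(- q r^2)] in [r]. *)
Lemma noise_int_scal (r : R) z t : noise_int (RtoC r * z)%C t = r ^ 2 * noise_int z t.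
Proof.
unfold noise_int.
assert (H : RInt (fun u => r ^ 2 * noise (expZ p u z)) 0 t
            = r ^ 2 * RInt (fun u => noise (expZ p u z)) 0 t).
{ apply (RInt_scal (V := R_CompleteNormedModule) (fun u => noise (expZ p u z))).
  apply (ex_RInt_continuous (V := R_CompleteNormedModule)); intros; apply noise_continuous. }
rewrite (RInt_ext _ (fun u => r ^ 2 * noise (expZ p u z))), H; [ring|].
intros; rewrite expZ_scal; apply noise_scal.
Qed.

Lemma weyl_factor_eq t z :
  zeta p = RtoC 0 -> weyl_factor p t z = RtoC (exp (- noise_int z t)).
Proof.
intros H0; unfold weyl_factor, Cexp.
assert (E : RInt (fun r => Re (Cconj (zeta p) * expZ p r z)%C) 0 t = 0).
{ rewrite (RInt_ext _ (fun _ => 0)).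
  - rewrite RInt_const; unfold scal; simpl; unfold mult; simpl; ring.
  - intros; rewrite H0, RtoC_conj; simpl; ring. }
rewrite E; unfold noise_int, noise.
set (I := RInt _ 0 t); apply injective_projections; simpl.
- replace (0 * 0 - 1 * 0) with 0 by ring.
  replace (0 + (0 * 0 + 1 * 0)) with 0 by ring.
  rewrite cos_0, Rmult_1_r; f_equal; ring.
- replace (0 + (0 * 0 + 1 * 0)) with 0 by ring; rewrite sin_0; ring.
Qed.

End Flow.

(** * The semigroup on embedded powers of the field operators *)

(** Coefficients of [exp (- q r^2)] as a power series in [r]. *)
Definition gauss_coeff (q : R) (j : nat) : R :=
  if Nat.even j then (- q) ^ (Nat.div2 j) / INR (fact (Nat.div2 j)) else 0.

Lemma is_pseries_gauss q r : is_pseries (gauss_coeff q) r (exp (- q * r ^ 2)).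
Proof.
replace (exp (- q * r ^ 2)) with (exp (- q * r ^ 2) + r * 0) by ring.
apply is_pseries_odd_even.
- pose proof (is_exp_Reals (- q * r ^ 2)) as H.
  apply is_pseries_R in H; apply is_pseries_R, is_series_ext with (2 := H); intros n.
  unfold gauss_coeff; rewrite Nat.even_mul; cbn [Nat.even orb]; rewrite Nat.div2_double.
  rewrite Rpow_mult_distr; unfold Rdiv; real_equation; ring.
- apply is_pseries_R, is_series_ext with (fun _ => 0).
  + intros n; unfold gauss_coeff; rewrite Nat.even_add, Nat.even_mul; simpl; real_equation; ring.
  + apply is_series_rsum; apply is_lim_seq_ext with (fun _ => 0); [|apply is_lim_seq_const].
    intros k; induction k; simpl; lra.
Qed.

Lemma gauss_coeff_entire q : CV_radius (gauss_coeff q) = p_infty.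
Proof.
apply CV_radius_entire; intros r Hr; exists (exp (Rabs q * r ^ 2)); intros n.
unfold gauss_coeff; destruct (Nat.even n) eqn:E.
- assert (Hn : n = (2 * Nat.div2 n)%nat)
    by (rewrite <- Nat.double_twice; apply Nat.Even_double, Nat.even_spec, E).
  rewrite Hn at 3; set (k := Nat.div2 n).
  rewrite pow_mult, Rabs_mult; unfold Rdiv; rewrite Rabs_mult, <- !RPow_abs, Rabs_Ropp.
  pose proof (INR_fact_pos k).
  rewrite (Rabs_pos_eq (/ _)) by (apply Rlt_le, Rinv_0_lt_compat; lra).
  rewrite (Rabs_pos_eq r) by easy.
  replace (Rabs q ^ k * / INR (fact k) * (r ^ 2) ^ k) with ((Rabs q * r ^ 2) ^ k / INR (fact k))
    by (rewrite Rpow_mult_distr; unfold Rdiv; ring).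
  apply pow_fact_le_exp, Rmult_le_pos; [apply Rabs_pos|apply pow2_ge_0].
- rewrite Rmult_0_l, Rabs_R0; left; apply exp_pos.
Qed.

Lemma pol_colsum f N : (forall i, pol (f i)) -> pol (colsum f N).
Proof.
intros H; induction N as [|N IH]; simpl; [|auto with pol].
replace czero with (cscal (RtoC 0) cone); [auto with pol|].
apply cols_ext; intros; unfold cscal, czero; ring.
Qed.

Lemma weyl_term_scal (r : R) z k : weyl_term (RtoC r * z)%C k = cscal (RtoC (r ^ k)) (weyl_term z k).
Proof.
unfold weyl_term; rewrite field_power_scal, RtoC_pow; apply cols_ext; intros; unfold cscal; ring.
Qed.

Lemma is_pseries_of_Clim (a : nat -> C) r l :
  Clim (csum (fun k => RtoC (r ^ k) * a k)%C) l ->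
  is_pseries (fun k => Re (a k)) r (Re l) /\ is_pseries (fun k => Im (a k)) r (Im l).
Proof.
intros [H1 H2]; split; apply is_pseries_R, is_series_rsum.
- apply is_lim_seq_ext with (2 := H1); intros N; rewrite Re_csum; apply rsum_ext; intros.
  unfold Re; simpl; ring.
- apply is_lim_seq_ext with (2 := H2); intros N; rewrite Im_csum; apply rsum_ext; intros.
  unfold Im; simpl; ring.
Qed.

Lemma is_lim_seq_geom_0 B x : 0 <= x <= / 2 -> is_lim_seq (fun K => B * x ^ K) 0.
Proof.
intros Hx; replace (Finite 0) with (Finite (B * 0)) by (f_equal; ring).
apply is_lim_seq_mult'; [apply is_lim_seq_const|].
apply is_lim_seq_geom; rewrite Rabs_pos_eq; lra.
Qed.

Lemma Clim_of_geometric u l B x :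
  0 <= x <= / 2 -> (forall K, Cmod (l - u K)%C <= B * x ^ K) -> Clim u l.
Proof.
intros Hx H; apply Clim_of_Cmod.
apply (is_lim_seq_le_le (fun _ => 0) _ (fun K => B * x ^ K)).
- intros K; split; [apply Cmod_ge_0|].
  replace (u K - l)%C with (- (l - u K))%C by ring; rewrite Cmod_opp; apply H.
- apply is_lim_seq_const.
- now apply is_lim_seq_geom_0.
Qed.

Section Induced.

Variable p : gaussian_data.
Variable T : R -> op -> op.
Variable s : R.
Variable Ts : R -> op -> op.
Hypothesis Hb : 0 < beta p.
Hypothesis Hs : 0 <= s <= 1.
Hypothesis Hz : zeta p = RtoC 0.
Hypothesis HT : is_gaussian_qms p T.
Hypothesis HTs : is_induced p s T Ts.

Lemma Ts_weyl_emb t z n m :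
  0 <= t -> small_param p z -> small_param p (expZ p t z) ->
  Ts t (weyl_emb p s z) (e n) m
  = (RtoC (exp (- noise_int p z t)) * emb p s (weyl_mx (expZ p t z)) n m)%C.
Proof.
intros Ht H1 H2.
pose proof (weyl_mx_bdd z (proj1 H1)) as Hw1; pose proof (weyl_mx_bdd (expZ p t z) (proj1 H2)) as Hw2.
assert (He : embedded p s (fun n => toop (weyl_mx z) (e n)) (weyl_emb p s z)).
{ split; [now apply weyl_emb_hs|]; intros; rewrite weyl_emb_e by easy; unfold emb.
  now rewrite (toop_e _ 1). }
apply (ind_embed _ _ _ _ HTs t) in He; auto; [|now apply toop_bounded with 1].
destruct He as [_ He]; rewrite He.
destruct HT as [_ HW].
rewrite (HW t z (toop (weyl_mx z)) (toop (weyl_mx (expZ p t z)))); auto;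
  [|apply weyl_mx_weyl; apply H1|apply weyl_mx_weyl; apply H2].
rewrite weyl_factor_eq by easy; unfold op_scal; cbn [coord fscal].
rewrite (toop_e _ 1) by easy; unfold emb; ring.
Qed.

Lemma Ts_sub t A B : 0 <= t -> hs A -> hs B -> Ts t (op_sub A B) = op_sub (Ts t A) (Ts t B).
Proof.
intros Ht HA HB; unfold op_sub.
rewrite (ind_add _ _ _ _ HTs), (ind_scal _ _ _ _ HTs); auto; now apply hs_scal.
Qed.

Lemma Ts_colsum t f N n m :
  0 <= t -> (forall i, pol (f i)) ->
  Ts t (embop p s (colsum f N)) (e n) m = csum (fun i => Ts t (embop p s (f i)) (e n) m) N.
Proof.
intros Ht Hf; induction N as [|N IH]; simpl.
- replace czero with (cscal (RtoC 0) cone)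
    by (apply cols_ext; intros; unfold cscal, czero; ring).
  rewrite embop_scal, (ind_scal _ _ _ _ HTs); auto with pol;
    [|now apply embop_hs, pol_one].
  unfold op_scal; cbn [coord fscal]; ring.
- rewrite embop_add, (ind_add _ _ _ _ HTs); auto using embop_hs, pol_colsum.
  unfold op_add; cbn [coord fplus]; now rewrite IH.
Qed.

Lemma Ts_entry_bound t A n m :
  0 <= t -> hs A -> Cmod (Ts t A (e n) m) <= hs_norm A.
Proof.
intros Ht HA; apply Rle_trans with (hs_norm (Ts t A)).
- now apply hs_entry, (ind_hs _ _ _ _ HTs).
- now apply (ind_contr _ _ _ _ HTs).
Qed.

Definition decay_const : R := 2 * exp (beta p / 4) * / (1 - eta p ^ 2).

(** The semigroup passes through the series because it contracts the remainder after [K] terms,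
    whose norm is at most [decay_const] times the [K]-th power of the ratio; entries are dominated
    by the Hilbert-Schmidt norm. *)
Lemma Ts_weyl_emb_series t z n m :
  0 <= t -> small_param p z ->
  Clim (csum (fun k => Ts t (embop p s (weyl_term z k)) (e n) m)) (Ts t (weyl_emb p s z) (e n) m).
Proof.
intros Ht Hsm.
apply Clim_of_geometric with decay_const (small_radius p * Cmod z).
{ split; [apply Rmult_le_pos; [apply sqrt_pos|apply Cmod_ge_0]|apply Hsm]. }
intros K.
assert (Hw : forall i, pol (weyl_term z i)) by (intros; apply pol_weyl_term).
pose proof (pol_colsum (weyl_term z) K Hw) as Hc.
pose proof (weyl_emb_hs p s Hb Hs z Hsm) as Ho.
pose proof (embop_hs p s Hb Hs _ Hc) as Hc'.
rewrite <- Ts_colsum by easy.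
replace (Ts t (weyl_emb p s z) (e n) m - Ts t (embop p s (colsum (weyl_term z) K)) (e n) m)%C
  with (Ts t (op_sub (weyl_emb p s z) (embop p s (colsum (weyl_term z) K))) (e n) m).
- eapply Rle_trans; [apply Ts_entry_bound; auto; now apply hs_sub|].
  pose proof (eta_01 p Hb) as He.
  set (x := small_radius p * Cmod z).
  apply Rle_trans with (2 * exp (beta p / 4) * x ^ K * / (1 - eta p ^ 2)).
  + apply hs_norm_decay; auto; [now apply hs_sub| |].
    * repeat apply Rmult_le_pos; try lra; [left; apply exp_pos|].
      apply pow_le, Rmult_le_pos; [apply sqrt_pos|apply Cmod_ge_0].
    * intros i j; unfold op_sub, op_add, op_scal; cbn [coord fplus fscal].
      rewrite weyl_emb_e, embop_e by easy.
      pose proof (emb_weyl_mx_tail p s Hb Hs z K i j Hsm) as Htail.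
      replace (emb p s (weyl_mx z) i j + RtoC (-1) * emb p s (colsum (weyl_term z) K) i j)%C
        with (emb p s (weyl_mx z) i j - csum (fun k => emb p s (weyl_term z k) i j) K)%C; [exact Htail|].
      rewrite emb_wt with (P := colsum (weyl_term z) K), colsum_entry, <- csum_scal, RtoC_m1.
      rewrite (csum_ext (fun n0 => _ * weyl_term z n0 i j)%C (fun k => emb p s (weyl_term z k) i j))
        by (intros; now rewrite emb_wt).
      ring.
  + unfold decay_const; right; ring.
- rewrite Ts_sub by easy; unfold op_sub, op_add, op_scal; cbn [coord fplus fscal].
  rewrite RtoC_m1; ring.
Qed.

Lemma hs_norm_weyl_term z k :
  hs_norm (embop p s (weyl_term z k)) <= decay_const * (small_radius p * Cmod z) ^ k.
Proof.
pose proof (eta_01 p Hb) as He; pose proof (pol_weyl_term z k) as Hw.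
assert (HD : 0 <= small_radius p * Cmod z)
  by (apply Rmult_le_pos; [apply sqrt_pos|apply Cmod_ge_0]).
apply Rle_trans with (2 * exp (beta p / 4) * (small_radius p * Cmod z) ^ k * / (1 - eta p ^ 2)).
- apply hs_norm_decay; auto; [now apply embop_hs| |].
  + repeat apply Rmult_le_pos; try lra; [left; apply exp_pos|now apply pow_le].
  + intros i j; rewrite embop_e by easy.
    eapply Rle_trans; [now apply emb_weyl_term_bound|].
    assert (0 <= exp (beta p / 4) * (small_radius p * Cmod z) ^ k * eta p ^ (i + j)).
    { repeat apply Rmult_le_pos; [left; apply exp_pos|now apply pow_le|apply pow_le; lra]. }
    lra.
- unfold decay_const; right; ring.
Qed.

(** For small real [r], the Weyl identity at [r z] equates two convergent power series in [r]. The
    coefficients on the left are the entries of the semigroup applied to embedded [A_z^k / k!]; the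
    right is a Gaussian times the series for [A_w], [w = e^(tZ) z]. Uniqueness of coefficients
    leaves the Cauchy product. *)
Lemma Ts_weyl_term t z k n m :
  0 <= t ->
  Ts t (embop p s (weyl_term z k)) (e n) m
  = csum (fun j => RtoC (gauss_coeff (noise_int p z t) j)
                   * emb p s (weyl_term (expZ p t z) (k - j)) n m)%C (S k).
Proof.
intros Ht; set (w := expZ p t z); set (q := noise_int p z t).
set (M := small_radius p * (Cmod z + Cmod w)).
assert (HR : 0 <= small_radius p) by apply sqrt_pos.
pose proof (Cmod_ge_0 z) as Hz0; pose proof (Cmod_ge_0 w) as Hw0.
assert (HM : 0 <= M) by (apply Rmult_le_pos; lra).
(* For [|r| < d] both [r z] and [r w] satisfy [small_param], and [M |r| <= 1/2] keeps [r] inside the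
   radii of convergence. *)
set (d := / (1 + 16 * (Cmod z + Cmod w) + 2 * M)).
assert (Hden : 0 < 1 + 16 * (Cmod z + Cmod w) + 2 * M) by lra.
assert (Hd : 0 < d) by (now apply Rinv_0_lt_compat).
assert (Hd1 : d * (1 + 16 * (Cmod z + Cmod w) + 2 * M) = 1) by (unfold d; field; lra).
assert (Hsmall : forall r v, Rabs r < d -> Cmod v <= Cmod z + Cmod w -> small_param p (RtoC r * v)%C).
{ intros r v Hr Hv; pose proof (Rabs_pos r); pose proof (Cmod_ge_0 v).
  unfold small_param; rewrite Cmod_mult, Cmod_R.
  assert (H1 : Rabs r * Cmod v <= d * (Cmod z + Cmod w)) by (apply Rmult_le_compat; lra).
  split; [nra|].
  apply Rle_trans with (d * M); [|nra].
  unfold M; pose proof (Rmult_le_compat_l _ _ _ HR H1); nra. }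
set (a := fun k => Ts t (embop p s (weyl_term z k)) (e n) m).
set (b := fun k => emb p s (weyl_term w k) n m).
assert (Hpol : forall v k, pol (weyl_term v k)) by (intros; apply pol_weyl_term).
assert (Ha : forall k, Cmod (a k) <= decay_const * M ^ k).
{ intros j; unfold a; eapply Rle_trans; [apply Ts_entry_bound; auto; now apply embop_hs|].
  eapply Rle_trans; [apply hs_norm_weyl_term|].
  apply Rmult_le_compat_l.
  - pose proof (eta_01 p Hb) as He; pose proof (eta2 _ He).
    unfold decay_const; repeat apply Rmult_le_pos; try lra; [left; apply exp_pos|].
    apply Rlt_le, Rinv_0_lt_compat; lra.
  - apply pow_incr; split; [now apply Rmult_le_pos|apply Rmult_le_compat_l; lra]. }
assert (Hbk : forall k, Cmod (b k) <= exp (beta p / 4) * eta p ^ (n + m) * M ^ k).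
{ intros j; unfold b; eapply Rle_trans; [now apply emb_weyl_term_bound|].
  pose proof (eta_01 p Hb) as He.
  rewrite Rmult_assoc, (Rmult_comm (_ ^ j)), <- Rmult_assoc.
  apply Rmult_le_compat_l.
  - apply Rmult_le_pos; [left; apply exp_pos|apply pow_le; lra].
  - apply pow_incr; split; [now apply Rmult_le_pos|apply Rmult_le_compat_l; lra]. }
assert (Hcv : forall (u : nat -> R) B, (forall k, Rabs (u k) <= B * M ^ k) ->
          forall r, Rabs r < d -> Rbar_lt (Rabs r) (CV_radius u)).
{ intros u B Hu r Hr; apply (CV_radius_geometric u B M d); auto; nra. }
assert (HL : forall r, Rabs r < d ->
  Clim (csum (fun k => RtoC (r ^ k) * a k)%C)
       (RtoC (exp (- q * r ^ 2)) * emb p s (weyl_mx (RtoC r * w)%C) n m)%C).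
{ intros r Hr.
  assert (H1 : small_param p (RtoC r * z)%C) by (apply Hsmall; auto; lra).
  assert (H2 : small_param p (RtoC r * w)%C) by (apply Hsmall; auto; lra).
  pose proof (Ts_weyl_emb_series t (RtoC r * z)%C n m Ht H1) as HS.
  rewrite Ts_weyl_emb, expZ_scal, noise_int_scal in HS; auto; [|rewrite expZ_scal; exact H2].
  fold w q in HS.
  replace (- q * r ^ 2) with (- (r ^ 2 * q)) by ring.
  apply Clim_ext with (2 := HS); intros K; apply csum_ext; intros j _.
  unfold a; rewrite weyl_term_scal, embop_scal, (ind_scal _ _ _ _ HTs); auto using embop_hs. }
assert (HR2 : forall r, Rabs r < d ->
  Clim (csum (fun k => RtoC (r ^ k) * b k)%C) (emb p s (weyl_mx (RtoC r * w)%C) n m)).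
{ intros r Hr.
  assert (H2 : small_param p (RtoC r * w)%C) by (apply Hsmall; auto; lra).
  apply Clim_of_geometric with (2 * exp (beta p / 4) * eta p ^ (n + m))
    (small_radius p * Cmod (RtoC r * w)%C).
  { split; [apply Rmult_le_pos; [easy|apply Cmod_ge_0]|apply H2]. }
  intros K.
  rewrite (csum_ext _ (fun k => emb p s (weyl_term (RtoC r * w)%C k) n m)).
  - eapply Rle_trans; [now apply emb_weyl_mx_tail|]; right; ring.
  - intros j _; rewrite weyl_term_scal, emb_scal; reflexivity. }
assert (Hball : forall P : R -> Prop, (forall r, Rabs r < d -> P r) -> locally 0 P).
{ intros P HP; exists (mkposreal d Hd); intros r Hr; apply HP.
  change (Rabs (r + - 0) < d) in Hr; now rewrite Ropp_0, Rplus_0_r in Hr. }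
assert (H0d : Rabs 0 < d) by (now rewrite Rabs_R0).
(* Uniqueness of coefficients is used for real power series, hence separately for [f = Re] and
   [f = Im]. *)
assert (Hgen : forall (f : C -> R),
  (forall c, Rabs (f c) <= Cmod c) ->
  (forall (u : nat -> C) r l, Clim (csum (fun k => RtoC (r ^ k) * u k)%C) l ->
     is_pseries (fun k => f (u k)) r (f l)) ->
  (forall (r : R) c, f (RtoC r * c)%C = r * f c) ->
  f (a k) = rsum (fun j => gauss_coeff q j * f (b (k - j)%nat)) (S k)).
{ intros f Hf1 Hf2 Hf3.
  assert (Ea : forall k, Rabs (f (a k)) <= decay_const * M ^ k)
    by (intros; eapply Rle_trans; [apply Hf1|apply Ha]).
  assert (Eb : forall k, Rabs (f (b k)) <= exp (beta p / 4) * eta p ^ (n + m) * M ^ k)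
    by (intros; eapply Rle_trans; [apply Hf1|apply Hbk]).
  assert (HPS : forall r, Rabs r < d ->
    is_pseries (PS_mult (gauss_coeff q) (fun k => f (b k))) r
      (exp (- q * r ^ 2) * f (emb p s (weyl_mx (RtoC r * w)%C) n m))).
  { intros r Hr; apply is_pseries_mult.
    - apply is_pseries_gauss.
    - now apply Hf2, HR2.
    - now rewrite gauss_coeff_entire.
    - now apply (Hcv _ _ Eb). }
  rewrite <- (sum_n_rsum (fun j => gauss_coeff q j * f (b (k - j)%nat))), sum_n_Reals.
  change (f (a k) = PS_mult (gauss_coeff q) (fun k => f (b k)) k).
  apply (PSeries_ext_recip (fun k => f (a k))).
  - rewrite <- Rabs_R0; now apply (Hcv _ _ Ea).
  (* The product series converges at [d / 2], so its terms there are bounded and its radius is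
     positive. *)
  - destruct (CV_radius_bounded (PS_mult (gauss_coeff q) (fun k => f (b k)))) as [Hub _].
    assert (Hd2 : Rabs (d / 2) < d) by (rewrite Rabs_pos_eq; lra).
    apply Rbar_lt_le_trans with (d / 2); [simpl; lra|].
    apply Hub.
    pose proof (ex_series_lim_0 _ (ex_intro _ _ (proj1 (is_pseries_R _ _ _) (HPS _ Hd2)))) as H0.
    apply is_lim_seq_spec in H0; destruct (H0 (mkposreal 1 Rlt_0_1)) as [N HN]; simpl in HN.
    set (g := fun n0 => Rabs (PS_mult (gauss_coeff q) (fun k => f (b k)) n0 * (d / 2) ^ n0)).
    assert (Hg : forall i, 0 <= g i) by (intros; apply Rabs_pos).
    exists (1 + rsum g N); intros i; change (g i <= 1 + rsum g N).
    destruct (Nat.le_gt_cases N i) as [Hi|Hi].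
    + specialize (HN i Hi); rewrite Rminus_0_r in HN.
      pose proof (rsum_nonneg g N (fun i _ => Hg i)); unfold g at 1; lra.
    + pose proof (rsum_term g N i Hg Hi); lra.
  - apply Hball; intros r Hr.
    rewrite (is_pseries_unique _ _ _ (HPS r Hr)).
    rewrite (is_pseries_unique _ _ _ (Hf2 _ _ _ (HL r Hr))).
    apply Hf3. }
change (a k = csum (fun j => RtoC (gauss_coeff q j) * b (k - j)%nat)%C (S k)).
apply injective_projections.
- change (Re (a k) = Re (csum (fun j => RtoC (gauss_coeff q j) * b (k - j)%nat)%C (S k))).
  rewrite Re_csum, (Hgen Re).
  + apply rsum_ext; intros; unfold Re; simpl; ring.
  + apply re_le_Cmod.
  + intros u r l H; now apply is_pseries_of_Clim.
  + intros; unfold Re; simpl; ring.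
- change (Im (a k) = Im (csum (fun j => RtoC (gauss_coeff q j) * b (k - j)%nat)%C (S k))).
  rewrite Im_csum, (Hgen Im).
  + apply rsum_ext; intros; unfold Im; simpl; ring.
  + apply im_le_Cmod.
  + intros u r l H; now apply is_pseries_of_Clim.
  + intros; unfold Im; simpl; ring.
Qed.

End Induced.

(** * The generator on embedded polynomials *)

(** Expanding [<A + B, A + B>] and applying Cauchy-Schwarz gives [x^2 <= (|A| + |B|) x], which is
    divided by [x] unless [x = 0]. *)
Lemma hs_triangle A B :
  hs A -> hs B -> hs_norm (op_add A B) <= hs_norm A + hs_norm B.
Proof.
intros HA HB; pose proof (proj1 (hs_add A B HA HB)) as HAB.
set (x := hs_norm (op_add A B)).
pose proof (hs_norm_pos (op_add A B)) as Hx; fold x in Hx.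
assert (H : x * x <= (hs_norm A + hs_norm B) * x).
{ replace (x * x) with (Re (hs_inner (op_add A B) (op_add A B)))
    by (rewrite hs_inner_self by easy; fold x; simpl; ring).
  rewrite hs_inner_add_l by easy.
  pose proof (hs_cauchy_schwarz A _ HA HAB); pose proof (hs_cauchy_schwarz B _ HB HAB).
  fold x in H, H0.
  pose proof (re_le_Cmod (hs_inner A (op_add A B))); pose proof (Rle_abs (Re (hs_inner A (op_add A B)))).
  pose proof (re_le_Cmod (hs_inner B (op_add A B))); pose proof (Rle_abs (Re (hs_inner B (op_add A B)))).
  replace (Re (hs_inner A (op_add A B) + hs_inner B (op_add A B))%C)
    with (Re (hs_inner A (op_add A B)) + Re (hs_inner B (op_add A B))) by reflexivity.
  lra. }
destruct Hx as [Hx|Hx]; [now apply Rmult_le_reg_r with x|].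
rewrite <- Hx; apply Rplus_le_le_0_compat; apply hs_norm_pos.
Qed.

Lemma hs_norm_scal_le c A : hs A -> hs_norm (op_scal c A) <= Cmod c * hs_norm A.
Proof.
intros HA; apply Rle_of_sq.
- apply Rmult_le_pos; [apply Cmod_ge_0|apply hs_norm_pos].
- rewrite Rpow_mult_distr; now apply hs_scal.
Qed.

Lemma hs_norm_entries_0 A : hs A -> hs_norm A = 0 -> forall n m, A (e n) m = RtoC 0.
Proof.
intros HA H n m; apply Cmod_eq_0; apply Rle_antisym; [|apply Cmod_ge_0].
rewrite <- H; now apply hs_entry.
Qed.

Lemma op_entry_add A B n m : op_add A B (e n) m = (A (e n) m + B (e n) m)%C.
Proof. reflexivity. Qed.

Lemma op_entry_scal c A n m : op_scal c A (e n) m = (c * A (e n) m)%C.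
Proof. reflexivity. Qed.

Lemma op_entry_sub A B n m : op_sub A B (e n) m = (A (e n) m - B (e n) m)%C.
Proof. unfold op_sub; rewrite op_entry_add, op_entry_scal, RtoC_m1; ring. Qed.

Lemma hs_norm_sub_self A : hs A -> hs_norm (op_sub A A) = 0.
Proof.
intros HA; apply Rle_antisym; [|apply hs_norm_pos].
apply Rle_of_sq; [lra|]; rewrite pow_i by lia.
apply hs_norm_le; [now apply hs_sub|]; intros N K.
right; transitivity (rsum (fun _ => 0 * 0) N); [|rewrite rsum_scal; ring].
apply rsum_ext; intros n _; transitivity (rsum (fun _ => 0 * 0) K); [|rewrite rsum_scal; ring].
apply rsum_ext; intros m _; rewrite op_entry_sub.
replace (_ - _)%C with (RtoC 0) by ring; rewrite Cmod_0; ring.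
Qed.

Definition csub (P Q : cols) : cols := cadd P (cscal (RtoC (-1)) Q).

Lemma csub_entry P Q n m : csub P Q n m = (P n m - Q n m)%C.
Proof. unfold csub, cadd, cscal; rewrite RtoC_m1; ring. Qed.

Lemma pol_csub P Q : pol P -> pol Q -> pol (csub P Q).
Proof. intros; unfold csub; auto with pol. Qed.

#[global] Hint Resolve pol_csub : pol.

Lemma squeeze_0 {F} {FF : Filter F} (f g : R -> R) :
  F (fun h => 0 <= f h <= g h) -> filterlim g F (locally 0) -> filterlim f F (locally 0).
Proof.
intros H Hg.
apply filterlim_locally; intros eps.
assert (H1 := proj1 (filterlim_locally g 0) Hg eps).
assert (H2 := filter_and _ _ H H1).
apply filter_imp with (2 := H2); intros h [H3 H4].
change (Rabs (g h - 0) < eps) in H4; change (Rabs (f h - 0) < eps).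
rewrite Rminus_0_r in *; rewrite Rabs_pos_eq in * by lra; lra.
Qed.

Lemma filterlim_plus_0 {F} {FF : Filter F} (f g : R -> R) :
  filterlim f F (locally 0) -> filterlim g F (locally 0) ->
  filterlim (fun h => f h + g h) F (locally 0).
Proof.
intros Hf Hg; replace 0 with (0 + 0) by ring.
eapply filterlim_comp_2; [exact Hf|exact Hg|].
apply (filterlim_plus (V := R_NormedModule) 0 0).
Qed.

Lemma filterlim_scal_0 {F} {FF : Filter F} (c : R) (f : R -> R) :
  filterlim f F (locally 0) -> filterlim (fun h => c * f h) F (locally 0).
Proof.
intros Hf; replace 0 with (c * 0) by ring.
apply (filterlim_comp _ _ _ f (fun x => c * x) _ (locally 0)); auto.
apply (filterlim_scal_r (V := R_NormedModule) c 0).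
Qed.

Lemma generator_add Ts (Hadd : forall t x y, 0 <= t -> hs x -> hs y ->
    Ts t (op_add x y) = op_add (Ts t x) (Ts t y))
  (Hhs : forall t x, 0 <= t -> hs x -> hs (Ts t x)) x y x' y' :
  generator Ts x y -> generator Ts x' y' -> generator Ts (op_add x x') (op_add y y').
Proof.
intros (Hx & Hy & H) (Hx' & Hy' & H'); split; [now apply hs_add|split; [now apply hs_add|]].
refine (squeeze_0 _ _ _ (filterlim_plus_0 _ _ H H')).
exists (mkposreal 1 Rlt_0_1); intros t _ Ht; split; [apply hs_norm_pos|].
assert (Ht' : 0 <= t) by lra.
assert (Hd : forall x y, hs x -> hs y ->
  hs (op_sub (op_scal (RtoC (/ t)) (op_sub (Ts t x) x)) y)).
{ intros a b Ha Hb'; apply hs_sub; auto; apply hs_scal, hs_sub; auto. }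
eapply Rle_trans; [|apply hs_triangle; apply Hd; auto].
right; f_equal; apply op_ext.
- apply Hd; now apply hs_add.
- apply hs_add; now apply Hd.
- intros n m; rewrite Hadd by easy.
  repeat rewrite ?op_entry_sub, ?op_entry_add, ?op_entry_scal; ring.
Qed.

Lemma generator_scal Ts (Hscal : forall t c x, 0 <= t -> hs x -> Ts t (op_scal c x) = op_scal c (Ts t x))
  (Hhs : forall t x, 0 <= t -> hs x -> hs (Ts t x)) c x y :
  generator Ts x y -> generator Ts (op_scal c x) (op_scal c y).
Proof.
intros (Hx & Hy & H); split; [now apply hs_scal|split; [now apply hs_scal|]].
refine (squeeze_0 _ _ _ (filterlim_scal_0 (Cmod c) _ H)).
exists (mkposreal 1 Rlt_0_1); intros t _ Ht; split; [apply hs_norm_pos|].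
assert (Ht' : 0 <= t) by lra.
assert (Hd : forall x y, hs x -> hs y ->
  hs (op_sub (op_scal (RtoC (/ t)) (op_sub (Ts t x) x)) y)).
{ intros a b Ha Hb'; apply hs_sub; auto; apply hs_scal, hs_sub; auto. }
eapply Rle_trans; [|apply hs_norm_scal_le; now apply Hd].
right; f_equal; apply op_ext.
- apply Hd; now apply hs_scal.
- apply hs_scal; now apply Hd.
- intros n m; rewrite Hscal by easy.
  repeat rewrite ?op_entry_sub, ?op_entry_add, ?op_entry_scal; ring.
Qed.

(** * Differentiable paths of polynomials *)

Fixpoint lsum (l : list ((R -> R) * cols)) (t : R) : cols :=
  match l with
  | nil => czero
  | cons (f, P) l' => cadd (cscal (RtoC (f t)) P) (lsum l' t)
  end.

Definition smooth_term (x : (R -> R) * cols) : Prop := (forall t, ex_derive (fst x) t) /\ pol (snd x).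

(** The path stays in the span of finitely many fixed polynomials, so differentiability in
    Hilbert-Schmidt norm reduces to that of its scalar coefficients. *)
Definition spath (F : R -> cols) : Prop :=
  exists l, List.Forall smooth_term l /\ forall t, F t = lsum l t.

Lemma lsum_app l l' t : lsum (app l l') t = cadd (lsum l t) (lsum l' t).
Proof.
induction l as [|[f P] l IH]; simpl.
- apply cols_ext; intros; unfold cadd, czero; ring.
- rewrite IH; apply cols_ext; intros; unfold cadd; ring.
Qed.

Lemma spath_add F G : spath F -> spath G -> spath (fun t => cadd (F t) (G t)).
Proof.
intros (l & Hl & HF) (l' & Hl' & HG); exists (app l l'); split.
- now apply List.Forall_app.
- intros t; now rewrite lsum_app, HF, HG.
Qed.

Lemma spath_scal (f : R -> R) F :
  (forall t, ex_derive f t) -> spath F -> spath (fun t => cscal (RtoC (f t)) (F t)).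
Proof.
intros Hf (l & Hl & HF).
exists (List.map (fun x : (R -> R) * cols => (fun t : R => f t * fst x t, snd x)) l); split.
- clear HF; induction Hl as [|x l [H1 H2] _ IH]; simpl; constructor; auto.
  split; simpl; auto; intros t; apply (ex_derive_mult f (fst x)); auto.
- intros t; rewrite HF; clear; induction l as [|[g P] l IH]; simpl.
  + apply cols_ext; intros; unfold cscal, czero; ring.
  + rewrite <- IH; apply cols_ext; intros; unfold cscal, cadd; rewrite RtoC_mult; ring.
Qed.

Lemma spath_map (phi : cols -> cols) F :
  (forall P Q, phi (cadd P Q) = cadd (phi P) (phi Q)) ->
  (forall c P, phi (cscal c P) = cscal c (phi P)) ->
  (forall P, pol P -> pol (phi P)) ->
  spath F -> spath (fun t => phi (F t)).
Proof.
intros Ha Hs Hp (l & Hl & HF).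
exists (List.map (fun x : (R -> R) * cols => (fst x, phi (snd x))) l); split.
- clear HF; induction Hl as [|x l [H1 H2] _ IH]; simpl; constructor; auto.
  split; simpl; auto.
- intros t; rewrite HF; clear - Ha Hs; induction l as [|[g P] l IH]; simpl.
  + replace czero with (cscal (RtoC 0) czero) by (apply cols_ext; intros; unfold cscal, czero; ring).
    rewrite Hs; apply cols_ext; intros; unfold cscal, czero; ring.
  + now rewrite <- IH, Ha, Hs.
Qed.

Lemma spath_const P : pol P -> spath (fun _ => P).
Proof.
intros HP; exists (cons (fun _ => 1, P) nil); split.
- constructor; [|constructor]; split; auto; intros t; simpl; auto_derive; auto.
- intros t; simpl; apply cols_ext; intros; unfold cadd, cscal, czero; ring.
Qed.

Lemma spath_ext F G : (forall t, F t = G t) -> spath F -> spath G.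
Proof. intros H (l & Hl & HF); exists l; split; auto; intros t; now rewrite <- H. Qed.

Lemma pol_czero : pol czero.
Proof.
replace czero with (cscal (RtoC 0) cone); [auto with pol|].
apply cols_ext; intros; unfold cscal, czero; ring.
Qed.

#[global] Hint Resolve pol_czero : pol.

Lemma spath_pol F t : spath F -> pol (F t).
Proof.
intros (l & Hl & HF); rewrite HF; clear HF; induction Hl as [|[f P] l [H1 H2] _ IH]; simpl;
  auto with pol.
Qed.

Lemma spath_colsum (F : nat -> R -> cols) N :
  (forall i, spath (F i)) -> spath (fun t => colsum (fun i => F i t) N).
Proof.
intros H; induction N as [|N IH]; simpl; [apply spath_const, pol_czero|].
now apply spath_add.
Qed.

Lemma spath_field_op (w : R -> C) F :
  (forall t, ex_derive (fun t => Re (w t)) t) -> (forall t, ex_derive (fun t => Im (w t)) t) ->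
  spath F -> spath (fun t => field_op (w t) (F t)).
Proof.
intros Hr Hi HF.
(* Real-linearity in the parameter: [A_w = Re w A_1 + Im w A_i], with fixed operators on the
   right. *)
apply spath_ext with (fun t =>
  cadd (cscal (RtoC (Re (w t))) (field_op (RtoC 1) (F t))) (cscal (RtoC (Im (w t))) (field_op Ci (F t)))).
- intros t; rewrite !field_op_eq; apply cols_ext; intros n m; unfold cadd, cscal.
  destruct (w t) as [x y]; simpl.
  apply injective_projections; simpl; ring.
- apply spath_add; apply spath_scal; auto; apply spath_map; auto;
    intros; auto using field_op_add, field_op_scal, pol_field_op.
Qed.

Lemma spath_field_power (w : R -> C) k :
  (forall t, ex_derive (fun t => Re (w t)) t) -> (forall t, ex_derive (fun t => Im (w t)) t) ->
  spath (fun t => field_power (w t) k).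
Proof.
intros Hr Hi; induction k as [|k IH]; [exact (spath_const cone pol_one)|].
now apply (spath_field_op w (fun t => field_power (w t) k)).
Qed.

Definition quot (F : R -> cols) (t h : R) : cols := cscal (RtoC (/ h)) (csub (F (t + h)) (F t)).

Section Paths.

Variable p : gaussian_data.
Variable s : R.
Hypothesis Hb : 0 < beta p.
Hypothesis Hs : 0 <= s <= 1.

Definition pol_norm (P : cols) : R := hs_norm (embop p s P).

Lemma pol_norm_add P Q : pol P -> pol Q -> pol_norm (cadd P Q) <= pol_norm P + pol_norm Q.
Proof.
intros HP HQ; unfold pol_norm; rewrite embop_add by easy.
apply hs_triangle; now apply embop_hs.
Qed.

Lemma pol_norm_scal c P : pol P -> pol_norm (cscal c P) <= Cmod c * pol_norm P.
Proof.
intros HP; unfold pol_norm; rewrite embop_scal by easy.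
apply hs_norm_scal_le; now apply embop_hs.
Qed.

Lemma pol_norm_pos P : 0 <= pol_norm P.
Proof. apply hs_norm_pos. Qed.

Lemma pol_norm_czero : pol_norm czero = 0.
Proof.
apply Rle_antisym; [|apply pol_norm_pos].
replace czero with (cscal (RtoC 0) czero) by (apply cols_ext; intros; unfold cscal, czero; ring).
eapply Rle_trans; [apply pol_norm_scal, pol_czero|]; rewrite Cmod_0; lra.
Qed.

Lemma quotient_limit f t l :
  is_derive f t l -> filterlim (fun h => (f (t + h) - f t) / h - l) (locally' 0) (locally 0).
Proof.
intros H; apply is_derive_Reals in H.
apply filterlim_locally; intros eps.
destruct (H eps (cond_pos eps)) as [d Hd].
exists d; intros h Hh H0.
change (Rabs ((f (t + h) - f t) / h - l - 0) < eps); rewrite Rminus_0_r.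
apply Hd; auto.
change (Rabs (h - 0) < d) in Hh; now rewrite Rminus_0_r in Hh.
Qed.

Lemma filterlim_abs_0 {F} {FF : Filter F} (f : R -> R) :
  filterlim f F (locally 0) -> filterlim (fun h => Rabs (f h)) F (locally 0).
Proof.
intros Hf; rewrite <- Rabs_R0.
apply (filterlim_comp _ _ _ f Rabs _ (locally 0)); auto.
apply (continuous_Rabs 0).
Qed.

(** Only existence is asserted. The value of the derivative is identified afterwards, through the
    entries at time zero and through the generator at later times. *)
Lemma spath_derivative F (t : R) :
  spath F -> exists D, pol D /\ filterlim (fun h => pol_norm (csub (quot F t h) D)) (locally' 0) (locally 0).
Proof.
intros (l & Hl & HF).
assert (H : exists D, pol D /\ filterlim (fun h => pol_norm (csub (quot (lsum l) t h) D)) (locally' 0) (locally 0)).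
{ clear HF; induction Hl as [|[f P] l [H1 H2] Hl (D & HD & IH)]; simpl in *.
  - exists czero; split; [apply pol_czero|].
    apply filterlim_ext with (fun _ => 0); [|apply filterlim_const].
    intros h; replace (csub _ _) with czero; [now rewrite pol_norm_czero|].
    apply cols_ext; intros n m; rewrite csub_entry; unfold quot, cscal; rewrite csub_entry.
    unfold czero; simpl; unfold czero; ring.
  - assert (Hpl : forall u, pol (lsum l u))
      by (intros; apply spath_pol; exists l; split; auto).
    exists (cadd (cscal (RtoC (Derive f t)) P) D); split; [auto with pol|].
    pose proof (quotient_limit f t _ (Derive_correct _ _ (H1 t))) as Hq.
    apply filterlim_abs_0, (filterlim_scal_0 (pol_norm P)) in Hq.
    refine (squeeze_0 _ _ _ (filterlim_plus_0 _ _ Hq IH)).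
    exists (mkposreal 1 Rlt_0_1); intros h _ Hh; split; [apply pol_norm_pos|].
    set (a := (f (t + h) - f t) / h - Derive f t).
    replace (csub (quot (fun t0 => cadd (cscal (RtoC (f t0)) P) (lsum l t0)) t h)
               (cadd (cscal (RtoC (Derive f t)) P) D))
      with (cadd (cscal (RtoC a) P) (csub (quot (lsum l) t h) D)).
    + eapply Rle_trans.
      { apply pol_norm_add; unfold quot; auto with pol. }
      apply Rplus_le_compat_r.
      eapply Rle_trans; [now apply pol_norm_scal|]; rewrite Cmod_R; lra.
    + apply cols_ext; intros n m; rewrite csub_entry; unfold cadd; rewrite csub_entry.
      unfold quot, cscal; rewrite !csub_entry; unfold cadd, cscal, a.
      rewrite RtoC_minus; unfold Rdiv; rewrite RtoC_mult, RtoC_minus; ring. }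
destruct H as (D & HD & H); exists D; split; [exact HD|].
apply filterlim_ext with (2 := H); intros h; unfold quot; now rewrite !HF.
Qed.

End Paths.

(** * Derivatives of complex functions of a real variable *)

Definition cderive (g : R -> C) (t : R) (l : C) : Prop :=
  is_derive (fun t => Re (g t)) t (Re l) /\ is_derive (fun t => Im (g t)) t (Im l).

Lemma cderive_const c t : cderive (fun _ => c) t (RtoC 0).
Proof. split; simpl; apply (is_derive_const (V := R_NormedModule)). Qed.

Lemma cderive_plus f g t a b :
  cderive f t a -> cderive g t b -> cderive (fun t => f t + g t)%C t (a + b)%C.
Proof.
intros [H1 H2] [H3 H4]; split; simpl.
- now apply (is_derive_plus (V := R_NormedModule) (fun t => Re (f t)) (fun t => Re (g t))).
- now apply (is_derive_plus (V := R_NormedModule) (fun t => Im (f t)) (fun t => Im (g t))).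
Qed.

Lemma is_derive_mult_R (f g : R -> R) t a b :
  is_derive f t a -> is_derive g t b -> is_derive (fun t => f t * g t) t (a * g t + f t * b).
Proof.
intros Hf Hg.
apply is_derive_Reals in Hf; apply is_derive_Reals in Hg; apply is_derive_Reals.
now apply derivable_pt_lim_mult.
Qed.

Lemma cderive_mult f g t a b :
  cderive f t a -> cderive g t b ->
  cderive (fun t => f t * g t)%C t (a * g t + f t * b)%C.
Proof.
intros [H1 H2] [H3 H4]; split.
- replace (Re (a * g t + f t * b)%C)
    with ((Re a * Re (g t) + Re (f t) * Re b) - (Im a * Im (g t) + Im (f t) * Im b))
    by (unfold Re, Im; simpl; ring).
  apply (is_derive_minus (V := R_NormedModule)
    (fun t => Re (f t) * Re (g t)) (fun t => Im (f t) * Im (g t))); now apply is_derive_mult_R.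
- replace (Im (a * g t + f t * b)%C)
    with ((Re a * Im (g t) + Re (f t) * Im b) + (Im a * Re (g t) + Im (f t) * Re b))
    by (unfold Re, Im; simpl; ring).
  apply (is_derive_plus (V := R_NormedModule)
    (fun t => Re (f t) * Im (g t)) (fun t => Im (f t) * Re (g t))); now apply is_derive_mult_R.
Qed.

Lemma cderive_conj f t a : cderive f t a -> cderive (fun t => Cconj (f t)) t (Cconj a).
Proof.
intros [H1 H2]; split; simpl; auto.
now apply (is_derive_opp (V := R_NormedModule) (fun t => Im (f t))).
Qed.

Lemma cderive_RtoC (f : R -> R) t (a : R) : is_derive f t a -> cderive (fun t => RtoC (f t)) t (RtoC a).
Proof.
intros H; split; simpl; auto; apply (is_derive_const (V := R_NormedModule)).
Qed.

Lemma cderive_ext f g t a : (forall t, f t = g t) -> cderive f t a -> cderive g t a.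
Proof.
intros H [H1 H2]; split.
- apply is_derive_ext with (2 := H1); intros; now rewrite H.
- apply is_derive_ext with (2 := H2); intros; now rewrite H.
Qed.

Lemma cderive_scal c g t b : cderive g t b -> cderive (fun t => c * g t)%C t (c * b)%C.
Proof.
intros H; replace (c * b)%C with (RtoC 0 * g t + c * b)%C by ring.
apply (cderive_mult (fun _ => c)); [apply cderive_const|easy].
Qed.

Lemma cderive_csum (f : nat -> R -> C) (a : nat -> C) t N :
  (forall j, (j < N)%nat -> cderive (f j) t (a j)) ->
  cderive (fun t => csum (fun j => f j t) N) t (csum a N).
Proof.
induction N as [|N IH]; intros H; simpl; [apply cderive_const|].
apply cderive_plus; auto.
Qed.

Lemma cderive_unique f t a b : cderive f t a -> cderive f t b -> a = b.
Proof.
intros [H1 H2] [H3 H4]; apply is_derive_unique in H1, H2, H3, H4.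
destruct a, b; simpl in *; congruence.
Qed.

Lemma cderive_field_op (w : R -> C) (P : R -> cols) t v D :
  cderive w t v -> (forall n m, cderive (fun t => P t n m) t (D n m)) ->
  forall n m, cderive (fun t => field_op (w t) (P t) n m) t (cadd (field_op (w t) D) (field_op v (P t)) n m).
Proof.
intros Hw HP n m; unfold field_op, weyl_gen, cadd, Cminus.
set (cr := fun Q : cols => cre (Q n) m).
set (an := fun Q : cols => ann (Q n) m).
assert (H1 : cderive (fun t => cr (P t)) t (cr D)).
{ unfold cr, cre; destruct m as [|m]; [apply cderive_const|]; now apply cderive_scal. }
assert (H2 : cderive (fun t => an (P t)) t (an D)).
{ unfold an, ann; now apply cderive_scal. }
fold (cr D) (an D) (cr (P t)) (an (P t)).
replace (w t * cr D + - (Cconj (w t) * an D) + (v * cr (P t) + - (Cconj v * an (P t))))%C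
  with ((v * cr (P t) + w t * cr D)
        + (RtoC (-1)) * (Cconj v * an (P t) + Cconj (w t) * an D))%C
  by (rewrite RtoC_m1; ring).
apply cderive_ext with (fun t => w t * cr (P t) + (RtoC (-1)) * (Cconj (w t) * an (P t)))%C.
{ intros; rewrite RtoC_m1; unfold cr, an; ring. }
apply cderive_plus; [now apply cderive_mult|].
apply cderive_scal, (cderive_mult (fun t => Cconj (w t))); [now apply cderive_conj|easy].
Qed.

(** The derivative of [A_(w(t))^k] is the first-order coefficient in direction [w'(t)]: both obey
    the same Leibniz recursion in [k]. *)
Lemma cderive_field_power (w : R -> C) t v k n m :
  cderive w t v -> cderive (fun t => field_power (w t) k n m) t (mixed_power (w t) v k 1 n m).
Proof.
intros Hw; revert n m; induction k as [|k IH]; intros n m; [exact (cderive_const (delta n m) t)|].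
cbn [mixed_power]; rewrite mixed_power_0.
exact (cderive_field_op w (fun t => field_power (w t) k) t v _ Hw IH n m).
Qed.

Section Generator.

Variable p : gaussian_data.
Variable T : R -> op -> op.
Variable s : R.
Variable Ts : R -> op -> op.
Hypothesis Hb : 0 < beta p.
Hypothesis Hs : 0 <= s <= 1.
Hypothesis Hz : zeta p = RtoC 0.
Hypothesis HT : is_gaussian_qms p T.
Hypothesis HTs : is_induced p s T Ts.

Definition path_derivative (F : R -> cols) (t : R) (D : cols) : Prop :=
  pol D /\ filterlim (fun h => pol_norm p s (csub (quot F t h) D)) (locally' 0) (locally 0).

(** A derivative in norm passes through any bounded functional. Entries are such functionals and
    serve to identify derivatives; inner products serve in the mean value argument. *)
Lemma functional_derivative (phi : cols -> R) M F t D :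
  (forall P Q, pol P -> pol Q -> phi (cadd P Q) = phi P + phi Q) ->
  (forall (r : R) P, pol P -> phi (cscal (RtoC r) P) = r * phi P) ->
  (forall P, pol P -> Rabs (phi P) <= M * pol_norm p s P) ->
  spath F -> path_derivative F t D -> is_derive (fun t => phi (F t)) t (phi D).
Proof.
intros Ha Hsc HM HF [HD H]; apply is_derive_Reals; intros eps Heps.
assert (HM' : 0 < Rabs M + 1) by (pose proof (Rabs_pos M); lra).
assert (He : 0 < eps / (Rabs M + 1)) by (now apply Rdiv_lt_0_compat).
destruct (proj1 (filterlim_locally _ 0) H (mkposreal _ He)) as [d Hd].
exists d; intros h H0 Hh.
assert (Hball : ball 0 d h) by (change (Rabs (h - 0) < d); now rewrite Rminus_0_r).
specialize (Hd h Hball H0).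
change (Rabs (pol_norm p s (csub (quot F t h) D) - 0) < eps / (Rabs M + 1)) in Hd.
rewrite Rminus_0_r, Rabs_pos_eq in Hd by apply pol_norm_pos.
assert (HpF : forall u, pol (F u)) by (intros; now apply spath_pol).
replace ((phi (F (t + h)) - phi (F t)) / h - phi D) with (phi (csub (quot F t h) D)).
- eapply Rle_lt_trans; [apply HM; unfold quot; auto with pol|].
  apply Rle_lt_trans with (Rabs M * pol_norm p s (csub (quot F t h) D)).
  { apply Rmult_le_compat_r; [apply pol_norm_pos|apply Rle_abs]. }
  apply Rle_lt_trans with ((Rabs M + 1) * pol_norm p s (csub (quot F t h) D)).
  { apply Rmult_le_compat_r; [apply pol_norm_pos|lra]. }
  apply Rmult_lt_reg_l with (/ (Rabs M + 1)); [now apply Rinv_0_lt_compat|].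
  replace (/ (Rabs M + 1) * ((Rabs M + 1) * pol_norm p s (csub (quot F t h) D)))
    with (pol_norm p s (csub (quot F t h) D)) by (field; lra).
  unfold Rdiv in Hd; lra.
- unfold csub at 1; rewrite Ha, (Hsc (-1)) by (unfold quot; auto with pol).
  unfold quot; rewrite Hsc by auto with pol.
  unfold csub; rewrite Ha, Hsc by auto with pol; field; auto.
Qed.

Lemma path_derivative_entry F t D n m :
  spath F -> path_derivative F t D -> cderive (fun t => F t n m) t (D n m).
Proof.
intros HF HD.
pose proof (wt_pos p s n m) as Hw.
assert (HM : forall P, pol P -> Cmod (P n m) <= / wt p s n m * pol_norm p s P).
{ intros P HP; apply Rmult_le_reg_l with (wt p s n m); auto.
  rewrite <- Rmult_assoc, Rinv_r, Rmult_1_l by lra.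
  unfold pol_norm; eapply Rle_trans; [|apply (hs_entry _ n m); now apply embop_hs].
  rewrite embop_e, emb_wt, Cmod_mult, Cmod_R, Rabs_pos_eq by (auto; lra); lra. }
split.
- apply (functional_derivative (fun P => Re (P n m)) (/ wt p s n m)); auto.
  + intros r P _; unfold cscal, Re; simpl; ring.
  + intros P HP; eapply Rle_trans; [apply re_le_Cmod|auto].
- apply (functional_derivative (fun P => Im (P n m)) (/ wt p s n m)); auto.
  + intros r P _; unfold cscal, Im; simpl; ring.
  + intros P HP; eapply Rle_trans; [apply im_le_Cmod|auto].
Qed.

Lemma path_derivative_inner A F t D :
  hs A -> spath F -> path_derivative F t D ->
  cderive (fun t => hs_inner A (embop p s (F t))) t (hs_inner A (embop p s D)).
Proof.
intros HA HF HD.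
assert (HM : forall P, pol P -> Cmod (hs_inner A (embop p s P)) <= hs_norm A * pol_norm p s P).
{ intros P HP; apply hs_cauchy_schwarz; auto; now apply embop_hs. }
assert (Hadd : forall P Q, pol P -> pol Q -> hs_inner A (embop p s (cadd P Q))
   = (hs_inner A (embop p s P) + hs_inner A (embop p s Q))%C).
{ intros P Q HP HQ; rewrite embop_add, hs_inner_add_r; auto using embop_hs. }
assert (Hsc : forall c P, pol P -> hs_inner A (embop p s (cscal c P))
   = (c * hs_inner A (embop p s P))%C).
{ intros c P HP; rewrite embop_scal, hs_inner_scal_r; auto using embop_hs. }
split.
- apply (functional_derivative (fun P => Re (hs_inner A (embop p s P))) (hs_norm A)); auto.
  + intros P Q HP HQ; now rewrite Hadd.
  + intros r P HP; rewrite Hsc by easy; unfold Re; simpl; ring.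
  + intros P HP; eapply Rle_trans; [apply re_le_Cmod|auto].
- apply (functional_derivative (fun P => Im (hs_inner A (embop p s P))) (hs_norm A)); auto.
  + intros P Q HP HQ; now rewrite Hadd.
  + intros r P HP; rewrite Hsc by easy; unfold Im; simpl; ring.
  + intros P HP; eapply Rle_trans; [apply im_le_Cmod|auto].
Qed.

(** The formula of [Ts_weyl_term] taken for all real [t], so that two-sided derivatives exist even
    at the endpoint zero of the semigroup. *)
Definition orbit (z : C) (k : nat) (t : R) : cols :=
  colsum (fun j => cscal (RtoC (gauss_coeff (noise_int p z t) j)) (weyl_term (expZ p t z) (k - j))) (S k).

Lemma ex_derive_gauss z j t : ex_derive (fun t => gauss_coeff (noise_int p z t) j) t.
Proof.
unfold gauss_coeff; destruct (Nat.even j); [|apply ex_derive_const].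
assert (H : forall (q : R -> R) n c, ex_derive q t -> ex_derive (fun t => (- q t) ^ n / c) t)
  by (intros; auto_derive; auto).
apply (H (noise_int p z)); eexists; apply is_derive_noise_int.
Qed.

Lemma spath_orbit z k : spath (orbit z k).
Proof.
apply (spath_colsum (fun j t =>
  cscal (RtoC (gauss_coeff (noise_int p z t) j)) (weyl_term (expZ p t z) (k - j)))).
intros j; apply spath_scal; [intros; apply ex_derive_gauss|].
apply (spath_map (cscal (RtoC (/ INR (fact (k - j)))))).
- intros; apply cols_ext; intros; unfold cscal, cadd; ring.
- intros; apply cols_ext; intros; unfold cscal; ring.
- auto with pol.
- apply (spath_field_power (fun t => expZ p t z)); intros;
    [apply ex_derive_expZ_re|apply ex_derive_expZ_im].
Qed.

Lemma Ts_orbit z k t : 0 <= t -> Ts t (embop p s (weyl_term z k)) = embop p s (orbit z k t).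
Proof.
intros Ht; pose proof (spath_pol _ t (spath_orbit z k)) as Hp.
pose proof (pol_weyl_term z k) as Hw.
apply op_ext.
- apply (ind_hs _ _ _ _ HTs); auto using embop_hs.
- now apply embop_hs.
- intros n m; rewrite (Ts_weyl_term p T s Ts) by auto; rewrite embop_e by auto.
  rewrite emb_wt; unfold orbit; rewrite colsum_entry, <- csum_scal.
  apply csum_ext; intros j _; rewrite emb_wt; unfold cscal; ring.
Qed.

(** Follows from [Ts 0] being the identity and injectivity of the embedding, rather than from
    evaluating the sum. *)
Lemma orbit_0 z k : orbit z k 0 = weyl_term z k.
Proof.
apply (emb_inj p s); apply cols_ext; intros n m.
pose proof (spath_pol _ 0 (spath_orbit z k)) as Hp; pose proof (pol_weyl_term z k) as Hw.
rewrite <- !(embop_e p s Hb Hs) by easy.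
rewrite <- Ts_orbit by lra.
rewrite (ind_0 _ _ _ _ HTs); auto using embop_hs.
Qed.

End Generator.

(** * The quadratic form of the generator *)

Lemma comm_a_field_op z P : comm_a (field_op z P) = cadd (field_op z (comm_a P)) (cscal z P).
Proof. rewrite !field_op_eq; cols_norm; ring. Qed.

Lemma comm_c_field_op z P : comm_c (field_op z P) = cadd (field_op z (comm_c P)) (cscal (Cconj z) P).
Proof. rewrite !field_op_eq; cols_norm; ring. Qed.

Lemma comm_a_scal c P : comm_a (cscal c P) = cscal c (comm_a P).
Proof. cols_norm; ring. Qed.

Lemma comm_c_scal c P : comm_c (cscal c P) = cscal c (comm_c P).
Proof. cols_norm; ring. Qed.

Lemma comm_a_add P Q : comm_a (cadd P Q) = cadd (comm_a P) (comm_a Q).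
Proof. cols_norm; ring. Qed.

Lemma comm_c_add P Q : comm_c (cadd P Q) = cadd (comm_c P) (comm_c Q).
Proof. cols_norm; ring. Qed.

Lemma cscal_0 P : cscal (RtoC 0) P = czero.
Proof. apply cols_ext; intros; unfold cscal, czero; ring. Qed.

Lemma comm_a_field_power z k : comm_a (field_power z k) = cscal (RtoC (INR k) * z)%C (field_power z (k - 1)).
Proof.
induction k as [|k IH].
- change (field_power z 0) with cone; rewrite comm_a_one; simpl INR; rewrite Cmult_0_l, cscal_0; easy.
- rewrite field_power_S, comm_a_field_op, IH, field_op_scal; replace (S k - 1)%nat with k by lia.
  destruct k as [|k].
  + apply cols_ext; intros; unfold cadd, cscal; simpl INR; ring.
  + rewrite <- field_power_S; replace (S (S k - 1)) with (S k) by lia.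
    rewrite (S_INR (S k)), RtoC_plus; apply cols_ext; intros; unfold cadd, cscal; ring.
Qed.

Lemma comm_c_field_power z k : comm_c (field_power z k) = cscal (RtoC (INR k) * Cconj z)%C (field_power z (k - 1)).
Proof.
induction k as [|k IH].
- change (field_power z 0) with cone; rewrite comm_c_one; simpl INR; rewrite Cmult_0_l, cscal_0; easy.
- rewrite field_power_S, comm_c_field_op, IH, field_op_scal; replace (S k - 1)%nat with k by lia.
  destruct k as [|k].
  + apply cols_ext; intros; unfold cadd, cscal; simpl INR; ring.
  + rewrite <- field_power_S; replace (S (S k - 1)) with (S k) by lia.
    rewrite (S_INR (S k)), RtoC_plus; apply cols_ext; intros; unfold cadd, cscal; ring.
Qed.

Lemma jordan_c_eq P : jordan_c P = csub (lc P) (cscal (RtoC (/ 2)) (comm_c P)).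
Proof.
apply cols_ext; intros n m; rewrite csub_entry; unfold jordan_c, comm_c, cadd, cscal.
rewrite RtoC_m1, half_inv; field; apply C2_neq.
Qed.

Lemma jordan_a_eq P : jordan_a P = csub (la P) (cscal (RtoC (/ 2)) (comm_a P)).
Proof.
apply cols_ext; intros n m; rewrite csub_entry; unfold jordan_a, comm_a, cadd, cscal.
rewrite RtoC_m1, half_inv; field; apply C2_neq.
Qed.

(** The parameters are the coefficients of [z] and of its conjugate in [Zop], those of [Cop], and
    their conjugates. *)
Definition gen_pol (p : gaussian_data) : cols -> cols :=
  gen_form (Ci * RtoC (Omega p) - RtoC (gamma p))%C
     (Cconj (Ci * RtoC (Omega p) - RtoC (gamma p)))%C
     (Ci * kappa p)%C (Cconj (Ci * kappa p))
     (uv p) (Cconj (uv p)) (RtoC (usq p + vsq p)).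

Lemma noise_C p z :
  RtoC (noise p z) = (RtoC (usq p + vsq p) * (z * Cconj z)
                      + (uv p * (Cconj z * Cconj z) + Cconj (uv p) * (z * z)))%C.
Proof.
rewrite noise_eq; destruct z as [x y], (uv p) as [a b].
apply injective_projections; simpl; ring.
Qed.

(** The Jordan products are left multiplications minus half a commutator: the left multiplications
    produce [k A_v A_z^(k-1)] with [v = Zop p z], and the half commutators supply exactly the
    reordering term of [mixed_power_1]. The double commutators lower the power by two and assemble
    to the quadratic form [noise]. *)
Lemma gen_pol_field_power p z k :
  gen_pol p (field_power z k)
  = cadd (mixed_power z (Zop p z) k 1)
         (cscal (RtoC (- / 2 * (INR k * (INR k - 1)) * noise p z)) (field_power z (k - 2))).
Proof.
destruct k as [|k].
- unfold gen_pol; change (field_power z 0) with cone; rewrite gen_form_one.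
  simpl mixed_power; simpl INR; rewrite Rmult_0_l, Rmult_0_r, Rmult_0_l, cscal_0.
  apply cols_ext; intros; unfold cadd, czero; ring.
- set (v := Zop p z); set (j := S k).
  assert (H1 : forall a b, cadd (cscal a (comm_a (field_power z j))) (cscal b (comm_c (field_power z j)))
            = cscal (RtoC (INR j) * (a * z + b * Cconj z))%C (field_power z k)).
  { intros a b; rewrite comm_a_field_power, comm_c_field_power; unfold j; replace (S k - 1)%nat with k by lia.
    apply cols_ext; intros; unfold cadd, cscal; ring. }
  assert (H2 : forall a b, cadd (cscal b (comm_c (field_power z j))) (cscal a (comm_a (field_power z j)))
            = cscal (RtoC (INR j) * (a * z + b * Cconj z))%C (field_power z k)).
  { intros a b; rewrite <- H1; apply cols_ext; intros; unfold cadd; ring. }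
  unfold gen_pol, gen_form; rewrite H1, H2.
  replace ((Ci * RtoC (Omega p) - RtoC (gamma p)) * z + Ci * kappa p * Cconj z)%C with v
    by reflexivity.
  replace (Cconj (Ci * kappa p) * z + Cconj (Ci * RtoC (Omega p) - RtoC (gamma p)) * Cconj z)%C
    with (Cconj v) by (unfold v, Zop; rewrite Cplus_conj, !(Cmult_conj _ (Cconj z)),
      !(Cmult_conj _ z), Cconj_conj; ring).
  rewrite jordan_c_eq, jordan_a_eq, !lc_scal, !la_scal, !comm_a_scal, !comm_c_scal, !comm_a_field_power, !comm_c_field_power.
  unfold j; rewrite mixed_power_1.
  rewrite !comm_a_scal, !comm_c_scal, !comm_a_field_power, !comm_c_field_power.
  replace (S k - 1)%nat with k by lia; replace (S k - 2)%nat with (k - 1)%nat by lia.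
  rewrite field_op_eq; apply cols_ext; intros n m; unfold cadd; rewrite !csub_entry; unfold cscal; rewrite !csub_entry.
  rewrite RtoC_mult, noise_C, S_INR.
  replace (INR k + 1 - 1) with (INR k) by ring.
  unfold Rdiv; rewrite RtoC_m1, !RtoC_mult, RtoC_opp, half_inv, !RtoC_plus.
  field; apply C2_neq.
Qed.

Section Generator2.

Variable p : gaussian_data.
Variable T : R -> op -> op.
Variable s : R.
Variable Ts : R -> op -> op.
Hypothesis Hb : 0 < beta p.
Hypothesis Hs : 0 <= s <= 1.
Hypothesis Hz : zeta p = RtoC 0.
Hypothesis HT : is_gaussian_qms p T.
Hypothesis HTs : is_induced p s T Ts.

Lemma gauss_coeff_0 j : gauss_coeff 0 j = if Nat.eqb j 0 then 1 else 0.
Proof.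
unfold gauss_coeff; rewrite Ropp_0.
destruct j as [|[|j]]; simpl; [field|easy|].
destruct (Nat.even j); [unfold Rdiv; ring|easy].
Qed.

(** As [noise_int] vanishes at time zero, the coefficient of index [2 i] is of order [i] in it; only
    [i = 1] has a nonzero first derivative. *)
Lemma gauss_coeff_derive z j :
  is_derive (fun t => gauss_coeff (noise_int p z t) j) 0
    (if Nat.eqb j 2 then - / 2 * noise p z else 0).
Proof.
pose proof (is_derive_noise_int p z 0) as H; rewrite expZ_0 in H.
pose proof (noise_int_0 p z) as H0.
assert (Hg : forall (q : R -> R) d, is_derive q 0 d -> q 0 = 0 ->
  is_derive (fun t => gauss_coeff (q t) j) 0 (if Nat.eqb j 2 then - d else 0)).
{ clear; intros q d Hd Hq; unfold gauss_coeff.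
  destruct j as [|[|[|[|j]]]]; cbn [Nat.even Nat.eqb Nat.div2].
  - apply is_derive_ext with (fun _ => 1 / INR (fact 0)); [intros; now rewrite pow_O|].
    apply (is_derive_const (V := R_NormedModule)).
  - apply (is_derive_const (V := R_NormedModule)).
  - apply is_derive_ext with (fun t => - q t).
    + intros t; simpl; real_equation; field.
    + now apply (is_derive_opp (V := R_NormedModule) q).
  - apply (is_derive_const (V := R_NormedModule)).
  - destruct (Nat.even j); [|apply (is_derive_const (V := R_NormedModule))].
    assert (Hx : ex_derive q 0) by (now exists d).
    evar_last.
    + auto_derive; [exact Hx|reflexivity].
    + rewrite Hq; simpl; ring. }
specialize (Hg _ _ H H0).
replace (- / 2 * noise p z) with (- (/ 2 * noise p z)) by ring; exact Hg.
Qed.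

Lemma orbit_derivative_0 z k n m :
  cderive (fun t => orbit p z k t n m) 0 (gen_pol p (weyl_term z k) n m).
Proof.
set (a := fun j => (RtoC (if Nat.eqb j 2 then - / 2 * noise p z else 0) * weyl_term z (k - j) n m
   + RtoC (if Nat.eqb j 0 then 1 else 0)
     * (RtoC (/ INR (fact (k - j))) * mixed_power z (Zop p z) (k - j) 1 n m))%C).
assert (H : cderive (fun t => orbit p z k t n m) 0 (csum a (S k))).
{ apply cderive_ext with (fun t => csum (fun j =>
    RtoC (gauss_coeff (noise_int p z t) j) * weyl_term (expZ p t z) (k - j) n m)%C (S k)).
  { intros t; unfold orbit; rewrite colsum_entry; reflexivity. }
  apply (cderive_csum (fun j t =>
    RtoC (gauss_coeff (noise_int p z t) j) * weyl_term (expZ p t z) (k - j) n m)%C).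
  intros j _; unfold a.
  assert (H2 : cderive (fun t => weyl_term (expZ p t z) (k - j) n m) 0
            (RtoC (/ INR (fact (k - j))) * mixed_power z (Zop p z) (k - j) 1 n m)%C).
  { unfold weyl_term, cscal; apply cderive_scal.
    pose proof (cderive_field_power (fun t => expZ p t z) 0 (Zop p z) (k - j) n m) as H.
    cbv beta in H; rewrite expZ_0 in H; apply H.
    split; [apply is_derive_expZ_re_0|apply is_derive_expZ_im_0]. }
  pose proof (cderive_mult _ _ _ _ _ (cderive_RtoC _ _ _ (gauss_coeff_derive z j)) H2) as H.
  cbv beta in H; rewrite noise_int_0, expZ_0, gauss_coeff_0 in H; exact H. }
replace (gen_pol p (weyl_term z k) n m) with (csum a (S k)); auto.
assert (E : gen_pol p (weyl_term z k) n m = (RtoC (/ INR (fact k)) * mixed_power z (Zop p z) k 1 n m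
   + RtoC (/ INR (fact k)) * (RtoC (- / 2 * (INR k * (INR k - 1)) * noise p z) * field_power z (k - 2) n m))%C).
{ unfold weyl_term, gen_pol.
  assert (Hsc : forall c P, gen_pol p (cscal c P) = cscal c (gen_pol p P)).
  { intros c P; unfold gen_pol, gen_form, comm_a, comm_c, jordan_a, jordan_c; autorewrite with cols.
    apply cols_ext; intros; unfold cadd, cscal; ring. }
  change (gen_pol p (cscal (RtoC (/ INR (fact k))) (field_power z k)) n m
    = (RtoC (/ INR (fact k)) * mixed_power z (Zop p z) k 1 n m
   + RtoC (/ INR (fact k)) * (RtoC (- / 2 * (INR k * (INR k - 1)) * noise p z) * field_power z (k - 2) n m))%C).
  rewrite Hsc, gen_pol_field_power; unfold cadd, cscal; ring. }
rewrite E; clear E H.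
destruct k as [|[|k]].
- simpl csum; unfold a; cbn [Nat.eqb Nat.sub].
  replace (- / 2 * (INR 0 * (INR 0 - 1)) * noise p z) with 0 by (simpl; ring); ring.
- simpl csum; unfold a; cbn [Nat.eqb Nat.sub].
  replace (- / 2 * (INR 1 * (INR 1 - 1)) * noise p z) with 0 by (simpl; ring); ring.
(* Only [j = 0], the drift, and [j = 2], the noise, contribute. For the latter, [1 / k!] is
   rewritten with the factorial of [k + 2], which produces the factor [(k+2) (k+1)]. *)
- replace (S (S (S k))) with (3 + k)%nat by lia; rewrite csum_split.
  rewrite (csum_ext (fun i => a (3 + i)%nat) (fun _ => RtoC 0)), csum_0
    by (intros i _; unfold a; simpl Nat.eqb; cbv iota; ring).
  simpl (csum a 3); unfold a; cbn [Nat.eqb].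
  replace (S (S k) - 2)%nat with k by lia; rewrite Nat.sub_0_r.
  unfold weyl_term, cscal.
  replace (/ INR (fact k)) with (/ INR (fact (S (S k))) * (INR (S (S k)) * (INR (S (S k)) - 1))).
  + rewrite !RtoC_mult; ring.
  + change (fact (S (S k))) with (S (S k) * (S k * fact k))%nat.
    rewrite !mult_INR, (S_INR (S k)); replace (INR (S k) + 1 - 1) with (INR (S k)) by ring.
    field; repeat split; [apply INR_fact_neq_0|apply not_0_INR; lia|].
    rewrite <- S_INR; apply not_0_INR; lia.
Qed.

(** The orbit has some norm derivative at zero; its entries are known from [orbit_derivative_0], and
    they determine it. Restriction of the two-sided limit to the right of zero is the generator. *)
Lemma generator_weyl_term z k : generator Ts (embop p s (weyl_term z k)) (embop p s (gen_pol p (weyl_term z k))).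
Proof.
pose proof (pol_weyl_term z k) as Hw.
destruct (spath_derivative p s Hb Hs _ 0 (spath_orbit p z k)) as (D & HD & H).
assert (E : D = gen_pol p (weyl_term z k)).
{ apply cols_ext; intros n m.
  apply (cderive_unique (fun t => orbit p z k t n m) 0); [|apply orbit_derivative_0].
  apply (path_derivative_entry p s); auto; [apply spath_orbit|split; auto]. }
subst D; split; [now apply embop_hs|split; [now apply embop_hs|]].
assert (H' : filterlim (fun h => pol_norm p s (csub (quot (orbit p z k) 0 h) (gen_pol p (weyl_term z k))))
               (at_right 0) (locally 0)).
{ intros P HP; specialize (H P HP); unfold filtermap in *.
  destruct H as [d Hd]; exists d; intros y Hy Hy0; apply Hd; auto; lra. }
refine (filterlim_ext_loc _ _ _ H').
exists (mkposreal 1 Rlt_0_1); intros t _ Ht.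
assert (Ht0 : 0 <= t) by lra.
assert (Hpo : pol (orbit p z k t)) by apply spath_pol, spath_orbit.
unfold pol_norm; f_equal; apply op_ext.
- apply embop_hs; auto; unfold quot; rewrite Rplus_0_l, (orbit_0 p T s Ts); auto with pol.
- rewrite (Ts_orbit p T s Ts) by auto.
  apply hs_sub; [apply hs_scal, hs_sub|]; now apply embop_hs.
- intros n m; rewrite (Ts_orbit p T s Ts) by auto.
  unfold quot; rewrite Rplus_0_l, (orbit_0 p T s Ts) by auto.
  repeat rewrite ?op_entry_sub, ?op_entry_scal; rewrite !embop_e by auto with pol.
  rewrite !emb_wt, csub_entry; unfold cscal; rewrite csub_entry; ring.
Qed.

Lemma gen_pol_add P Q : gen_pol p (cadd P Q) = cadd (gen_pol p P) (gen_pol p Q).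
Proof.
unfold gen_pol, gen_form, comm_a, comm_c, jordan_a, jordan_c; autorewrite with cols.
apply cols_ext; intros; unfold cadd, cscal; ring.
Qed.

Lemma gen_pol_scal c P : gen_pol p (cscal c P) = cscal c (gen_pol p P).
Proof.
unfold gen_pol, gen_form, comm_a, comm_c, jordan_a, jordan_c; autorewrite with cols.
apply cols_ext; intros; unfold cadd, cscal; ring.
Qed.

Lemma pol_gen_pol P : pol P -> pol (gen_pol p P).
Proof. apply pol_gen_form. Qed.

Lemma power_span_pol P : power_span P -> pol P.
Proof. induction 1; auto using pol_field_power with pol. Qed.

Lemma generator_pol P : pol P -> generator Ts (embop p s P) (embop p s (gen_pol p P)).
Proof.
intros HP; apply pol_power_span in HP; induction HP as [z k|P Q HP IHP HQ IHQ|c P HP IH].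
- rewrite field_power_weyl_term, gen_pol_scal, !embop_scal by auto using pol_weyl_term, pol_gen_pol.
  apply generator_scal; [apply (ind_scal _ _ _ _ HTs)|apply (ind_hs _ _ _ _ HTs)|].
  apply generator_weyl_term.
- apply power_span_pol in HP, HQ.
  rewrite gen_pol_add, !embop_add by auto using pol_gen_pol.
  apply generator_add; auto; [apply (ind_add _ _ _ _ HTs)|apply (ind_hs _ _ _ _ HTs)].
- apply power_span_pol in HP; rewrite gen_pol_scal, !embop_scal by auto using pol_gen_pol.
  apply generator_scal; auto; [apply (ind_scal _ _ _ _ HTs)|apply (ind_hs _ _ _ _ HTs)].
Qed.

End Generator2.

(** * Density of embedded polynomials *)

Definition diag (f : nat -> C) : cols := fun n m => (f n * delta n m)%C.

(** [a^dag^i f(N) a^b]. *)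
Definition weighted_shift (i b : nat) (f : nat -> C) : cols := Nat.iter i lc (Nat.iter b ra (diag f)).

(** The symbol is evaluated after [b] lowerings, at [n - b]. Truncated subtraction is harmless,
    since the remaining factor vanishes for [n < b]. *)
Lemma shifted_entry i b f n m :
  weighted_shift i b f n m = (f (n - b)%nat * weighted_shift i b (fun _ => RtoC 1) n m)%C.
Proof.
unfold weighted_shift; revert n m; induction i as [|i IH]; intros n m; simpl Nat.iter.
- revert n m; induction b as [|b IH]; intros n m; simpl Nat.iter.
  + unfold diag; rewrite Nat.sub_0_r; ring.
  + unfold ra at 1 3; destruct n as [|n]; [ring|]; rewrite IH; simpl; ring.
- unfold lc at 1 3, cre; destruct m as [|m]; [ring|]; rewrite IH; ring.
Qed.

Lemma pol_iter_lc i P : pol P -> pol (Nat.iter i lc P).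
Proof. induction i; simpl; auto with pol. Qed.

Lemma pol_iter_ra i P : pol P -> pol (Nat.iter i ra P).
Proof. induction i; simpl; auto with pol. Qed.

Lemma diag_number f : diag (fun n => RtoC (INR n) * f n)%C = lc (la (diag f)).
Proof.
apply cols_ext; intros n m; unfold lc, la, cre, ann, diag; destruct m as [|m].
- unfold delta; destruct n; simpl; ring.
- rewrite !Cmult_assoc, sqrt_INR_sq.
  unfold delta; destruct (Nat.eqb_spec (S m) n); [subst; ring|ring].
Qed.

Lemma pol_diag_pow l : pol (diag (fun n => RtoC (INR n ^ l))).
Proof.
induction l as [|l IH].
- replace (diag _) with cone; [apply pol_one|].
  apply cols_ext; intros; unfold diag, cone; simpl; ring.
- replace (diag (fun n => RtoC (INR n ^ S l))) with (lc (la (diag (fun n => RtoC (INR n ^ l)))));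
    [auto with pol|].
  rewrite <- diag_number; apply cols_ext; intros; unfold diag; simpl; rewrite RtoC_mult; ring.
Qed.

Definition unit_mx (b i : nat) : cols := fun n m =>
  if andb (Nat.eqb n b) (Nat.eqb m i) then RtoC 1 else RtoC 0.

Lemma ra_unit b i : ra (unit_mx b i) = cscal (RtoC (sqrt (INR (S b)))) (unit_mx (S b) i).
Proof.
apply cols_ext; intros n m; unfold ra, cscal, unit_mx; destruct n as [|n]; simpl Nat.eqb.
- simpl; ring.
- destruct (Nat.eqb_spec n b); [now subst|simpl; ring].
Qed.

Lemma lc_unit b i : lc (unit_mx b i) = cscal (RtoC (sqrt (INR (S i)))) (unit_mx b (S i)).
Proof.
apply cols_ext; intros n m; unfold lc, cre, cscal, unit_mx; destruct m as [|m]; simpl Nat.eqb.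
- rewrite Bool.andb_false_r; ring.
- destruct (Nat.eqb_spec m i); [now subst|rewrite Bool.andb_false_r; ring].
Qed.

(** With the vacuum projection as symbol, [b] lowerings and [i] raisings give a nonzero multiple of
    a matrix unit. Density thus reduces to approximating the vacuum projection by functions of
    [N]. *)
Lemma shifted_unit i b :
  exists c, c <> RtoC 0 /\
    weighted_shift i b (fun n => if Nat.eqb n 0 then RtoC 1 else RtoC 0) = cscal c (unit_mx b i).
Proof.
assert (Hs : forall k, RtoC (sqrt (INR (S k))) <> RtoC 0).
{ intros k H; apply RtoC_inj in H.
  assert (0 < sqrt (INR (S k))) by (apply sqrt_lt_R0, lt_0_INR; lia); lra. }
unfold weighted_shift; induction i as [|i (c & Hc & IH)]; simpl Nat.iter.
- induction b as [|b (c & Hc & IH)]; simpl Nat.iter.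
  + exists (RtoC 1); split; [intros H; apply RtoC_inj in H; lra|].
    apply cols_ext; intros [|n] [|m]; unfold diag, cscal, unit_mx, delta; simpl; ring.
  + exists (c * RtoC (sqrt (INR (S b))))%C; split; [now apply Cmult_neq_0|].
    rewrite IH, ra_scal, ra_unit; apply cols_ext; intros; unfold cscal; ring.
- exists (c * RtoC (sqrt (INR (S i))))%C; split; [now apply Cmult_neq_0|].
  rewrite IH, lc_scal, lc_unit; apply cols_ext; intros; unfold cscal; ring.
Qed.

Section Density.

Variable p : gaussian_data.
Variable s : R.
Hypothesis Hb : 0 < beta p.
Hypothesis Hs : 0 <= s <= 1.

Definition approximable (A : op) : Prop :=
  hs A /\ forall eps, 0 < eps -> exists P, pol P /\ hs_norm (op_sub A (embop p s P)) < eps.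

Lemma hs_norm_sub_le A B D :
  hs A -> hs B -> hs D -> hs_norm (op_sub A D) <= hs_norm (op_sub A B) + hs_norm (op_sub B D).
Proof.
intros HA HB HD.
assert (H1 : hs (op_sub A B)) by now apply hs_sub.
assert (H2 : hs (op_sub B D)) by now apply hs_sub.
eapply Rle_trans; [|now apply hs_triangle].
right; f_equal; apply op_ext.
- now apply hs_sub.
- now apply hs_add.
- intros n m; rewrite op_entry_add, !op_entry_sub; ring.
Qed.

Lemma approximable_limit A :
  hs A -> (forall eps, 0 < eps -> exists B, approximable B /\ hs_norm (op_sub A B) < eps) ->
  approximable A.
Proof.
intros HA H; split; auto; intros eps He.
destruct (H (eps / 2)) as (B & [HB HB'] & H1); [lra|].
destruct (HB' (eps / 2)) as (P & HP & H2); [lra|].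
exists P; split; auto.
eapply Rle_lt_trans; [now apply (hs_norm_sub_le A B); auto; apply embop_hs|lra].
Qed.

Lemma approximable_pol P : pol P -> approximable (embop p s P).
Proof.
intros HP; pose proof (embop_hs p s Hb Hs P HP) as H; split; auto.
intros eps He; exists P; split; auto.
now rewrite hs_norm_sub_self.
Qed.

Lemma approximable_add A B : approximable A -> approximable B -> approximable (op_add A B).
Proof.
intros [HA HA'] [HB HB']; split; [now apply hs_add|]; intros eps He.
destruct (HA' (eps / 2)) as (P & HP & H1); [lra|].
destruct (HB' (eps / 2)) as (Q & HQ & H2); [lra|].
exists (cadd P Q); split; [auto with pol|].
pose proof (embop_hs p s Hb Hs P HP); pose proof (embop_hs p s Hb Hs Q HQ).
assert (H3 : hs (op_sub A (embop p s P))) by now apply hs_sub.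
assert (H4 : hs (op_sub B (embop p s Q))) by now apply hs_sub.
apply Rle_lt_trans with (hs_norm (op_add (op_sub A (embop p s P)) (op_sub B (embop p s Q)))).
- right; f_equal; rewrite embop_add by easy; apply op_ext.
  + apply hs_sub; now apply hs_add.
  + now apply hs_add.
  + intros n m; repeat rewrite ?op_entry_add, ?op_entry_sub; ring.
- eapply Rle_lt_trans; [now apply hs_triangle|lra].
Qed.

Lemma approximable_scal c A : approximable A -> approximable (op_scal c A).
Proof.
intros [HA HA']; split; [now apply hs_scal|]; intros eps He.
pose proof (Cmod_ge_0 c) as Hc.
destruct (HA' (eps / (Cmod c + 1))) as (P & HP & H1); [apply Rdiv_lt_0_compat; lra|].
exists (cscal c P); split; [auto with pol|].
pose proof (embop_hs p s Hb Hs P HP).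
assert (H3 : hs (op_sub A (embop p s P))) by now apply hs_sub.
apply Rle_lt_trans with (hs_norm (op_scal c (op_sub A (embop p s P)))).
- right; f_equal; rewrite embop_scal by easy; apply op_ext.
  + apply hs_sub; now apply hs_scal.
  + now apply hs_scal.
  + intros n m; repeat rewrite ?op_entry_scal, ?op_entry_sub; ring.
- eapply Rle_lt_trans; [now apply hs_norm_scal_le|].
  apply Rle_lt_trans with ((Cmod c + 1) * hs_norm (op_sub A (embop p s P))).
  + apply Rmult_le_compat_r; [apply hs_norm_pos|lra].
  + apply Rmult_lt_reg_l with (/ (Cmod c + 1)); [apply Rinv_0_lt_compat; lra|].
    rewrite <- Rmult_assoc, Rinv_l, Rmult_1_l by lra.
    unfold Rdiv in H1; lra.
Qed.

Definition rate : R := beta p / 8.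

(** Half of the decay rate [eta]; the other half absorbs the growth of [n ^ l]
    and of the remainders of the exponential series. *)
Definition eta' : R := exp (- rate / 2).

Lemma eta'_01 : 0 < eta' < 1.
Proof.
split; [apply exp_pos|]; unfold eta', rate; rewrite <- exp_0; apply exp_increasing; lra.
Qed.

(** The constant [B] depends on [i] and [b] alone, so convergence of symbols in the weighted
    supremum norm with weight [exp(- rate n / 2)] implies Hilbert-Schmidt convergence of the
    embedded operators. *)
Lemma shifted_dec i b :
  exists B, 0 <= B /\ forall f D n m, 0 <= D ->
    (forall n, Cmod (f n) <= D * exp (rate / 2 * INR n)) ->
    Cmod (emb p s (weighted_shift i b f) n m) <= D * B * eta' ^ (n + m).
Proof.
destruct (dec_emb_pol p s Hb Hs (weighted_shift i b (fun _ => RtoC 1))) as (B & HB & H).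
{ apply pol_iter_lc, pol_iter_ra; exact (pol_diag_pow 0). }
exists B; split; auto; intros f D n m HD Hf.
rewrite emb_wt, shifted_entry.
replace (RtoC (wt p s n m) * (f (n - b)%nat * weighted_shift i b (fun _ => RtoC 1) n m))%C
  with (f (n - b)%nat * emb p s (weighted_shift i b (fun _ => RtoC 1)) n m)%C
  by (rewrite emb_wt; ring).
rewrite Cmod_mult.
apply Rle_trans with (D * exp (rate / 2 * INR n) * (B * eta p ^ (n + m))).
- apply Rmult_le_compat; try apply Cmod_ge_0; auto.
  eapply Rle_trans; [apply Hf|]; apply Rmult_le_compat_l; auto; apply exp_le.
  apply Rmult_le_compat_l; [unfold rate; lra|apply le_INR; lia].
- replace (D * exp (rate / 2 * INR n) * (B * eta p ^ (n + m)))
    with (D * B * (exp (rate / 2 * INR n) * eta p ^ (n + m))) by ring.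
  apply Rmult_le_compat_l; [now apply Rmult_le_pos|].
  unfold eta, eta'; rewrite !exp_pow, <- exp_plus; apply exp_le.
  rewrite plus_INR; unfold rate; pose proof (pos_INR n); pose proof (pos_INR m); nra.
Qed.

Definition growth (f : nat -> C) : Prop :=
  exists D, 0 <= D /\ forall n, Cmod (f n) <= D * exp (rate / 2 * INR n).

Definition symbol_op (i b : nat) (f : nat -> C) : op := toop (emb p s (weighted_shift i b f)).

Lemma symbol_op_spec i b f :
  growth f -> hs (symbol_op i b f) /\ forall n m, symbol_op i b f (e n) m = emb p s (weighted_shift i b f) n m.
Proof.
intros (D & HD & Hf); apply (dec_hs eta' eta'_01).
destruct (shifted_dec i b) as (B & HB & H); exists (D * B); split; [now apply Rmult_le_pos|].
intros n m; apply H; auto.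
Qed.

Lemma symbol_op_norm i b : exists B, 0 <= B /\ forall A f D, hs A -> 0 <= D ->
    (forall n, Cmod (f n) <= D * exp (rate / 2 * INR n)) ->
    (forall n m, A (e n) m = emb p s (weighted_shift i b f) n m) -> hs_norm A <= D * B.
Proof.
destruct (shifted_dec i b) as (B & HB & H).
pose proof eta'_01 as He; pose proof (eta2 _ He) as He2.
assert (Hi : 0 < / (1 - eta' ^ 2)) by (apply Rinv_0_lt_compat; lra).
exists (B * / (1 - eta' ^ 2)); split; [apply Rmult_le_pos; lra|].
intros A f D HA HD Hf HE; rewrite <- Rmult_assoc.
apply hs_norm_decay; auto; [now apply Rmult_le_pos|].
intros n m; rewrite HE; apply H; auto.
Qed.

Lemma shifted_lin i b c f g n m :
  weighted_shift i b (fun k => f k + c * g k)%C n m = (weighted_shift i b f n m + c * weighted_shift i b g n m)%C.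
Proof.
rewrite shifted_entry, (shifted_entry i b f), (shifted_entry i b g); ring.
Qed.

Lemma growth_lin c f g : growth f -> growth g -> growth (fun k => f k + c * g k)%C.
Proof.
intros (D & HD & Hf) (D' & HD' & Hg); exists (D + Cmod c * D'); split.
- apply Rplus_le_le_0_compat; auto; apply Rmult_le_pos; auto; apply Cmod_ge_0.
- intros n; eapply Rle_trans; [apply Cmod_triangle|]; rewrite Cmod_mult.
  rewrite Rmult_plus_distr_r; apply Rplus_le_compat; auto.
  rewrite Rmult_assoc; apply Rmult_le_compat_l; auto; apply Cmod_ge_0.
Qed.

Definition approximable_symbol (i b : nat) (f : nat -> C) : Prop := growth f /\ approximable (symbol_op i b f).

Lemma approximable_symbol_lin i b c f g :
  approximable_symbol i b f -> approximable_symbol i b g -> approximable_symbol i b (fun k => f k + c * g k)%C.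
Proof.
intros [Hf Hf'] [Hg Hg']; pose proof (growth_lin c f g Hf Hg) as H; split; [exact H|].
destruct (symbol_op_spec i b f Hf) as [F1 F2]; destruct (symbol_op_spec i b g Hg) as [G1 G2].
destruct (symbol_op_spec i b _ H) as [H1 H2].
replace (symbol_op i b (fun k => f k + c * g k)%C) with (op_add (symbol_op i b f) (op_scal c (symbol_op i b g))).
- now apply approximable_add, approximable_scal.
- apply op_ext; [apply hs_add; auto; now apply hs_scal|apply H1|].
  intros n m; rewrite H2, op_entry_add, op_entry_scal, F2, G2, !emb_wt, shifted_lin; ring.
Qed.

Lemma approximable_symbol_limit i b f :
  growth f ->
  (forall eps, 0 < eps -> exists g, approximable_symbol i b g /\
     forall n, Cmod (f n - g n)%C <= eps * exp (rate / 2 * INR n)) ->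
  approximable_symbol i b f.
Proof.
intros Hf H; split; [exact Hf|].
destruct (symbol_op_spec i b f Hf) as [F1 F2].
destruct (symbol_op_norm i b) as (B & HB & HN).
apply approximable_limit; auto; intros eps He.
destruct (H (eps / (B + 1))) as (g & [Hg Hg'] & Hfg); [apply Rdiv_lt_0_compat; lra|].
destruct (symbol_op_spec i b g Hg) as [G1 G2].
exists (symbol_op i b g); split; auto.
apply Rle_lt_trans with (eps / (B + 1) * B).
- apply (HN _ (fun n => f n + RtoC (-1) * g n)%C).
  + now apply hs_sub.
  + apply Rlt_le, Rdiv_lt_0_compat; lra.
  + intros n; replace (f n + RtoC (-1) * g n)%C with (f n - g n)%C by (rewrite RtoC_m1; ring).
    apply Hfg.
  + intros n m; rewrite op_entry_sub, F2, G2, !emb_wt, shifted_lin, RtoC_m1; ring.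
- apply Rmult_lt_reg_r with (B + 1); [lra|].
  replace (eps / (B + 1) * B * (B + 1)) with (eps * B) by (field; lra); nra.
Qed.

(** [n^l x^(j n)] with [x = e^(-rate/8)].  One factor [x^n] is absorbed by
    expanding it in powers of [n]; letting [j] grow isolates [n = 0]. *)
Definition damped (j l : nat) (n : nat) : C :=
  RtoC (INR n ^ l * exp (- (rate / 8) * (INR j * INR n))).

Lemma pow_growth l : exists D, 0 <= D /\ forall n, INR n ^ l <= D * exp (rate / 4 * INR n).
Proof.
assert (Hr : 0 < rate / 4) by (unfold rate; lra).
exists (INR (fact l) * (/ (rate / 4)) ^ l); split.
- apply Rmult_le_pos; [apply pos_INR|apply pow_le, Rlt_le, Rinv_0_lt_compat; lra].
- intros n.
  assert (H : 0 <= rate / 4 * INR n) by (apply Rmult_le_pos; [lra|apply pos_INR]).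
  pose proof (pow_fact_le_exp _ l H) as He; pose proof (INR_fact_pos l).
  replace (INR n ^ l) with (INR (fact l) * (/ (rate / 4)) ^ l * ((rate / 4 * INR n) ^ l / INR (fact l))).
  + apply Rmult_le_compat_l; auto.
    apply Rmult_le_pos; [apply pos_INR|apply pow_le, Rlt_le, Rinv_0_lt_compat; lra].
  + rewrite Rpow_mult_distr, pow_inv; field; repeat split; try apply pow_nonzero; lra.
Qed.

Lemma damped_growth j l : growth (damped j l).
Proof.
destruct (pow_growth l) as (D & HD & H); exists D; split; auto; intros n.
unfold damped; rewrite Cmod_R, Rabs_mult, (Rabs_pos_eq (exp _)) by (left; apply exp_pos).
rewrite Rabs_pos_eq by (apply pow_le, pos_INR).
apply Rle_trans with (D * exp (rate / 4 * INR n) * 1).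
- apply Rmult_le_compat; auto; [apply pow_le, pos_INR|left; apply exp_pos|].
  rewrite <- exp_0; apply exp_le.
  assert (0 <= rate / 8 * (INR j * INR n)); [|lra].
  apply Rmult_le_pos; [unfold rate; lra|apply Rmult_le_pos; apply pos_INR].
- rewrite Rmult_1_r; apply Rmult_le_compat_l; auto; apply exp_le.
  apply Rmult_le_compat_r; [apply pos_INR|unfold rate; lra].
Qed.

(** Writing [y^k / k!] as [(2 y)^k / k!] times [2^(-k)] buys a geometric rate independent of [y], at
    the price of [exp(2 y)]. *)
Lemma exp_remainder y K :
  0 <= y ->
  Cmod (RtoC (exp (- y)) - csum (fun i => RtoC ((- y) ^ i / INR (fact i))) K)%C
  <= 2 * exp (2 * y) * (/ 2) ^ K.
Proof.
intros Hy.
destruct (CSeries_tail (fun i => RtoC ((- y) ^ i / INR (fact i))) (exp (2 * y)) (/ 2) K) as [H1 H2].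
- lra.
- left; apply exp_pos.
- intros k; rewrite Cmod_R; unfold Rdiv; rewrite Rabs_mult, <- RPow_abs, Rabs_Ropp.
  pose proof (INR_fact_pos k).
  rewrite (Rabs_pos_eq y), (Rabs_pos_eq (/ _)) by (auto; apply Rlt_le, Rinv_0_lt_compat; lra).
  pose proof (pow_fact_le_exp (2 * y) k ltac:(lra)) as He.
  replace (y ^ k * / INR (fact k)) with ((2 * y) ^ k / INR (fact k) * (/ 2) ^ k).
  + apply Rmult_le_compat_r; [apply pow_le; lra|easy].
  + rewrite Rpow_mult_distr, pow_inv; field; repeat split; try apply pow_nonzero; lra.
- replace (RtoC (exp (- y))) with (CSeries (fun i => RtoC ((- y) ^ i / INR (fact i)))).
  + eapply Rle_trans; [apply H2|]; right; field.
  + apply CSeries_eq; auto.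
    apply Clim_ext with (fun N => RtoC (rsum (fun i => (- y) ^ i / INR (fact i)) N)).
    { intros; now rewrite csum_RtoC. }
    split; simpl; [|apply is_lim_seq_const].
    apply is_series_rsum; pose proof (is_exp_Reals (- y)) as H; apply is_pseries_R in H.
    apply is_series_ext with (2 := H); intros n; unfold Rdiv; real_equation; ring.
Qed.

Lemma damped_S j l n K :
  Cmod (damped (S j) l n
        - csum (fun i => RtoC ((- (rate / 8)) ^ i / INR (fact i)) * damped j (l + i) n) K)%C
  <= INR n ^ l * (2 * exp (rate / 4 * INR n) * (/ 2) ^ K).
Proof.
set (y := rate / 8 * INR n).
assert (Hy : 0 <= y) by (apply Rmult_le_pos; [unfold rate; lra|apply pos_INR]).
set (g := INR n ^ l * exp (- (rate / 8) * (INR j * INR n))).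
assert (Hl : 0 <= INR n ^ l) by (apply pow_le, pos_INR).
replace (damped (S j) l n
        - csum (fun i => RtoC ((- (rate / 8)) ^ i / INR (fact i)) * damped j (l + i) n) K)%C
  with (RtoC g * (RtoC (exp (- y)) - csum (fun i => RtoC ((- y) ^ i / INR (fact i))) K))%C.
- rewrite Cmod_mult, Cmod_R.
  assert (Hg : Rabs g <= INR n ^ l).
  { unfold g; rewrite Rabs_mult, (Rabs_pos_eq (INR n ^ l)) by easy.
    rewrite Rabs_pos_eq by (left; apply exp_pos).
    rewrite <- (Rmult_1_r (INR n ^ l)) at 2; apply Rmult_le_compat_l; auto.
    rewrite <- exp_0; apply exp_le.
    assert (0 <= rate / 8 * (INR j * INR n)); [|lra].
    apply Rmult_le_pos; [unfold rate; lra|apply Rmult_le_pos; apply pos_INR]. }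
  apply Rmult_le_compat; auto; [apply Rabs_pos|apply Cmod_ge_0|].
  eapply Rle_trans; [now apply exp_remainder|].
  replace (2 * y) with (rate / 4 * INR n) by (unfold y; field); lra.
- assert (Hd : forall a b c, (a * (b - c) = a * b - a * c)%C) by (intros; ring).
  rewrite Hd, <- csum_scal; f_equal.
  + unfold damped; rewrite <- RtoC_mult; f_equal; unfold g.
    rewrite Rmult_assoc, <- exp_plus; do 2 f_equal; unfold y; rewrite S_INR; ring.
  + apply csum_ext; intros i _; unfold damped; rewrite <- !RtoC_mult; f_equal.
    unfold g, y; rewrite pow_add.
    replace (- (rate / 8 * INR n)) with (- (rate / 8) * INR n) by ring.
    rewrite Rpow_mult_distr; unfold Rdiv; ring.
Qed.

(** Induction on [j]. The extra factor is expanded in powers of [n], which leaves symbols with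
    damping [j]. Of the admissible growth [exp(rate n / 2)], one half absorbs [n^l] and the other
    the exponential in [exp_remainder]. *)
Lemma approximable_symbol_damped i b j l : approximable_symbol i b (damped j l).
Proof.
revert l; induction j as [|j IH]; intros l.
- split; [apply damped_growth|].
  replace (symbol_op i b (damped 0 l)) with (embop p s (weighted_shift i b (fun n => RtoC (INR n ^ l)))).
  + apply approximable_pol, pol_iter_lc, pol_iter_ra, pol_diag_pow.
  + unfold symbol_op, embop; do 3 f_equal; apply functional_extensionality; intros n.
    unfold damped; simpl (INR 0); rewrite Rmult_0_l, Rmult_0_r, exp_0, Rmult_1_r; easy.
- apply approximable_symbol_limit; [apply damped_growth|]; intros eps He.
  destruct (pow_growth l) as (D & HD & HDn).
  assert (Hgeo : exists K, 2 * D * (/ 2) ^ K < eps).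
  { assert (Hl : is_lim_seq (fun K => 2 * D * (/ 2) ^ K) 0).
    { apply is_lim_seq_geom_0; lra. }
    apply is_lim_seq_spec in Hl; destruct (Hl (mkposreal _ He)) as [K HK]; exists K.
    specialize (HK K (Nat.le_refl K)); simpl in HK; rewrite Rminus_0_r in HK.
    eapply Rle_lt_trans; [apply Rle_abs|exact HK]. }
  destruct Hgeo as [K HK].
  exists (fun n => csum (fun i => RtoC ((- (rate / 8)) ^ i / INR (fact i)) * damped j (l + i) n)%C K).
  split.
  + clear HK; induction K as [|K IHK]; simpl csum.
    * apply approximable_symbol_limit.
      -- exists 0; split; [lra|]; intros n; rewrite Cmod_0; lra.
      -- intros d Hd; exists (fun n => damped j l n + RtoC (-1) * damped j l n)%C; split.
         ++ apply approximable_symbol_lin; apply IH.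
         ++ intros n; replace (_ - _)%C with (RtoC 0) by (rewrite RtoC_m1; ring).
            rewrite Cmod_0; apply Rmult_le_pos; [lra|left; apply exp_pos].
    * apply (approximable_symbol_lin i b _ (fun n => csum _ K) (damped j (l + K))); [exact IHK|apply IH].
  + intros n; eapply Rle_trans; [apply damped_S|].
    apply Rle_trans with (D * exp (rate / 4 * INR n) * (2 * exp (rate / 4 * INR n) * (/ 2) ^ K)).
    * apply Rmult_le_compat_r; auto.
      repeat apply Rmult_le_pos; try lra; [left; apply exp_pos|apply pow_le; lra].
    * replace (D * exp (rate / 4 * INR n) * (2 * exp (rate / 4 * INR n) * (/ 2) ^ K))
        with (2 * D * (/ 2) ^ K * (exp (rate / 4 * INR n) * exp (rate / 4 * INR n))) by ring.
      rewrite <- exp_plus; replace (rate / 4 * INR n + rate / 4 * INR n) with (rate / 2 * INR n) by field.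
      apply Rmult_le_compat_r; [left; apply exp_pos|lra].
Qed.

Lemma unit_mx_dec b i : decays (eta p) (emb p s (unit_mx b i)).
Proof.
pose proof (eta_01 p Hb) as He.
assert (Hp : 0 < eta p ^ (b + i)) by (apply pow_lt; lra).
exists (wt p s b i / eta p ^ (b + i)); split.
- pose proof (wt_pos p s b i); apply Rlt_le, Rdiv_lt_0_compat; lra.
- intros n m; rewrite emb_wt; unfold unit_mx.
  destruct (Nat.eqb_spec n b) as [->|]; [destruct (Nat.eqb_spec m i) as [->|]|]; simpl;
    rewrite Cmod_mult, ?Cmod_0, ?Cmod_1, Cmod_R, Rabs_pos_eq by (left; apply wt_pos).
  + right; field; lra.
  + rewrite Rmult_0_r; pose proof (wt_pos p s b i).
    apply Rmult_le_pos; [apply Rlt_le, Rdiv_lt_0_compat; lra|apply pow_le; lra].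
  + rewrite Rmult_0_r; pose proof (wt_pos p s b i).
    apply Rmult_le_pos; [apply Rlt_le, Rdiv_lt_0_compat; lra|apply pow_le; lra].
Qed.

(** The symbols [x^(j n)] with [0 < x < 1] equal 1 at [n = 0] and are at most [x^j] elsewhere, so
    they converge uniformly to the symbol of the vacuum projection as [j] grows. *)
Lemma approximable_unit b i : approximable (toop (emb p s (unit_mx b i))).
Proof.
set (d0 := fun n : nat => if Nat.eqb n 0 then RtoC 1 else RtoC 0).
assert (Hr : 0 < rate) by (unfold rate; lra).
assert (Hg : growth d0).
{ exists 1; split; [lra|]; intros n; rewrite Rmult_1_l.
  apply Rle_trans with 1; [unfold d0; destruct (Nat.eqb n 0); rewrite ?Cmod_1, ?Cmod_0; lra|].
  rewrite <- exp_0; apply exp_le; apply Rmult_le_pos; [lra|apply pos_INR]. }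
assert (H : approximable_symbol i b d0).
{ apply approximable_symbol_limit; auto; intros eps He.
  set (x := exp (- (rate / 8))).
  assert (Hx : 0 < x < 1).
  { split; [apply exp_pos|]; unfold x; rewrite <- exp_0; apply exp_increasing; lra. }
  assert (Hj : exists j, x ^ j < eps).
  { assert (Hl : is_lim_seq (fun j => x ^ j) 0) by (apply is_lim_seq_geom; rewrite Rabs_pos_eq; lra).
    apply is_lim_seq_spec in Hl; destruct (Hl (mkposreal _ He)) as [j Hj]; exists j.
    specialize (Hj j (Nat.le_refl j)); simpl in Hj; rewrite Rminus_0_r in Hj.
    eapply Rle_lt_trans; [apply Rle_abs|exact Hj]. }
  destruct Hj as [j Hj]; exists (damped j 0); split; [apply approximable_symbol_damped|].
  intros n.
  assert (H1 : 1 <= exp (rate / 2 * INR n)).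
  { rewrite <- exp_0; apply exp_le; apply Rmult_le_pos; [lra|apply pos_INR]. }
  apply Rle_trans with eps; [|nra].
  unfold d0, damped; destruct (Nat.eqb_spec n 0) as [->|Hn].
  - simpl (INR 0); rewrite !Rmult_0_r, exp_0; simpl pow.
    replace (_ - _)%C with (RtoC 0) by (rewrite Rmult_1_r; ring); rewrite Cmod_0; lra.
  - rewrite pow_O, Rmult_1_l.
    replace (RtoC 0 - RtoC (exp (- (rate / 8) * (INR j * INR n))))%C
      with (- RtoC (exp (- (rate / 8) * (INR j * INR n))))%C by ring.
    rewrite Cmod_opp, Cmod_R, Rabs_pos_eq by (left; apply exp_pos).
    apply Rle_trans with (x ^ j); [|lra]; unfold x; rewrite exp_pow; apply exp_le.
    assert (1 <= INR n) by (apply (le_INR 1); lia).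
    pose proof (pos_INR j); assert (INR j <= INR j * INR n) by nra; nra. }
destruct H as [_ H]; destruct (shifted_unit i b) as (c & Hc & E).
destruct (symbol_op_spec i b d0 Hg) as [S1 S2].
destruct (dec_hs _ (eta_01 p Hb) _ (unit_mx_dec b i)) as [U1 U2].
replace (toop (emb p s (unit_mx b i))) with (op_scal (/ c)%C (symbol_op i b d0));
  [now apply approximable_scal|].
apply op_ext; [now apply bounded_scal, S1|apply U1|].
intros n m; rewrite op_entry_scal, S2, U2; unfold d0; rewrite E, emb_scal; unfold cscal.
field; auto.
Qed.

Definition truncated (A : op) (N : nat) : cols := fun n m =>
  if andb (Nat.ltb n N) (Nat.ltb m N) then A (e n) m else RtoC 0.

Lemma approximable_truncated A N : exists B, approximable B /\
  forall n m, B (e n) m = truncated A N n m.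
Proof.
assert (Hz : exists B, approximable B /\ forall n m, B (e n) m = RtoC 0).
{ exists (op_scal (RtoC 0) (embop p s cone)); split.
  - apply approximable_scal, approximable_pol, pol_one.
  - intros n m; rewrite op_entry_scal; ring. }
(* The truncation is assembled one entry at a time: [K] complete columns and the first [L] entries
   of the next one. *)
assert (H : forall K L, exists B, approximable B /\
  forall n m, B (e n) m = if orb (Nat.ltb n K) (andb (Nat.eqb n K) (Nat.ltb m L))
                          then (if Nat.ltb m N then A (e n) m else RtoC 0) else RtoC 0).
{ assert (Hstep : forall K L, (exists B, approximable B /\
    forall n m, B (e n) m = if orb (Nat.ltb n K) (andb (Nat.eqb n K) (Nat.ltb m L))
                          then (if Nat.ltb m N then A (e n) m else RtoC 0) else RtoC 0) ->
    exists B, approximable B /\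
    forall n m, B (e n) m = if orb (Nat.ltb n K) (andb (Nat.eqb n K) (Nat.ltb m (S L)))
                          then (if Nat.ltb m N then A (e n) m else RtoC 0) else RtoC 0).
  { intros K L (B & HB & E).
    set (c := (if Nat.ltb L N then A (e K) L else RtoC 0)).
    destruct (dec_hs _ (eta_01 p Hb) _ (unit_mx_dec K L)) as [U1 U2].
    exists (op_add B (op_scal (c / RtoC (wt p s K L))%C (toop (emb p s (unit_mx K L))))); split.
    - apply approximable_add, approximable_scal, approximable_unit; auto.
    - intros n m; rewrite op_entry_add, op_entry_scal, E, U2, emb_wt; unfold unit_mx.
      assert (Hw : RtoC (wt p s K L) <> RtoC 0)
        by (intros H0; apply RtoC_inj in H0; pose proof (wt_pos p s K L); lra).
      destruct (Nat.ltb_spec n K), (Nat.eqb_spec n K), (Nat.ltb_spec m L),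
        (Nat.ltb_spec m (S L)), (Nat.eqb_spec m L); try lia; simpl; try (subst; ring).
      subst; unfold c; field; auto. }
  induction K as [|K IHK].
  - induction L as [|L IHL]; [|now apply Hstep].
    destruct Hz as (B & HB & E); exists B; split; auto; intros n m; rewrite E.
    destruct (Nat.eqb n 0); easy.
  - induction L as [|L IHL]; [|now apply Hstep].
    destruct (IHK N) as (B & HB & E); exists B; split; auto; intros n m; rewrite E.
    destruct (Nat.ltb_spec n K), (Nat.ltb_spec n (S K)), (Nat.eqb_spec n K), (Nat.eqb_spec n (S K)),
      (Nat.ltb_spec m N); try lia; easy. }
destruct (H N 0%nat) as (B & HB & E); exists B; split; auto; intros n m; rewrite E.
unfold truncated; destruct (Nat.ltb_spec n N), (Nat.ltb_spec m N), (Nat.eqb_spec n N); easy.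
Qed.

Lemma hs_dense A : hs A -> approximable A.
Proof.
intros HA; apply approximable_limit; auto; intros eps He.
set (S0 := hs_norm A ^ 2).
set (f := fun n m => Cmod (A (e n) m) ^ 2).
assert (Hf : forall n m, 0 <= f n m) by (intros; apply pow2_ge_0).
(* The square of side [N] misses at most [eps^2 / 4] of the squared norm: [eps^2 / 8] from cutting
   the columns and [eps^2 / 8] from cutting the rows. *)
assert (HN : exists N, S0 - eps ^ 2 / 4 < rsum (fun n => rsum (f n) N) N).
{ assert (He2 : 0 < eps ^ 2 / 8) by (pose proof (pow_lt eps 2 He); lra).
  assert (H1 : is_lim_seq (rsum (fun n => fnorm (A (e n)) ^ 2)) S0).
  { unfold S0; rewrite hs_norm_sq by easy; apply Series_lim, HA. }
  apply is_lim_seq_spec in H1; destruct (H1 (mkposreal _ He2)) as [N1 HN1].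
  specialize (HN1 N1 (Nat.le_refl N1)); simpl in HN1.
  assert (H2 : is_lim_seq (fun K => rsum (fun n => rsum (f n) K) N1)
                 (rsum (fun n => fnorm (A (e n)) ^ 2) N1)).
  { apply is_lim_seq_rsum with (u := fun K n => rsum (f n) K).
    intros n; rewrite fnorm_sq; apply Series_lim, fockP. }
  apply is_lim_seq_spec in H2; destruct (H2 (mkposreal _ He2)) as [N2 HN2].
  specialize (HN2 (max N1 N2) (Nat.le_max_r N1 N2)); simpl in HN2.
  exists (max N1 N2).
  assert (H3 : rsum (fun n => rsum (f n) (max N1 N2)) N1
               <= rsum (fun n => rsum (f n) (max N1 N2)) (max N1 N2)).
  { apply rsum_mono; [intros; apply rsum_nonneg; auto|lia]. }
  apply Rabs_def2 in HN1, HN2; simpl in *; lra. }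
destruct HN as [N HN].
destruct (approximable_truncated A N) as (B & HB & E); exists B; split; auto.
assert (HAB : hs (op_sub A B)) by (apply hs_sub; [easy|apply HB]).
apply Rle_lt_trans with (eps / 2); [|lra].
apply Rle_of_sq; [lra|]; apply hs_norm_le; auto; intros N' K'.
set (L := max N (max N' K')).
set (g := fun n m => Cmod (op_sub A B (e n) m) ^ 2).
assert (Hg : forall n m, 0 <= g n m) by (intros; apply pow2_ge_0).
apply Rle_trans with (rsum (fun n => rsum (g n) L) L).
{ apply Rle_trans with (rsum (fun n => rsum (g n) L) N').
  - apply rsum_le; intros n _; apply rsum_mono; [apply Hg|lia].
  - apply rsum_mono; [intros; apply rsum_nonneg; auto|lia]. }
set (ind := fun n m => if andb (Nat.ltb n N) (Nat.ltb m N) then f n m else 0).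
assert (Egf : forall n m, f n m = g n m + ind n m).
{ intros n m; unfold g, ind, f; rewrite op_entry_sub, E; unfold truncated.
  destruct (andb (Nat.ltb n N) (Nat.ltb m N)).
  - replace (_ - _)%C with (RtoC 0) by ring; rewrite Cmod_0; ring.
  - replace (A (e n) m - RtoC 0)%C with (A (e n) m) by ring; ring. }
assert (Hsum : rsum (fun n => rsum (f n) L) L
   = rsum (fun n => rsum (g n) L) L + rsum (fun n => rsum (ind n) L) L).
{ rewrite <- rsum_plus; apply rsum_ext; intros n _; rewrite <- rsum_plus.
  apply rsum_ext; intros m _; apply Egf. }
assert (Hind : rsum (fun n => rsum (f n) N) N <= rsum (fun n => rsum (ind n) L) L).
{ assert (Hi : forall n m, 0 <= ind n m)
    by (intros n m; unfold ind; destruct (andb _ _); auto; lra).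
  apply Rle_trans with (rsum (fun n => rsum (ind n) L) N).
  - apply rsum_le; intros n Hn; apply Rle_trans with (rsum (ind n) N).
    + right; apply rsum_ext; intros m Hm; unfold ind.
      destruct (Nat.ltb_spec n N), (Nat.ltb_spec m N); easy || lia.
    + apply rsum_mono; [apply Hi|lia].
  - apply rsum_mono; [intros; apply rsum_nonneg; auto|lia]. }
pose proof (hs_hsmx A HA L L) as HS; change (rsum (fun n => rsum (f n) L) L <= S0) in HS.
replace ((eps / 2) ^ 2) with (eps ^ 2 / 4) by field; lra.
Qed.

End Density.

(** * The adjoint of the generator *)

Section Adjoint.

Variable p : gaussian_data.
Variable s : R.
Hypothesis Hb : 0 < beta p.
Hypothesis Hs : 0 <= s <= 1.

Definition pol_inner (P Q : cols) : C := hs_inner (embop p s P) (embop p s Q).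

Lemma pol_inner_add_r P Q Q' : pol P -> pol Q -> pol Q' -> pol_inner P (cadd Q Q') = (pol_inner P Q + pol_inner P Q')%C.
Proof.
intros; unfold pol_inner; rewrite embop_add by easy; apply hs_inner_add_r; now apply embop_hs.
Qed.

Lemma pol_inner_scal_r c P Q : pol P -> pol Q -> pol_inner P (cscal c Q) = (c * pol_inner P Q)%C.
Proof.
intros; unfold pol_inner; rewrite embop_scal by easy; apply hs_inner_scal_r; now apply embop_hs.
Qed.

Lemma pol_inner_add_l P P' Q : pol P -> pol P' -> pol Q -> pol_inner (cadd P P') Q = (pol_inner P Q + pol_inner P' Q)%C.
Proof.
intros; unfold pol_inner; rewrite embop_add by easy; apply hs_inner_add_l; now apply embop_hs.
Qed.

Lemma pol_inner_scal_l c P Q : pol P -> pol Q -> pol_inner (cscal c P) Q = (Cconj c * pol_inner P Q)%C.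
Proof.
intros; unfold pol_inner; rewrite embop_scal by easy; apply hs_inner_scal_l; now apply embop_hs.
Qed.

Lemma pol_inner_conj P Q : pol P -> pol Q -> pol_inner Q P = Cconj (pol_inner P Q).
Proof. intros; unfold pol_inner; apply hs_inner_conj; now apply embop_hs. Qed.

Lemma inner_eq P Q n :
  pol P -> pol Q ->
  inner (embop p s P (e n)) (embop p s Q (e n))
  = CSeries (fun m => RtoC (wt p s n m ^ 2) * (Cconj (P n m) * Q n m))%C.
Proof.
intros HP HQ; unfold inner; apply CSeries_ext; intros m.
rewrite !embop_e, !emb_wt, Cmult_conj, RtoC_conj by easy.
replace (wt p s n m ^ 2) with (wt p s n m * wt p s n m) by ring; rewrite RtoC_mult; ring.
Qed.

Lemma inner_eq_summable P Q n :
  pol P -> pol Q -> csummable (fun m => RtoC (wt p s n m ^ 2) * (Cconj (P n m) * Q n m))%C.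
Proof.
intros HP HQ.
apply csummable_ext with (2 := inner_summable (embop p s P (e n)) (embop p s Q (e n))).
intros m; rewrite !embop_e, !emb_wt, Cmult_conj, RtoC_conj by easy.
replace (wt p s n m ^ 2) with (wt p s n m * wt p s n m) by ring; rewrite RtoC_mult; ring.
Qed.

Lemma wt_sq_S_r n m : wt p s n m ^ 2 = exp (beta p * s) * wt p s n (S m) ^ 2.
Proof.
rewrite !wt_sq by easy.
replace (exp (- beta p * (s * INR m + (1 - s) * INR n)))
  with (exp (beta p * s) * exp (- beta p * (s * INR (S m) + (1 - s) * INR n))); [ring|].
rewrite <- exp_plus; f_equal; rewrite S_INR; ring.
Qed.

Lemma wt_sq_S_l n m : wt p s (S n) m ^ 2 = exp (- (beta p * (1 - s))) * wt p s n m ^ 2.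
Proof.
rewrite !wt_sq by easy.
replace (exp (- beta p * (s * INR m + (1 - s) * INR (S n))))
  with (exp (- (beta p * (1 - s))) * exp (- beta p * (s * INR m + (1 - s) * INR n))); [ring|].
rewrite <- exp_plus; f_equal; rewrite S_INR; ring.
Qed.

Definition mod_l : C := RtoC (exp (beta p * s)).
Definition mod_l_inv : C := RtoC (exp (- (beta p * s))).
Definition mod_r : C := RtoC (exp (beta p * (1 - s))).
Definition mod_r_inv : C := RtoC (exp (- (beta p * (1 - s)))).

(** A shift of the summation index by one: the square roots in [ann] and [cre] match, the boundary
    term vanishes, and the ratio of consecutive weights is [mod_l]. *)
Lemma pol_inner_la P Q : pol P -> pol Q -> pol_inner P (la Q) = (mod_l * pol_inner (lc P) Q)%C.
Proof.
intros HP HQ; unfold pol_inner, hs_inner.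
rewrite <- CSeries_scal by (apply hs_inner_summable; apply embop_hs; auto with pol).
apply CSeries_ext; intros n; rewrite !inner_eq by auto with pol.
rewrite (CSeries_incr (fun m => RtoC (wt p s n m ^ 2) * (Cconj (lc P n m) * Q n m))%C)
  by (apply inner_eq_summable; auto with pol).
replace (RtoC (wt p s n 0 ^ 2) * (Cconj (lc P n 0%nat) * Q n 0%nat))%C with (RtoC 0)
  by (unfold lc, cre; rewrite RtoC_conj; ring).
rewrite Cplus_0_l, <- CSeries_scal.
- apply CSeries_ext; intros m; rewrite (wt_sq_S_r n m); unfold la, lc, ann, cre, mod_l.
  rewrite RtoC_mult, Cmult_conj, RtoC_conj; ring.
- apply (csummable_incr (fun m => RtoC (wt p s n m ^ 2) * (Cconj (lc P n m) * Q n m))%C).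
  apply inner_eq_summable; auto with pol.
Qed.

Lemma pol_inner_ra P Q : pol P -> pol Q -> pol_inner P (ra Q) = (mod_r_inv * pol_inner (rc P) Q)%C.
Proof.
intros HP HQ; unfold pol_inner, hs_inner.
rewrite <- CSeries_scal by (apply hs_inner_summable; apply embop_hs; auto with pol).
rewrite CSeries_incr by (apply hs_inner_summable; apply embop_hs; auto with pol).
rewrite inner_eq by auto with pol.
rewrite CSeries_0, Cplus_0_l by (intros m; unfold ra; ring).
apply CSeries_ext; intros n; rewrite !inner_eq by auto with pol.
rewrite <- CSeries_scal by (apply inner_eq_summable; auto with pol).
apply CSeries_ext; intros m; rewrite wt_sq_S_l; unfold ra, rc, mod_r_inv.
rewrite RtoC_mult, Cmult_conj, RtoC_conj; ring.
Qed.

Lemma mod_l_mul_inv : (mod_l * mod_l_inv = 1)%C.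
Proof.
unfold mod_l, mod_l_inv; rewrite <- RtoC_mult, <- exp_plus; f_equal.
replace (_ + _) with 0 by ring; apply exp_0.
Qed.

Lemma mod_r_mul_inv : (mod_r * mod_r_inv = 1)%C.
Proof.
unfold mod_r, mod_r_inv; rewrite <- RtoC_mult, <- exp_plus; f_equal.
replace (_ + _) with 0 by ring; apply exp_0.
Qed.

Lemma pol_inner_lc P Q : pol P -> pol Q -> pol_inner P (lc Q) = (mod_l_inv * pol_inner (la P) Q)%C.
Proof.
intros HP HQ.
assert (H : pol_inner Q (la P) = (mod_l * pol_inner (lc Q) P)%C) by now apply pol_inner_la.
rewrite (pol_inner_conj (lc Q) P), (pol_inner_conj Q (la P)), H by auto with pol.
rewrite Cmult_conj, Cmult_assoc; unfold mod_l at 1; rewrite RtoC_conj; fold mod_l.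
replace (mod_l_inv * mod_l)%C with (RtoC 1) by (rewrite Cmult_comm; now rewrite mod_l_mul_inv); ring.
Qed.

Lemma pol_inner_rc P Q : pol P -> pol Q -> pol_inner P (rc Q) = (mod_r * pol_inner (ra P) Q)%C.
Proof.
intros HP HQ.
assert (H : pol_inner Q (ra P) = (mod_r_inv * pol_inner (rc Q) P)%C) by now apply pol_inner_ra.
rewrite (pol_inner_conj (rc Q) P), (pol_inner_conj Q (ra P)), H by auto with pol.
rewrite Cmult_conj, Cmult_assoc; unfold mod_r_inv at 1; rewrite RtoC_conj; fold mod_r_inv.
rewrite mod_r_mul_inv; ring.
Qed.

(** Adjointness tested on polynomials, which both maps preserve. The notion is closed under sums,
    multiples and composition, so the four multiplications determine the rest. *)
Definition adjoint_pair (f g : cols -> cols) : Prop :=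
  (forall P, pol P -> pol (f P)) /\ (forall P, pol P -> pol (g P)) /\
  forall P Q, pol P -> pol Q -> pol_inner P (f Q) = pol_inner (g P) Q.

Lemma adjoint_pair_comp f g f' g' :
  adjoint_pair f g -> adjoint_pair f' g' ->
  adjoint_pair (fun P => f (f' P)) (fun P => g' (g P)).
Proof.
intros (A1 & A2 & A3) (B1 & B2 & B3); split; [auto|split; [auto|]].
intros P Q HP HQ; rewrite A3, B3; auto.
Qed.

Lemma adjoint_pair_add f g f' g' :
  adjoint_pair f g -> adjoint_pair f' g' ->
  adjoint_pair (fun P => cadd (f P) (f' P)) (fun P => cadd (g P) (g' P)).
Proof.
intros (A1 & A2 & A3) (B1 & B2 & B3); split; [auto with pol|split; [auto with pol|]].
intros P Q HP HQ; rewrite pol_inner_add_r, pol_inner_add_l, A3, B3; auto.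
Qed.

Lemma adjoint_pair_scal c c' f g :
  Cconj c' = c -> adjoint_pair f g ->
  adjoint_pair (fun P => cscal c (f P)) (fun P => cscal c' (g P)).
Proof.
intros Hc (A1 & A2 & A3); split; [auto with pol|split; [auto with pol|]].
intros P Q HP HQ; rewrite pol_inner_scal_r, pol_inner_scal_l, A3, Hc; auto.
Qed.

Lemma adjoint_pair_ext f g g' :
  (forall P, g P = g' P) -> adjoint_pair f g -> adjoint_pair f g'.
Proof.
intros H (A1 & A2 & A3); split; [auto|split].
- intros P HP; rewrite <- H; auto.
- intros P Q HP HQ; rewrite <- H; auto.
Qed.

Lemma adjoint_pair_la : adjoint_pair la (fun P => cscal mod_l (lc P)).
Proof.
split; [auto with pol|split; [auto with pol|]]; intros P Q HP HQ.
rewrite pol_inner_la, pol_inner_scal_l; auto with pol; unfold mod_l at 2; now rewrite RtoC_conj.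
Qed.

Lemma adjoint_pair_lc : adjoint_pair lc (fun P => cscal mod_l_inv (la P)).
Proof.
split; [auto with pol|split; [auto with pol|]]; intros P Q HP HQ.
rewrite pol_inner_lc, pol_inner_scal_l; auto with pol; unfold mod_l_inv at 2; now rewrite RtoC_conj.
Qed.

Lemma adjoint_pair_ra : adjoint_pair ra (fun P => cscal mod_r_inv (rc P)).
Proof.
split; [auto with pol|split; [auto with pol|]]; intros P Q HP HQ.
rewrite pol_inner_ra, pol_inner_scal_l; auto with pol; unfold mod_r_inv at 2; now rewrite RtoC_conj.
Qed.

Lemma adjoint_pair_rc : adjoint_pair rc (fun P => cscal mod_r (ra P)).
Proof.
split; [auto with pol|split; [auto with pol|]]; intros P Q HP HQ.
rewrite pol_inner_rc, pol_inner_scal_l; auto with pol; unfold mod_r at 2; now rewrite RtoC_conj.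
Qed.

Lemma adjoint_pair_comm_a : adjoint_pair comm_a (comm_a_adj mod_l mod_r_inv).
Proof.
eapply adjoint_pair_ext;
  [|apply adjoint_pair_add; [apply adjoint_pair_la|apply adjoint_pair_scal, adjoint_pair_ra; apply RtoC_conj]].
intros P; unfold comm_a_adj; f_equal; apply cols_ext; intros; unfold cscal; rewrite RtoC_m1; ring.
Qed.

Lemma adjoint_pair_comm_c : adjoint_pair comm_c (comm_c_adj mod_l_inv mod_r).
Proof.
eapply adjoint_pair_ext;
  [|apply adjoint_pair_add; [apply adjoint_pair_lc|apply adjoint_pair_scal, adjoint_pair_rc; apply RtoC_conj]].
intros P; unfold comm_c_adj; f_equal; apply cols_ext; intros; unfold cscal; rewrite RtoC_m1; ring.
Qed.

Lemma adjoint_pair_jordan_a : adjoint_pair jordan_a (jordan_a_adj mod_l mod_r_inv).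
Proof.
apply (adjoint_pair_scal _ _ (fun P => cadd (la P) (ra P))
         (fun P => cadd (cscal mod_l (lc P)) (cscal mod_r_inv (rc P)))); [apply RtoC_conj|].
apply adjoint_pair_add; [apply adjoint_pair_la|apply adjoint_pair_ra].
Qed.

Lemma adjoint_pair_jordan_c : adjoint_pair jordan_c (jordan_c_adj mod_l_inv mod_r).
Proof.
apply (adjoint_pair_scal _ _ (fun P => cadd (lc P) (rc P))
         (fun P => cadd (cscal mod_l_inv (la P)) (cscal mod_r (ra P)))); [apply RtoC_conj|].
apply adjoint_pair_add; [apply adjoint_pair_lc|apply adjoint_pair_rc].
Qed.

Definition gen_pol_adj : cols -> cols :=
  gen_form_adj (Ci * RtoC (Omega p) - RtoC (gamma p))%C
     (Cconj (Ci * RtoC (Omega p) - RtoC (gamma p)))%C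
     (Ci * kappa p)%C (Cconj (Ci * kappa p))
     (uv p) (Cconj (uv p)) (RtoC (usq p + vsq p)) mod_l mod_l_inv mod_r mod_r_inv.

Lemma gen_pol_adjoint_pair : adjoint_pair (gen_pol p) gen_pol_adj.
Proof.
pose proof adjoint_pair_comm_a as Hd; pose proof adjoint_pair_comm_c as Hbb.
set (al := (Ci * RtoC (Omega p) - RtoC (gamma p))%C); set (k := (Ci * kappa p)%C).
assert (H1 : adjoint_pair (fun P => jordan_c (cadd (cscal al (comm_a P)) (cscal k (comm_c P))))
  (fun P => cadd (cscal (Cconj al) (comm_a_adj mod_l mod_r_inv (jordan_c_adj mod_l_inv mod_r P)))
                 (cscal (Cconj k) (comm_c_adj mod_l_inv mod_r (jordan_c_adj mod_l_inv mod_r P))))).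
{ apply (adjoint_pair_comp jordan_c (jordan_c_adj mod_l_inv mod_r) (fun P => cadd (cscal al (comm_a P)) (cscal k (comm_c P)))
    (fun P => cadd (cscal (Cconj al) (comm_a_adj mod_l mod_r_inv P)) (cscal (Cconj k) (comm_c_adj mod_l_inv mod_r P))));
    [apply adjoint_pair_jordan_c|].
  apply adjoint_pair_add; apply adjoint_pair_scal; auto; apply Cconj_conj. }
assert (H2 : adjoint_pair (fun P => jordan_a (cadd (cscal (Cconj al) (comm_c P)) (cscal (Cconj k) (comm_a P))))
  (fun P => cadd (cscal al (comm_c_adj mod_l_inv mod_r (jordan_a_adj mod_l mod_r_inv P))) (cscal k (comm_a_adj mod_l mod_r_inv (jordan_a_adj mod_l mod_r_inv P))))).
{ apply (adjoint_pair_comp jordan_a (jordan_a_adj mod_l mod_r_inv)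
    (fun P => cadd (cscal (Cconj al) (comm_c P)) (cscal (Cconj k) (comm_a P)))
    (fun P => cadd (cscal al (comm_c_adj mod_l_inv mod_r P)) (cscal k (comm_a_adj mod_l mod_r_inv P))));
    [apply adjoint_pair_jordan_a|].
  apply adjoint_pair_add; apply adjoint_pair_scal; auto. }
assert (H3 : adjoint_pair (fun P => cscal (RtoC (usq p + vsq p)) (comm_a (comm_c P)))
  (fun P => cscal (RtoC (usq p + vsq p)) (comm_c_adj mod_l_inv mod_r (comm_a_adj mod_l mod_r_inv P)))).
{ apply adjoint_pair_scal; [apply RtoC_conj|]; now apply (adjoint_pair_comp comm_a _ comm_c). }
assert (H4 : adjoint_pair (fun P => cscal (uv p) (comm_c (comm_c P)))
  (fun P => cscal (Cconj (uv p)) (comm_c_adj mod_l_inv mod_r (comm_c_adj mod_l_inv mod_r P)))).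
{ apply adjoint_pair_scal; [apply Cconj_conj|]; now apply (adjoint_pair_comp comm_c _ comm_c). }
assert (H5 : adjoint_pair (fun P => cscal (Cconj (uv p)) (comm_a (comm_a P)))
  (fun P => cscal (uv p) (comm_a_adj mod_l mod_r_inv (comm_a_adj mod_l mod_r_inv P)))).
{ apply adjoint_pair_scal; [reflexivity|]; now apply (adjoint_pair_comp comm_a _ comm_a). }
unfold gen_pol, gen_pol_adj, gen_form, gen_form_adj; fold al k.
apply adjoint_pair_add; [apply adjoint_pair_add; [exact H1|]|].
- now apply adjoint_pair_scal; [apply RtoC_conj|].
- apply adjoint_pair_scal; [apply RtoC_conj|].
  apply adjoint_pair_add; [exact H3|]; apply adjoint_pair_add; [exact H4|exact H5].
Qed.

Variable T : R -> op -> op.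
Variable Ts : R -> op -> op.
Hypothesis Hz : zeta p = RtoC 0.
Hypothesis HT : is_gaussian_qms p T.
Hypothesis HTs : is_induced p s T Ts.

(** By linearity from the orbits of field powers. Embedded polynomials are thus invariant under the
    semigroup and move differentiably. *)
Lemma Ts_path Q :
  pol Q -> exists F, spath F /\ forall t, 0 <= t -> Ts t (embop p s Q) = embop p s (F t).
Proof.
intros HQ; apply pol_power_span in HQ; induction HQ as [z k|P Q HP IHP HQ IHQ|c P HP IH].
- exists (fun t => cscal (RtoC (INR (fact k))) (orbit p z k t)); split.
  + apply (spath_scal (fun _ => INR (fact k))); [intros; apply ex_derive_const|].
    apply spath_orbit.
  + intros t Ht; rewrite field_power_weyl_term, embop_scal by auto using pol_weyl_term.
    rewrite (ind_scal _ _ _ _ HTs) by auto using embop_hs, pol_weyl_term.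
    rewrite (Ts_orbit p T s Ts) by auto.
    rewrite embop_scal by (auto; apply spath_pol, spath_orbit); reflexivity.
- destruct IHP as (F & HF & EF), IHQ as (G & HG & EG); apply power_span_pol in HP, HQ.
  exists (fun t => cadd (F t) (G t)); split; [now apply spath_add|].
  intros t Ht; rewrite embop_add by auto.
  rewrite (ind_add _ _ _ _ HTs) by auto using embop_hs.
  rewrite EF, EG by auto; symmetry; apply embop_add; auto using spath_pol.
- destruct IH as (F & HF & EF); apply power_span_pol in HP.
  exists (fun t => cscal c (F t)); split.
  + apply (spath_map (cscal c)); auto with pol.
    * intros; apply cols_ext; intros; unfold cadd, cscal; ring.
    * intros; apply cols_ext; intros; unfold cscal; ring.
  + intros t Ht; rewrite embop_scal by auto.
    rewrite (ind_scal _ _ _ _ HTs) by auto using embop_hs.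
    rewrite EF by auto; symmetry; apply embop_scal; auto using spath_pol.
Qed.

Lemma embop_sub P Q : pol P -> pol Q -> embop p s (csub P Q) = op_sub (embop p s P) (embop p s Q).
Proof.
intros HP HQ; unfold csub, op_sub; rewrite embop_add, embop_scal by auto with pol; reflexivity.
Qed.

(** The semigroup law turns the two-sided derivative of an orbit at [t] into
    the generator at [F t]. *)
Lemma path_derivative_generator Q F t D :
  pol Q -> spath F -> (forall t, 0 <= t -> Ts t (embop p s Q) = embop p s (F t)) ->
  0 <= t -> path_derivative p s F t D -> D = gen_pol p (F t).
Proof.
intros HQ HF EF Ht [HD H].
assert (HpF : forall u, pol (F u)) by (intros; now apply spath_pol).
pose proof (pol_gen_pol p (F t) (HpF t)) as Hg.
destruct (generator_pol p T s Ts Hb Hs Hz HT HTs (F t) (HpF t)) as (_ & _ & HG).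
assert (H' : filterlim (fun h => pol_norm p s (csub (quot F t h) D)) (at_right 0) (locally 0)).
{ intros P HP; specialize (H P HP); unfold filtermap in *.
  destruct H as [d Hd]; exists d; intros y Hy Hy0; apply Hd; auto; lra. }
pose proof (filterlim_plus_0 _ _ H' HG) as HH.
assert (HN : filterlim (fun _ : R => pol_norm p s (csub D (gen_pol p (F t)))) (at_right 0) (locally 0)).
{ refine (squeeze_0 _ _ _ HH).
  exists (mkposreal 1 Rlt_0_1); intros h _ Hh; split; [apply pol_norm_pos|].
  assert (Hh' : 0 <= h) by lra.
  assert (Eh : Ts h (embop p s (F t)) = embop p s (F (t + h))).
  { rewrite <- EF by auto; rewrite <- (ind_semigroup _ _ _ _ HTs) by auto using embop_hs.
    rewrite Rplus_comm; apply EF; lra. }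
  rewrite Eh.
  replace (op_sub (op_scal (RtoC (/ h)) (op_sub (embop p s (F (t + h))) (embop p s (F t))))
             (embop p s (gen_pol p (F t))))
    with (embop p s (csub (quot F t h) (gen_pol p (F t)))).
  - fold (pol_norm p s (csub (quot F t h) (gen_pol p (F t)))).
    assert (Hq : pol (quot F t h)) by (unfold quot; auto with pol).
    replace (csub D (gen_pol p (F t)))
      with (cadd (cscal (RtoC (-1)) (csub (quot F t h) D)) (csub (quot F t h) (gen_pol p (F t)))).
    + eapply Rle_trans; [apply pol_norm_add; auto with pol|].
      apply Rplus_le_compat_r.
      eapply Rle_trans; [apply pol_norm_scal; auto with pol|].
      rewrite Cmod_R, (Rabs_left (-1)); lra.
    + apply cols_ext; intros n m; unfold cadd, cscal; rewrite !csub_entry, RtoC_m1; ring.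
  - unfold quot; rewrite embop_sub, embop_scal, embop_sub by auto with pol; reflexivity. }
assert (E0 : pol_norm p s (csub D (gen_pol p (F t))) = 0).
{ apply (filterlim_locally_unique (F := at_right 0) (fun _ : R => pol_norm p s (csub D (gen_pol p (F t))))).
  - apply filterlim_const.
  - exact HN. }
assert (Hpd : pol (csub D (gen_pol p (F t)))) by auto with pol.
apply cols_ext; intros n m.
pose proof (hs_norm_entries_0 _ (embop_hs p s Hb Hs _ Hpd) E0 n m) as E.
rewrite embop_e, emb_wt, csub_entry in E by auto.
assert (Hw : RtoC (wt p s n m) <> RtoC 0)
  by (intros H0; apply RtoC_inj in H0; pose proof (wt_pos p s n m); lra).
replace (D n m) with (D n m - gen_pol p (F t) n m + gen_pol p (F t) n m)%C by ring.
replace (D n m - gen_pol p (F t) n m)%C with (RtoC 0); [ring|].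
replace (D n m - gen_pol p (F t) n m)%C
  with (/ RtoC (wt p s n m) * (RtoC (wt p s n m) * (D n m - gen_pol p (F t) n m)))%C by (field; auto).
rewrite E; ring.
Qed.

(** The first-order Taylor remainder of [<P, Ts t x>] at zero, with the formal adjoint in place of
    the derivative. The adjoint relation amounts to this being [o(t)]. *)
Definition duality_gap (P : cols) (x : op) (t : R) : C :=
  (hs_inner (embop p s P) (Ts t x) - hs_inner (embop p s P) x
   - RtoC t * hs_inner (embop p s (gen_pol_adj P)) x)%C.

Lemma pol_gen_pol_adj P : pol P -> pol (gen_pol_adj P).
Proof. apply pol_gen_form_adj. Qed.

(** Along the orbit of [Q] the derivative of [<P, Ts r Q>] is [<gen_pol_adj P, Ts r Q>], whose
    variation on [[0,t]] is at most [M]. The mean value theorem applies to real and imaginary parts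
    separately, whence the factor 2. *)
Lemma duality_gap_pol P Q t M :
  pol P -> pol Q -> 0 <= t ->
  (forall r, 0 <= r <= t ->
     Cmod (hs_inner (embop p s (gen_pol_adj P)) (Ts r (embop p s Q))
           - hs_inner (embop p s (gen_pol_adj P)) (embop p s Q))%C <= M) ->
  Cmod (duality_gap P (embop p s Q) t) <= 2 * t * M.
Proof.
intros HP HQ Ht HM.
destruct (Ts_path Q HQ) as (F & HF & EF).
assert (HpF : forall u, pol (F u)) by (intros; now apply spath_pol).
set (G := fun r => hs_inner (embop p s P) (embop p s (F r))).
set (y := fun r => hs_inner (embop p s (gen_pol_adj P)) (embop p s (F r))).
assert (HG : forall r, 0 <= r -> cderive G r (y r)).
{ intros r Hr.
  destruct (spath_derivative p s Hb Hs F r HF) as (D & HD & HDl).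
  assert (E : D = gen_pol p (F r)) by exact (path_derivative_generator Q F r D HQ HF EF Hr (conj HD HDl)).
  replace (y r) with (hs_inner (embop p s P) (embop p s D)).
  - exact (path_derivative_inner p s Hb Hs _ F r D (embop_hs p s Hb Hs P HP) HF (conj HD HDl)).
  - rewrite E; apply gen_pol_adjoint_pair; auto. }
assert (HM' : forall r, 0 <= r <= t -> Cmod (y r - y 0)%C <= M).
{ intros r Hr; specialize (HM r Hr); unfold y.
  assert (E0 : embop p s (F 0) = embop p s Q)
    by (rewrite <- EF by lra; apply (ind_0 _ _ _ _ HTs); auto using embop_hs).
  rewrite E0, <- EF by lra; exact HM. }
assert (HE : duality_gap P (embop p s Q) t = (G t - G 0 - RtoC t * y 0)%C).
{ unfold duality_gap, G, y.
  assert (E0 : embop p s (F 0) = embop p s Q)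
    by (rewrite <- EF by lra; apply (ind_0 _ _ _ _ HTs); auto using embop_hs).
  rewrite E0, <- EF by lra; reflexivity. }
rewrite HE.
assert (Hmvt : forall f : C -> R, (forall c, Rabs (f c) <= Cmod c) ->
  (forall a b, f (a - b)%C = f a - f b) -> (forall (r : R) c, f (RtoC r * c)%C = r * f c) ->
  (forall r, 0 <= r -> is_derive (fun r => f (G r)) r (f (y r))) ->
  Rabs (f (G t - G 0 - RtoC t * y 0)%C) <= t * M).
{ intros f Hf1 Hf2 Hf3 Hf4.
  destruct (MVT_gen (fun r => f (G r)) 0 t (fun r => f (y r))) as (c & Hc & E).
  - intros r Hr; apply Hf4; rewrite Rmin_left in Hr by easy; lra.
  - intros r Hr; rewrite Rmin_left in Hr by easy.
    apply continuity_pt_filterlim, (ex_derive_continuous (V := R_NormedModule) (fun r => f (G r))).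
    exists (f (y r)); apply Hf4; lra.
  - rewrite Rmin_left, Rmax_right in Hc by easy.
    rewrite !Hf2, Hf3, E.
    replace (f (y c) * (t - 0) - t * f (y 0)) with (t * (f (y c - y 0)%C)) by (rewrite Hf2; ring).
    rewrite Rabs_mult, (Rabs_pos_eq t) by easy.
    apply Rmult_le_compat_l; auto; eapply Rle_trans; [apply Hf1|now apply HM']. }
eapply Rle_trans; [apply Cmod_le_re_im|].
assert (H1 : Rabs (Re (G t - G 0 - RtoC t * y 0)%C) <= t * M).
{ apply Hmvt; [apply re_le_Cmod|reflexivity| |].
  - intros; unfold Re; simpl; ring.
  - intros r Hr; apply (HG r Hr). }
assert (H2 : Rabs (Im (G t - G 0 - RtoC t * y 0)%C) <= t * M).
{ apply Hmvt; [apply im_le_Cmod|reflexivity| |].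
  - intros; unfold Im; simpl; ring.
  - intros r Hr; apply (HG r Hr). }
lra.
Qed.

Lemma hs_inner_sub_bound A x x' :
  hs A -> hs x -> hs x' ->
  Cmod (hs_inner A x - hs_inner A x')%C <= hs_norm A * hs_norm (op_sub x x').
Proof.
intros HA Hx Hx'; rewrite <- hs_inner_sub_r by easy.
apply hs_cauchy_schwarz; auto; now apply hs_sub.
Qed.

Lemma Ts_diff_norm t x x' :
  0 <= t -> hs x -> hs x' -> hs_norm (op_sub (Ts t x) (Ts t x')) <= hs_norm (op_sub x x').
Proof.
intros Ht Hx Hx'; rewrite <- (Ts_sub p T s Ts HTs) by easy.
apply (ind_contr _ _ _ _ HTs); auto; now apply hs_sub.
Qed.

(** Both the gap and the variation bounded by [M] depend continuously on [x] in norm, uniformly for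
    times in [[0,t]], because the semigroup contracts. Density therefore carries the estimate over
    from polynomials. *)
Lemma duality_gap_hs P x t M :
  pol P -> hs x -> 0 <= t ->
  (forall r, 0 <= r <= t ->
     Cmod (hs_inner (embop p s (gen_pol_adj P)) (Ts r x) - hs_inner (embop p s (gen_pol_adj P)) x)%C <= M) ->
  Cmod (duality_gap P x t) <= 2 * t * M.
Proof.
intros HP Hx Ht HM.
pose proof (embop_hs p s Hb Hs P HP) as HA.
pose proof (embop_hs p s Hb Hs _ (pol_gen_pol_adj P HP)) as HB.
set (A := embop p s P) in *; set (B := embop p s (gen_pol_adj P)) in *.
pose proof (hs_norm_pos A); pose proof (hs_norm_pos B).
(* Collects the errors per unit of [d]: [4 t |B|] from the change of the variation bound,
   [t |B| + 2 |A|] from the change of the gap. *)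
set (L := 5 * t * hs_norm B + 2 * hs_norm A).
assert (HL : 0 <= L).
{ pose proof (Rmult_le_pos t (hs_norm B) Ht (hs_norm_pos B)); unfold L; lra. }
apply le_epsilon; intros eps He.
set (d := eps / (L + 1)).
assert (Hd : 0 < d) by (apply Rdiv_lt_0_compat; lra).
destruct (hs_dense p s Hb Hs x Hx) as [_ Hdense].
destruct (Hdense d Hd) as (Q & HQ & HxQ).
pose proof (embop_hs p s Hb Hs Q HQ) as Hq; set (q := embop p s Q) in *.
assert (Hts : forall r u, 0 <= r -> hs u -> hs (Ts r u)) by (apply (ind_hs _ _ _ _ HTs)).
assert (Hcomp : forall D r, hs D -> 0 <= r -> Cmod (hs_inner D (Ts r x) - hs_inner D (Ts r q))%C <= hs_norm D * d).
{ intros D r HD Hr; eapply Rle_trans; [apply hs_inner_sub_bound; auto|].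
  apply Rmult_le_compat_l; [apply hs_norm_pos|].
  eapply Rle_trans; [now apply Ts_diff_norm|lra]. }
assert (Hcomp0 : forall D, hs D -> Cmod (hs_inner D x - hs_inner D q)%C <= hs_norm D * d).
{ intros D HD; eapply Rle_trans; [apply hs_inner_sub_bound; auto|].
  apply Rmult_le_compat_l; [apply hs_norm_pos|lra]. }
assert (Hgq : Cmod (duality_gap P q t) <= 2 * t * (M + 2 * (hs_norm B * d))).
{ apply duality_gap_pol; auto; intros r Hr; fold B; fold q.
  replace (hs_inner B (Ts r q) - hs_inner B q)%C
    with ((hs_inner B (Ts r x) - hs_inner B x)
          + (- (hs_inner B (Ts r x) - hs_inner B (Ts r q)) + (hs_inner B x - hs_inner B q)))%C by ring.
  eapply Rle_trans; [apply Cmod_triangle|].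
  apply Rle_trans with (M + (hs_norm B * d + hs_norm B * d)); [|lra].
  apply Rplus_le_compat; [now apply HM|].
  eapply Rle_trans; [apply Cmod_triangle|]; rewrite Cmod_opp.
  apply Rplus_le_compat; [apply Hcomp; auto; lra|now apply Hcomp0]. }
assert (Hdiff : Cmod (duality_gap P x t - duality_gap P q t)%C
                <= hs_norm A * d + (hs_norm A * d + t * (hs_norm B * d))).
{ unfold duality_gap; fold A B.
  replace (_ - _)%C with ((hs_inner A (Ts t x) - hs_inner A (Ts t q))
     + (- (hs_inner A x - hs_inner A q) + - (RtoC t * (hs_inner B x - hs_inner B q))))%C by ring.
  eapply Rle_trans; [apply Cmod_triangle|]; apply Rplus_le_compat; [now apply Hcomp|].
  eapply Rle_trans; [apply Cmod_triangle|]; rewrite !Cmod_opp, Cmod_mult, Cmod_R, Rabs_pos_eq by easy.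
  apply Rplus_le_compat; [now apply Hcomp0|].
  apply Rmult_le_compat_l; auto. }
replace (duality_gap P x t)
  with (duality_gap P q t + (duality_gap P x t - duality_gap P q t))%C by ring.
eapply Rle_trans; [apply Cmod_triangle|].
assert (HLd : L * d <= eps).
{ apply Rle_trans with ((L + 1) * d); [nra|]; unfold d; right; field; lra. }
apply Rle_trans with (2 * t * M + L * d); [|lra].
unfold L; lra.
Qed.

(** For [x] in the domain, strong continuity at [x] makes the variation on [[0,t]] small, so the gap
    divided by [t] tends to zero, while the difference quotient tends to [w]. This leaves
    [<P, w> = <gen_pol_adj P, x>]. *)
Lemma adjoint_pol P :
  pol P -> adjoint (generator Ts) (embop p s P) (embop p s (gen_pol_adj P)).
Proof.
intros HP.
pose proof (embop_hs p s Hb Hs P HP) as HA.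
pose proof (embop_hs p s Hb Hs _ (pol_gen_pol_adj P HP)) as HB.
split; [exact HA|split; [exact HB|]]; intros x w (Hx & Hw & HG).
set (A := embop p s P) in *; set (B := embop p s (gen_pol_adj P)) in *.
pose proof (hs_norm_pos A) as HA0; pose proof (hs_norm_pos B) as HB0.
assert (Hts : forall r u, 0 <= r -> hs u -> hs (Ts r u)) by (apply (ind_hs _ _ _ _ HTs)).
assert (Hle : Cmod (hs_inner A w - hs_inner B x)%C <= 0).
{ apply le_epsilon; intros eps He; rewrite Rplus_0_l.
  set (d := eps / (hs_norm A + 2 * hs_norm B + 1)).
  assert (Hd : 0 < d) by (apply Rdiv_lt_0_compat; lra).
  destruct (proj1 (filterlim_locally _ 0) HG (mkposreal d Hd)) as [d1 H1].
  destruct (proj1 (filterlim_locally _ 0) (ind_cont _ _ _ _ HTs x Hx) (mkposreal d Hd)) as [d2 H2].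
  set (t := Rmin d1 d2 / 2).
  assert (Hm : 0 < Rmin d1 d2) by (apply Rmin_pos; apply cond_pos).
  assert (Ht : 0 < t) by (unfold t; lra).
  assert (Ht1 : t < d1) by (unfold t; pose proof (Rmin_l d1 d2); lra).
  assert (Ht2 : t < d2) by (unfold t; pose proof (Rmin_r d1 d2); lra).
  assert (Hball : forall (d0 : posreal) r, 0 < r < d0 -> ball 0 d0 r).
  { intros d0 r Hr; change (Rabs (r - 0) < d0); rewrite Rminus_0_r, Rabs_pos_eq; lra. }
  specialize (H1 t (Hball d1 t (conj Ht Ht1)) Ht).
  change (Rabs (hs_norm (op_sub (op_scal (RtoC (/ t)) (op_sub (Ts t x) x)) w) - 0) < d) in H1.
  rewrite Rminus_0_r, Rabs_pos_eq in H1 by apply hs_norm_pos.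
  assert (Hgap : Cmod (duality_gap P x t) <= 2 * t * (hs_norm B * d)).
  { apply duality_gap_hs; auto; [lra|]; intros r Hr; fold B.
    eapply Rle_trans; [apply hs_inner_sub_bound; auto; apply Hts; auto; lra|].
    apply Rmult_le_compat_l; auto.
    destruct (Req_dec r 0) as [->|Hr0].
    - rewrite (ind_0 _ _ _ _ HTs) by easy.
      rewrite hs_norm_sub_self by easy; lra.
    - assert (Hr' : 0 < r < d2) by lra.
      specialize (H2 r (Hball d2 r Hr') (proj1 Hr')).
      change (Rabs (hs_norm (op_sub (Ts r x) x) - 0) < d) in H2.
      rewrite Rminus_0_r, Rabs_pos_eq in H2 by apply hs_norm_pos; lra. }
  assert (Htx : hs (op_sub (Ts t x) x)) by (apply hs_sub; auto; apply Hts; auto; lra).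
  assert (E : (hs_inner A w - hs_inner B x)%C
    = (- (hs_inner A (op_scal (RtoC (/ t)) (op_sub (Ts t x) x)) - hs_inner A w)
       + RtoC (/ t) * duality_gap P x t)%C).
  { rewrite hs_inner_scal_r, hs_inner_sub_r by (auto; apply Hts; auto; lra).
    unfold duality_gap; fold A B.
    replace (RtoC (/ t) * (hs_inner A (Ts t x) - hs_inner A x - RtoC t * hs_inner B x))%C
      with (RtoC (/ t) * (hs_inner A (Ts t x) - hs_inner A x) - (RtoC (/ t) * RtoC t) * hs_inner B x)%C
      by ring.
    rewrite <- RtoC_mult, Rinv_l by lra; ring. }
  rewrite E; eapply Rle_trans; [apply Cmod_triangle|].
  rewrite Cmod_opp, Cmod_mult, Cmod_R, (Rabs_pos_eq (/ t)) by (apply Rlt_le, Rinv_0_lt_compat; lra).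
  apply Rle_trans with (hs_norm A * d + 2 * (hs_norm B * d)).
  - apply Rplus_le_compat.
    + eapply Rle_trans; [apply hs_inner_sub_bound; auto; now apply hs_scal|].
      apply Rmult_le_compat_l; auto; lra.
    + apply Rle_trans with (/ t * (2 * t * (hs_norm B * d))).
      * apply Rmult_le_compat_l; auto; apply Rlt_le, Rinv_0_lt_compat; lra.
      * right; field; lra.
  - apply Rle_trans with ((hs_norm A + 2 * hs_norm B + 1) * d); [nra|].
    unfold d; right; field; lra. }
assert (H0 : (hs_inner A w - hs_inner B x)%C = RtoC 0).
{ apply Cmod_eq_0, Rle_antisym; auto; apply Cmod_ge_0. }
replace (hs_inner A w) with (hs_inner A w - hs_inner B x + hs_inner B x)%C by ring.
rewrite H0; ring.
Qed.

End Adjoint.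

(** * The sum of the generator and its adjoint on polynomials *)

Section Sum.

Variable p : gaussian_data.
Variable T : R -> op -> op.
Variable s : R.
Variable Ts : R -> op -> op.
Hypothesis Hst : standing p T.
Hypothesis Hs : 0 <= s <= 1.
Hypothesis HT : is_gaussian_qms p T.
Hypothesis HTs : is_induced p s T Ts.

Definition sym_gen (P : cols) : cols := cadd (gen_pol p P) (gen_pol_adj p s P).

Lemma sym_gen_add P Q : sym_gen (cadd P Q) = cadd (sym_gen P) (sym_gen Q).
Proof. apply sym_form_add. Qed.

Lemma sym_gen_scal c P : sym_gen (cscal c P) = cscal c (sym_gen P).
Proof. apply sym_form_scal. Qed.

Lemma pol_sym_gen P : pol P -> pol (sym_gen P).
Proof. intros; unfold sym_gen; auto using pol_gen_pol, pol_gen_pol_adj with pol. Qed.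

Lemma adj_plus_gen_pol P : pol P -> adj_plus_gen Ts (embop p s P) (embop p s (sym_gen P)).
Proof.
intros HP; pose proof (st_beta _ _ Hst) as Hb; pose proof (st_zeta _ _ Hst) as Hz.
exists (embop p s (gen_pol_adj p s P)), (embop p s (gen_pol p P)); split; [|split].
- now apply (adjoint_pol p s Hb Hs T Ts).
- now apply (generator_pol p T s Ts).
- rewrite <- embop_add by (auto using pol_gen_pol, pol_gen_pol_adj).
  f_equal; apply cols_ext; intros; unfold sym_gen, cadd; ring.
Qed.

Lemma hs_norm_0_eq A B : hs A -> hs B -> hs_norm (op_sub A B) = 0 -> A = B.
Proof.
intros HA HB H; apply op_ext; [apply HA|apply HB|]; intros n m.
assert (HAB : hs (op_sub A B)) by now apply hs_sub.
pose proof (hs_norm_entries_0 _ HAB H n m) as E; rewrite op_entry_sub in E.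
replace (A (e n) m) with (A (e n) m - B (e n) m + B (e n) m)%C by ring; rewrite E; ring.
Qed.

Lemma generator_unique x w w' : generator Ts x w -> generator Ts x w' -> w = w'.
Proof.
intros (Hx & Hw & H) (_ & Hw' & H'); apply hs_norm_0_eq; auto.
assert (HN : filterlim (fun _ : R => hs_norm (op_sub w w')) (at_right 0) (locally 0)).
{ refine (squeeze_0 _ _ _ (filterlim_plus_0 _ _ H H')).
  exists (mkposreal 1 Rlt_0_1); intros t _ Ht; split; [apply hs_norm_pos|].
  assert (Htx : hs (op_scal (RtoC (/ t)) (op_sub (Ts t x) x)))
    by (apply hs_scal, hs_sub; auto; apply (ind_hs _ _ _ _ HTs); auto; lra).
  eapply Rle_trans; [apply (hs_norm_sub_le _ (op_scal (RtoC (/ t)) (op_sub (Ts t x) x))); auto|].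
  apply Rplus_le_compat_r.
  assert (H1 : hs (op_sub (op_scal (RtoC (/ t)) (op_sub (Ts t x) x)) w)) by now apply hs_sub.
  apply Rle_trans with
    (hs_norm (op_scal (RtoC (-1)) (op_sub (op_scal (RtoC (/ t)) (op_sub (Ts t x) x)) w))).
  - right; f_equal; apply op_ext; [now apply hs_sub|now apply hs_scal|].
    intros n m; repeat rewrite ?op_entry_sub, ?op_entry_scal; rewrite RtoC_m1; ring.
  - eapply Rle_trans; [now apply hs_norm_scal_le|]; rewrite Cmod_R, (Rabs_left (-1)); lra. }
apply (filterlim_locally_unique (F := at_right 0) (fun _ : R => hs_norm (op_sub w w')));
  [apply filterlim_const|exact HN].
Qed.

(** The domain of the generator contains the embedded polynomials, hence is dense, and [w - w'] is
    orthogonal to it. *)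
Lemma adjoint_unique x w w' :
  adjoint (generator Ts) x w -> adjoint (generator Ts) x w' -> w = w'.
Proof.
pose proof (st_beta _ _ Hst) as Hb; pose proof (st_zeta _ _ Hst) as Hz.
intros (_ & Hw & H) (_ & Hw' & H'); apply hs_norm_0_eq; auto.
assert (HD : hs (op_sub w w')) by now apply hs_sub.
set (D := op_sub w w') in *.
assert (HP : forall P, pol P -> hs_inner D (embop p s P) = RtoC 0).
{ intros P HP; pose proof (generator_pol p T s Ts Hb Hs Hz HT HTs P HP) as HG.
  pose proof (embop_hs p s Hb Hs P HP) as He.
  unfold D, op_sub; rewrite hs_inner_add_l, hs_inner_scal_l, RtoC_conj, RtoC_m1
    by (auto; now apply hs_scal).
  rewrite <- (H _ _ HG), <- (H' _ _ HG); ring. }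
apply Rle_antisym; [|apply hs_norm_pos].
apply le_epsilon; intros eps He; rewrite Rplus_0_l.
destruct (hs_dense p s Hb Hs D HD) as [_ Hd]; destruct (Hd eps He) as (P & HPp & Hlt).
pose proof (embop_hs p s Hb Hs P HPp) as Hp.
assert (Hsub : hs (op_sub D (embop p s P))) by now apply hs_sub.
assert (E : hs_inner D (op_sub D (embop p s P)) = RtoC (hs_norm D ^ 2)).
{ rewrite hs_inner_sub_r, HP, hs_inner_self by auto; ring. }
pose proof (hs_cauchy_schwarz D _ HD Hsub) as HC.
rewrite E, Cmod_R, Rabs_pos_eq in HC by apply pow2_ge_0.
destruct (hs_norm_pos D) as [Hpos|Hz0]; [|lra].
apply Rmult_le_reg_l with (hs_norm D); auto; nra.
Qed.

Lemma adj_plus_gen_unique P y :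
  pol P -> adj_plus_gen Ts (embop p s P) y -> y = embop p s (sym_gen P).
Proof.
intros HP (w1 & w2 & H1 & H2 & ->).
destruct (adj_plus_gen_pol P HP) as (w1' & w2' & H1' & H2' & E); rewrite E.
now rewrite (adjoint_unique _ _ _ H1 H1'), (generator_unique _ _ _ H2 H2').
Qed.

(** Uniqueness of both values of the graph turns an eigenvalue equation between operators into an
    equation between columns; what follows is algebra. *)
Lemma adj_plus_gen_eigen Q xi (nu : C) :
  embedded_poly p s Q xi -> adj_plus_gen Ts xi (op_scal nu xi) ->
  sym_gen (nc_cols Q) = cscal nu (nc_cols Q).
Proof.
pose proof (st_beta _ _ Hst) as Hb.
intros HQ H; assert (HP : pol (nc_cols Q)) by now exists Q.
assert (E : xi = embop p s (nc_cols Q)).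
{ apply (embedded_unique p s (nc_cols Q)); [exact HQ|now apply embop_embedded]. }
subst xi; apply adj_plus_gen_unique in H; auto.
apply (emb_inj p s); apply cols_ext; intros n m.
rewrite <- !(embop_e p s Hb Hs) by (auto using pol_sym_gen with pol).
rewrite <- H, embop_scal; auto.
Qed.

Lemma beta_ratio : 0 < usq p /\ 0 < vsq p /\ exp (beta p) = vsq p / usq p.
Proof.
pose proof (st_beta _ _ Hst) as Hb; unfold beta in Hb.
assert (Hu : 0 <= usq p) by (unfold usq; apply Rplus_le_le_0_compat; apply pow2_ge_0).
assert (Hv : 0 <= vsq p) by (unfold vsq; apply Rplus_le_le_0_compat; apply pow2_ge_0).
(* With the default values [ln 0 = 0] and [/ 0 = 0], a vanishing [usq p] or [vsq p] would give
   [beta p = 0]. *)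
assert (Hln0 : ln 0 = 0) by (unfold ln; case (Rlt_dec 0 0); intros H; [destruct (Rlt_irrefl 0 H)|reflexivity]).
assert (Hu' : 0 < usq p).
{ destruct Hu as [Hu|Hu]; auto; rewrite <- Hu in Hb; unfold Rdiv in Hb.
  rewrite Rmult_0_l, Hln0 in Hb; lra. }
assert (Hv' : 0 < vsq p).
{ destruct Hv as [Hv|Hv]; auto; rewrite <- Hv in Hb; unfold Rdiv in Hb.
  rewrite Rinv_0, Rmult_0_r, Hln0 in Hb; lra. }
split; [easy|split; [easy|]].
unfold beta; rewrite exp_Ropp, exp_ln by (now apply Rdiv_lt_0_compat); field; lra.
Qed.

Lemma tanh_half b : tanh (b / 2) = (exp b - 1) / (exp b + 1).
Proof.
unfold tanh, sinh, cosh.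
assert (E : exp b = exp (b / 2) * exp (b / 2)) by (rewrite <- exp_plus; f_equal; field).
pose proof (exp_pos (b / 2)); rewrite E, exp_Ropp; field; split; nra.
Qed.

(** As [mod_r] is [e^beta] times [mod_l_inv], the ratio of their difference to their sum does not
    depend on [s] and equals [- tanh(beta / 2)]. *)
Lemma kappa_relation (u : C) :
  (- (RtoC (tanh (beta p / 2)) * u) * (mod_l_inv p s + mod_r p s) = u * (mod_l_inv p s - mod_r p s))%C.
Proof.
assert (E : exp (beta p * (1 - s)) = exp (beta p) * exp (- (beta p * s)))
  by (rewrite <- exp_plus; f_equal; ring).
unfold mod_l_inv, mod_r; rewrite E, tanh_half, !RtoC_mult.
rewrite <- RtoC_mult, <- RtoC_plus, <- RtoC_minus.
set (x := exp (- (beta p * s))); set (y := exp (beta p)).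
assert (Hy : 0 < y) by apply exp_pos.
replace (RtoC (x - y * x)) with (- (RtoC ((y - 1) / (y + 1)) * RtoC (x + y * x)))%C; [ring|].
rewrite <- RtoC_mult, <- RtoC_opp; f_equal; field; lra.
Qed.

(** In the third relation, [mod_l mod_r = e^beta = vsq / usq], and twice the real part of
    [i Omega - gamma] is [usq - vsq]; the two products are then opposite. *)
Lemma sym_gen_hyps :
  (Ci * kappa p * (mod_l_inv p s + mod_r p s) = uv p * (mod_l_inv p s - mod_r p s)
   /\ Cconj (Ci * kappa p) * (mod_l_inv p s + mod_r p s) = Cconj (uv p) * (mod_l_inv p s - mod_r p s)
   /\ (Ci * RtoC (Omega p) - RtoC (gamma p) + Cconj (Ci * RtoC (Omega p) - RtoC (gamma p)))
        * (1 + mod_l p s * mod_r p s) + RtoC (usq p + vsq p) * (mod_l p s * mod_r p s - 1) = 0)%C.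
Proof.
assert (Hk : (Ci * kappa p = - (RtoC (tanh (beta p / 2)) * uv p))%C).
{ rewrite (st_kappa _ _ Hst).
  replace (Ci * (Ci * RtoC (tanh (beta p / 2)) * uv p))%C
    with ((Ci * Ci) * (RtoC (tanh (beta p / 2)) * uv p))%C by ring.
  replace (Ci * Ci)%C with (- RtoC 1)%C by (apply injective_projections; simpl; ring); ring. }
split; [|split].
- rewrite Hk; apply kappa_relation.
- rewrite Hk, Copp_conj, Cmult_conj, RtoC_conj; apply kappa_relation.
- destruct beta_ratio as (Hu & Hv & Hbr).
  assert (HEF : (mod_l p s * mod_r p s)%C = RtoC (vsq p / usq p)).
  { unfold mod_l, mod_r; rewrite <- RtoC_mult, <- exp_plus, <- Hbr; do 2 f_equal; ring. }
  rewrite HEF.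
  replace (Ci * RtoC (Omega p) - RtoC (gamma p) + Cconj (Ci * RtoC (Omega p) - RtoC (gamma p)))%C
    with (RtoC (usq p - vsq p))
    by (unfold gamma; apply injective_projections; simpl; field).
  rewrite <- RtoC_minus, <- RtoC_plus, <- !RtoC_mult, <- RtoC_plus; f_equal; field; lra.
Qed.

Lemma mod_inverses : mod_l p s <> RtoC 0 /\ mod_r p s <> RtoC 0 /\ mod_l_inv p s = (/ mod_l p s)%C /\ mod_r_inv p s = (/ mod_r p s)%C.
Proof.
assert (HE : mod_l p s <> RtoC 0)
  by (intros H; apply RtoC_inj in H; pose proof (exp_pos (beta p * s)); lra).
assert (HF : mod_r p s <> RtoC 0)
  by (intros H; apply RtoC_inj in H; pose proof (exp_pos (beta p * (1 - s))); lra).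
split; [easy|split; [easy|split]].
- replace (mod_l_inv p s) with (/ mod_l p s * (mod_l p s * mod_l_inv p s))%C by (field; auto).
  rewrite mod_l_mul_inv; ring.
- replace (mod_r_inv p s) with (/ mod_r p s * (mod_r p s * mod_r_inv p s))%C by (field; auto).
  rewrite mod_r_mul_inv; ring.
Qed.

Lemma sym_gen_one : sym_gen cone = czero.
Proof.
destruct sym_gen_hyps as (H1 & H2 & H3); destruct mod_inverses as (H4 & H5 & H6 & H7).
now apply sym_form_one.
Qed.

Lemma sym_gen_la : exists c1 c2 g1 g2 : C, forall P,
  sym_gen (la P) = cadd (cadd (la (sym_gen P)) (cadd (cscal c1 (la P)) (cscal c2 (lc P))))
                     (cadd (cscal g1 (comm_a P)) (cscal g2 (comm_c P))).
Proof. destruct mod_inverses as (H4 & H5 & H6 & H7); now apply sym_form_la. Qed.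

Lemma sym_gen_lc : exists c1 c2 g1 g2 : C, forall P,
  sym_gen (lc P) = cadd (cadd (lc (sym_gen P)) (cadd (cscal c1 (la P)) (cscal c2 (lc P))))
                     (cadd (cscal g1 (comm_a P)) (cscal g2 (comm_c P))).
Proof. destruct mod_inverses as (H4 & H5 & H6 & H7); now apply sym_form_lc. Qed.

End Sum.

(** * Triangular structure *)

(** An inductive form of the span, in which membership is preserved by rules; explicit coefficients
    are recovered only in [in_span_of_lin]. *)
Inductive lin_span {I : Type} (M : I -> cols) (Q : I -> Prop) : cols -> Prop :=
  | lin_zero : lin_span M Q czero
  | lin_elem i : Q i -> lin_span M Q (M i)
  | lin_add A B : lin_span M Q A -> lin_span M Q B -> lin_span M Q (cadd A B)
  | lin_scal c A : lin_span M Q A -> lin_span M Q (cscal c A).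

Lemma cadd_czero_l P : cadd czero P = P.
Proof. apply cols_ext; intros; unfold cadd, czero; ring. Qed.

Lemma cadd_czero_r P : cadd P czero = P.
Proof. apply cols_ext; intros; unfold cadd, czero; ring. Qed.

Lemma cscal_czero c : cscal c czero = czero.
Proof. apply cols_ext; intros; unfold cscal, czero; ring. Qed.

Lemma lin_mono {I} (M : I -> cols) (Q Q' : I -> Prop) P :
  (forall i, Q i -> Q' i) -> lin_span M Q P -> lin_span M Q' P.
Proof. intros H; induction 1; constructor; auto. Qed.

Lemma lin_empty {I} (M : I -> cols) (Q : I -> Prop) P : (forall i, ~ Q i) -> lin_span M Q P -> P = czero.
Proof.
intros H; induction 1 as [|i Hi|A B _ -> _ ->|c A _ ->]; auto.
- now apply H in Hi.
- apply cadd_czero_l.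
- apply cscal_czero.
Qed.

Definition linear_map (f : cols -> cols) : Prop :=
  (forall P Q, f (cadd P Q) = cadd (f P) (f Q)) /\ (forall c P, f (cscal c P) = cscal c (f P)).

Lemma linear_map_zero f : linear_map f -> f czero = czero.
Proof. intros [_ H]; rewrite <- (cscal_0 czero), H, !cscal_0; easy. Qed.

Lemma lin_map {I J} (M : I -> cols) (N : J -> cols) Q Q' f P :
  linear_map f -> (forall i, Q i -> lin_span N Q' (f (M i))) -> lin_span M Q P -> lin_span N Q' (f P).
Proof.
intros Hf H; induction 1 as [|i Hi|A B _ HA _ HB|c A _ HA].
- rewrite linear_map_zero by easy; constructor.
- auto.
- rewrite (proj1 Hf); now constructor.
- rewrite (proj2 Hf); now constructor.
Qed.

Lemma lin_csub {I} (M : I -> cols) Q A B : lin_span M Q A -> lin_span M Q B -> lin_span M Q (csub A B).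
Proof. intros; unfold csub; apply lin_add; [easy|now apply lin_scal]. Qed.

Definition lmul (x y c : C) (P : cols) : cols :=
  cadd (cadd (cscal x (la P)) (cscal y (lc P))) (cscal c P).

Lemma lmul_linear x y c : linear_map (lmul x y c).
Proof.
split; intros; unfold lmul; autorewrite with cols; apply cols_ext; intros;
  unfold cadd, cscal; ring.
Qed.

Lemma pol_lmul x y c P : pol P -> pol (lmul x y c P).
Proof. intros; unfold lmul; auto with pol. Qed.

(** The Leibniz rule for [D] against a first-order factor whose image under [D] is the scalar
    [al]. *)
Definition derives (D : cols -> cols) (x y c al : C) : Prop :=
  forall P, D (lmul x y c P) = cadd (lmul x y c (D P)) (cscal al P).

Definition deriv (u v : C) (P : cols) : cols := cadd (cscal u (comm_a P)) (cscal v (comm_c P)).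

Lemma deriv_linear u v : linear_map (deriv u v).
Proof.
split; intros; unfold deriv; rewrite ?comm_a_add, ?comm_c_add, ?comm_a_scal, ?comm_c_scal;
  apply cols_ext; intros; unfold cadd, cscal; ring.
Qed.

Lemma deriv_lmul u v x y c : derives (deriv u v) x y c (u * y - v * x)%C.
Proof.
intros P; unfold deriv, lmul.
rewrite !comm_a_add, !comm_c_add, !comm_a_scal, !comm_c_scal, comm_a_la, comm_a_lc, comm_c_la, comm_c_lc; autorewrite with cols.
apply cols_ext; intros n m; unfold cadd, cscal; rewrite RtoC_m1; ring.
Qed.

Lemma deriv_one u v : deriv u v cone = czero.
Proof.
unfold deriv; rewrite comm_a_one, comm_c_one, !cscal_czero; apply cadd_czero_l.
Qed.

Section Monomials.

Variables x1 y1 c1 x2 y2 c2 : C.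

Local Definition lX := lmul x1 y1 c1.
Local Definition lY := lmul x2 y2 c2.

Definition mono (ij : nat * nat) : cols :=
  Nat.iter (fst ij) (lmul x1 y1 c1) (Nat.iter (snd ij) (lmul x2 y2 c2) cone).

Lemma mono_S i j : mono (S i, j) = lX (mono (i, j)).
Proof. reflexivity. Qed.

Lemma mono_0_S j : mono (0%nat, S j) = lY (mono (0%nat, j)).
Proof. reflexivity. Qed.

Lemma pol_mono ij : pol (mono ij).
Proof.
destruct ij as [i j]; induction i as [|i IH]; [|rewrite mono_S; now apply pol_lmul].
induction j as [|j IH]; [apply pol_one|rewrite mono_0_S; now apply pol_lmul].
Qed.

(** [X] and [Y] are sent to scalars, so differentiating an ordered monomial deletes one factor and
    requires no reordering. The truncated exponents occur only with coefficient zero. *)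
Lemma deriv_mono D al bt :
  linear_map D -> D cone = czero ->
  derives D x1 y1 c1 al -> derives D x2 y2 c2 bt ->
  forall i j, D (mono (i, j)) = cadd (cscal (RtoC (INR i) * al)%C (mono ((i - 1)%nat, j)))
                                     (cscal (RtoC (INR j) * bt)%C (mono (i, (j - 1)%nat))).
Proof.
intros HD H1 HX HY i j; induction i as [|i IH].
- simpl INR at 1; rewrite Cmult_0_l, cscal_0, cadd_czero_l.
  induction j as [|j IH].
  + simpl INR; rewrite Cmult_0_l, cscal_0; exact H1.
  + rewrite mono_0_S; unfold lY; rewrite HY; fold lY; rewrite IH.
    replace (S j - 1)%nat with j by lia.
    unfold lY at 1; rewrite (proj2 (lmul_linear x2 y2 c2)); fold lY; rewrite <- mono_0_S.
    destruct j as [|j].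
    * apply cols_ext; intros; unfold cadd, cscal; simpl INR; ring.
    * replace (S (S j - 1)) with (S j) by lia.
      rewrite (S_INR (S j)), RtoC_plus; apply cols_ext; intros; unfold cadd, cscal; ring.
- rewrite mono_S; unfold lX; rewrite HX; fold lX; rewrite IH.
  replace (S i - 1)%nat with i by lia.
  unfold lX at 1; rewrite (proj1 (lmul_linear x1 y1 c1)), !(proj2 (lmul_linear x1 y1 c1)).
  fold lX; rewrite <- !mono_S.
  destruct i as [|i].
  + apply cols_ext; intros; unfold cadd, cscal; simpl INR; ring.
  + replace (S (S i - 1)) with (S i) by lia.
    rewrite (S_INR (S i)), RtoC_plus; apply cols_ext; intros; unfold cadd, cscal; ring.
Qed.

Lemma deriv_mono_lin u v i j :
  lin_span mono (fun ab => fst ab + snd ab + 1 <= i + j /\ (i = 0 -> fst ab = 0))%nat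
    (deriv u v (mono (i, j))).
Proof.
rewrite (deriv_mono _ _ _ (deriv_linear u v) (deriv_one u v)
  (deriv_lmul u v x1 y1 c1) (deriv_lmul u v x2 y2 c2)).
apply lin_add.
- destruct i as [|i].
  + simpl INR; rewrite Cmult_0_l, cscal_0; constructor.
  + apply lin_scal, lin_elem; simpl; lia.
- destruct j as [|j].
  + simpl INR; rewrite Cmult_0_l, cscal_0; constructor.
  + apply lin_scal, lin_elem; simpl; lia.
Qed.

Variable K : cols -> cols.
Hypothesis K_linear : linear_map K.
Hypothesis K_one : K cone = czero.
Variables lambda mu : C.
Hypothesis K_X : exists u v, forall P,
  K (lX P) = cadd (cadd (lX (K P)) (cscal lambda (lX P))) (deriv u v P).
Hypothesis K_Y : exists u v, forall P,
  K (lY P) = cadd (cadd (lY (K P)) (cscal mu (lY P))) (deriv u v P).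

Definition eigval (ij : nat * nat) : C :=
  (RtoC (INR (fst ij)) * lambda + RtoC (INR (snd ij)) * mu)%C.

(** Induction on the leftmost factor: the new remainder is that factor times the old one, plus a
    derivative of a monomial of degree one less, so the drop by two persists. The clause
    [i = 0 -> fst ab = 0] is what allows left multiplication by [Y]: applied to a power of [Y] it
    gives an ordered monomial, which would fail if a factor [X] were present. *)
Lemma K_mono i j :
  exists R0, lin_span mono (fun ab => fst ab + snd ab + 2 <= i + j /\ (i = 0 -> fst ab = 0))%nat R0 /\
    K (mono (i, j)) = cadd (cscal (eigval (i, j)) (mono (i, j))) R0.
Proof.
induction i as [|i (R0 & HR & E)].
- induction j as [|j (R0 & HR & E)].
  + exists czero; split; [constructor|].
    unfold eigval; simpl INR; rewrite !Cmult_0_l, Cplus_0_l, cscal_0, cadd_czero_l; exact K_one.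
  + destruct K_Y as (u & v & HK).
    exists (cadd (lY R0) (deriv u v (mono (0%nat, j)))); split.
    * apply lin_add.
      -- apply (lin_map mono mono _ _ lY _ (lmul_linear x2 y2 c2)) with (2 := HR).
         intros [a b] [Hab Ha]; simpl in *; rewrite Ha by easy.
         rewrite <- mono_0_S; apply lin_elem; simpl; lia.
      -- apply lin_mono with (2 := deriv_mono_lin u v 0 j); intros [a b]; simpl; lia.
    * rewrite mono_0_S, HK, E; unfold lY at 1.
      rewrite (proj1 (lmul_linear x2 y2 c2)), (proj2 (lmul_linear x2 y2 c2)); fold lY.
      unfold eigval; cbn [fst snd]; rewrite (S_INR j), RtoC_plus.
      apply cols_ext; intros; unfold cadd, cscal; ring.
- destruct K_X as (u & v & HK).
  exists (cadd (lX R0) (deriv u v (mono (i, j)))); split.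
  + apply lin_add.
    * apply (lin_map mono mono _ _ lX _ (lmul_linear x1 y1 c1)) with (2 := HR).
      intros [a b] [Hab Ha]; simpl in *.
      rewrite <- mono_S; apply lin_elem; simpl; lia.
    * apply lin_mono with (2 := deriv_mono_lin u v i j); intros [a b]; simpl; lia.
  + rewrite mono_S, HK, E; unfold lX at 1.
    rewrite (proj1 (lmul_linear x1 y1 c1)), (proj2 (lmul_linear x1 y1 c1)); fold lX.
    unfold eigval; cbn [fst snd]; rewrite (S_INR i), RtoC_plus.
    apply cols_ext; intros; unfold cadd, cscal; ring.
Qed.

(** Cantor's numbering of the pairs refines the total degree. *)
Definition below (N : nat) (ij : nat * nat) : Prop := (Cantor.to_nat ij < N)%nat.

Lemma below_degree a b i j :
  (a + b < i + j)%nat -> below (Cantor.to_nat (i, j)) (a, b).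
Proof.
intros H; unfold below.
pose proof (Cantor.to_nat_spec a b); pose proof (Cantor.to_nat_spec i j).
nia.
Qed.

Lemma below_cases a b i j :
  below (Cantor.to_nat (i, j)) (a, b) -> (a < i \/ b < j)%nat.
Proof.
intros H; unfold below in H.
pose proof (Cantor.to_nat_spec a b); pose proof (Cantor.to_nat_spec i j).
destruct (Nat.lt_ge_cases a i) as [|Ha]; auto.
destruct (Nat.lt_ge_cases b j) as [|Hb]; auto; nia.
Qed.

Lemma K_mono_below ij :
  exists R0, lin_span mono (below (Cantor.to_nat ij)) R0 /\
    K (mono ij) = cadd (cscal (eigval ij) (mono ij)) R0.
Proof.
destruct ij as [i j]; destruct (K_mono i j) as (R0 & HR & E); exists R0; split; auto.
apply lin_mono with (2 := HR); intros [a b] [H _]; apply below_degree; simpl in H; lia.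
Qed.

Lemma K_below N P : lin_span mono (below N) P -> lin_span mono (below N) (K P).
Proof.
apply lin_map; auto; intros ij Hij.
destruct (K_mono_below ij) as (R0 & HR & ->); apply lin_add; [now apply lin_scal, lin_elem|].
apply lin_mono with (2 := HR); unfold below in *; intros; lia.
Qed.

Lemma lin_below_S N P :
  lin_span mono (below (S N)) P ->
  exists c P', lin_span mono (below N) P' /\ P = cadd (cscal c (mono (Cantor.of_nat N))) P'.
Proof.
induction 1 as [|ij Hij|A B _ (a & A' & HA & ->) _ (b & B' & HB & ->)|c A _ (a & A' & HA & ->)].
- exists (RtoC 0), czero; split; [constructor|].
  rewrite cscal_0; symmetry; apply cadd_czero_l.
- unfold below in Hij; destruct (Nat.eq_dec (Cantor.to_nat ij) N) as [E|E].
  + exists (RtoC 1), czero; split; [constructor|].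
    rewrite <- E, Cantor.cancel_of_to; apply cols_ext; intros; unfold cadd, cscal, czero; ring.
  + exists (RtoC 0), (mono ij); split; [apply lin_elem; unfold below; lia|].
    rewrite cscal_0; symmetry; apply cadd_czero_l.
- exists (a + b)%C, (cadd A' B'); split; [now apply lin_add|].
  apply cols_ext; intros; unfold cadd, cscal; ring.
- exists (c * a)%C, (cscal c A'); split; [now apply lin_scal|].
  apply cols_ext; intros; unfold cadd, cscal; ring.
Qed.

(** Comparing the two sides of [K P = nu P], the top term times [eigval - nu] lies in the span of
    the earlier monomials. As the factor is nonzero, so does [P], and the descent ends at zero. *)
Lemma no_eigenvector nu N P :
  (forall ij, eigval ij <> nu) -> lin_span mono (below N) P -> K P = cscal nu P -> P = czero.
Proof.
intros Hnu; induction N as [|N IH]; intros HP E.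
- apply lin_empty with (2 := HP); unfold below; intros; lia.
- apply IH; auto.
  destruct (lin_below_S N P HP) as (c & P' & HP' & EP).
  set (ij := Cantor.of_nat N) in *.
  destruct (K_mono_below ij) as (R0 & HR & EK).
  assert (HijN : Cantor.to_nat ij = N) by apply Cantor.cancel_to_of.
  rewrite HijN in HR.
  assert (Hd : (eigval ij - nu)%C <> RtoC 0).
  { intros H; apply (Hnu ij); replace (eigval ij) with (eigval ij - nu + nu)%C by ring; rewrite H; ring. }
  assert (HcM : lin_span mono (below N) (cscal c (mono ij))).
  { replace (cscal c (mono ij))
      with (cscal (/ (eigval ij - nu))%C (csub (cscal nu P') (cadd (cscal c R0) (K P')))).
    - apply lin_scal, lin_csub; [now apply lin_scal|].
      apply lin_add; [now apply lin_scal|now apply K_below].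
    - rewrite EP, (proj1 K_linear), (proj2 K_linear), EK in E.
      apply cols_ext; intros n m.
      assert (En : forall A B : cols, A = B -> A n m = B n m) by (intros A B HAB; now rewrite HAB).
      apply En in E; unfold cadd, cscal in E; unfold cscal at 1; rewrite csub_entry.
      unfold cadd, cscal.
      assert (EZ : (nu * (c * mono ij n m + P' n m)
                 - (c * (eigval ij * mono ij n m + R0 n m) + K P' n m) = 0)%C)
        by (rewrite E; ring).
      replace (nu * P' n m - (c * R0 n m + K P' n m))%C
        with ((eigval ij - nu) * (c * mono ij n m) + (nu * (c * mono ij n m + P' n m)
                 - (c * (eigval ij * mono ij n m + R0 n m) + K P' n m)))%C by ring.
      rewrite EZ; field; auto. }
  rewrite EP; now apply lin_add.
Qed.

(** Back substitution for the triangular system [(K - nu) Q = R0]: the top coefficient is divided by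
    its diagonal entry, and the remainder it creates is moved into the right side for the earlier
    indices. *)
Lemma resolvent nu N R0 :
  (forall ij, below N ij -> eigval ij <> nu) -> lin_span mono (below N) R0 ->
  exists Q, lin_span mono (below N) Q /\ K Q = cadd (cscal nu Q) R0.
Proof.
revert R0; induction N as [|N IH]; intros R0 Hnu HR.
- exists czero; split; [constructor|].
  rewrite linear_map_zero, cscal_czero, cadd_czero_l by easy; symmetry.
  apply lin_empty with (2 := HR); unfold below; intros; lia.
- destruct (lin_below_S N R0 HR) as (c & R' & HR' & ER).
  set (ij := Cantor.of_nat N) in *.
  assert (HijN : Cantor.to_nat ij = N) by apply Cantor.cancel_to_of.
  destruct (K_mono_below ij) as (R1 & HR1 & EK); rewrite HijN in HR1.
  assert (Hd : (eigval ij - nu)%C <> RtoC 0).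
  { intros H; apply (Hnu ij); [unfold below; lia|].
    replace (eigval ij) with (eigval ij - nu + nu)%C by ring; rewrite H; ring. }
  set (a := (c / (eigval ij - nu))%C).
  destruct (IH (csub R' (cscal a R1))) as (Q & HQ & EQ).
  + intros kl Hkl; apply Hnu; unfold below in *; lia.
  + apply lin_csub; [easy|now apply lin_scal].
  + exists (cadd (cscal a (mono ij)) Q); split.
    * apply lin_add.
      -- apply lin_scal, lin_elem; unfold below; lia.
      -- apply lin_mono with (2 := HQ); unfold below; intros; lia.
    * rewrite (proj1 K_linear), (proj2 K_linear), EK, EQ, ER.
      apply cols_ext; intros n m; unfold cadd; rewrite csub_entry; unfold cadd, cscal, a.
      field; auto.
Qed.

(** * Independence and completeness of the monomials *)

Hypothesis Hdet : (x1 * y2 - x2 * y1)%C <> RtoC 0.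

(** The constant is the falling factorial [i (i-1) ... (i-n+1)], which is zero exactly when
    [i < n]. *)
Lemma iter_lowering D (M : nat -> cols) :
  linear_map D -> (forall i, D (M i) = cscal (RtoC (INR i)) (M (i - 1)%nat)) ->
  forall n i, exists c, Nat.iter n D (M i) = cscal (RtoC c) (M (i - n)%nat)
    /\ ((i < n)%nat -> c = 0) /\ ((n <= i)%nat -> c <> 0).
Proof.
intros HD H n i; induction n as [|n (c & E & H0 & H1)].
- exists 1; split; [|split; intros; try lia; lra].
  rewrite Nat.sub_0_r; apply cols_ext; intros; unfold cscal; simpl; ring.
- exists (c * INR (i - n)); simpl Nat.iter; rewrite E, (proj2 HD), H; split; [|split].
  + replace (i - n - 1)%nat with (i - S n)%nat by lia.
    apply cols_ext; intros; unfold cscal; rewrite RtoC_mult; ring.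
  + intros Hi; destruct (Nat.eq_dec i n) as [->|]; [rewrite Nat.sub_diag; simpl; ring|].
    rewrite H0 by lia; ring.
  + intros Hi; apply Rmult_integral_contrapositive_currified; [apply H1; lia|].
    apply not_0_INR; lia.
Qed.

Lemma linear_iter n f : linear_map f -> linear_map (Nat.iter n f).
Proof.
intros [H1 H2]; split; induction n as [|n IH]; intros; simpl; auto.
- now rewrite IH, H1.
- now rewrite IH, H2.
Qed.

(** [D1] sends [X] to [1] and kills [Y], and [D2] conversely, so that [D1^n D2^m]
    kills the lower monomials but not [X^n Y^m]. *)
Lemma mono_independent ij Q :
  lin_span mono (below (Cantor.to_nat ij)) Q -> cadd (mono ij) Q <> czero.
Proof.
destruct ij as [n m]; intros HQ E.
set (d := (x1 * y2 - x2 * y1)%C) in *.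
(* Cramer's rule for the scalars [u y - v x] of [deriv_lmul]: they should be 1 on [X] and 0 on [Y],
   and conversely for [D2]. *)
set (D1 := deriv (- x2 / d)%C (- y2 / d)%C).
set (D2 := deriv (x1 / d)%C (y1 / d)%C).
assert (L1 : linear_map D1) by apply deriv_linear.
assert (L2 : linear_map D2) by apply deriv_linear.
assert (E1 : forall i j, D1 (mono (i, j)) = cscal (RtoC (INR i)) (mono ((i - 1)%nat, j))).
{ intros i j; unfold D1.
  rewrite (deriv_mono _ _ _ (deriv_linear _ _) (deriv_one _ _) (deriv_lmul _ _ x1 y1 c1)
             (deriv_lmul _ _ x2 y2 c2)).
  apply cols_ext; intros; unfold cadd, cscal, d in *; field; auto. }
assert (E2 : forall i j, D2 (mono (i, j)) = cscal (RtoC (INR j)) (mono (i, (j - 1)%nat))).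
{ intros i j; unfold D2.
  rewrite (deriv_mono _ _ _ (deriv_linear _ _) (deriv_one _ _) (deriv_lmul _ _ x1 y1 c1)
             (deriv_lmul _ _ x2 y2 c2)).
  apply cols_ext; intros; unfold cadd, cscal, d in *; field; auto. }
set (Phi := fun P => Nat.iter n D1 (Nat.iter m D2 P)).
assert (LP : linear_map Phi).
{ pose proof (linear_iter n D1 L1) as [A1 A2]; pose proof (linear_iter m D2 L2) as [B1 B2].
  split; intros; unfold Phi; [now rewrite B1, A1|now rewrite B2, A2]. }
assert (Hlow : Phi Q = czero).
{ apply (lin_empty mono (fun _ => False)); [auto|].
  apply (lin_map mono mono _ _ Phi _ LP) with (2 := HQ).
  intros [a b] Hab; apply below_cases in Hab; unfold Phi.
  destruct (iter_lowering D2 (fun j => mono (a, j)) L2 (E2 a) m b) as (c & -> & Hc0 & _).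
  rewrite (proj2 (linear_iter n D1 L1)).
  destruct (iter_lowering D1 (fun i => mono (i, (b - m)%nat)) L1 (fun i => E1 i _) n a) as (c' & -> & Hc0' & _).
  destruct Hab as [Ha|Hb].
  - rewrite Hc0' by easy; rewrite cscal_0, cscal_czero; constructor.
  - rewrite Hc0 by easy; rewrite cscal_0; constructor. }
assert (Htop : exists c, c <> RtoC 0 /\ Phi (mono (n, m)) = cscal c cone).
{ unfold Phi; destruct (iter_lowering D2 (fun j => mono (n, j)) L2 (E2 n) m m) as (c & -> & _ & Hc).
  rewrite (proj2 (linear_iter n D1 L1)).
  destruct (iter_lowering D1 (fun i => mono (i, (m - m)%nat)) L1 (fun i => E1 i _) n n) as (c' & -> & _ & Hc').
  exists (RtoC c * RtoC c')%C; split.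
  - apply Cmult_neq_0; intros H; apply RtoC_inj in H; [now apply Hc in H|now apply Hc' in H].
  - rewrite !Nat.sub_diag; apply cols_ext; intros; unfold cscal.
    change (mono (0%nat, 0%nat)) with cone; ring. }
destruct Htop as (c & Hc & Htop).
assert (HE : Phi (cadd (mono (n, m)) Q) = czero) by (rewrite E; now apply linear_map_zero).
rewrite (proj1 LP), Hlow, Htop, cadd_czero_r in HE.
assert (H0 : cscal c cone 0%nat 0%nat = RtoC 0) by (now rewrite HE).
unfold cscal, cone, delta in H0; simpl in H0; apply Hc; rewrite <- H0; ring.
Qed.

(** The same number may be the diagonal entry at several indices. At the least of them, [kl], no
    earlier entry equals [nu], so [resolvent] corrects the monomial by lower terms into an
    eigenvector, nonzero by [mono_independent]. *)
Lemma eigenvector_exists ij :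
  exists P, pol P /\ P <> czero /\ K P = cscal (eigval ij) P.
Proof.
set (nu := eigval ij).
assert (Hleast : exists k0 : nat, (exists kl, Cantor.to_nat kl = k0 /\ eigval kl = nu) /\
   forall kl, (Cantor.to_nat kl < k0)%nat -> eigval kl <> nu).
{ assert (H : forall k : nat, (exists kl, Cantor.to_nat kl = k /\ eigval kl = nu) ->
   exists k0 : nat, (exists kl, Cantor.to_nat kl = k0 /\ eigval kl = nu) /\
   forall kl, (Cantor.to_nat kl < k0)%nat -> eigval kl <> nu).
  { intros k; induction k as [k IH] using lt_wf_ind; intros Hk.
    destruct (classic (exists kl, (Cantor.to_nat kl < k)%nat /\ eigval kl = nu)) as [(kl & Hl & E)|Hn].
    - apply (IH (Cantor.to_nat kl)); auto; now exists kl.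
    - exists k; split; auto; intros kl Hl E; apply Hn; now exists kl. }
  apply (H (Cantor.to_nat ij)); now exists ij. }
destruct Hleast as (k0 & (kl & Ek & Enu) & Hmin); subst k0.
destruct (K_mono_below kl) as (R0 & HR & EK).
destruct (resolvent nu (Cantor.to_nat kl) (cscal (RtoC (-1)) R0)) as (Q & HQ & EQ).
- exact Hmin.
- now apply lin_scal.
- exists (cadd (mono kl) Q); split; [|split].
  + apply pol_add; [apply pol_mono|].
    clear - HQ; induction HQ; auto using pol_mono with pol.
  + exact (mono_independent kl Q HQ).
  + rewrite (proj1 K_linear), EK, EQ, Enu; apply cols_ext; intros; unfold cadd, cscal.
    rewrite RtoC_m1; ring.
Qed.

Lemma lin_lX P : lin_span mono (fun _ => True) P -> lin_span mono (fun _ => True) (lX P).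
Proof.
apply lin_map; [apply lmul_linear|]; intros [i j] _; rewrite <- mono_S; now apply lin_elem.
Qed.

Lemma lY_lX P : lY (lX P) = cadd (lX (lY P)) (cscal (x2 * y1 - x1 * y2)%C P).
Proof.
unfold lX, lY, lmul; autorewrite with cols; apply cols_ext; intros; unfold cadd, cscal; ring.
Qed.

Lemma lin_lY P : lin_span mono (fun _ => True) P -> lin_span mono (fun _ => True) (lY P).
Proof.
apply lin_map; [apply lmul_linear|]; intros [i j] _; induction i as [|i IH].
- rewrite <- mono_0_S; now apply lin_elem.
- rewrite mono_S, lY_lX; apply lin_add; [now apply lin_lX|now apply lin_scal, lin_elem].
Qed.

(** Inverting the two-by-two coefficient matrix expresses [a] and [a^dag] through [X], [Y] and
    constants. The span of the ordered monomials is stable under left multiplication by [X], and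
    also by [Y], whose commutator with [X] is scalar. *)
Lemma pol_spanned P : pol P -> exists N, lin_span mono (below N) P.
Proof.
intros [Q ->].
assert (Hla : forall P, lin_span mono (fun _ => True) P -> lin_span mono (fun _ => True) (la P)).
{ intros P HP.
  replace (la P) with (cscal (/ (x1 * y2 - x2 * y1))%C
    (cadd (cadd (cscal y2 (lX P)) (cscal (- y1)%C (lY P))) (cscal (y1 * c2 - y2 * c1)%C P))).
  - apply lin_scal, lin_add; [apply lin_add; apply lin_scal|now apply lin_scal];
      [now apply lin_lX|now apply lin_lY].
  - apply cols_ext; intros; unfold lX, lY, lmul, cadd, cscal; field; auto. }
assert (Hlc : forall P, lin_span mono (fun _ => True) P -> lin_span mono (fun _ => True) (lc P)).
{ intros P HP.
  replace (lc P) with (cscal (/ (x1 * y2 - x2 * y1))%C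
    (cadd (cadd (cscal (- x2)%C (lX P)) (cscal x1 (lY P))) (cscal (x2 * c1 - x1 * c2)%C P))).
  - apply lin_scal, lin_add; [apply lin_add; apply lin_scal|now apply lin_scal];
      [now apply lin_lX|now apply lin_lY].
  - apply cols_ext; intros; unfold lX, lY, lmul, cadd, cscal; field; auto. }
assert (H : forall Q P, lin_span mono (fun _ => True) P ->
              lin_span mono (fun _ => True) (fun n => nc_eval Q (P n))).
{ clear Q; induction Q as [c| | |Q1 IH1 Q2 IH2|Q1 IH1 Q2 IH2]; intros P HP; simpl.
  - now apply (lin_scal mono _ c P).
  - now apply Hla.
  - now apply Hlc.
  - apply (lin_add mono _ (fun n => nc_eval Q1 (P n)) (fun n => nc_eval Q2 (P n))); auto.
  - apply (IH1 (fun n => nc_eval Q2 (P n))); auto. }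
assert (HQ : lin_span mono (fun _ => True) (nc_cols Q)).
{ apply (H Q cone); now apply (lin_elem mono _ (0%nat, 0%nat)). }
induction HQ as [|ij _|A B _ (N & HN) _ (N' & HN')|c A _ (N & HN)].
- exists 0%nat; constructor.
- exists (S (Cantor.to_nat ij)); apply lin_elem; unfold below; lia.
- exists (max N N'); apply lin_add.
  + apply lin_mono with (2 := HN); unfold below; intros; lia.
  + apply lin_mono with (2 := HN'); unfold below; intros; lia.
- exists N; now apply lin_scal.
Qed.

End Monomials.

(** * From expressions in [X] and [Y] to ordered monomials *)

Lemma first_order_eval X x y c :
  nc_eq X (NCadd (NCadd (NCmul (NCconst x) NCa) (NCmul (NCconst y) NCadag)) (NCconst c)) ->
  forall P : cols, (fun n => nc_eval X (P n)) = lmul x y c P.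
Proof.
intros H P; apply functional_extensionality; intros n.
rewrite (nc_eval_ext _ _ (P n) H); reflexivity.
Qed.

Lemma NCpow_eval X k f : nc_eval (NCpow X k) f = Nat.iter k (nc_eval X) f.
Proof.
induction k as [|k IH]; simpl; [|now rewrite IH].
apply functional_extensionality; intros; ring.
Qed.

Lemma nc_cols_monom X Y x1 y1 c1 x2 y2 c2 i j :
  (forall P : cols, (fun n => nc_eval X (P n)) = lmul x1 y1 c1 P) ->
  (forall P : cols, (fun n => nc_eval Y (P n)) = lmul x2 y2 c2 P) ->
  nc_cols (monom X Y i j) = mono x1 y1 c1 x2 y2 c2 (i, j).
Proof.
intros HX HY; unfold monom, mono; cbn [fst snd].
transitivity (fun n => Nat.iter i (nc_eval X) (Nat.iter j (nc_eval Y) (delta n))).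
- apply functional_extensionality; intros n; unfold nc_cols; simpl; now rewrite !NCpow_eval.
- assert (H : forall (Z : ncpoly) x y c k (P : cols),
    (forall P : cols, (fun n => nc_eval Z (P n)) = lmul x y c P) ->
    (fun n => Nat.iter k (nc_eval Z) (P n)) = Nat.iter k (lmul x y c) P).
  { intros Z x y c k P HZ; induction k as [|k IH]; simpl; [easy|].
    now rewrite (HZ (fun n => Nat.iter k (nc_eval Z) (P n))), IH. }
  rewrite (H X x1 y1 c1 i (fun n => Nat.iter j (nc_eval Y) (delta n)) HX).
  f_equal; exact (H Y x2 y2 c2 j cone HY).
Qed.

Lemma csum_indicator (f : nat -> C) k N :
  (k < N)%nat -> csum (fun i => if Nat.eqb i k then f i else RtoC 0) N = f k.
Proof.
induction N as [|N IH]; intros Hk; [lia|]; simpl.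
destruct (Nat.eqb_spec N k) as [->|Hn].
- rewrite (csum_ext _ (fun _ => RtoC 0)), csum_0; [ring|].
  intros i Hi; destruct (Nat.eqb_spec i k); [lia|easy].
- rewrite IH by lia; ring.
Qed.

(** Induction on membership in the span, carrying a full coefficient table; a single monomial has an
    indicator table. *)
Lemma in_span_of_lin X Y (M : nat * nat -> cols) d (Q : ncpoly) :
  (forall i j, nc_cols (monom X Y i j) = M (i, j)) ->
  lin_span M (fun ab => fst ab + snd ab <= d)%nat (nc_cols Q) -> in_span X Y d Q.
Proof.
intros HM H; unfold in_span.
assert (Hc : exists c : nat -> nat -> C, forall n m, nc_cols Q n m
   = csum (fun i => csum (fun j => c i j * M (i, j) n m)%C (S (d - i))) (S d)).
{ induction H as [|[a b] Hab|A B _ (c & Hc) _ (c' & Hc')|k A _ (c & Hc)].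
  - exists (fun _ _ => RtoC 0); intros n m; symmetry; unfold czero.
    rewrite (csum_ext _ (fun _ => RtoC 0)); [apply csum_0|]; intros i _.
    rewrite (csum_ext _ (fun _ => RtoC 0)); [apply csum_0|]; intros j _; ring.
  - exists (fun i j => if Nat.eqb i a then (if Nat.eqb j b then RtoC 1 else RtoC 0) else RtoC 0).
    intros n m; cbn [fst snd] in Hab.
    rewrite (csum_ext _ (fun i => if Nat.eqb i a then M (i, b) n m else RtoC 0)).
    + now rewrite (csum_indicator (fun i => M (i, b) n m)) by lia.
    + intros i Hi; destruct (Nat.eqb_spec i a) as [->|].
      * rewrite (csum_ext _ (fun j => if Nat.eqb j b then M (a, j) n m else RtoC 0)).
        -- now rewrite (csum_indicator (fun j => M (a, j) n m)) by lia.
        -- intros j _; destruct (Nat.eqb j b); ring.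
      * rewrite (csum_ext _ (fun _ => RtoC 0)); [apply csum_0|]; intros j _; ring.
  - exists (fun i j => c i j + c' i j)%C; intros n m; unfold cadd; rewrite Hc, Hc', <- csum_plus.
    apply csum_ext; intros i _; rewrite <- csum_plus; apply csum_ext; intros; ring.
  - exists (fun i j => k * c i j)%C; intros n m; unfold cscal; rewrite Hc, <- csum_scal.
    apply csum_ext; intros i _; rewrite <- csum_scal; apply csum_ext; intros; ring. }
destruct Hc as (c & Hc); exists c; intros n m; rewrite Hc, sum_n_csum.
apply csum_ext; intros i _; rewrite sum_n_csum; apply csum_ext; intros j _; now rewrite HM.
Qed.

Lemma lin_pol {I} (M : I -> cols) (Q : I -> Prop) P :
  (forall i, pol (M i)) -> lin_span M Q P -> pol P.
Proof. intros HM; induction 1; auto with pol. Qed.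

Lemma first_order_coeffs (a b c : C) :
  lmul a b c cone = czero -> a = RtoC 0 /\ b = RtoC 0 /\ c = RtoC 0.
Proof.
intros H.
assert (HE : forall n m, lmul a b c cone n m = RtoC 0) by (intros; now rewrite H).
pose proof (HE 1%nat 0%nat) as H1; pose proof (HE 0%nat 1%nat) as H2; pose proof (HE 0%nat 0%nat) as H3.
unfold lmul, cadd, cscal, la, lc, ann, cre, cone, delta in H1, H2, H3.
simpl in H1, H2, H3; rewrite ?sqrt_1 in *; split; [|split].
- rewrite <- H1; ring.
- rewrite <- H2; ring.
- rewrite <- H3; ring.
Qed.

(** The leading parts of [X] and [Y] are nonzero left eigenvectors of one two-by-two matrix; a
    vanishing determinant makes them proportional, hence with the same eigenvalue. *)
Lemma eigenvectors_det (a11 a12 a21 a22 x1 y1 x2 y2 lam mu : C) :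
  (x1 <> RtoC 0 \/ y1 <> RtoC 0) -> (x2 <> RtoC 0 \/ y2 <> RtoC 0) ->
  (x1 * a11 + y1 * a21 = lam * x1)%C -> (x1 * a12 + y1 * a22 = lam * y1)%C ->
  (x2 * a11 + y2 * a21 = mu * x2)%C -> (x2 * a12 + y2 * a22 = mu * y2)%C ->
  (x1 * y2 - x2 * y1 = 0)%C ->
  lam = mu /\ exists t, x2 = (t * x1)%C /\ y2 = (t * y1)%C.
Proof.
intros H1 H2 E1 E2 E3 E4 Hd.
assert (Ht : exists t, t <> RtoC 0 /\ x2 = (t * x1)%C /\ y2 = (t * y1)%C).
{ assert (Ht : exists t, x2 = (t * x1)%C /\ y2 = (t * y1)%C).
  { destruct H1 as [H1|H1].
    - exists (x2 / x1)%C; split; [field; auto|].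
      replace y2 with ((x1 * y2 - x2 * y1 + x2 * y1) / x1)%C by (field; auto).
      rewrite Hd; field; auto.
    - exists (y2 / y1)%C; split; [|field; auto].
      replace x2 with ((x1 * y2 - (x1 * y2 - x2 * y1)) / y1)%C by (field; auto).
      rewrite Hd; field; auto. }
  destruct Ht as (t & Hx & Hy); exists t; split; [|split; auto].
  intros ->; rewrite Cmult_0_l in Hx, Hy; destruct H2; auto. }
destruct Ht as (t & Ht & Hx & Hy); split; [|now exists t].
assert (F1 : ((lam - mu) * x1 = 0)%C).
{ rewrite Hx, Hy in E3.
  replace ((lam - mu) * x1)%C with (/ t * (t * (lam * x1) - mu * (t * x1)))%C by (field; auto).
  rewrite <- E1, <- E3; field; auto. }
assert (F2 : ((lam - mu) * y1 = 0)%C).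
{ rewrite Hx, Hy in E4.
  replace ((lam - mu) * y1)%C with (/ t * (t * (lam * y1) - mu * (t * y1)))%C by (field; auto).
  rewrite <- E2, <- E4; field; auto. }
replace lam with (lam - mu + mu)%C by ring.
destruct H1 as [H1|H1].
- replace (lam - mu)%C with ((lam - mu) * x1 / x1)%C by (field; auto); rewrite F1; field; auto.
- replace (lam - mu)%C with ((lam - mu) * y1 / y1)%C by (field; auto); rewrite F2; field; auto.
Qed.

(** For distinct [lambda] and [mu] the leading parts of [X] and [Y] are automatically independent by
    [eigenvectors_det]. For equal values [Y] could be a multiple of [X], whose monomials do not span
    the polynomials; the claim about the eigenvalues then includes the independence of [X] and [Y]
    as a premise. *)
Theorem theorem4p2 :
  forall (p : gaussian_data) (T : R -> op -> op) (s : R) (Ts : R -> op -> op)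
    (X Y : ncpoly) (lambda mu : R),
  is_gaussian_qms p T ->
  standing p T ->
  0 <= s <= 1 ->
  is_induced p s T Ts ->
  first_order X ->
  first_order Y ->
  (exists xi, embedded_poly p s X xi /\
     adj_plus_gen Ts xi (op_scal (RtoC lambda) xi)) ->
  (exists eta, embedded_poly p s Y eta /\
     adj_plus_gen Ts eta (op_scal (RtoC mu) eta)) ->
  mu <= lambda <= 0 ->
  (lambda, mu) <> (0, 0) ->
  (forall n m : nat,
     exists (Rnm : ncpoly) (xi rem : op),
       embedded_poly p s (monom X Y n m) xi /\
       embedded_poly p s Rnm rem /\
       adj_plus_gen Ts xi
         (op_add (op_scal (RtoC (INR n * lambda + INR m * mu)) xi) rem) /\
       ((2 <= n + m)%nat -> in_span X Y (n + m - 2) Rnm) /\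
       ((n + m < 2)%nat -> nc_eq Rnm (NCconst (RtoC 0)))) /\
  ((lambda = mu -> lin_indep X Y) ->
   forall nu : C,
     eigenvalue_on_polys p s Ts nu <->
     exists n m : nat, nu = RtoC (INR n * lambda + INR m * mu)).
Proof.
intros p T s Ts X Y lambda mu HT Hst Hs HTs (x1 & y1 & c1 & Hx & HX) (x2 & y2 & c2 & Hy & HY)
  (xi & Hxi & HxiE) (xj & Hxj & HxjE) Hle Hne.
pose proof (st_beta _ _ Hst) as Hb.
pose proof (first_order_eval _ _ _ _ HX) as HXe; pose proof (first_order_eval _ _ _ _ HY) as HYe.
assert (HXc : nc_cols X = lmul x1 y1 c1 cone) by apply (HXe cone).
assert (HYc : nc_cols Y = lmul x2 y2 c2 cone) by apply (HYe cone).
pose proof (adj_plus_gen_eigen p T s Ts Hst Hs HT HTs X xi _ Hxi HxiE) as EX.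
pose proof (adj_plus_gen_eigen p T s Ts Hst Hs HT HTs Y xj _ Hxj HxjE) as EY.
pose proof (sym_gen_one p T s Hst) as K1.
destruct (sym_gen_la p s) as (a11 & a12 & g11 & g12 & Kla).
destruct (sym_gen_lc p s) as (a21 & a22 & g21 & g22 & Klc).
set (K := sym_gen p s) in *.
assert (KL : linear_map K) by (split; [apply sym_gen_add|apply sym_gen_scal]).
(* Linear combination of the commutation rules for [a] and [a^dag]; constants commute with [K], so
   [c] does not enter the new coefficients. *)
assert (Hlin : forall x y c P, K (lmul x y c P)
  = cadd (cadd (lmul x y c (K P)) (lmul (x * a11 + y * a21) (x * a12 + y * a22) (RtoC 0) P)%C)
         (deriv (x * g11 + y * g21) (x * g12 + y * g22) P)%C).
{ intros x y c P; unfold lmul at 1.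
  rewrite !(proj1 KL), !(proj2 KL), Kla, Klc; unfold lmul, deriv.
  apply cols_ext; intros; unfold cadd, cscal; ring. }
(* Taking [P = 1], where [K] and the derivation vanish: the leading part is an eigenvector of the
   coefficient matrix, and a constant term can occur only for eigenvalue zero. *)
assert (Heig : forall x y c (lam : C), K (lmul x y c cone) = cscal lam (lmul x y c cone) ->
  (x * a11 + y * a21 = lam * x /\ x * a12 + y * a22 = lam * y /\ lam * c = 0)%C).
{ intros x y c lam E; rewrite Hlin, K1, deriv_one, (linear_map_zero _ (lmul_linear x y c)) in E.
  rewrite cadd_czero_l, cadd_czero_r in E.
  destruct (first_order_coeffs (x * a11 + y * a21 - lam * x)%C (x * a12 + y * a22 - lam * y)%C
              (- (lam * c))%C) as (F1 & F2 & F3).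
  { transitivity (csub (lmul (x * a11 + y * a21) (x * a12 + y * a22) (RtoC 0) cone)%C
                       (cscal lam (lmul x y c cone))).
    - apply cols_ext; intros; rewrite csub_entry; unfold lmul, cadd, cscal; ring.
    - rewrite E; apply cols_ext; intros; rewrite csub_entry; unfold czero; ring. }
  split; [|split].
  - replace (x * a11 + y * a21)%C with (x * a11 + y * a21 - lam * x + lam * x)%C by ring.
    rewrite F1; ring.
  - replace (x * a12 + y * a22)%C with (x * a12 + y * a22 - lam * y + lam * y)%C by ring.
    rewrite F2; ring.
  - replace (lam * c)%C with (- - (lam * c))%C by ring; rewrite F3; ring. }
rewrite HXc in EX; rewrite HYc in EY.
destruct (Heig _ _ _ _ EX) as (X1 & X2 & X3); destruct (Heig _ _ _ _ EY) as (Y1 & Y2 & Y3).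
(* Since [lambda c1 = 0], the leading part times [lambda] is all of [lambda X]. *)
assert (KX : exists u v, forall P, K (lmul x1 y1 c1 P)
  = cadd (cadd (lmul x1 y1 c1 (K P)) (cscal (RtoC lambda) (lmul x1 y1 c1 P))) (deriv u v P)).
{ do 2 eexists; intros P; rewrite Hlin, X1, X2; f_equal; f_equal.
  apply cols_ext; intros n m; unfold lmul, cadd, cscal.
  replace (RtoC lambda * (x1 * la P n m + y1 * lc P n m + c1 * P n m))%C
    with (RtoC lambda * x1 * la P n m + RtoC lambda * y1 * lc P n m
          + RtoC lambda * c1 * P n m)%C by ring.
  rewrite X3; ring. }
assert (KY : exists u v, forall P, K (lmul x2 y2 c2 P)
  = cadd (cadd (lmul x2 y2 c2 (K P)) (cscal (RtoC mu) (lmul x2 y2 c2 P))) (deriv u v P)).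
{ do 2 eexists; intros P; rewrite Hlin, Y1, Y2; f_equal; f_equal.
  apply cols_ext; intros n m; unfold lmul, cadd, cscal.
  replace (RtoC mu * (x2 * la P n m + y2 * lc P n m + c2 * P n m))%C
    with (RtoC mu * x2 * la P n m + RtoC mu * y2 * lc P n m
          + RtoC mu * c2 * P n m)%C by ring.
  rewrite Y3; ring. }
assert (HM : forall i j, nc_cols (monom X Y i j) = mono x1 y1 c1 x2 y2 c2 (i, j))
  by (intros; now apply nc_cols_monom).
assert (Hkap : forall i j, eigval (RtoC lambda) (RtoC mu) (i, j) = RtoC (INR i * lambda + INR j * mu)).
{ intros; unfold eigval; cbn [fst snd]; now rewrite RtoC_plus, !RtoC_mult. }
split.
- intros n m.
  destruct (K_mono _ _ _ _ _ _ K K1 _ _ KX KY n m) as (R0 & HR & E).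
  assert (HpR : pol R0) by (apply lin_pol with (2 := HR); apply pol_mono).
  pose proof (pol_mono x1 y1 c1 x2 y2 c2 (n, m)) as HpM.
  destruct HpR as [Q HQ]; pose proof (ex_intro _ Q HQ : pol R0) as HpR.
  exists Q, (embop p s (mono x1 y1 c1 x2 y2 c2 (n, m))), (embop p s R0).
  split; [|split; [|split; [|split]]].
  + unfold embedded_poly; rewrite HM; now apply embop_embedded.
  + unfold embedded_poly; rewrite <- HQ; now apply embop_embedded.
  + rewrite <- Hkap, <- !embop_scal, <- embop_add by auto with pol.
    rewrite <- E; now apply (adj_plus_gen_pol p T s Ts).
  + intros Hd; apply (in_span_of_lin X Y (mono x1 y1 c1 x2 y2 c2)); auto.
    rewrite <- HQ; apply lin_mono with (2 := HR); intros [a b]; simpl; lia.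
  + intros Hd; intros k l; rewrite <- HQ.
    (* For [n + m < 2] no exponents satisfy [a + b + 2 <= n + m]. *)
    assert (E0 : R0 = czero) by (apply lin_empty with (2 := HR); intros [a b]; simpl; lia).
    rewrite E0; unfold nc_cols; simpl; unfold czero; ring.
- intros Hind nu.
  (* Proportional leading parts force [lambda = mu], and this common value is nonzero because
     [(lambda, mu)] is not [(0, 0)]. Both constant terms then vanish, so [Y] is a multiple of [X],
     against their linear independence. *)
  assert (Hdet : (x1 * y2 - x2 * y1)%C <> RtoC 0).
  { intros Hd.
    destruct (eigenvectors_det _ _ _ _ _ _ _ _ _ _ Hx Hy X1 X2 Y1 Y2 Hd) as (Elm & t & Et1 & Et2).
    apply RtoC_inj in Elm.
    assert (Hl0 : RtoC lambda <> RtoC 0).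
    { intros H0; apply RtoC_inj in H0; apply Hne; subst mu; now rewrite H0. }
    rewrite <- Elm in Y3.
    assert (Hc0 : forall c, (RtoC lambda * c = 0)%C -> c = RtoC 0).
    { intros c Hc; replace c with (RtoC lambda * c / RtoC lambda)%C by (field; auto).
      rewrite Hc; field; auto. }
    apply Hc0 in X3; apply Hc0 in Y3.
    destruct (Hind Elm (- t)%C (RtoC 1)) as [_ H1]; [|apply RtoC_inj in H1; lra].
    intros n m; rewrite nc_cols_add, !nc_cols_scal, HXc, HYc, X3, Y3, Et1, Et2.
    unfold nc_cols at 1; simpl; unfold lmul, cadd, cscal; ring. }
  split.
  + intros (Q & xk & HQ & Hxk & HQE).
    apply NNPP; intros Hno; apply Hxk.
    pose proof (adj_plus_gen_eigen p T s Ts Hst Hs HT HTs Q xk nu HQ HQE) as EQ.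
    assert (HpQ : pol (nc_cols Q)) by now exists Q.
    destruct (pol_spanned _ _ c1 _ _ c2 Hdet _ HpQ) as [N HN].
    assert (E0 : nc_cols Q = czero).
    { apply (no_eigenvector _ _ _ _ _ _ K KL K1 _ _ KX KY nu N); auto.
      intros [i j] Hij; apply Hno; exists i, j; now rewrite <- Hkap. }
    destruct HQ as [[Hbd _] HE]; apply op_ext; auto using bounded_zero.
    intros n m; rewrite HE, E0; unfold czero; simpl; ring.
  + intros (i & j & ->).
    destruct (eigenvector_exists _ _ _ _ _ _ K KL K1 _ _ KX KY Hdet (i, j)) as (P & HP & HP0 & EP).
    destruct HP as [Q HQ]; pose proof (ex_intro _ Q HQ : pol P) as HP.
    exists Q, (embop p s P); split; [|split].
    * unfold embedded_poly; rewrite <- HQ; now apply embop_embedded.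
    * intros E0; apply HP0, (emb_inj p s); apply cols_ext; intros n m.
      rewrite <- (embop_e p s Hb Hs P) by auto; rewrite E0, emb_wt; unfold czero; simpl; ring.
    * rewrite <- embop_scal by auto; rewrite <- Hkap, <- EP.
      now apply (adj_plus_gen_pol p T s Ts).
Qed.
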